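(* Let $u:\mathbb{R}^3\to\mathbb{R}^3$ be a smooth solution (with some smooth scalar pressure $P$) of the stationary Navier--Stokes equations $$-\Delta u+u\cdot\nabla u+\nabla P=0,\qquad \nabla\cdot u=0\qquad\text{in }\mathbb{R}^3,$$ with $\int_{\mathbb{R}^3}|\nabla u|^2dx<\infty$. If $$\liminf_{k\to-\infty}2^{-k}\|\dot S_ku\|_{L^\infty(\mathbb{R}^3)}<\infty,$$ then $u\equiv0$. In particular, if $u$ satisfies $$\liminf_{k\to-\infty}\|\dot S_ku\|_{\dot B^{-1}_{\infty,\infty}}<\infty,$$ or $$\liminf_{k\to-\infty}\|\hat u\|_{L^r(B_{2^k})}<\infty\quad\text{for some } r\ge\tfrac32,$$ then $u\equiv0$. Here $k$ ranges over the integers.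
   Context: Fourier transform on $\mathcal{S}'(\mathbb{R}^3)$: $\hat f(\xi)=(2\pi)^{-3/2}\int_{\mathbb{R}^3} e^{-ix\cdot\xi}f(x)\,dx$, with inverse $\mathcal{F}^{-1}$. $B_r=\{x\in\mathbb{R}^3:|x|\le r\}$. Fix a non-negative $\psi\in C_0^\infty(B_1)$ with $\psi(\xi)=1$ for $|\xi|\le\frac12$, and set $\varphi(\xi)=\psi(2^{-1}\xi)-\psi(\xi)$. For $k\in\mathbb{Z}$ and $u\in\mathcal{S}'(\mathbb{R}^3)$ put $\dot\Delta_ku=\mathcal{F}^{-1}(\varphi(2^{-k}\cdot)\hat u)$ and $\dot S_ku=\mathcal{F}^{-1}(\psi(2^{-k}\cdot)\hat u)$ (componentwise on vector fields). $\mathcal{S}_h'(\mathbb{R}^3)=\{f\in\mathcal{S}'(\mathbb{R}^3):\lim_{k\to-\infty}\dot S_kf=0\}$. The homogeneous Besov space $\dot B^{\sigma}_{\infty,\infty}$ is the set of $f\in\mathcal{S}_h'(\mathbb{R}^3)$ with $\|f\|_{\dot B^\sigma_{\infty,\infty}}=\sup_{j\in\mathbb{Z}}2^{j\sigma}\|\dot\Delta_jf\|_{L^\infty}<\infty$; the norm is understood to be $+\infty$ if $f\notin\mathcal{S}_h'$. Likewise $\|\hat u\|_{L^r(B_{2^k})}$ is understood to be $+\infty$ if the restriction of the distribution $\hat u$ to (a neighbourhood of the origin given by the interior of) $B_{2^k}$ is not given by an $L^r$ function. *)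

(* Defs.v *)
From HB Require Import structures.
From mathcomp Require Import all_boot all_order all_algebra complex.
From mathcomp Require Import all_classical all_reals all_analysis.

Set Implicit Arguments.
Unset Strict Implicit.
Unset Printing Implicit Defensive.

Import Order.TTheory GRing.Theory Num.Theory.
Import numFieldNormedType.Exports.

Local Open Scope classical_set_scope.
Local Open Scope ring_scope.
Local Open Scope complex_scope.

(* R^3 is the iterated product, which carries both the product topology and
   the product sigma-algebra; its library norm is the max norm, whence the
   separate Euclidean norm [enorm] below. *)
Notation R3 R := (R * R * R)%type.

(* The same type with the measurable structure on which [lebesgue_measure]
   is defined. *)
Notation M3 R :=
  (measurableTypeR R * measurableTypeR R * measurableTypeR R)%type.

Section Euclidean.
Context {R : realType}.
Implicit Types x y : R3 R.

Definition ecoord (i : 'I_3) x : R :=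
  if i == 0 :> nat then x.1.1 else if i == 1%N :> nat then x.1.2 else x.2.

Definition evec (i : 'I_3) : R3 R :=
  ((i == 0 :> nat)%:R, (i == 1%N :> nat)%:R, (i == 2%N :> nat)%:R).

Definition dot x y : R := \sum_(i < 3) ecoord i x * ecoord i y.

Definition enorm x : R := Num.sqrt (dot x x).

Definition eball (r : R) : set (R3 R) := [set x | enorm x <= r].

Definition leb3 : {measure set (M3 R) -> \bar R} :=
  (@lebesgue_measure R \x @lebesgue_measure R \x @lebesgue_measure R)%E.

End Euclidean.

Section Smooth.
Context {R : realType}.
Implicit Types (f : R3 R -> R) (phi : R3 R -> R[i]) (s : seq 'I_3).

Definition partial (i : 'I_3) f : R3 R -> R := 'D_(evec i) f.

Definition dpart s f : R3 R -> R := foldr partial f s.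

Definition smooth f : Prop :=
  forall s, continuous (dpart s f) /\
    forall i x, derivable (dpart s f) x (evec i).

Definition csmooth phi : Prop :=
  smooth (fun x => complex.Re (phi x)) /\ smooth (fun x => complex.Im (phi x)).

Definition cdpart s phi : R3 R -> R[i] := fun x =>
  dpart s (fun y => complex.Re (phi y)) x
    +i* dpart s (fun y => complex.Im (phi y)) x.

Definition cmod (z : R[i]) : R :=
  Num.sqrt (complex.Re z ^+ 2 + complex.Im z ^+ 2).

Definition cint (phi : R3 R -> R[i]) : R[i] :=
  Rintegral leb3 setT (fun x => complex.Re (phi x))
    +i* Rintegral leb3 setT (fun x => complex.Im (phi x)).

Definition schwartz_seminorm (N : nat) phi : \bar R :=
  ereal_sup [set y | exists s x, (size s <= N)%N /\
    y = ((1 + enorm x) ^+ N * cmod (cdpart s phi x))%:E].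

Definition schwartz phi : Prop :=
  csmooth phi /\ forall N, (schwartz_seminorm N phi < +oo)%E.

Definition supp {V : nmodType} (f : R3 R -> V) : set (R3 R) :=
  closure [set x | f x != 0].

Definition test_fun (U : set (R3 R)) phi : Prop :=
  [/\ csmooth phi, compact (supp phi) & supp phi `<=` U].

Definition cexpi (t : R) : R[i] := cos t +i* sin t.

Definition fourier phi : R3 R -> R[i] := fun xi =>
  ((2 * pi) `^ (- (3 / 2)))%:C * cint (fun x => cexpi (- dot x xi) * phi x).

Definition ifourier phi : R3 R -> R[i] := fun x =>
  ((2 * pi) `^ (- (3 / 2)))%:C * cint (fun xi => cexpi (dot x xi) * phi xi).

End Smooth.

(* A distribution is a total functional on complex-valued functions of which
   only the values on Schwartz functions are meaningful; membership in S' is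
   the predicate [tempered].  The pairing is bilinear (no conjugation). *)
Notation dist R := ((R3 R -> R[i]) -> R[i]).

Section Distributions.
Context {R : realType}.
Implicit Types (T : dist R) (m : R3 R -> R).

Definition tempered T : Prop :=
  (forall (a : R[i]) phi chi, schwartz phi -> schwartz chi ->
     T (fun x => a * phi x + chi x) = a * T phi + T chi) /\
  exists (C : R) (N : nat), forall phi, schwartz phi ->
    ((cmod (T phi))%:E <= C%:E * schwartz_seminorm N phi)%E.

Definition dist_of (f : R3 R -> R) : dist R :=
  fun phi => cint (fun x => (f x)%:C * phi x).

Definition dist_fourier T : dist R := fun phi => T (fourier phi).

Definition dist_ifourier T : dist R := fun phi => T (ifourier phi).

Definition dist_mul m T : dist R := fun phi => T (fun x => (m x)%:C * phi x).

Definition fourier_mult m T : dist R :=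
  dist_ifourier (dist_mul m (dist_fourier T)).

Definition cmod3 (z : 'I_3 -> R[i]) : R :=
  Num.sqrt (\sum_(i < 3) cmod (z i) ^+ 2).

Definition Lnorm_on (B : set (R3 R)) (r : \bar R) (g : R3 R -> 'I_3 -> R[i]) :
    \bar R :=
  Lnorm leb3 r (fun x => (\1_B x * cmod3 (g x))%:E).

(* The restriction to the interior of B of the vector-valued distribution T is
   given by the function g, which is L^r on B. *)
Definition given_by_Lfun (B : set (R3 R)) (r : \bar R) (T : 'I_3 -> dist R)
    (g : R3 R -> 'I_3 -> R[i]) : Prop :=
  [/\ forall i, measurable_fun (B : set (M3 R)) (fun x => complex.Re (g x i)) /\
                measurable_fun (B : set (M3 R)) (fun x => complex.Im (g x i)),
      (Lnorm_on B r g < +oo)%E &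
      forall i phi, test_fun B° phi -> T i phi = cint (fun x => g x i * phi x)].

(* +oo when there is no such g; otherwise g is unique up to null sets when B
   has a null boundary. *)
Definition dist_Lnorm (B : set (R3 R)) (r : \bar R) (T : 'I_3 -> dist R) :
    \bar R :=
  ereal_inf [set y | exists2 g, given_by_Lfun B r T g & y = Lnorm_on B r g].

End Distributions.

Section LittlewoodPaley.
Context {R : realType}.
Implicit Types (psi : R3 R -> R) (k : int) (T : dist R).

Definition LP_cutoff psi : Prop :=
  [/\ smooth psi, supp psi `<=` eball 1, forall xi, 0 <= psi xi &
      forall xi, enorm xi <= 2^-1 -> psi xi = 1].

Definition LP_phi psi : R3 R -> R := fun xi => psi (2^-1 *: xi) - psi xi.

Definition LP_Delta psi k T : dist R :=
  fourier_mult (fun xi => LP_phi psi ((2 : R) ^ (- k) *: xi)) T.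

Definition LP_S psi k T : dist R :=
  fourier_mult (fun xi => psi ((2 : R) ^ (- k) *: xi)) T.

(* The limit of [LP_S psi k T] as k tends to -oo is taken in S' (weak-star). *)
Definition Sh psi T : Prop :=
  tempered T /\ forall phi, schwartz phi ->
    (fun n : nat => cmod (LP_S psi (- n%:Z) T phi)) @ \oo --> (0 : R).

Definition besov_norm psi (sigma : R) (T : 'I_3 -> dist R) : \bar R :=
  if `[< forall i, Sh psi (T i) >] then
    ereal_sup [set y | exists j : int, y =
      ((2 `^ (j%:~R * sigma))%:E *
       dist_Lnorm setT +oo (fun i => LP_Delta psi j (T i)))%E]
  else +oo%E.

Definition liminf_ninfty (a : int -> \bar R) : \bar R :=
  limn_einf (fun n : nat => a (- n%:Z)).

End LittlewoodPaley.

Section NavierStokes.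
Context {R : realType}.
Implicit Types (u : R3 R -> R3 R) (P : R3 R -> R).

Definition vcomp u (i : 'I_3) : R3 R -> R := fun x => ecoord i (u x).

Definition laplacian (f : R3 R -> R) : R3 R -> R :=
  fun x => \sum_(j < 3) partial j (partial j f) x.

Definition stationary_NS u P : Prop :=
  (forall x i, - laplacian (vcomp u i) x
      + \sum_(j < 3) vcomp u j x * partial j (vcomp u i) x
      + partial i P x = 0) /\
  (forall x, \sum_(i < 3) partial i (vcomp u i) x = 0).

Definition dirichlet_energy u : \bar R :=
  (\int[leb3]_x
     (\sum_(i < 3) \sum_(j < 3) partial j (vcomp u i) x ^+ 2)%R%:E)%E.

Definition vdist_of u : 'I_3 -> dist R := fun i => dist_of (vcomp u i).

End NavierStokes.

(* Main.v *)
(* The low frequency part v = K * u of u at scale lam is a convolution with a real even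
   kernel of integral 1 with fast decay; each of the three conditions provides scales
   lam -> 0 at which |v| <= M lam, the second by telescoping the blocks below lam,
   the third by Hoelder's inequality on the ball of radius lam (r >= 3/2).

   Put w = u - v, which lies in H^1, hence in L^4. Test the equation with chi_R w. As K is even,
   w is an average of second differences of u, that is, of integrals of derivatives
   d_j b of divergence free fields b in H^1. The field d_j (chi b) - e_j div (chi b) is
   divergence free, so replacing chi d_j b by it eliminates the pressure, at the cost
   of terms carrying derivatives of chi_R, which are O(1/R). Hence
     int |grad u|^2 <= int |grad u| |grad v| + C lam int |w| (|grad u| + |grad v|).
   The right-hand side tends to 0 with lam, because lam w is bounded in L^2 and
   grad v -> 0 in L^2. So u is constant, and |u| <= M lam forces u = 0. *)

Require Import Defs.
From HB Require Import structures.
From mathcomp Require Import all_boot all_order all_algebra complex.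
From mathcomp Require Import all_classical all_reals all_analysis.
From mathcomp Require Import measurable_realfun ess_sup_inf.
From mathcomp Require Import ring lra.
Import Order.TTheory GRing.Theory Num.Theory.
Import numFieldNormedType.Exports.
Local Open Scope classical_set_scope.
Local Open Scope ring_scope.
Set Implicit Arguments.
Unset Strict Implicit.
Unset Printing Implicit Defensive.

(** * Integration *)

(** Only the gradient of [u] is integrable: [u] need not decay and no growth bound on [P] is
    available, so a product of [P] with the gradient of a cutoff could not be estimated.
    Antidifferences [u (x - p) - u (x + p)] serve as the fields [b] because, unlike [u], they lie in
    L2 and L4, with norms growing polynomially in [p]; the decay of [K] pays for this growth. The
    convective term cubic in [w] is finite but not small: it has to disappear through div u = div w
    = 0, not through an estimate.

    The limits come in a fixed order. With [lam] frozen, the cutoff radius tends to infinity. Then a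
    parameter [d] splits the gradient into a compactly supported part, whose mollification tends to
    0 in L2 with [lam] because it lies in L1, and an L2 tail of norm at most [d]. Last, [lam] and
    then [d] tend to 0.

    Since [psi] may fail to be even, the convolution kernel of its multiplier may be complex. [K] is
    the real part of that kernel, a cosine transform, hence even; a bound on the modulus of the low
    frequency part bounds its real part [K * u]. *)

Section product_measure_extra.
Context {R : realType} d1 d2 (T1 : measurableType d1) (T2 : measurableType d2).
Variable m1 : {sigma_finite_measure set T1 -> \bar R}.
Variable m2 : {sigma_finite_measure set T2 -> \bar R}.

Lemma sigma_finite_prod : sigma_finite setT (m1 \x m2)%E.
Proof.
have /sigma_finiteP[F [TF ndF Foo]] := sigma_finiteT m1.
have /sigma_finiteP[G [TG ndG Goo]] := sigma_finiteT m2.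
exists (fun n => F n `*` G n) => [|k].
  apply/esym; rewrite -subTset => -[x y] _.
  have [n _ Fx] : (\bigcup_i F i) x by rewrite -TF.
  have [k _ Gy] : (\bigcup_i G i) y by rewrite -TG.
  exists (maxn n k) => //; split.
    by move: x Fx; exact/subsetPset/ndF/leq_maxl.
  by move: y Gy; exact/subsetPset/ndG/leq_maxr.
have [? ?] := Foo k; have [? ?] := Goo k; split; first exact: measurableX.
by rewrite product_measure1E// lte_mul_pinfty// ge0_fin_numE.
Qed.

(* The library's canonical structures on [m1 \x m2] only provide the
   sigma-finite instance when both factors are subprobabilities. *)
Definition prod_measure : {sigma_finite_measure set (T1 * T2)%type -> \bar R} :=
  HB.pack_for {sigma_finite_measure set (T1 * T2)%type -> \bar R} (m1 \x m2)%E
    (Measure_isSigmaFinite.Build _ _ _ (m1 \x m2)%E sigma_finite_prod).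

End product_measure_extra.

Definition L1 {R : realType} d (T : measurableType d)
  (mu : {measure set T -> \bar R}) (f : T -> R) : Prop :=
  mu.-integrable setT (EFin \o f).

Section L1_theory.
Context {R : realType} d (T : measurableType d).
Variable mu : {measure set T -> \bar R}.
Implicit Types f g h : T -> R.

Lemma L1_measurable f : L1 mu f -> measurable_fun setT f.
Proof. by move=> /measurable_int/measurable_EFinP. Qed.

Lemma L1_dom f g : measurable_fun setT f -> L1 mu g ->
  (forall x, `|f x| <= g x) -> L1 mu f.
Proof.
move=> mf ig fg; apply: le_integrable ig => //; first exact/measurable_EFinP.
by move=> x _ /=; rewrite lee_fin (le_trans (fg x))// ler_norm.
Qed.

Lemma L1_0 : L1 mu (fun=> 0).
Proof. exact: integrable0. Qed.

Lemma L1D f g : L1 mu f -> L1 mu g -> L1 mu (fun x => f x + g x).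
Proof. by move=> hf hg; exact: (@integrableD _ _ _ mu _ measurableT _ _ hf hg). Qed.

Lemma L1N f : L1 mu f -> L1 mu (fun x => - f x).
Proof. by move=> hf; exact: (@integrableN _ _ _ mu _ _ hf). Qed.

Lemma L1B f g : L1 mu f -> L1 mu g -> L1 mu (fun x => f x - g x).
Proof. by move=> hf hg; exact: (@integrableB _ _ _ mu _ measurableT _ _ hf hg). Qed.

Lemma L1Z c f : L1 mu f -> L1 mu (fun x => c * f x).
Proof. by move=> hf; exact: (@integrableZl _ _ _ mu _ measurableT c _ hf). Qed.

Lemma L1Zr c f : L1 mu f -> L1 mu (fun x => f x * c).
Proof. by move=> hf; exact: (@integrableZr _ _ _ mu _ measurableT c _ hf). Qed.

Lemma L1_norm f : L1 mu f -> L1 mu (fun x => `|f x|).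
Proof. by move=> *; exact: integrable_norm. Qed.

Lemma L1_eq f g : f =1 g -> L1 mu f -> L1 mu g.
Proof. by move=> /funext ->. Qed.

Lemma L1_sum (I : Type) (s : seq I) (P : pred I) (F : I -> T -> R) :
  (forall i, P i -> L1 mu (F i)) -> L1 mu (fun x => \sum_(i <- s | P i) F i x).
Proof.
move=> iF; elim: s => [|i s ih].
  by apply: L1_eq L1_0 => x; rewrite big_nil.
case Pi: (P i).
  by apply: L1_eq (L1D (iF i Pi) ih) => x; rewrite big_cons Pi.
by apply: L1_eq ih => x; rewrite big_cons Pi.
Qed.

Lemma Rint_eq f g : f =1 g -> \int[mu]_x f x = \int[mu]_x g x.
Proof. by move=> /funext ->. Qed.

Lemma Rint0 : \int[mu]_x (0 : R) = 0.
Proof. by rewrite /Rintegral integral0. Qed.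

Lemma RintD f g : L1 mu f -> L1 mu g ->
  \int[mu]_x (f x + g x) = \int[mu]_x f x + \int[mu]_x g x.
Proof. by move=> *; exact: RintegralD. Qed.

Lemma RintB f g : L1 mu f -> L1 mu g ->
  \int[mu]_x (f x - g x) = \int[mu]_x f x - \int[mu]_x g x.
Proof. by move=> *; exact: RintegralB. Qed.

Lemma RintZ c f : L1 mu f -> \int[mu]_x (c * f x) = c * \int[mu]_x f x.
Proof. by move=> *; exact: RintegralZl. Qed.

Lemma RintZr c f : L1 mu f -> \int[mu]_x (f x * c) = \int[mu]_x f x * c.
Proof. by move=> *; exact: RintegralZr. Qed.

Lemma RintN f : L1 mu f -> \int[mu]_x (- f x) = - \int[mu]_x f x.
Proof.
by move=> h; rewrite -mulN1r -RintZ//; apply: Rint_eq => x; rewrite mulN1r.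
Qed.

Lemma Rint_sum (I : Type) (s : seq I) (P : pred I) (F : I -> T -> R) :
  (forall i, P i -> L1 mu (F i)) ->
  \int[mu]_x (\sum_(i <- s | P i) F i x) = \sum_(i <- s | P i) \int[mu]_x F i x.
Proof.
move=> iF; elim: s => [|i s ih].
  by rewrite big_nil -[RHS]Rint0; apply: Rint_eq => x; rewrite big_nil.
rewrite big_cons -ih; case: ifPn => Pi.
  rewrite -RintD; [|exact: iF|exact: L1_sum].
  by apply: Rint_eq => x; rewrite big_cons Pi.
by apply: Rint_eq => x; rewrite big_cons (negbTE Pi).
Qed.

Lemma Rint_le f g : L1 mu f -> L1 mu g -> (forall x, f x <= g x) ->
  \int[mu]_x f x <= \int[mu]_x g x.
Proof. by move=> ? ? ?; apply: le_Rintegral. Qed.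

Lemma Rint_ge0 f : (forall x, 0 <= f x) -> 0 <= \int[mu]_x f x.
Proof. by move=> ?; apply: Rintegral_ge0. Qed.

Lemma Rint_norm f : L1 mu f -> `|\int[mu]_x f x| <= \int[mu]_x `|f x|.
Proof. by move=> ?; apply: le_normr_Rintegral. Qed.

Lemma Rint_dom f g : measurable_fun setT f -> L1 mu g ->
  (forall x, `|f x| <= g x) -> `|\int[mu]_x f x| <= \int[mu]_x g x.
Proof.
move=> mf ig fg; have lf := L1_dom mf ig fg.
by rewrite (le_trans (Rint_norm lf))// Rint_le//; exact: L1_norm.
Qed.

Lemma EFin_Rint f : L1 mu f -> (\int[mu]_x f x)%:E = (\int[mu]_x (f x)%:E)%E.
Proof. by move=> h; rewrite /Rintegral fineK//; exact: integrable_fin_num. Qed.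

Lemma L1_lty f : measurable_fun setT f -> (forall x, 0 <= f x) ->
  (\int[mu]_x (f x)%:E < +oo)%E -> L1 mu f.
Proof.
move=> mf f0 h; apply/integrableP; split; first exact/measurable_EFinP.
by under eq_integral => x _ do rewrite /= ger0_norm//.
Qed.

Lemma Rdct (f_ : nat -> T -> R) f g :
  (forall n, measurable_fun setT (f_ n)) ->
  (forall x, f_ n x @[n --> \oo] --> f x) ->
  L1 mu g -> (forall n x, `|f_ n x| <= g x) ->
  L1 mu f /\ \int[mu]_x f_ n x @[n --> \oo] --> \int[mu]_x f x.
Proof.
move=> mf cf ig fg.
have mff : measurable_fun setT f.
  by apply: (measurable_fun_cvg mf) => x _; exact: cf.
have cE : {ae mu, forall x, setT x ->
    (EFin \o f_ n) x @[n --> \oo] --> (EFin \o f) x}.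
  by apply: aeW => x _ /=; apply: cvg_EFin; [exact: nearW|exact: cf].
have dE : {ae mu, forall x n, setT x -> (`|(EFin \o f_ n) x| <= (EFin \o g) x)%E}.
  by apply: aeW => x n _ /=; rewrite lee_fin.
have mE n : measurable_fun setT (EFin \o f_ n) by exact/measurable_EFinP.
have [i1 _ i2] := dominated_convergence measurableT mE
  (proj2 (measurable_EFinP _ _) mff) cE ig dE.
split=> //; apply: fine_cvg; move: i2.
by have /= <- := EFin_Rint (i1 : L1 mu f).
Qed.

(** An integrable function is finite almost everywhere, so replacing its infinite values by 0
    changes no integral. This turns the extended-real inner integrals of Fubini's theorem into real
    functions. *)
Lemma fine_integrable (H : T -> \bar R) : mu.-integrable setT H ->
  L1 mu (fun x => fine (H x)) /\
  \int[mu]_x fine (H x) = fine (\int[mu]_x H x)%E.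
Proof.
move=> iH; have mH := measurable_int _ iH.
have mfH : measurable_fun setT (fun x => (fine (H x))%:E).
  apply/measurable_EFinP.
  exact: (measurable_comp measurableT _ (fine_measurable measurableT) mH).
have E : ae_eq mu setT H (fun x => (fine (H x))%:E).
  have := integrable_ae measurableT iH; apply: filterS => x /= h _.
  by rewrite fineK// h.
split; last by rewrite /Rintegral (ae_eq_integral _ _ measurableT mH mfH E).
apply/integrableP; split => //; have /integrableP[_] := iH.
have E' : ae_eq mu setT (abse \o H) (abse \o (fun x => (fine (H x))%:E)).
  move: E; apply: filterS => x h xT.
  by have e : H x = (fine (H x))%:E := h xT; rewrite /comp -e.
have mabs := @abse_measurable R setT.
by rewrite -(ae_eq_integral _ _ measurableT (measurableT_comp mabs mH)
  (measurableT_comp mabs mfH) E').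
Qed.

End L1_theory.

Section Rfubini.
Context {R : realType} d1 d2 (T1 : measurableType d1) (T2 : measurableType d2).
Variable m1 : {sigma_finite_measure set T1 -> \bar R}.
Variable m2 : {sigma_finite_measure set T2 -> \bar R}.
Implicit Type F : T1 * T2 -> R.

(** Tonelli's theorem with a majorant [G] of the inner integral, so that the inner integral itself
    never has to be computed. *)
Lemma L1_prod1 F (G : T1 -> R) : measurable_fun setT F ->
  (forall x, L1 m2 (fun y => F (x, y))) -> L1 m1 G ->
  (forall x, \int[m2]_y `|F (x, y)| <= G x) -> L1 (prod_measure m1 m2) F.
Proof.
move=> mF l2 lG FG; apply/integrable12ltyP; first exact/measurable_EFinP.
apply: (@le_lt_trans _ _ (\int[m1]_x (G x)%:E)%E); last first.
  by rewrite -EFin_Rint// ltry.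
have mF' : measurable_fun setT (fun z => `|(F z)%:E|%E).
  by apply: measurableT_comp => //; exact/measurable_EFinP.
apply: ge0_le_integral => //.
- by move=> x _; exact: integral_ge0.
- by have := measurable_fun_fubini_tonelli_F (m2 := m2) _ mF' (fun=> abse_ge0 _).
- exact/measurable_EFinP/(L1_measurable lG).
- move=> x _; apply: le_trans (_ : (\int[m2]_y `|F (x, y)|)%:E <= _)%E; last first.
    by rewrite lee_fin.
  by rewrite EFin_Rint//; exact: L1_norm.
Qed.

Lemma Rfubini1 F : L1 (prod_measure m1 m2) F ->
  L1 m1 (fun x => \int[m2]_y F (x, y)) /\
  \int[m1]_x \int[m2]_y F (x, y) = \int[prod_measure m1 m2]_z F z.
Proof.
move=> lF; have [h1 h2] := fine_integrable (integrable_fubini_F lF).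
by split => //; rewrite [LHS]h2 (integral12_prod_meas1 lF).
Qed.

Lemma Rfubini2 F : L1 (prod_measure m1 m2) F ->
  L1 m2 (fun y => \int[m1]_x F (x, y)) /\
  \int[m2]_y \int[m1]_x F (x, y) = \int[prod_measure m1 m2]_z F z.
Proof.
move=> lF.
have iG : m2.-integrable setT (fun y => (\int[m1]_x (F (x, y))%:E)%E).
  have mF := measurable_int _ lF; have mG := measurable_fubini_G lF.
  have mabs := @abse_measurable R setT.
  apply/integrableP; split; first exact: mG.
  apply: le_lt_trans ((integrable21ltyP m1 m2 mF).1 lF).
  apply: ge0_le_integral => //.
  - exact: measurableT_comp mabs mG.
  - apply: (measurable_fun_fubini_tonelli_G (abse \o (EFin \o F))) => //=.
    exact: measurableT_comp mabs mF.
  - move=> y _; apply: le_abse_integral => //.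
    exact: (measurableT_comp mF (pair2_measurable y)).
have [h1 h2] := fine_integrable iG.
by split => //; rewrite [LHS]h2 (integral21_prod_meas1 lF).
Qed.

Lemma Rfubini F : L1 (prod_measure m1 m2) F ->
  \int[m1]_x \int[m2]_y F (x, y) = \int[m2]_y \int[m1]_x F (x, y).
Proof. by move=> lF; rewrite (Rfubini1 lF).2 (Rfubini2 lF).2. Qed.

End Rfubini.

Section L1_prod2.
Context {R : realType} d1 d2 (T1 : measurableType d1) (T2 : measurableType d2).
Variable m1 : {sigma_finite_measure set T1 -> \bar R}.
Variable m2 : {sigma_finite_measure set T2 -> \bar R}.

Lemma L1_prod2 (F : T1 * T2 -> R) (G : T2 -> R) : measurable_fun setT F ->
  (forall y, L1 m1 (fun x => F (x, y))) -> L1 m2 G ->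
  (forall y, \int[m1]_x `|F (x, y)| <= G y) -> L1 (prod_measure m1 m2) F.
Proof.
move=> mF l2 lG FG; apply/integrable21ltyP; first exact/measurable_EFinP.
apply: (@le_lt_trans _ _ (\int[m2]_x (G x)%:E)%E); last first.
  by rewrite -EFin_Rint// ltry.
have mF' : measurable_fun setT (fun z => `|(F z)%:E|%E).
  by apply: measurableT_comp => //; exact/measurable_EFinP.
apply: ge0_le_integral => //.
- by move=> x _; exact: integral_ge0.
- by have := measurable_fun_fubini_tonelli_G (m1 := m1) _ mF' (fun=> abse_ge0 _).
- exact/measurable_EFinP/(L1_measurable lG).
- move=> x _; apply: le_trans (_ : (\int[m1]_y `|F (y, x)|)%:E <= _)%E; last first.
    by rewrite lee_fin.
  by rewrite EFin_Rint//; exact: L1_norm.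
Qed.

End L1_prod2.

(** * Change of variables under affine maps *)

Section scaling_maps.
Context {R : realType}.

(** Stated for nonnegative extended-real functions so that, for maps acting separately on the
    coordinates of a product, Tonelli's theorem multiplies the factors [c]. *)
Definition scales d (T : measurableType d) (mu : {measure set T -> \bar R})
    (phi : T -> T) (c : R) : Prop :=
  measurable_fun setT phi /\ forall f : T -> \bar R, measurable_fun setT f ->
    (forall x, 0 <= f x)%E ->
    (\int[mu]_x f (phi x) = c%:E * \int[mu]_x f x)%E.

Lemma scales_prod d1 d2 (T1 : measurableType d1) (T2 : measurableType d2)
    (m1 : {sigma_finite_measure set T1 -> \bar R})
    (m2 : {sigma_finite_measure set T2 -> \bar R}) phi1 c1 phi2 c2 :
  0 <= c1 -> 0 <= c2 -> scales m1 phi1 c1 -> scales m2 phi2 c2 ->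
  scales (prod_measure m1 m2) (fun z => (phi1 z.1, phi2 z.2)) (c1 * c2).
Proof.
move=> c10 c20 [mp1 s1] [mp2 s2].
have mphi : measurable_fun setT (fun z : T1 * T2 => (phi1 z.1, phi2 z.2)).
  by apply: measurable_fun_pair; exact: measurableT_comp.
split=> // f mf f0.
have E := fubini_tonelli1 (m1 := m1) (m2 := m2).
rewrite [LHS](E (fun z => f (phi1 z.1, phi2 z.2)))//; last first.
  exact: measurableT_comp mf mphi.
rewrite [X in (_ = _ * X)%E](E f)// /fubini_F /=.
have mfx x : measurable_fun setT (fun y => f (x, y)).
  exact: measurableT_comp mf (pair1_measurable x).
have e x : (\int[m2]_y f (phi1 x, phi2 y) = c2%:E * \int[m2]_y f (phi1 x, y))%E.
  by rewrite (s2 (fun y => f (phi1 x, y))).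
under eq_integral do rewrite e.
have mG : measurable_fun setT (fun x => \int[m2]_y f (x, y))%E.
  exact: (measurable_fun_fubini_tonelli_F f).
have G0 x : (0 <= \int[m2]_y f (x, y))%E by exact: integral_ge0.
rewrite (ge0_integralZl _ measurableT); [|exact: measurableT_comp mG mp1|by move=> x _; exact: G0|by rewrite lee_fin].
by rewrite (s1 _ mG)// muleA -EFinM mulrC.
Qed.

(** Uniqueness of Lebesgue measure: [|a|] times its image under the affine map takes the right
    values on half-open intervals. *)
Lemma scales_lebesgue (a b : R) : a != 0 ->
  scales (@lebesgue_measure R) (fun x : measurableTypeR R => (a * x + b : measurableTypeR R)) `|a|^-1.
Proof.
move=> a0.
have ma : measurable_fun setT (fun x : measurableTypeR R => (a * x + b : measurableTypeR R)).
  apply: continuous_measurable_fun => x.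
  by apply: cvgD; [apply: cvgM; [exact: cvg_cst|exact: cvg_id]|exact: cvg_cst].
split=> // f mf f0.
have na0 : 0 <= `|a| by [].
have @p : {measure set (measurableTypeR R) -> \bar R}.
  by refine (pushforward (@lebesgue_measure R)
    (fun x : measurableTypeR R => (a * x + b : measurableTypeR R))); exact: ma.
pose nu : {measure set (measurableTypeR R) -> \bar R} := mscale (NngNum na0) p.
have key A : measurable A -> lebesgue_measure A = nu A.
  apply: lebesgue_measure_unique => X [[c e] /= ce <-].
  rewrite /nu /mscale /= /pushforward.
  (* A negative slope exchanges the two ends, so the closed end of the preimage is on the other
     side. *)
  have [a1|a1|/eqP] := ltgtP a 0; last by rewrite (negbTE a0).
    rewrite (_ : _ @^-1` _ = `[(e - b) / a, (c - b) / a[%classic); last first.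
      apply/seteqP; split=> x /=; rewrite !in_itv/= => /andP[h1 h2].
        by rewrite ler_ndivrMr// ltr_ndivlMr//; apply/andP; split; lra.
      move: h1 h2; rewrite ler_ndivrMr// ltr_ndivlMr// => h1 h2.
      by apply/andP; split; lra.
    rewrite !lebesgue_measure_itv/= !lte_fin ltr_ndivrMr// mulfVK// ltrD2r.
    case: ifPn => _; last by rewrite mule0.
    rewrite -!EFinB -EFinM ltr0_norm//; congr EFin; field.
    by rewrite lt_eqF.
  rewrite (_ : _ @^-1` _ = `](c - b) / a, (e - b) / a]%classic); last first.
    apply/seteqP; split=> x /=; rewrite !in_itv/= => /andP[h1 h2].
      by rewrite ler_pdivlMr// ltr_pdivrMr//; apply/andP; split; lra.
    move: h1 h2; rewrite ler_pdivlMr// ltr_pdivrMr// => h1 h2.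
    by apply/andP; split; lra.
  rewrite !lebesgue_measure_itv/= !lte_fin ltr_pM2r ?invr_gt0// ltrD2r.
  case: ifPn => _; last by rewrite mule0.
  rewrite -!EFinB -EFinM gtr0_norm//; congr EFin; field.
  by rewrite gt_eqF.
rewrite [X in (_ = _ * X)%E](_ : _ = \int[nu]_x f x)%E; last first.
  by apply: eq_measure_integral => A mA _; exact: key.
rewrite ge0_integral_mscale//= ge0_integral_pushforward//=.
by rewrite preimage_setT muleA -EFinM mulVf ?normr_eq0// mul1e.
Qed.

Lemma scales_Rint d (T : measurableType d) (mu : {measure set T -> \bar R})
    phi c (f : T -> R) : 0 <= c -> scales mu phi c -> L1 mu f ->
  L1 mu (fun x => f (phi x)) /\
  \int[mu]_x f (phi x) = c * \int[mu]_x f x.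
Proof.
move=> c0 [mphi s] lf; have mf := L1_measurable lf.
have mfE : measurable_fun setT (EFin \o f) by exact/measurable_EFinP.
have mfp : measurable_fun setT (fun x => f (phi x)) by exact: measurableT_comp.
have l : L1 mu (fun x => f (phi x)).
  apply/integrableP; split; first exact/measurable_EFinP.
  have /integrableP[_ h] := lf.
  rewrite (s (fun x => `|(EFin \o f) x|)%E)//; last first.
    exact: measurableT_comp (@abse_measurable R setT) mfE.
  by apply: lte_mul_pinfty.
split=> //.
have E (g : T -> R) : measurable_fun setT g -> (forall x, 0 <= g x) -> L1 mu g ->
    L1 mu (fun x => g (phi x)) ->
    \int[mu]_x g (phi x) = c * \int[mu]_x g x.
  move=> mg g0 lg lgp; apply: EFin_inj; rewrite EFinM !EFin_Rint//.
  rewrite (s (EFin \o g))//; first exact/measurable_EFinP.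
pose fp x := Num.max (f x) 0; pose fn x := Num.max (- f x) 0.
have fE x : f x = fp x - fn x.
  by rewrite /fp /fn; have [h|h] := leP (f x) 0; have [k|k] := leP (- f x) 0; lra.
have mp : measurable_fun setT fp by exact: measurable_maxr.
have mn : measurable_fun setT fn.
  by apply: measurable_maxr => //; exact: measurableT_comp.
have bp x : `|fp x| <= `|f x|.
  rewrite /fp; have [h|h] := leP (f x) 0; first by rewrite normr0.
  by rewrite lexx.
have bn x : `|fn x| <= `|f x|.
  rewrite /fn; have [h|h] := leP (- f x) 0; first by rewrite normr0.
  by rewrite normrN.
have lp := L1_dom mp (L1_norm lf) bp.
have ln := L1_dom mn (L1_norm lf) bn.
have lpp := L1_dom (measurableT_comp mp mphi) (L1_norm l) (fun x => bp (phi x)).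
have lnp := L1_dom (measurableT_comp mn mphi) (L1_norm l) (fun x => bn (phi x)).
rewrite (Rint_eq mu (fun x => fE (phi x))) (Rint_eq mu fE) !RintB// mulrBr.
by rewrite !E// => x; rewrite le_max lexx orbT.
Qed.

End scaling_maps.

(** * Lebesgue measure on [R3 R] and its behaviour under affine maps *)

Section R3_measure.
Context {R : realType}.

Definition mu1 : {sigma_finite_measure set (measurableTypeR R) -> \bar R} :=
  @lebesgue_measure R.

Definition mu2 := prod_measure mu1 mu1.

Definition mu3 : {sigma_finite_measure set (M3 R) -> \bar R} :=
  prod_measure mu2 mu1.

Lemma leb3E : (leb3 : {measure set (M3 R) -> \bar R}) = mu3.
Proof. by []. Qed.

Lemma scales_mu3 (a : R) (b : R3 R) : a != 0 ->
  scales mu3 (fun x : M3 R => a *: (x : R3 R) + b : M3 R) (`|a| ^- 3).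
Proof.
move=> a0; have h : 0 <= `|a|^-1 by rewrite invr_ge0.
have := scales_prod (mulr_ge0 h h) h
  (scales_prod h h (scales_lebesgue b.1.1 a0) (scales_lebesgue b.1.2 a0))
  (scales_lebesgue b.2 a0).
rewrite (_ : _ * _ = `|a| ^- 3); last by rewrite !exprS expr0 mulr1 !invfM mulrA.
by congr (scales _ _ _).
Qed.

Lemma Rint_affine (a : R) (b : R3 R) (f : R3 R -> R) : a != 0 -> L1 mu3 f ->
  L1 mu3 (fun x : R3 R => f (a *: x + b)) /\
  \int[mu3]_x f (a *: (x : R3 R) + b) = `|a| ^- 3 * \int[mu3]_x f x.
Proof.
move=> a0; apply: (scales_Rint (phi := fun x : M3 R => a *: (x : R3 R) + b : M3 R)).
  by rewrite invr_ge0 exprn_ge0.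
exact: scales_mu3.
Qed.

Lemma L1_shift b (f : R3 R -> R) : L1 mu3 f -> L1 mu3 (fun x : R3 R => f (x + b)).
Proof.
move=> /(Rint_affine b (oner_neq0 _))[+ _]; apply: L1_eq => x.
by rewrite scale1r.
Qed.

Lemma Rint_shift b (f : R3 R -> R) : L1 mu3 f ->
  \int[mu3]_x f ((x : R3 R) + b) = \int[mu3]_x f x.
Proof.
move=> /(Rint_affine b (oner_neq0 _))[_].
rewrite normr1 expr1n invr1 mul1r => <-; apply: Rint_eq => x.
by rewrite scale1r.
Qed.

Lemma L1_reflect b (f : R3 R -> R) : L1 mu3 f -> L1 mu3 (fun x : R3 R => f (b - x)).
Proof.
move=> lf; have n1 : (-1 : R) != 0 by rewrite oppr_eq0 oner_eq0.
have [+ _] := Rint_affine b n1 lf; apply: L1_eq => x.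
by rewrite scaleN1r addrC.
Qed.

Lemma Rint_reflect b (f : R3 R -> R) : L1 mu3 f ->
  \int[mu3]_x f (b - (x : R3 R)) = \int[mu3]_x f x.
Proof.
move=> lf; have n1 : (-1 : R) != 0 by rewrite oppr_eq0 oner_eq0.
have [_] := Rint_affine b n1 lf.
rewrite normrN1 expr1n invr1 mul1r => <-; apply: Rint_eq => x.
by rewrite scaleN1r addrC.
Qed.

End R3_measure.
Arguments mu3 {R}.

Section R3_measurable.
Context {R : realType}.

Lemma mid_interval (t a e r : R) : `|t - a| < e / 4 -> e / 4 < r -> a - r < t < a + r.
Proof. by rewrite ltr_norml => /andP[h1 h2] h3; apply/andP; split; lra. Qed.

Lemma mid_ball (t a e r y : R) : `|t - a| < e / 4 -> r < e / 2 -> a - r < y < a + r ->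
  `|t - y| < e.
Proof.
rewrite !ltr_norml => /andP[h1 h2] h3 /andP[h4 h5]; apply/andP; split; lra.
Qed.

(** The topology is that of the max norm, so an open set is the countable union of the rational open
    cubes it contains. Around a point with a ball of radius [e], a centre within [e / 4] and a
    half-side between [e / 4] and [e / 2] give a cube that contains the point and stays in the
    ball. *)
Lemma open_measurable3 (U : set (R3 R)) : open U -> measurable (U : set (M3 R)).
Proof.
move=> oU.
pose box (q : rat * rat * rat * rat) : set (M3 R) :=
  (`](ratr q.1.1.1 - ratr q.2), (ratr q.1.1.1 + ratr q.2)[%classic `*`
   `](ratr q.1.1.2 - ratr q.2), (ratr q.1.1.2 + ratr q.2)[%classic) `*`
   `](ratr q.1.2 - ratr q.2), (ratr q.1.2 + ratr q.2)[%classic.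
rewrite (_ : U = \bigcup_(q in [set q | box q `<=` U]) box q); last first.
  apply/seteqP; split=> [x Ux|x [q qU]]; last exact: qU.
  have [e /= e0 eU] := (nbhs_ballP _ _).1 (oU _ Ux).
  have rd (t : R) : exists q : rat, `|t - ratr q| < e / 4.
    have h : t - e / 4 < t + e / 4 by rewrite ltrD2l gtrN ?divr_gt0.
    have [q] := rat_in_itvoo h; rewrite in_itv/= => /andP[h1 h2].
    by exists q; rewrite ltr_norml; apply/andP; split; lra.
  have [q1 h1] := rd x.1.1; have [q2 h2] := rd x.1.2; have [q3 h3] := rd x.2.
  have h : e / 4 < e / 2 by lra.
  have [r] := rat_in_itvoo h; rewrite in_itv/= => /andP[r1 r2].
  exists (q1, q2, q3, r); last first.
    by split; [split|]; rewrite /= in_itv/=; apply: (mid_interval _ r1).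
  move=> y [[+ +] +]; rewrite /= !in_itv/= => a b c.
  by apply: eU; split; [split|]; rewrite /ball/=; [exact: mid_ball h1 r2 a|exact: mid_ball h2 r2 b|exact: mid_ball h3 r2 c].
rewrite bigcup_mkcond; apply: countable_bigcupT_measurable => [|q].
  exact: countableP.
case: ifP => // _; apply: measurableX => //; exact: measurableX.
Qed.

Lemma continuous_measurable3 (f : R3 R -> R) : continuous f ->
  measurable_fun setT (f : M3 R -> measurableTypeR R).
Proof.
move=> /continuousP cf; apply: (measurability _ (RGenOpens.measurableE R)).
by move=> _ [_ [a [b ->] <-]]; rewrite setTI; apply: open_measurable3; exact/cf/interval_open.
Qed.

End R3_measurable.

(** * Integration over the unit interval and the fundamental theorem of calculus *)

Section unit_interval.
Context {R : realType}.

Let unit_itv_lty :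
  (@lebesgue_measure R (`[0%R, 1%R]%classic : set (measurableTypeR R)) < +oo)%E.
Proof. by rewrite lebesgue_measure_itv/= lte_fin ltr01 -EFinB ltry. Qed.

Let measurable_unit_itv : measurable (`[0%R, 1%R]%classic : set (measurableTypeR R)).
Proof. exact: measurable_itv. Qed.

(** Lebesgue measure on [0, 1], seen as a finite measure on the whole line: integrals along a
    segment then have domain [setT] and fall under the Fubini lemmas above. *)
Definition m01 : {finite_measure set (measurableTypeR R) -> \bar R} :=
  mfrestr measurable_unit_itv unit_itv_lty.

(** The retraction of the line onto [0, 1]. It makes a continuous integrand bounded everywhere
    without changing it where [m01] lives. *)
Definition clamp (t : R) : R := Num.max 0 (Num.min t 1).

Lemma clamp_ge0 t : 0 <= clamp t. Proof. by rewrite /clamp le_max lexx. Qed.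

Lemma clamp_le1 t : clamp t <= 1.
Proof. by rewrite /clamp ge_max ler01 ge_min lexx orbT. Qed.

Lemma clamp_id t : 0 <= t <= 1 -> clamp t = t.
Proof. by case/andP => t0 t1; rewrite /clamp (min_idPl t1) (max_idPr t0). Qed.

Lemma clamp_cont : continuous clamp.
Proof.
move=> t; apply: (@continuous_max R R (fun=> 0) (fun t => Num.min t 1) t).
  exact: cvg_cst.
by apply: (@continuous_min R R id (fun=> 1) t); [exact: cvg_id|exact: cvg_cst].
Qed.

Lemma m01T : m01 setT = 1%E.
Proof.
rewrite /m01 /= /mfrestr /mrestr setTI lebesgue_measure_itv/= lte_fin ltr01.
by rewrite -EFinB subr0.
Qed.

Lemma L1_m01_bounded (g : R -> R) (c : R) : measurable_fun setT (g : measurableTypeR R -> R) ->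
  (forall t, `|g t| <= c) -> L1 m01 g.
Proof.
move=> mg gc; apply: measurable_bounded_integrable => //.
  by have : (m01 setT < +oo)%E by rewrite m01T ltry.
exists c; split; first exact: num_real.
by move=> x cx t _ /=; rewrite (le_trans (gc t))// ltW.
Qed.

Lemma L1_m01_cst (c : R) : L1 m01 (fun=> c).
Proof. by apply: (@L1_m01_bounded _ `|c|) => //; exact: measurable_cst. Qed.

Lemma Rint_m01_cst (c : R) : \int[m01]_t (fun=> c) t = c.
Proof.
rewrite Rintegral_cst// (_ : fine _ = 1) ?mulr1//.
exact: (congr1 fine m01T).
Qed.

Lemma clamp_comp_bounded (g : R -> R) : continuous g ->
  exists c, forall t, `|g (clamp t)| <= c.
Proof.
move=> cg.
have cn : {within `[0, 1], continuous (fun t => `|g t|)}.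
  by apply: continuous_subspaceT => t; apply: cvg_norm; exact: cg.
have [c _ h] := EVT_max ler01 cn.
exists (`|g c|) => t; apply: h.
by rewrite in_itv/= clamp_ge0 clamp_le1.
Qed.

Lemma continuous_clamp_comp (g : R -> R) : continuous g -> continuous (g \o clamp).
Proof. by move=> cg t; apply: continuous_comp; [exact: clamp_cont|exact: cg]. Qed.

Lemma L1_m01 (g : R -> R) : continuous g -> L1 m01 (fun t => g (clamp t)).
Proof.
move=> cg; have [c h] := clamp_comp_bounded cg; apply: L1_m01_bounded h.
exact: (continuous_measurable_fun (continuous_clamp_comp cg)).
Qed.

Lemma Rint_m01_norm_le (g : R -> R) c : measurable_fun setT (g : measurableTypeR R -> R) ->
  (forall t, `|g t| <= c) -> `|\int[m01]_t g t| <= c.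
Proof.
by move=> mg gc; rewrite -[leRHS]Rint_m01_cst; apply: Rint_dom => //; exact: L1_m01_cst.
Qed.

Lemma Rint_m01_sqr (g : R -> R) : L1 m01 g -> L1 m01 (fun t => g t ^+ 2) ->
  (\int[m01]_t g t) ^+ 2 <= \int[m01]_t (g t ^+ 2).
Proof.
move=> lg lg2; set a := \int[m01]_t g t.
(* Expand the integral of [(g t - a) ^ 2]; the total mass of [m01] is 1. *)
have : 0 <= \int[m01]_t (g t ^+ 2 - (2 * a * g t - a ^+ 2)).
  by apply: Rint_ge0 => t; rewrite (_ : _ - _ = (g t - a) ^+ 2) ?sqr_ge0//; ring.
rewrite RintB//; last by apply: L1B; [exact: L1Z|exact: L1_m01_cst].
rewrite RintB; [|exact: L1Z|exact: L1_m01_cst].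
by rewrite RintZ// Rint_m01_cst -/a => h; nra.
Qed.

Lemma ftc01 (G g : R -> R) : continuous g ->
  (forall t : R, is_derive t 1 G (g t)) ->
  G 1 - G 0 = \int[m01]_t g (clamp t).
Proof.
move=> cg dG.
have dG' t : derivable G t 1 by case: (dG t).
have cG : continuous G by move=> t; exact/differentiable_continuous/derivable1_diffP.
have E : (\int[lebesgue_measure]_(x in `[0%R, 1%R]) (g x)%:E = (G 1)%:E - (G 0)%:E)%E.
  apply: continuous_FTC2 => //; first exact: continuous_subspaceT.
    split; first by move=> x _; exact: dG'.
      exact/cvg_at_right_filter/cG.
    exact/cvg_at_left_filter/cG.
  by move=> x _; rewrite derive1E; case: (dG x).
rewrite /Rintegral -(setUCr `[0%R, 1%R]%classic).
have mgc := measurable_int _ (L1_m01 cg).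
rewrite integral_setU//; last 3 first.
- exact: measurableC.
- by rewrite setUCr.
- by rewrite disj_set2E setICr.
rewrite [X in (_ + X)%E](null_set_integral (mu := m01)) ?adde0//; last 3 first.
- exact: measurableC.
- exact: measurable_funTS.
- by rewrite /m01 /= /mfrestr /mrestr setICl measure0.
transitivity (fine (\int[lebesgue_measure]_(x in `[0%R, 1%R]) (g x)%:E)).
  by rewrite E.
congr fine.
transitivity (\int[lebesgue_measure]_(x in `[0%R, 1%R]) (g (clamp x))%:E)%E.
  apply: eq_integral => x; rewrite inE /= in_itv/= => h.
  by rewrite clamp_id.
apply: eq_measure_integral => A mA AD.
by rewrite /m01 /= /mfrestr /mrestr setIidl.
Qed.

End unit_interval.

(** * Partial derivatives *)

Section directional_derivatives.
Context {R : realType}.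
Implicit Types (f g : R3 R -> R) (x y v b : R3 R).

Lemma is_derive_lineP f x v c :
  is_derive x v f c <-> is_derive (0 : R) 1 (fun s : R => f (x + s *: v)) c.
Proof.
have E : (fun h : R => h^-1 *: (((fun s : R => f (x + s *: v)) \o shift 0) (h *: 1) -
    f (x + 0 *: v))) = (fun h : R => h^-1 *: ((f \o shift x) (h *: v) - f x)).
  apply/funext => h /=.
  by rewrite scale0r addr0 addr0 scaler1 [x + _]addrC.
split=> -[d1 d2]; split.
- by rewrite /derivable E.
- by rewrite /derive E.
- by move: d1; rewrite /derivable E.
- by move: d2; rewrite /derive E.
Qed.

Lemma is_derive_line f x v (t : R) : derivable f (x + t *: v) v ->
  is_derive t 1 (fun s : R => f (x + s *: v)) ('D_v f (x + t *: v)).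
Proof.
move=> df.
have E : (fun h : R => h^-1 *: (((fun s : R => f (x + s *: v)) \o shift t) (h *: 1) -
    f (x + t *: v))) =
    (fun h : R => h^-1 *: ((f \o shift (x + t *: v)) (h *: v) - f (x + t *: v))).
  apply/funext => h /=.
  by rewrite scaler1 scalerDl addrCA.
by split; [rewrite /derivable E|rewrite /derive E].
Qed.

Lemma is_derive_mulc (a t : R) : is_derive t 1 (fun s : R => a * s) a.
Proof.
by have := @is_deriveZ R R^o R^o id a t 1 1 (is_derive_id t 1); rewrite /GRing.scale/= mulr1.
Qed.

Lemma is_derive_affine f (a : R) b x v : derivable f (a *: x + b) v ->
  is_derive x v (fun y => f (a *: y + b)) (a * 'D_v f (a *: x + b)).
Proof.
move=> df; apply/is_derive_lineP.
have h : is_derive (a * 0 : R) 1 (fun s : R => f ((a *: x + b) + s *: v))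
    ('D_v f (a *: x + b)).
  by rewrite mulr0; apply/is_derive_lineP/derivableP.
have ha : is_derive (0 : R) 1 (fun s : R => a * s) a.
  exact: is_derive_mulc.
have := is_derive1_comp h ha; rewrite mulrC.
rewrite (_ : _ \o _ = fun s : R => f (a *: (x + s *: v) + b))//.
by apply/funext => s /=; rewrite scalerDr scalerA addrAC.
Qed.

(** A scale of finite smoothness. The mollified field is only ever differentiated once, and for it
    [smooth] would be more than what is established. *)
Fixpoint Cn (n : nat) f : Prop :=
  continuous f /\ if n is m.+1 then
    forall i, (forall x, derivable f x (evec i)) /\ Cn m (partial i f) else True.

Lemma Cn_cont n f : Cn n f -> continuous f. Proof. by case: n => [|n] []. Qed.

Lemma CnS_derivable n f i x : Cn n.+1 f -> derivable f x (evec i).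
Proof. by case=> _ /(_ i)[]. Qed.
Arguments CnS_derivable {n f} i x _.

Lemma CnS_partial n f i : Cn n.+1 f -> Cn n (partial i f).
Proof. by case=> _ /(_ i)[]. Qed.
Arguments CnS_partial {n f} i _.

Lemma CnW n f : Cn n.+1 f -> Cn n f.
Proof.
elim: n f => [|n ih] f [cf h]; split=> // i.
by have [? ?] := h i; split=> //; exact: ih.
Qed.

Lemma Cn_le m n f : (m <= n)%N -> Cn n f -> Cn m f.
Proof. by elim: n => [|n ih]; rewrite leq_eqVlt => /predU1P[->//|//] mn /CnW; exact: ih. Qed.

Lemma smooth_partial f i : smooth f -> smooth (partial i f).
Proof. by move=> sf s; rewrite /dpart -foldr_rcons; exact: sf. Qed.

Lemma smooth_Cn n f : smooth f -> Cn n f.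
Proof.
elim: n f => [|n ih] f sf; split=> //; try exact: (sf [::]).1.
by move=> i; split; [exact: (sf [::]).2|exact/ih/smooth_partial].
Qed.

Lemma Cn_smooth f : (forall n, Cn n f) -> smooth f.
Proof.
move=> cf s.
have h : forall n, Cn n (dpart s f).
  by elim: s => [//|i s ih] n /=; exact: CnS_partial (ih n.+1).
by split; [exact: Cn_cont (h 0%N)|move=> i x; exact: CnS_derivable (h 1%N)].
Qed.

Lemma is_derive_partial n f i x : Cn n.+1 f -> is_derive x (evec i) f (partial i f x).
Proof. by move=> /CnS_derivable h; exact/derivableP. Qed.
Arguments is_derive_partial {n f} i x _.

Lemma partial_val f i x c : is_derive x (evec i) f c -> partial i f x = c.
Proof. by case. Qed.

Lemma partial_cst (c : R) i : partial i (fun _ : R3 R => c) = fun=> 0.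
Proof. by apply/funext => x; apply: partial_val; exact: is_derive_cst. Qed.

Lemma partialD n f g i : Cn n.+1 f -> Cn n.+1 g ->
  partial i (fun x => f x + g x) = fun x => partial i f x + partial i g x.
Proof.
move=> cf cg; apply/funext => x; apply: partial_val.
exact: (is_deriveD (is_derive_partial i x cf) (is_derive_partial i x cg)).
Qed.
Arguments partialD {n f g} i _ _.

Lemma partialB n f g i : Cn n.+1 f -> Cn n.+1 g ->
  partial i (fun x => f x - g x) = fun x => partial i f x - partial i g x.
Proof.
move=> cf cg; apply/funext => x; apply: partial_val.
exact: (is_deriveB (is_derive_partial i x cf) (is_derive_partial i x cg)).
Qed.
Arguments partialB {n f g} i _ _.

Lemma partialZ n (c : R) f i : Cn n.+1 f ->
  partial i (fun x => c * f x) = fun x => c * partial i f x.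
Proof.
move=> cf; apply/funext => x; apply: partial_val.
exact: (is_deriveZ c (is_derive_partial i x cf)).
Qed.
Arguments partialZ {n} c {f} i _.

Lemma partialM n f g i : Cn n.+1 f -> Cn n.+1 g ->
  partial i (fun x => f x * g x) =
  fun x => f x * partial i g x + partial i f x * g x.
Proof.
move=> cf cg; apply/funext => x; apply: partial_val.
have := is_deriveM (is_derive_partial i x cf) (is_derive_partial i x cg).
by rewrite [g x *: _]mulrC.
Qed.
Arguments partialM {n f g} i _ _.

Lemma partial_affine n (a : R) b f i : Cn n.+1 f ->
  partial i (fun x => f (a *: x + b)) = fun x => a * partial i f (a *: x + b).
Proof.
move=> cf; apply/funext => x; apply: partial_val; apply: is_derive_affine.
exact: CnS_derivable cf.
Qed.
Arguments partial_affine {n} a b {f} i _.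

Lemma Cn_cst n (c : R) : Cn n (fun=> c).
Proof.
have h (c' : R) : continuous (fun _ : R3 R => c') by move=> x; exact: cvg_cst.
elim: n c => [|n ih] c; split=> // i; split; last by rewrite partial_cst.
by move=> x; exact: derivable_cst.
Qed.

Lemma CnD n f g : Cn n f -> Cn n g -> Cn n (fun x => f x + g x).
Proof.
elim: n f g => [|n ih] f g cf cg; split=> //.
- by move=> x; apply: cvgD; [exact: Cn_cont cf x|exact: Cn_cont cg x].
- by move=> x; apply: cvgD; [exact: Cn_cont cf x|exact: Cn_cont cg x].
move=> i; split; first by move=> x; exact: (derivableD (CnS_derivable i x cf) (CnS_derivable i x cg)).
by rewrite (partialD i cf cg); apply: ih;
  [exact: (CnS_partial i cf)|exact: (CnS_partial i cg)].
Qed.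

Lemma CnM n f g : Cn n f -> Cn n g -> Cn n (fun x => f x * g x).
Proof.
elim: n f g => [|n ih] f g cf cg; split=> //.
- by move=> x; apply: cvgM; [exact: Cn_cont cf x|exact: Cn_cont cg x].
- by move=> x; apply: cvgM; [exact: Cn_cont cf x|exact: Cn_cont cg x].
move=> i; split; first by move=> x; exact: (derivableM (CnS_derivable i x cf) (CnS_derivable i x cg)).
rewrite (partialM i cf cg); apply: CnD; apply: ih.
- exact: CnW cf.
- exact: (CnS_partial i cg).
- exact: (CnS_partial i cf).
- exact: CnW cg.
Qed.

Lemma CnZ n (c : R) f : Cn n f -> Cn n (fun x => c * f x).
Proof. by apply: CnM; exact: Cn_cst. Qed.

Lemma CnN n f : Cn n f -> Cn n (fun x => - f x).
Proof.
move=> cf; rewrite (_ : (fun x => _) = fun x => -1 * f x); first exact: CnZ.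
by apply/funext => x; rewrite mulN1r.
Qed.

Lemma CnB n f g : Cn n f -> Cn n g -> Cn n (fun x => f x - g x).
Proof. by move=> cf cg; apply: CnD => //; exact: CnN. Qed.

Lemma Cn_sum n (I : Type) (s : seq I) (F : I -> R3 R -> R) :
  (forall i, Cn n (F i)) -> Cn n (fun x => \sum_(i <- s) F i x).
Proof.
move=> cF; elim: s => [|i s ih].
  rewrite (_ : (fun x => _) = fun=> 0); first exact: Cn_cst.
  by apply/funext => x; rewrite big_nil.
rewrite (_ : (fun x => _) = fun x => F i x + \sum_(j <- s) F j x).
  exact: CnD.
by apply/funext => x; rewrite big_cons.
Qed.

Lemma continuous_affine (a : R) b : continuous (fun x : R3 R => a *: x + b).
Proof. by move=> x; apply: cvgD; [apply: cvgZr; exact: cvg_id|exact: cvg_cst]. Qed.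

Lemma Cn_affine n (a : R) b f : Cn n f -> Cn n (fun x => f (a *: x + b)).
Proof.
have h g : continuous g -> continuous (fun x => g (a *: x + b)).
  by move=> cg x; apply: continuous_comp; [exact: continuous_affine|exact: cg].
elim: n f => [|n ih] f cf; split=> //; try exact/h/(Cn_cont cf).
move=> i; split.
  by move=> x; case: (is_derive_affine (CnS_derivable i (a *: x + b) cf)).
by rewrite (partial_affine a b i cf); apply: CnZ; apply: ih; exact: (CnS_partial i cf).
Qed.

Lemma Cn_shift n b f : Cn n f -> Cn n (fun x => f (x + b)).
Proof.
move=> /(Cn_affine 1 b); rewrite (_ : (fun x => _) = fun x => f (x + b))//.
by apply/funext => x; rewrite scale1r.
Qed.

Lemma partial_shift n b f i : Cn n.+1 f ->
  partial i (fun x => f (x + b)) = fun x => partial i f (x + b).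
Proof.
move=> cf; have := partial_affine 1 b i cf.
rewrite (_ : (fun x => f _) = fun x => f (x + b)); last first.
  by apply/funext => x; rewrite scale1r.
by move=> ->; apply/funext => x; rewrite mul1r scale1r.
Qed.
Arguments partial_shift {n} b {f} i _.

Lemma continuous_line x v : continuous (fun s : R => x + s *: v).
Proof. by move=> s; apply: cvgD; [exact: cvg_cst|apply: cvgZl; exact: cvg_id]. Qed.

Lemma diff01 n f x (h : R) i : Cn n.+1 f ->
  f (x + h *: evec i) - f x =
  \int[m01]_t (h * partial i f (x + (h * clamp t) *: evec i)).
Proof.
move=> cf.
have cg : continuous (fun t : R => h * partial i f (x + (h * t) *: evec i)).
  move=> t; apply: cvgM; first exact: cvg_cst.
  apply: (@continuous_comp _ _ _ (fun t : R => x + (h * t) *: evec i)).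
    apply: cvgD; first exact: cvg_cst.
    by apply: cvgZl; apply: cvgM; [exact: cvg_cst|exact: cvg_id].
  exact: Cn_cont (CnS_partial i cf) _.
have dG (t : R) : is_derive t 1 (fun t : R => f (x + (h * t) *: evec i))
    (h * partial i f (x + (h * t) *: evec i)).
  have h1 := is_derive_line (CnS_derivable i (x + (h * t) *: evec i) cf).
  have h2 : is_derive (t : R) 1 (fun s : R => h * s) h.
    exact: is_derive_mulc.
  by have := is_derive1_comp h1 h2; rewrite mulrC.
have := ftc01 cg dG.
by rewrite mulr1 mulr0 scale0r addr0.
Qed.
Arguments diff01 {n f} x h i _.

(** A converse of [diff01]: if the increments are integrals of a continuous function along segments,
    that function is the derivative. Differentiation under an integral sign thus reduces to
    exchanging two integrals. *)
Lemma is_derive_of_int f g x i : continuous g ->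
  (forall h : R, f (x + h *: evec i) - f x =
     \int[m01]_t (h * g (x + (h * clamp t) *: evec i))) ->
  is_derive x (evec i) f (g x).
Proof.
move=> cg E; apply/is_derive_lineP.
suff H : (fun h : R => h^-1 *: (((fun s : R => f (x + s *: evec i)) \o shift 0) (h *: 1) -
    f (x + 0 *: evec i))) @ 0^' --> g x.
  by split; [apply/cvg_ex; exists (g x)|exact: cvg_lim].
apply/cvgrPdist_le => e e0.
have /cvgrPdist_le/(_ _ e0) [d /= d0 dg] : (fun s : R => g (x + s *: evec i)) @ (0:R) --> g x.
  rewrite -[X in _ --> g X]addr0 -(scale0r (evec i)).
  by apply: (@continuous_comp _ _ _ (fun s : R => x + s *: evec i));
    [exact: continuous_line|exact: cg].
exists d => //= h hd h0.
rewrite /= addr0 scaler1 scale0r addr0 E.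
have cgh : continuous (fun t : R => g (x + (h * t) *: evec i)).
  move=> t; apply: (@continuous_comp _ _ _ (fun t : R => x + (h * t) *: evec i)).
    apply: cvgD; first exact: cvg_cst.
    by apply: cvgZl; apply: cvgM; [exact: cvg_cst|exact: cvg_id].
  exact: cg.
rewrite RintZ; last exact: (L1_m01 cgh).
rewrite /GRing.scale/= mulKf// -[g x]Rint_m01_cst -RintB; last 2 first.
- exact: L1_m01_cst.
- exact: (L1_m01 cgh).
apply: Rint_m01_norm_le.
  apply: measurable_funB; first exact: measurable_cst.
  exact: L1_measurable (L1_m01 cgh).
move=> t; apply: dg; rewrite /= sub0r normrN normrM.
move: hd; rewrite /= sub0r normrN => hd.
rewrite (le_lt_trans _ hd)// ler_piMr// ger0_norm ?clamp_ge0//.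
exact: clamp_le1.
Qed.

Lemma near_norm x (Q : set (R3 R)) : (\forall y \near x, Q y) ->
  exists2 d : R, 0 < d & forall y, `|x - y| < d -> Q y.
Proof. by case/nbhs_normP => d /= d0 dQ; exists d. Qed.

Lemma norm_evec i : `|evec i : R3 R| <= 1.
Proof.
rewrite /evec /Num.norm/= !ge_max.
by case: i => [[|[|[|]]]]//= _; rewrite !(normr0, normr1) ?lexx ?ler01.
Qed.

Lemma mvt_line n f x i (h : R) : Cn n.+1 f -> 0 < h ->
  exists2 c, 0 <= c <= h & f (x + h *: evec i) - f x = h * partial i f (x + c *: evec i).
Proof.
move=> cf h0.
have d t : is_derive (t : R) 1 (fun s : R => f (x + s *: evec i))
    (partial i f (x + t *: evec i)).
  exact/is_derive_line/(CnS_derivable i _ cf).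
have [c] := MVT_segment (ltW h0) (fun t _ => d t)
  (derivable_within_continuous (fun t _ => @ex_derive _ _ _ _ _ _ _ (d t))).
by rewrite in_itv/= => ch; rewrite scale0r addr0 subr0 mulrC; exists c.
Qed.
Arguments mvt_line {n f} x i {h} _ _.

(** The double difference of [f] with steps [h e_i] and [h e_j] is symmetric in the two directions.
    The mean value theorem, used twice in either order, equates it with [h ^ 2] times either mixed
    derivative at a point close to [x]. *)
Lemma partialC n f i j : Cn n.+2 f ->
  partial i (partial j f) = partial j (partial i f).
Proof.
move=> cf; apply/funext => x; apply/eqP; rewrite -subr_eq0 -normr_eq0.
rewrite eq_le normr_ge0 andbT; apply/ler_addgt0Pl => e e0; rewrite addr0.
have e20 : 0 < e / 2 by rewrite divr_gt0.
have sw (A B C D : R) : A - B - (C - D) = A - C - (B - D) by ring.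
have hE (d1 d2 : R) : 0 < d1 -> 0 < d2 ->
    exists h : R, [/\ 0 < h, h * 4 <= d1 & h * 4 <= d2].
  move=> d10 d20; exists (Num.min d1 d2 / 4); split.
  - by rewrite divr_gt0// lt_min d10 d20.
  - by rewrite divfK// ge_min lexx.
  - by rewrite divfK// ge_min lexx orbT.
have fin (a b c : R) : `|a - c| < e / 2 -> `|b - c| < e / 2 -> `|a - b| <= e.
  rewrite !ltr_norml ler_norml => /andP[? ?] /andP[? ?].
  by apply/andP; split; lra.
have eC (h : R) : x + h *: evec j + h *: evec i = x + h *: evec i + h *: evec j.
  exact: addrAC.
have key (h : R) k l : 0 < h -> exists2 y, `|x - y| < h * 4 &
    f (x + h *: evec k + h *: evec l) - f (x + h *: evec k) - (f (x + h *: evec l) - f x)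
    = h ^+ 2 * partial l (partial k f) y.
  move=> h0; pose phi y := f (y + h *: evec l) - f y.
  have cphi : Cn n.+2 phi := CnB (Cn_shift (h *: evec l) cf) cf.
  have [c /andP[c0 ch] Ec] := mvt_line x k cphi h0.
  have [c' /andP[c'0 c'h] Ec'] := mvt_line (x + c *: evec k) l (CnS_partial k cf) h0.
  exists (x + c *: evec k + c' *: evec l).
    rewrite -addrA opprD addNKr normrN (le_lt_trans (ler_normD _ _))//.
    rewrite !normrZ !ger0_norm//.
    have := norm_evec k; have := norm_evec l => nl nk; nra.
  have -> : f (x + h *: evec k + h *: evec l) - f (x + h *: evec k) -
     (f (x + h *: evec l) - f x) = phi (x + h *: evec k) - phi x by [].
  rewrite Ec /phi (partialB k (Cn_shift (h *: evec l) cf) cf).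
  by rewrite (partial_shift (h *: evec l) k cf) Ec' expr2 mulrA.
have c1 := Cn_cont (CnS_partial i (CnS_partial j cf)) (x := x).
have c2 := Cn_cont (CnS_partial j (CnS_partial i cf)) (x := x).
have /cvgrPdist_lt/(_ _ e20)/near_norm[d1 d10 D1] := c1.
have /cvgrPdist_lt/(_ _ e20)/near_norm[d2 d20 D2] := c2.
have [h [h0 m1 m2]] := hE _ _ d10 d20.
have [y1 n1 E1] := key h i j h0; have [y2 n2 E2] := key h j i h0.
have {}D1 := D1 y2 (lt_le_trans n2 m1); have {}D2 := D2 y1 (lt_le_trans n1 m2).
have E : partial j (partial i f) y1 = partial i (partial j f) y2.
  apply: (@mulfI _ (h ^+ 2)); first by rewrite expf_neq0// gt_eqF.
  by move: E2; rewrite eC sw; exact: etrans (esym E1).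
by rewrite E in D2; exact: fin D1 D2.
Qed.
Arguments partialC {n f} i j _.

End directional_derivatives.

Arguments CnS_derivable {R n f} i x _.
Arguments CnS_partial {R n f} i _.
Arguments is_derive_partial {R n f} i x _.
Arguments partialD {R n f g} i _ _.
Arguments partialB {R n f g} i _ _.
Arguments partialZ {R n} c {f} i _.
Arguments partialM {R n f g} i _ _.
Arguments partial_affine {R n} a b {f} i _.
Arguments partial_shift {R n} b {f} i _.
Arguments diff01 {R n f} x h i _.
Arguments mvt_line {R n f} x i {h} _ _.
Arguments partialC {R n f} i j _.

Section measurable_R3.
Context {R : realType} d (T : measurableType d).
Implicit Types (phi chi : T -> M3 R).

Lemma measurable_fun_R3 (a b c : T -> measurableTypeR R) :
  measurable_fun setT a -> measurable_fun setT b -> measurable_fun setT c ->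
  measurable_fun setT (fun z => (a z, b z, c z) : M3 R).
Proof. by move=> ma mb mc; apply: measurable_fun_pair => //; exact: measurable_fun_pair. Qed.

Lemma measurable_coords phi : measurable_fun setT phi ->
  [/\ measurable_fun setT (fun z => (phi z).1.1),
      measurable_fun setT (fun z => (phi z).1.2) &
      measurable_fun setT (fun z => (phi z).2)].
Proof.
move=> mp; have m1 : measurable_fun setT (fun z => (phi z).1) by exact: measurableT_comp.
by split; [exact: measurableT_comp|exact: measurableT_comp|exact: measurableT_comp].
Qed.

Lemma measurable_add3 phi chi : measurable_fun setT phi -> measurable_fun setT chi ->
  measurable_fun setT (fun z => (phi z : R3 R) + chi z : M3 R).
Proof.
move=> /measurable_coords[a1 a2 a3] /measurable_coords[b1 b2 b3].
by apply: (measurable_fun_R3 (a := fun z => (phi z).1.1 + (chi z).1.1)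
  (b := fun z => (phi z).1.2 + (chi z).1.2) (c := fun z => (phi z).2 + (chi z).2));
  apply: measurable_funD.
Qed.

Lemma measurable_scale3 (h : T -> R) phi : measurable_fun setT (h : T -> measurableTypeR R) ->
  measurable_fun setT phi ->
  measurable_fun setT (fun z => h z *: (phi z : R3 R) : M3 R).
Proof.
move=> mh /measurable_coords[a1 a2 a3].
by apply: (measurable_fun_R3 (a := fun z => h z * (phi z).1.1)
  (b := fun z => h z * (phi z).1.2) (c := fun z => h z * (phi z).2));
  apply: measurable_funM.
Qed.

Lemma measurable_sub3 phi chi : measurable_fun setT phi -> measurable_fun setT chi ->
  measurable_fun setT (fun z => (phi z : R3 R) - chi z : M3 R).
Proof.
move=> mp mc; rewrite (_ : (fun z => _) = fun z => (phi z : R3 R) + (-1 *: (chi z : R3 R))).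
  by apply: measurable_add3 => //; apply: measurable_scale3.
by apply/funext => z; rewrite scaleN1r.
Qed.

Lemma measurable_comp3 phi (f : R3 R -> R) : measurable_fun setT phi -> continuous f ->
  measurable_fun setT (fun z => f (phi z)).
Proof. by move=> mp /continuous_measurable3 mf; exact: measurableT_comp. Qed.

End measurable_R3.

Section weighted_cauchy_schwarz.
Context {R : realType} d (T : measurableType d) (mu : {measure set T -> \bar R}).
Implicit Types k g : T -> R.

Lemma L1_weighted k g : measurable_fun setT k -> measurable_fun setT g ->
  L1 mu (fun x => `|k x|) -> L1 mu (fun x => `|k x| * g x ^+ 2) ->
  L1 mu (fun x => k x * g x).
Proof.
move=> mk mg l1 l2; apply: (L1_dom _ (L1D l1 l2)); first exact: measurable_funM.
move=> x; rewrite normrM -[X in X + _]mulr1 -mulrDr ler_wpM2l//.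
rewrite -[g x ^+ 2]real_normK ?num_real//.
by have := sqr_ge0 (`|g x| - 1); nra.
Qed.

(** The integral of [|k| (s - |g|) ^ 2] is nonnegative for every real [s]; the claim is the sign of
    the discriminant of this quadratic polynomial. *)
Lemma weighted_CS k g : measurable_fun setT k -> measurable_fun setT g ->
  L1 mu (fun x => `|k x|) -> L1 mu (fun x => `|k x| * g x ^+ 2) ->
  (\int[mu]_x (k x * g x)) ^+ 2 <=
  \int[mu]_x `|k x| * \int[mu]_x (`|k x| * g x ^+ 2).
Proof.
move=> mk mg l1 l2; have l3 := L1_weighted mk mg l1 l2.
set A := \int[mu]_x `|k x|; set D := \int[mu]_x (`|k x| * _).
have l4 : L1 mu (fun x => `|k x| * `|g x|).
  by apply: L1_eq (L1_norm l3) => x; rewrite normrM.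
pose B := \int[mu]_x (`|k x| * `|g x|).
have A0 : 0 <= A by apply: Rint_ge0.
have B0 : 0 <= B by apply: Rint_ge0 => x; rewrite mulr_ge0.
have D0 : 0 <= D by apply: Rint_ge0 => x; rewrite mulr_ge0// sqr_ge0.
apply: (@le_trans _ _ (B ^+ 2)).
  rewrite -real_normK ?num_real// lerXn2r ?nnegrE// /B.
  apply: le_trans (Rint_norm l3) _; apply: Rint_le => //; first exact: L1_norm l3.
  by move=> x; rewrite normrM.
have key s : 0 <= s ^+ 2 * A - 2 * s * B + D.
  rewrite -RintZ// -RintZ// -RintB; [|exact: L1Z|exact: L1Z].
  rewrite -RintD//; last by apply: L1B; exact: L1Z.
  apply: Rint_ge0 => x.
  have -> : s ^+ 2 * `|k x| - 2 * s * (`|k x| * `|g x|) + `|k x| * g x ^+ 2 =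
      `|k x| * (s - `|g x|) ^+ 2.
    by rewrite -(real_normK (num_real (g x))); ring.
  by rewrite mulr_ge0// sqr_ge0.
have [A1|A1] := eqVneq A 0.
  have [->|B1] := eqVneq B 0; first by rewrite A1 expr0n mul0r.
  have Bp : 0 < B by rewrite lt_neqAle eq_sym B1.
  (* With [A = 0] the polynomial is affine in [s], and at this [s] it takes the negative value
     [- D - 2]. *)
  have := key ((D + 1) / B); rewrite A1 mulr0.
  rewrite (_ : 0 - _ + D = - D - 2); last by field.
  lra.
have Ap : 0 < A by rewrite lt_neqAle eq_sym A1.
have := key (B / A).
rewrite (_ : _ + D = (A * D - B ^+ 2) / A); last by field.
by rewrite pmulr_lge0 ?invr_gt0// subr_ge0.
Qed.

End weighted_cauchy_schwarz.

Lemma continuous_sqr {R : realType} (T : topologicalType) (f : T -> R) :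
  continuous f -> continuous (fun x => f x ^+ 2).
Proof.
move=> cf x; rewrite (_ : (fun x => _) = fun x => f x * f x).
  by apply: cvgM; exact: cf.
by apply/funext => y; rewrite expr2.
Qed.

Section integrals_R3.
Context {R : realType}.
Implicit Types (f g : R3 R -> R) (x y : R3 R).

Lemma continuous_m f : continuous f -> measurable_fun setT (f : M3 R -> R).
Proof. exact: continuous_measurable3. Qed.

Let measurable_step (h : R) i :
  measurable_fun setT (fun z : M3 R * measurableTypeR R =>
    (z.1 : R3 R) + (h * clamp z.2) *: evec i : M3 R).
Proof.
apply: measurable_add3 => //; apply: measurable_scale3 => //.
apply: measurable_funM => //; apply: measurableT_comp => //.
exact: (continuous_measurable_fun (@clamp_cont R)).
Qed.

Lemma L1_path g (h : R) i : continuous g -> L1 mu3 g ->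
  L1 (prod_measure mu3 m01)
    (fun z => g ((z.1 : R3 R) + (h * clamp z.2) *: evec i)).
Proof.
move=> cg lg; apply: (@L1_prod2 _ _ _ _ _ _ _ _ (fun=> \int[mu3]_x `|g x|)).
- exact: (measurable_comp3 (measurable_step h i) cg).
- by move=> t; exact: (L1_shift ((h * clamp t) *: evec i) lg).
- exact: L1_m01_cst.
- by move=> t; have -> := Rint_shift ((h * clamp t) *: evec i) (L1_norm lg).
Qed.
Arguments L1_path {g} h i _ _.

Lemma Rint_path g (h : R) i : continuous g -> L1 mu3 g ->
  L1 mu3 (fun x => \int[m01]_t g (x + (h * clamp t) *: evec i)) /\
  \int[mu3]_x \int[m01]_t g ((x : R3 R) + (h * clamp t) *: evec i) = \int[mu3]_x g x.
Proof.
move=> cg lg; have l := L1_path h i cg lg; split; first exact: (Rfubini1 l).1.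
rewrite (Rfubini l)/= -[RHS]Rint_m01_cst; apply: Rint_eq => t.
exact: Rint_shift.
Qed.
Arguments Rint_path {g} h i _ _.

(** The increment [f (x + e_i) - f x] has integral 0 by translation invariance. It is also the mean
    of the derivative over a segment, and this mean has the same integral as the derivative. *)
Lemma Rint_partial f i : Cn 1 f -> L1 mu3 f -> L1 mu3 (partial i f) ->
  \int[mu3]_x partial i f x = 0.
Proof.
move=> cf lf lp.
rewrite -(Rint_path 1 i (Cn_cont (CnS_partial i cf)) lp).2.
transitivity (\int[mu3]_x (f ((x : R3 R) + evec i) - f x)).
  apply: Rint_eq => x; rewrite -{2}[evec i]scale1r (diff01 x 1 i cf).
  by apply: Rint_eq => t; rewrite [RHS]mul1r.
by rewrite RintB//; [rewrite (Rint_shift (evec i) lf) subrr|exact: L1_shift].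
Qed.
Arguments Rint_partial {f} i _ _ _.

Lemma Rint_parts f g i : Cn 1 f -> Cn 1 g -> L1 mu3 (fun x => f x * g x) ->
  L1 mu3 (fun x => f x * partial i g x) -> L1 mu3 (fun x => partial i f x * g x) ->
  \int[mu3]_x (f x * partial i g x) = - \int[mu3]_x (partial i f x * g x).
Proof.
move=> cf cg l1 l2 l3; apply/eqP; rewrite -addr_eq0 -RintD//.
have := Rint_partial i (CnM cf cg) l1; rewrite (partialM i cf cg) => -> //.
exact: L1D.
Qed.
Arguments Rint_parts {f g} i _ _ _ _ _.

(** Jensen's inequality on the segment, then translation invariance of the integral of the squared
    derivative. *)
Lemma L2_step f (h : R) i : Cn 1 f -> L1 mu3 (fun x => partial i f x ^+ 2) ->
  L1 mu3 (fun x => (f (x + h *: evec i) - f x) ^+ 2) /\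
  \int[mu3]_x ((f ((x : R3 R) + h *: evec i) - f x) ^+ 2) <=
  h ^+ 2 * \int[mu3]_x (partial i f x ^+ 2).
Proof.
move=> cf l2; have cp := Cn_cont (CnS_partial i cf).
have cp2 : continuous (fun x => partial i f x ^+ 2) by exact: continuous_sqr.
have [l E] := Rint_path h i cp2 l2.
have cfd : continuous (fun x => (f (x + h *: evec i) - f x) ^+ 2).
  exact: continuous_sqr (Cn_cont (CnB (Cn_shift (h *: evec i) cf) cf)).
have b x : (f (x + h *: evec i) - f x) ^+ 2 <=
    h ^+ 2 * \int[m01]_t (partial i f (x + (h * clamp t) *: evec i) ^+ 2).
  have cl : continuous (fun t : R => partial i f (x + (h * t) *: evec i)).
    move=> t; apply: (@continuous_comp _ _ _ (fun t : R => x + (h * t) *: evec i)).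
      apply: cvgD; first exact: cvg_cst.
      by apply: cvgZl; apply: cvgM; [exact: cvg_cst|exact: cvg_id].
    exact: cp.
  have cl2 := continuous_sqr cl.
  rewrite (diff01 x h i cf) RintZ; last exact: (L1_m01 cl).
  rewrite exprMn ler_wpM2l ?sqr_ge0//; apply: Rint_m01_sqr.
    exact: (L1_m01 cl).
  exact: (L1_m01 cl2).
have ld : L1 mu3 (fun x => (f (x + h *: evec i) - f x) ^+ 2).
  apply: L1_dom (L1Z (h ^+ 2) l) _; first exact: continuous_m.
  by move=> x; rewrite ger0_norm ?sqr_ge0.
by split=> //; rewrite -E -RintZ//; apply: Rint_le => //; exact: L1Z.
Qed.
Arguments L2_step {f} h i _ _.

Definition j0 : 'I_3 := @Ordinal 3 0 isT.
Definition j1 : 'I_3 := @Ordinal 3 1 isT.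
Definition j2 : 'I_3 := @Ordinal 3 2 isT.

Lemma sum3 (V : nmodType) (F : 'I_3 -> V) : \sum_(i < 3) F i = F j0 + F j1 + F j2.
Proof.
rewrite !big_ord_recl big_ord0 addr0 addrA.
by congr (F _ + F _ + F _); exact: val_inj.
Qed.

Lemma ord3P (Q : 'I_3 -> Prop) : Q j0 -> Q j1 -> Q j2 -> forall i, Q i.
Proof.
move=> h0 h1 h2 [[|[|[|//]]] h].
- by rewrite (_ : Ordinal h = j0)//; exact: val_inj.
- by rewrite (_ : Ordinal h = j1)//; exact: val_inj.
- by rewrite (_ : Ordinal h = j2)//; exact: val_inj.
Qed.

Lemma evec_sum y : y = y.1.1 *: evec j0 + y.1.2 *: evec j1 + y.2 *: evec j2.
Proof.
case: y => -[a b] c; congr (_, _, _); rewrite /= /GRing.scale/=.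
- by rewrite mulr1 !mulr0 !addr0.
- by rewrite mulr1 !mulr0 add0r addr0.
- by rewrite mulr1 !mulr0 !add0r.
Qed.

Lemma sqr_add3_le (p q r : R) : (p + q + r) ^+ 2 <= 3 * (p ^+ 2 + q ^+ 2 + r ^+ 2).
Proof. by have := sqr_ge0 (p - q); have := sqr_ge0 (p - r); have := sqr_ge0 (q - r); nra. Qed.

Lemma telescope3 (p q r s : R) : q - p + (r - q) + (s - r) = s - p.
Proof. by ring. Qed.

Lemma sum3_mul_le (p q r a b c : R) : 0 <= p -> 0 <= q -> 0 <= r ->
  0 <= a -> 0 <= b -> 0 <= c -> p * a + q * b + r * c <= (p + q + r) * (a + b + c).
Proof. by move=> *; nra. Qed.

(* L2 control of a translation by the gradient, moving along the axes. *)
Lemma L2_diff f y : Cn 1 f -> (forall i, L1 mu3 (fun x => partial i f x ^+ 2)) ->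
  L1 mu3 (fun x => (f (x + y) - f x) ^+ 2) /\
  \int[mu3]_x ((f ((x : R3 R) + y) - f x) ^+ 2) <=
  3 * (y.1.1 ^+ 2 + y.1.2 ^+ 2 + y.2 ^+ 2) *
    \sum_(i < 3) \int[mu3]_x (partial i f x ^+ 2).
Proof.
move=> cf l2.
pose a := y.1.1 *: evec j0 : R3 R; pose b := y.1.2 *: evec j1 : R3 R.
pose c := y.2 *: evec j2 : R3 R.
have yE : y = a + b + c by exact: evec_sum.
have [la Ia] := L2_step y.1.1 j0 cf (l2 j0).
have [lb Ib] := L2_step y.1.2 j1 cf (l2 j1).
have [lc Ic] := L2_step y.2 j2 cf (l2 j2).
have lb' := L1_shift a lb; have lc' := L1_shift (a + b) lc.
have Ib' := Rint_shift a lb; have Ic' := Rint_shift (a + b) lc.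
have bnd x : (f (x + y) - f x) ^+ 2 <=
    3 * ((f (x + a) - f x) ^+ 2 + (f (x + a + b) - f (x + a)) ^+ 2 +
         (f (x + (a + b) + c) - f (x + (a + b))) ^+ 2).
  apply: le_trans (sqr_add3_le _ _ _).
  have -> : x + y = x + (a + b) + c by rewrite yE addrA.
  by rewrite -[x + a + b]addrA telescope3.
have lg := L1Z 3 (L1D (L1D la lb') lc').
have ld : L1 mu3 (fun x => (f (x + y) - f x) ^+ 2).
  apply: L1_dom lg _.
    exact: continuous_m (continuous_sqr (Cn_cont (CnB (Cn_shift y cf) cf))).
  by move=> x; rewrite ger0_norm ?sqr_ge0//; exact: bnd.
split=> //; apply: le_trans (Rint_le ld lg bnd) _.
rewrite RintZ; last exact: L1D (L1D la lb') lc'.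
rewrite RintD; [|exact: L1D la lb'|exact: lc'].
rewrite RintD; [|exact: la|exact: lb'].
rewrite Ib' Ic' -mulrA ler_wpM2l// sum3.
have p i : 0 <= \int[mu3]_x (partial i f x ^+ 2) by apply: Rint_ge0 => x; exact: sqr_ge0.
apply: le_trans (lerD (lerD Ia Ib) Ic) _.
by apply: sum3_mul_le; rewrite ?sqr_ge0 ?p.
Qed.

End integrals_R3.

Arguments L1_path {R g} h i _ _.
Arguments Rint_path {R g} h i _ _.
Arguments Rint_partial {R f} i _ _ _.
Arguments Rint_parts {R f g} i _ _ _ _ _.
Arguments L2_step {R f} h i _ _.

(** * Functions vanishing outside a cube *)

Section compact_support.
Context {R : realType}.
Implicit Types (f g : R3 R -> R) (x y : R3 R).

Definition vanish (r : R) f := forall x, r < `|x| -> f x = 0.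

Lemma vanish_mull r f g : vanish r f -> vanish r (fun x => f x * g x).
Proof. by move=> vf x rx; rewrite vf// mul0r. Qed.

Lemma vanish_mulr r f g : vanish r g -> vanish r (fun x => f x * g x).
Proof. by move=> vf x rx; rewrite vf// mulr0. Qed.

Lemma vanish_partial r f i : vanish r f -> vanish r (partial i f).
Proof.
move=> vf x rx.
rewrite /partial (near_eq_derive (g := fun=> 0)); last first.
  apply/nbhs_normP; exists (`|x| - r); first by rewrite /= subr_gt0.
  move=> y /= xy; apply: vf.
  by have := lerB_dist x y; lra.
exact: derive_cst.
Qed.
Arguments vanish_partial {r f} i _.

Definition box (r : R) : set (R3 R) :=
  (`[- r, r]%classic `*` `[- r, r]%classic) `*` `[- r, r]%classic.

Lemma box_compact r : compact (box r).
Proof. by apply: compact_setX; [apply: compact_setX|]; exact: segment_compact. Qed.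

Lemma norm_boxP r x : `|x| <= r -> box r x.
Proof.
rewrite /Num.norm/= !ge_max => /andP[/andP[h1 h2] h3].
by split; [split|]; rewrite /= in_itv/= -ler_norml.
Qed.

Lemma box_norm r x : box r x -> `|x| <= r.
Proof.
case=> -[/=]; rewrite !in_itv/= -!ler_norml => h1 h2 h3.
by rewrite /Num.norm/= !ge_max h1 h2 h3.
Qed.

Lemma box_bounded r f : continuous f ->
  exists2 C, 0 <= C & forall x, `|x| <= r -> `|f x| <= C.
Proof.
move=> cf; have [r0|r0] := leP 0 r; last first.
  by exists 0 => // x xr; move: r0; rewrite ltNge (le_trans _ xr).
have b0 : box r !=set0 by exists 0; apply: norm_boxP; rewrite normr0.
have cn : {within box r, continuous (fun x => `|f x|)}.
  by apply: continuous_subspaceT => x; apply: cvg_norm; exact: cf.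
have [c _ h] := compact_EVT_max b0 (@box_compact r) cn.
by exists `|f c| => // x xr; apply: h; rewrite inE; exact: norm_boxP.
Qed.

Lemma vanish_bounded r f : continuous f -> vanish r f ->
  exists2 C, 0 <= C & forall x, `|f x| <= C.
Proof.
move=> /(box_bounded r)[C C0 h] vf; exists C => // x.
by have [/h//|/vf ->] := leP `|x| r; rewrite normr0.
Qed.

Lemma measurable_box r : measurable (box r : set (M3 R)).
Proof. by apply: measurableX => //; apply: measurableX. Qed.

Lemma mu3_box r : 0 <= r -> mu3 (box r) = ((2 * r) ^+ 3)%:E.
Proof.
move=> r0; have h : lebesgue_measure (`[- r, r]%classic : set (measurableTypeR R)) = (2 * r)%:E.
  rewrite lebesgue_measure_itv/= lte_fin; case: ifPn => [_|].
    by rewrite -EFinB; congr EFin; ring.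
  by rewrite -leNgt => ?; congr EFin; lra.
have E1 := @product_measure1E _ _ _ _ R mu2 mu1 _ _ 
  (measurableX (measurable_itv `[- r, r]) (measurable_itv `[- r, r])) (measurable_itv `[- r, r]).
have E2 := @product_measure1E _ _ _ _ R mu1 mu1 _ _ 
  (measurable_itv `[- r, r]) (measurable_itv `[- r, r]).
transitivity ((2 * r)%:E * (2 * r)%:E * (2 * r)%:E)%E.
  rewrite -h; apply: etrans E1 _; congr (_ * _)%E; exact: E2.
by rewrite -!EFinM; congr EFin; ring.
Qed.

Lemma L1_box r : L1 mu3 (\1_(box r) : R3 R -> R).
Proof.
have [r0|r0] := leP 0 r.
  have mb : (mu3 (box r) < +oo)%E by rewrite mu3_box// ltry.
  apply: L1_lty; [|by move=> x; exact: ler0n|].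
    exact: (measurable_indic (measurable_box r)).
  by rewrite integral_indic ?setIT//; exact: measurable_box.
apply: L1_eq (L1_0 mu3) => x; rewrite indicE memNset//.
by move=> /box_norm /(le_trans (normr_ge0 x)); rewrite leNgt r0.
Qed.

Lemma vanish_L1 r f : continuous f -> vanish r f -> L1 mu3 f.
Proof.
move=> cf vf; have [C C0 h] := vanish_bounded cf vf.
apply: L1_dom (L1Z C (L1_box r)) _; first exact: continuous_m.
move=> x; rewrite indicE; have [xr|xr] := leP `|x| r; last first.
  by rewrite vf// normr0 mulr_ge0.
by rewrite mem_set ?mulr1//; exact: norm_boxP.
Qed.

Lemma L1_bounded_mul f g C : continuous f -> continuous g -> (forall x, `|f x| <= C) ->
  L1 mu3 g -> L1 mu3 (fun x => f x * g x).
Proof.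
move=> cf cg fC lg; apply: L1_dom (L1Z C (L1_norm lg)) _.
  by apply: continuous_m => x; apply: cvgM; [exact: cf|exact: cg].
by move=> x; rewrite normrM ler_wpM2r.
Qed.

End compact_support.
Arguments vanish_partial {R r f} i _.

(** * Polynomial weights and Peetre's inequality *)

Section weights.
Context {R : realType}.
Implicit Types (f g : R3 R -> R) (x y : R3 R).

(** A product weight in place of [1 + |x| ^ 2]: its inverse is, up to normalisation, a product of
    three Cauchy densities, hence already integrable, and it is also the profile of a product of
    one-dimensional Poisson kernels. *)
Definition rho x : R := (1 + x.1.1 ^+ 2) * (1 + x.1.2 ^+ 2) * (1 + x.2 ^+ 2).

Lemma one_sqr_ge1 (a : R) : 1 <= 1 + a ^+ 2.
Proof. by rewrite lerDl sqr_ge0. Qed.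

Lemma one_sqr_gt0 (a : R) : 0 < 1 + a ^+ 2.
Proof. exact: lt_le_trans ltr01 (one_sqr_ge1 a). Qed.

Lemma rho_ge1 x : 1 <= rho x.
Proof. by rewrite /rho !mulr_ege1 ?one_sqr_ge1. Qed.

Lemma rho_gt0 x : 0 < rho x.
Proof. exact: lt_le_trans ltr01 (rho_ge1 x). Qed.

Lemma rhoX_ge1 m x : 1 <= rho x ^+ m. Proof. by rewrite exprn_ege1// rho_ge1. Qed.

Lemma rhoX_gt0 m x : 0 < rho x ^+ m. Proof. by rewrite exprn_gt0// rho_gt0. Qed.

Lemma sqr_coords_le_rho x : x.1.1 ^+ 2 + x.1.2 ^+ 2 + x.2 ^+ 2 <= rho x.
Proof.
rewrite /rho; have := sqr_ge0 x.1.1; have := sqr_ge0 x.1.2; have := sqr_ge0 x.2.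
move: (x.1.1 ^+ 2) (x.1.2 ^+ 2) (x.2 ^+ 2) => a b c c0 b0 a0.
by have := mulr_ge0 a0 b0; have := mulr_ge0 a0 c0; have := mulr_ge0 b0 c0;
   have := mulr_ge0 (mulr_ge0 a0 b0) c0; nra.
Qed.

Lemma peetre1 (a b : R) : 1 + (a - b) ^+ 2 <= 2 * (1 + a ^+ 2) * (1 + b ^+ 2).
Proof.
have := sqr_ge0 (a + b); have := sqr_ge0 (a * b); have := sqr_ge0 a; have := sqr_ge0 b.
nra.
Qed.

(** Peetre's inequality; [8] collects one factor 2 of [peetre1] per coordinate. *)
Lemma peetre x y : rho (x - y) <= 8 * rho x * rho y.
Proof.
rewrite (_ : 8 * _ * _ = (2 * (1 + x.1.1 ^+ 2) * (1 + y.1.1 ^+ 2)) *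
  (2 * (1 + x.1.2 ^+ 2) * (1 + y.1.2 ^+ 2)) * (2 * (1 + x.2 ^+ 2) * (1 + y.2 ^+ 2))).
  have h (a : R) : 0 <= 1 + a ^+ 2 by rewrite ltW// one_sqr_gt0.
  by rewrite /rho; apply: ler_pM; rewrite ?mulr_ge0// ?peetre1//; apply: ler_pM; rewrite ?h ?peetre1.
by rewrite /rho; ring.
Qed.

Lemma rho_cont : continuous rho.
Proof.
have h (p : R3 R -> R) : continuous p -> continuous (fun x => 1 + p x ^+ 2).
  by move=> cp x; apply: cvgD; [exact: cvg_cst|exact: continuous_sqr].
have c1 : continuous (fun x : R3 R => x.1.1).
  by move=> x; apply: (@continuous_comp _ _ _ fst fst); exact: cvg_fst.
have c2 : continuous (fun x : R3 R => x.1.2).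
  by move=> x; apply: (@continuous_comp _ _ _ fst snd); [exact: cvg_fst|exact: cvg_snd].
have c3 : continuous (fun x : R3 R => x.2) by move=> x; exact: cvg_snd.
by move=> x; apply: cvgM; [apply: cvgM|]; apply: h.
Qed.

Lemma rhoX_cont m : continuous (fun x => rho x ^+ m).
Proof.
move=> x; apply: (@continuous_comp _ _ _ rho (fun r : R => r ^+ m)).
  exact: rho_cont.
exact: exprn_continuous.
Qed.

Lemma rhoXV_cont m : continuous (fun x => (rho x ^+ m)^-1).
Proof.
move=> x; apply: cvgV; first by rewrite gt_eqF// rhoX_gt0.
exact: rhoX_cont.
Qed.

Lemma int_cauchy : L1 mu1 (fun t : R => (1 + t ^+ 2)^-1) /\
  \int[mu1]_t (1 + (t : R) ^+ 2)^-1 = pi.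
Proof.
have c : continuous (fun t : R => (1 + t ^+ 2)^-1).
  move=> t; apply: cvgV; first by rewrite gt_eqF// one_sqr_gt0.
  by apply: cvgD; [exact: cvg_cst|exact: exprn_continuous].
have p t : 0 <= (1 + t ^+ 2 : R)^-1 by rewrite invr_ge0 ltW// one_sqr_gt0.
have E : (\int[lebesgue_measure]_t ((1 + t ^+ 2 : R)^-1)%:E = pi%:E)%E.
  rewrite ge0_symfun_integralT//; last by move=> t /=; rewrite sqrrN.
  rewrite -set_itvcy (ge0_continuous_FTC2y (F := @atan R) (l := pi / 2))//.
  - by rewrite atan0 sube0 -EFinM mulrC divfK.
  - exact: continuous_subspaceT.
  - exact: cvgy_atan.
  - by apply: cvg_at_right_filter; exact: continuous_atan.
  - by move=> t _; rewrite derive1_atan.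
have l : L1 mu1 (fun t : R => (1 + t ^+ 2)^-1).
  apply: L1_lty => //; first exact: continuous_measurable_fun.
  by rewrite [X in (X < _)%E]E ltry.
by split=> //; apply: EFin_inj; rewrite EFin_Rint//.
Qed.

End weights.

Section tensor.
Context {R : realType}.

Lemma L1_tensor d1 d2 (T1 : measurableType d1) (T2 : measurableType d2)
    (m1 : {sigma_finite_measure set T1 -> \bar R})
    (m2 : {sigma_finite_measure set T2 -> \bar R}) (a : T1 -> R) (b : T2 -> R) :
  L1 m1 a -> L1 m2 b ->
  L1 (prod_measure m1 m2) (fun z => a z.1 * b z.2) /\
  \int[prod_measure m1 m2]_z (a z.1 * b z.2) = \int[m1]_x a x * \int[m2]_x b x.
Proof.
move=> la lb.
have l : L1 (prod_measure m1 m2) (fun z => a z.1 * b z.2).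
  apply: (L1_prod1 (G := fun x => `|a x| * \int[m2]_y `|b y|)).
  - have ma := L1_measurable la; have mb := L1_measurable lb.
    by apply: measurable_funM; apply: measurableT_comp.
  - by move=> x; exact: (L1Z (a x) lb).
  - by apply: L1Zr; exact: L1_norm la.
  - move=> x /=; rewrite -RintZ; last exact: L1_norm lb.
    by rewrite le_eqVlt; apply/orP; left; apply/eqP; apply: Rint_eq => y; rewrite normrM.
split=> //; rewrite -(Rfubini1 l).2 /= -RintZr//.
by apply: Rint_eq => x; rewrite RintZ.
Qed.

Lemma L1_tensor3 (a b c : R -> R) : L1 mu1 a -> L1 mu1 b -> L1 mu1 c ->
  L1 mu3 (fun x : R3 R => a x.1.1 * b x.1.2 * c x.2) /\
  \int[mu3]_x (a (x : R3 R).1.1 * b (x : R3 R).1.2 * c (x : R3 R).2) =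
  \int[mu1]_t a t * \int[mu1]_t b t * \int[mu1]_t c t.
Proof.
move=> la lb lc; have [l1 e1] := L1_tensor la lb; have [l2 e2] := L1_tensor l1 lc.
by split; [exact: l2|rewrite -e1 -e2].
Qed.

Lemma L1_rhoV : L1 mu3 (fun x : R3 R => (rho x)^-1).
Proof.
have [l _] := @int_cauchy R; have [h _] := L1_tensor3 l l l.
by apply: L1_eq h => x; rewrite /rho !invfM.
Qed.

Lemma L1_rhoXV m : (0 < m)%N -> L1 mu3 (fun x : R3 R => (rho x ^+ m)^-1).
Proof.
move=> m0; apply: L1_dom L1_rhoV _; first exact: continuous_m (@rhoXV_cont R m).
move=> x; rewrite ger0_norm; last by rewrite invr_ge0 ltW// rhoX_gt0.
rewrite lef_pV2 ?posrE ?rhoX_gt0 ?rho_gt0//.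
by rewrite -{1}[rho x]expr1 ler_weXn2l// rho_ge1.
Qed.

End tensor.

(** * Convolution with decaying kernels *)

Section parametric_continuity.
Context {R : realType}.

Lemma norm_near (x : R3 R) (d : R) (Q : set (R3 R)) : 0 < d ->
  (forall y, `|x - y| < d -> Q y) -> nbhs x Q.
Proof.
move=> d0 h; have := @nbhs_normP _ _ x Q; move=> H; apply/H.
by exists d => //= y; exact: h.
Qed.

(** Dominated convergence is sequential, so continuity is tested on sequences. They may be taken in
    the unit ball around [x0], so a majorant valid near [x0] is enough. *)
Lemma seq_continuous (F : R3 R -> R) (x0 : R3 R) :
  (forall u : nat -> R3 R, (forall n, `|x0 - u n| <= 1) -> u n @[n --> \oo] --> x0 ->
     F (u n) @[n --> \oo] --> F x0) -> {for x0, continuous F}.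
Proof.
move=> h; apply/cvgrPdist_le => e e0; apply: contrapT => nh.
have ex (n : nat) : exists x, `|x0 - x| < n.+1%:R^-1 /\ e < `|F x0 - F x|.
  apply: contrapT => nx; apply: nh.
  have : nbhs x0 [set x | `|F x0 - F x| <= e]; last by [].
  apply: (@norm_near _ n.+1%:R^-1); first by rewrite invr_gt0.
  move=> x xn; rewrite /= leNgt; apply/negP => ex; apply: nx.
  by exists x.
have [u hu] := choice ex.
have u1 n : `|x0 - u n| <= 1.
  by apply: le_trans (ltW (hu n).1) _; rewrite invf_le1// ler1n.
have cu : u n @[n --> \oo] --> x0.
  apply/cvgrPdist_lt => d d0; near=> n.
  apply: lt_trans (hu n).1 _.
  by near: n; exact: near_infty_natSinv_lt (PosNum d0).
have /cvgrPdist_lt/(_ _ e0)[N _ /(_ N (leqnn N))] := h u u1 cu.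
by rewrite ltNge ltW// (hu N).2.
Unshelve. all: by end_near. Qed.

Lemma continuous_Rint d (T : measurableType d) (mu : {measure set T -> \bar R})
    (f : R3 R -> T -> R) (g : T -> R) (x0 : R3 R) :
  (forall x, measurable_fun setT (f x)) ->
  (forall y, {for x0, continuous (f^~ y)}) -> L1 mu g ->
  (forall x y, `|x0 - x| <= 1 -> `|f x y| <= g y) ->
  {for x0, continuous (fun x => \int[mu]_y f x y)}.
Proof.
move=> mf cf lg fg; apply: seq_continuous => u u1 cu.
apply: (Rdct (f_ := fun n => f (u n)) (g := g) _ _ lg _).2 => //.
- by move=> y; exact: (continuous_cvg _ (cf y) cu).
- by move=> n y; exact: fg.
Qed.

End parametric_continuity.

Section convolution.
Context {R : realType}.
Implicit Types (f g K : R3 R -> R) (x y : R3 R).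

Lemma rhoXV_ge0 m x : 0 <= (rho x ^+ m)^-1.
Proof. by rewrite invr_ge0 ltW// rhoX_gt0. Qed.

Lemma normr_rhoXV m x : `|(rho x ^+ m)^-1| = (rho x ^+ m)^-1.
Proof. by rewrite ger0_norm// rhoXV_ge0. Qed.

Lemma rhoXV_le1 m x : (rho x ^+ m)^-1 <= 1.
Proof. by rewrite invf_le1 ?rhoX_gt0// rhoX_ge1. Qed.

(* Kernels of decay [rho^-m], and the functions they can be convolved with. *)
Definition kern m C K : Prop :=
  continuous K /\ forall x, `|K x| <= C / rho x ^+ m.

Definition W m f : Prop :=
  continuous f /\ L1 mu3 (fun x => f x / rho x ^+ m).

Definition conv K f x : R := \int[mu3]_y (K y * f (x - (y : R3 R))).

Lemma kern_ge0 m C K : kern m C K -> 0 <= C.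
Proof.
move=> [_ /(_ 0) h]; have := le_trans (normr_ge0 _) h.
by rewrite pmulr_lge0// invr_gt0 rhoX_gt0.
Qed.

Lemma kern_norm m C K : kern m C K -> kern m C (fun x => `|K x|).
Proof.
move=> [cK h]; split; first by move=> x; apply: cvg_norm; exact: cK.
by move=> x; rewrite normr_id.
Qed.

Lemma W_norm m f : W m f -> W m (fun x => `|f x|).
Proof.
move=> [cf lf]; split; first by move=> x; apply: cvg_norm; exact: cf.
apply: L1_eq (L1_norm lf) => x.
by rewrite normrM normr_rhoXV.
Qed.

Lemma continuous_minus_arg x : continuous (fun y : R3 R => x - y).
Proof. by move=> y; apply: cvgB; [exact: cvg_cst|exact: cvg_id]. Qed.

Lemma continuous_minus_cst y : continuous (fun x : R3 R => x - y).
Proof. by move=> x; apply: cvgB; [exact: cvg_id|exact: cvg_cst]. Qed.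

(** Peetre's inequality in the form [rho y <= 8 * rho x * rho (x - y)]: translating a kernel costs a
    factor that depends on [x] alone and is locally bounded. *)
Lemma kern_shift_bound m C K x y : kern m C K ->
  `|K (x - y)| <= C * 8 ^+ m * rho x ^+ m / rho y ^+ m.
Proof.
move=> hK; have C0 := kern_ge0 hK; apply: le_trans (hK.2 _) _.
have := peetre x (x - y); rewrite subKr => p.
have := rho_gt0 x; have := rho_gt0 y; have := rho_gt0 (x - y).
move: (rho x) (rho y) (rho (x - y)) p => a b c p c0 b0 a0.
have h : c^-1 <= 8 * (a * b^-1).
  by rewrite mulrA ler_pdivlMr// mulrC ler_pdivrMr.
have c1 : 0 <= c^-1 by rewrite invr_ge0 ltW.
rewrite -!mulrA ler_wpM2l// -!exprVn -!exprMn.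
by apply: lerXn2r; rewrite ?nnegrE// (le_trans c1).
Qed.

Lemma conv_flip_L1 m C K f x : kern m C K -> W m f ->
  L1 mu3 (fun y => K (x - y) * f y).
Proof.
move=> hK [cf lf]; apply: L1_dom (L1Z (C * 8 ^+ m * rho x ^+ m) (L1_norm lf)) _.
  apply: continuous_m => y; apply: cvgM; last exact: cf.
  by apply: continuous_comp; [exact: continuous_minus_arg|exact: hK.1].
move=> y; rewrite !normrM normr_rhoXV.
by rewrite mulrCA [leLHS]mulrC ler_wpM2l// kern_shift_bound.
Qed.

Lemma conv_L1 m C K f x : kern m C K -> W m f ->
  L1 mu3 (fun y => K y * f (x - y)).
Proof.
move=> hK hf; apply: L1_eq (L1_reflect x (conv_flip_L1 x hK hf)) => y.
by rewrite subKr.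
Qed.

Lemma conv_flip m C K f x : kern m C K -> W m f ->
  conv K f x = \int[mu3]_y (K (x - (y : R3 R)) * f y).
Proof.
move=> hK hf; rewrite -(Rint_reflect x (conv_flip_L1 x hK hf)).
by apply: Rint_eq => y; rewrite subKr.
Qed.

Lemma conv_cont m C K f : kern m C K -> W m f -> continuous (conv K f).
Proof.
move=> hK hf x0; have [cf lf] := hf.
have -> : conv K f = fun x => \int[mu3]_y (K (x - (y : R3 R)) * f y).
  by apply/funext => x; exact: conv_flip hK hf.
have [B B0 hB] := box_bounded (`|x0| + 1) (@rhoX_cont R m).
apply: (@continuous_Rint _ _ _ mu3 (fun x (y : M3 R) => K (x - (y : R3 R)) * f y)
  (fun y => C * 8 ^+ m * B * `|f y / rho y ^+ m|) x0).
- by move=> x; exact: L1_measurable (conv_flip_L1 x hK hf).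
- move=> y; apply: cvgM; last exact: cvg_cst.
  by apply: continuous_comp; [exact: continuous_minus_cst|exact: hK.1].
- exact: L1Z (L1_norm lf).
move=> x y x1; have C0 := kern_ge0 hK.
have hx : rho x ^+ m <= B.
  apply: le_trans (ler_norm _) _; apply: hB.
  by rewrite -[x](subrK x0) addrC (le_trans (ler_normD _ _))// lerD2l distrC.
rewrite !normrM normr_rhoXV.
rewrite mulrCA [leLHS]mulrC ler_wpM2l// (le_trans (kern_shift_bound x y hK))//.
by rewrite ler_wpM2r ?rhoXV_ge0// ler_wpM2l// mulr_ge0// exprn_ge0.
Qed.

Lemma W_L2 m f : (0 < m)%N -> continuous f -> L1 mu3 (fun x => f x ^+ 2) -> W m f.
Proof.
move=> m0 cf l2; split=> //.
apply: L1_dom (L1D l2 (L1_rhoXV m0)) _.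
  by apply: continuous_m => x; apply: cvgM; [exact: cf|exact: rhoXV_cont].
move=> x; have h := rhoX_ge1 m x.
have h0 : 0 < (rho x ^+ m)^-1 by rewrite invr_gt0 rhoX_gt0.
have h1 := rhoXV_le1 m x.
rewrite normrM normr_rhoXV -[f x ^+ 2]real_normK ?num_real//.
move: (rho x ^+ m)^-1 `|f x| h0 h1 => a b a0 a1.
by have := sqr_ge0 (b - a); nra.
Qed.

Lemma W_L1 m f : continuous f -> L1 mu3 f -> W m f.
Proof.
move=> cf lf; split=> //; apply: L1_dom (L1_norm lf) _.
  by apply: continuous_m => x; apply: cvgM; [exact: cf|exact: rhoXV_cont].
by move=> x; rewrite normrM normr_rhoXV ler_piMr// rhoXV_le1.
Qed.

Lemma kern_L1 m C K : (0 < m)%N -> kern m C K -> L1 mu3 K.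
Proof.
move=> m0 [cK h]; apply: L1_dom (L1Z C (L1_rhoXV m0)) _ => //.
exact: continuous_m.
Qed.

End convolution.

(** * Derivatives and L2 bounds of convolutions *)

Section convolution_calculus.
Context {R : realType}.
Implicit Types (f g K : R3 R -> R) (x y : R3 R).

Lemma continuous_ray x (h : R) i : continuous (fun s : R => x + (h * s) *: evec i).
Proof.
move=> t; apply: cvgD; first exact: cvg_cst.
by apply: cvgZl; apply: cvgM; [exact: cvg_cst|exact: cvg_id].
Qed.

Let measurable_ray_sub x (h : R) i :
  measurable_fun setT (fun z : M3 R * measurableTypeR R =>
    x + (h * clamp z.2) *: evec i - (z.1 : R3 R) : M3 R).
Proof.
apply: measurable_sub3 => //; apply: measurable_add3 => //; apply: measurable_scale3 => //.
apply: measurable_funM => //; apply: measurableT_comp => //.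
exact: (continuous_measurable_fun (@clamp_cont R)).
Qed.

(** By [is_derive_of_int] it suffices to write the increment of [f] as a segment integral and to
    exchange it with the convolution. Integrability over the product comes from [|K|] convolved with
    [|partial i f|], which is continuous along the segment. *)
Lemma is_derive_conv m C K f i x : kern m C K -> Cn 1 f -> W m f ->
  W m (partial i f) -> is_derive x (evec i) (conv K f) (conv K (partial i f) x).
Proof.
move=> hK cf hf hp; apply: is_derive_of_int; first exact: conv_cont hK hp.
move=> h; have cp := hp.1.
pose Phi (z : M3 R * measurableTypeR R) : R :=
  K z.1 * (h * partial i f (x + (h * clamp z.2) *: evec i - (z.1 : R3 R))).
have hp' := W_norm hp; have hK' := kern_norm hK.
have cG : continuous (fun s : R => `|h| *
    conv (fun y => `|K y|) (fun y => `|partial i f y|) (x + (h * s) *: evec i)).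
  move=> s; apply: cvgM; first exact: cvg_cst.
  apply: (@continuous_comp _ _ _ (fun s : R => x + (h * s) *: evec i)).
    exact: continuous_ray.
  exact: conv_cont hK' hp' _.
have lPhi : L1 (prod_measure mu3 m01) Phi.
  apply: (@L1_prod2 _ _ _ _ _ _ _ _ (fun t : measurableTypeR R => `|h| *
    conv (fun y => `|K y|) (fun y => `|partial i f y|) (x + (h * clamp t) *: evec i))).
  - apply: measurable_funM; first exact: (measurable_comp3 measurable_fst hK.1).
    apply: measurable_funM => //.
    exact: (measurable_comp3 (measurable_ray_sub x h i) cp).
  - move=> t; apply: L1_eq (L1Z h (conv_L1 (x + (h * clamp t) *: evec i) hK hp)) => y.
    by rewrite mulrCA.
  - exact: (L1_m01 cG).
  - move=> t; rewrite -RintZ; last exact: conv_L1 hK' hp'.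
    rewrite le_eqVlt; apply/orP; left; apply/eqP; apply: Rint_eq => y.
    by rewrite !normrM mulrCA.
have E y : K y * f (x + h *: evec i - y) - K y * f (x - y) =
    \int[m01]_t Phi (y, t).
  rewrite -mulrBr addrAC (diff01 (x - y) h i cf) -RintZ; last first.
    have cl : continuous (fun t : R => h * partial i f (x - y + (h * t) *: evec i)).
      move=> t; apply: cvgM; first exact: cvg_cst.
      apply: (@continuous_comp _ _ _ (fun t : R => x - y + (h * t) *: evec i)).
        exact: continuous_ray.
      exact: cp.
    exact: (L1_m01 cl).
  by apply: Rint_eq => t; rewrite /Phi /= addrAC.
rewrite /conv -RintB; [|exact: conv_L1 hK hf|exact: conv_L1 hK hf].
rewrite (Rint_eq mu3 E) (Rfubini lPhi); apply: Rint_eq => t.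
rewrite -RintZ; last exact: conv_L1 hK hp.
by apply: Rint_eq => y; rewrite /Phi /= mulrCA.
Qed.

Lemma conv_Cn1 m C K f : kern m C K -> Cn 1 f -> W m f ->
  (forall i, W m (partial i f)) ->
  Cn 1 (conv K f) /\ forall i, partial i (conv K f) = conv K (partial i f).
Proof.
move=> hK cf hf hp.
have E i : partial i (conv K f) = conv K (partial i f).
  apply/funext => x; apply: partial_val; exact: is_derive_conv hK cf hf (hp i).
split=> //; split; first exact: conv_cont hK hf.
move=> i; split; last by split=> //; rewrite E; exact: conv_cont hK (hp i).
by move=> x; case: (is_derive_conv x hK cf hf (hp i)).
Qed.

Lemma measurable_fst_sub_snd : measurable_fun setT
  (fun z : M3 R * M3 R => (z.1 : R3 R) - (z.2 : R3 R) : M3 R).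
Proof. exact: measurable_sub3. Qed.

Lemma measurable_minus_arg x :
  measurable_fun setT (fun y : M3 R => x - (y : R3 R) : M3 R).
Proof. exact: measurable_sub3. Qed.

Lemma conv_young m C K g : (0 < m)%N -> kern m C K -> continuous g -> L1 mu3 g ->
  L1 mu3 (conv K g) /\ \int[mu3]_x conv K g x = \int[mu3]_x K x * \int[mu3]_x g x.
Proof.
move=> m0 hK cg lg; have lK := kern_L1 m0 hK.
have l : L1 (prod_measure mu3 mu3) (fun z => K z.2 * g ((z.1 : R3 R) - (z.2 : R3 R))).
  apply: (@L1_prod2 _ _ _ _ _ _ _ _ (fun y : M3 R => `|K y| * \int[mu3]_x `|g x|)).
  - apply: measurable_funM; first exact: (measurable_comp3 measurable_snd hK.1).
    exact: (measurable_comp3 measurable_fst_sub_snd cg).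
  - by move=> y; exact: (L1Z (K y) (L1_shift (- y) lg)).
  - exact: (L1Zr _ (L1_norm lK)).
  - move=> y /=; rewrite -(Rint_shift (- y) (L1_norm lg)) -RintZ; last first.
      exact: (L1_shift (- y) (L1_norm lg)).
    rewrite le_eqVlt; apply/orP; left; apply/eqP; apply: Rint_eq => x.
    by rewrite normrM.
split; first exact: (Rfubini1 l).1.
rewrite (Rfubini l) /= -RintZr//; apply: Rint_eq => y.
by rewrite RintZ; [congr (_ * _); exact: (Rint_shift (- y) lg)|exact: (L1_shift (- y) lg)].
Qed.

Lemma kern_sqr m C K : kern m C K -> kern m (C ^+ 2) (fun x => K x ^+ 2).
Proof.
move=> hK; have C0 := kern_ge0 hK; have [cK h] := hK.
split=> [|x]; first exact: continuous_sqr.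
have := h x; have := rhoXV_ge0 m x; have := rhoXV_le1 m x.
rewrite normrX; move: (rho x ^+ m)^-1 `|K x| (normr_ge0 (K x)) => a b b0 a1 a0 bC.
apply: (@le_trans _ _ ((C * a) ^+ 2)); first by rewrite lerXn2r ?nnegrE ?mulr_ge0.
by rewrite exprMn ler_wpM2l ?sqr_ge0// expr2 ler_piMr.
Qed.

(* Schur test with the kernel itself as weight. *)
Lemma conv_L2 m C K f : (0 < m)%N -> kern m C K -> continuous f ->
  L1 mu3 (fun x => f x ^+ 2) ->
  L1 mu3 (fun x => conv K f x ^+ 2) /\
  \int[mu3]_x (conv K f x ^+ 2) <=
  (\int[mu3]_x `|K x|) ^+ 2 * \int[mu3]_x (f x ^+ 2).
Proof.
move=> m0 hK cf l2; have hf := W_L2 m0 cf l2; have lK := kern_L1 m0 hK.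
have hK' := kern_norm hK; have cf2 := continuous_sqr cf.
have [lc Ec] := conv_young m0 hK' cf2 l2.
have b x : conv K f x ^+ 2 <=
    \int[mu3]_y `|K y| * conv (fun y => `|K y|) (fun y => f y ^+ 2) x.
  apply: weighted_CS.
  - exact: continuous_m hK.1.
  - exact: (measurable_comp3 (measurable_minus_arg x) cf).
  - exact: L1_norm lK.
  - exact: (conv_L1 x hK' (W_L1 m cf2 l2)).
have cc := conv_cont hK hf.
have l : L1 mu3 (fun x => conv K f x ^+ 2).
  apply: L1_dom (L1Z (\int[mu3]_y `|K y|) lc) _.
    exact: continuous_m (continuous_sqr cc).
  by move=> x; rewrite ger0_norm ?sqr_ge0.
split; first exact: l.
rewrite expr2 -mulrA -Ec -RintZ; last exact: lc.
apply: Rint_le; [exact: l|exact: L1Z lc|exact: b].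
Qed.

(* Schur test with the function as weight: small when [K] is small. *)
Lemma conv_L2_small m C K g : (0 < m)%N -> kern m C K -> continuous g -> L1 mu3 g ->
  L1 mu3 (fun x => conv K g x ^+ 2) /\
  \int[mu3]_x (conv K g x ^+ 2) <=
  (\int[mu3]_x `|g x|) ^+ 2 * \int[mu3]_x (K x ^+ 2).
Proof.
move=> m0 hK cg lg; have hg := W_L1 m cg lg; have lK := kern_L1 m0 hK.
have hK2 := kern_sqr hK; have lg' := L1_norm lg; have hg' := W_norm hg.
have cg' : continuous (fun x => `|g x|) := hg'.1.
have [lc Ec] := conv_young m0 hK2 cg' lg'.
have b x : conv K g x ^+ 2 <=
    \int[mu3]_y `|g y| * conv (fun y => K y ^+ 2) (fun y => `|g y|) x.
  rewrite (conv_flip x hK hg) (conv_flip x hK2 hg').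
  rewrite (Rint_eq mu3 (fun y => mulrC (K (x - y)) (g y))).
  rewrite [X in _ <= _ * X](Rint_eq mu3 (fun y => mulrC (K (x - y) ^+ 2) `|g y|)).
  apply: weighted_CS.
  - exact: continuous_m cg.
  - exact: (measurable_comp3 (measurable_minus_arg x) hK.1).
  - exact: lg'.
  - by apply: L1_eq (conv_flip_L1 x hK2 hg') => y; rewrite mulrC.
have cc := conv_cont hK hg.
have l : L1 mu3 (fun x => conv K g x ^+ 2).
  apply: L1_dom (L1Z (\int[mu3]_y `|g y|) lc) _.
    exact: continuous_m (continuous_sqr cc).
  by move=> x; rewrite ger0_norm ?sqr_ge0.
split; first exact: l.
rewrite expr2 -mulrA [\int[mu3]_x `|g x| * \int[mu3]_x _]mulrC -Ec -RintZ; last exact: lc.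
apply: Rint_le; [exact: l|exact: L1Z lc|exact: b].
Qed.

End convolution_calculus.

(** * Growth of functions with square-integrable gradient *)

Section a_priori_growth.
Context {R : realType}.
Implicit Types (f g K : R3 R -> R) (x y : R3 R).

Lemma ae_mu3_exists (Q : R3 R -> Prop) : {ae mu3, forall x, Q x} -> exists x, Q x.
Proof.
case=> A [mA A0 hA]; apply: contrapT => nQ.
have : (mu3 (box 1) <= mu3 A)%E.
  apply: le_measure; rewrite ?inE//; first exact: measurable_box.
  by move=> x _; apply: hA => /= q; apply: nQ; exists x.
rewrite A0 mu3_box ?ler01// lee_fin leNgt => /negP; apply.
by rewrite exprn_gt0// mulr_gt0.
Qed.

Definition grad2 f : R := \sum_(i < 3) \int[mu3]_x (partial i f x ^+ 2).

Lemma grad2_ge0 f : 0 <= grad2 f.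
Proof. by apply: sumr_ge0 => i _; apply: Rint_ge0 => x; exact: sqr_ge0. Qed.

(** A homogeneous Sobolev class: [f] itself is not asked to be integrable, as a finite Dirichlet
    integral says nothing of the kind. *)
Definition D12 f : Prop := Cn 1 f /\ forall i, L1 mu3 (fun x => partial i f x ^+ 2).

Lemma L2_diff_rho f y : D12 f ->
  L1 mu3 (fun x => (f x - f (x - y)) ^+ 2) /\
  \int[mu3]_x ((f x - f ((x : R3 R) - y)) ^+ 2) <=
  3 * (y.1.1 ^+ 2 + y.1.2 ^+ 2 + y.2 ^+ 2) * grad2 f.
Proof.
move=> [cf l2]; have [l h] := L2_diff (- y) cf l2.
have E x : (f (x - y) - f x) ^+ 2 = (f x - f (x - y)) ^+ 2.
  by rewrite -sqrrN opprB.
split; first by apply: L1_eq l => x; exact: E.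
by rewrite -(Rint_eq mu3 E); move: h; rewrite /= !sqrrN.
Qed.

(** Integrating first in the point, [L2_diff_rho] leaves a second moment of the weight. This serves
    twice: for the weighted integrability of [f] and for the bound on [f - conv K f]. *)
Lemma L1_diff2_weight f (k : R3 R -> R) : continuous k -> (forall y, 0 <= k y) ->
  L1 mu3 (fun y : R3 R => k y * (y.1.1 ^+ 2 + y.1.2 ^+ 2 + y.2 ^+ 2)) -> D12 f ->
  L1 (prod_measure mu3 mu3)
    (fun z => k z.2 * (f z.1 - f ((z.1 : R3 R) - (z.2 : R3 R))) ^+ 2).
Proof.
move=> ck k0 lk hf.
have cf := Cn_cont hf.1.
apply: (@L1_prod2 _ _ _ _ _ _ _ _ (fun y : M3 R =>
  k y * ((y : R3 R).1.1 ^+ 2 + (y : R3 R).1.2 ^+ 2 + (y : R3 R).2 ^+ 2) * (3 * grad2 f))).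
- apply: measurable_funM; first exact: (measurable_comp3 measurable_snd ck).
  apply: measurable_funX; apply: measurable_funB.
    exact: (measurable_comp3 measurable_fst cf).
  exact: (measurable_comp3 measurable_fst_sub_snd cf).
- by move=> y; exact: (L1Z (k y) (L2_diff_rho y hf).1).
- exact: (L1Zr _ lk).
- move=> y /=; have [l h] := L2_diff_rho y hf.
  rewrite (Rint_eq mu3 (g := fun x : R3 R => k y * (f x - f (x - y)) ^+ 2)); last first.
    by move=> x; rewrite ger0_norm//; apply: mulr_ge0 => //; exact: sqr_ge0.
  rewrite RintZ// -mulrA ler_wpM2l//.
  by rewrite mulrA [_ * 3]mulrC.
Qed.

Lemma W_le m n f : (m <= n)%N -> W m f -> W n f.
Proof.
move=> mn [cf lf]; split=> //; apply: L1_dom (L1_norm lf) _.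
  by apply: continuous_m => x; apply: cvgM; [exact: cf|exact: rhoXV_cont].
move=> x; rewrite !normrM !normr_rhoXV ler_wpM2l//.
by rewrite lef_pV2 ?posrE ?rhoX_gt0// ler_weXn2l// rho_ge1.
Qed.

(* Almost every point [x0] sees [f] with a square-integrable weight, and the
   weights seen from two points are comparable. *)
Lemma D12_W f : D12 f -> W 2 (fun x => f x ^+ 2).
Proof.
move=> hf; have cf := Cn_cont hf.1; have cf2 := continuous_sqr cf.
split=> //.
have lk : L1 mu3 (fun y : R3 R =>
    (rho y ^+ 2)^-1 * (y.1.1 ^+ 2 + y.1.2 ^+ 2 + y.2 ^+ 2)).
  apply: L1_dom L1_rhoV _.
    apply: measurable_funM; first exact: continuous_m (@rhoXV_cont R 2).
    have m1 : measurable_fun setT (fun y : M3 R => y.1.1) by exact: measurableT_comp.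
    have m2 : measurable_fun setT (fun y : M3 R => y.1.2) by exact: measurableT_comp.
    by apply: measurable_funD; [apply: measurable_funD|]; apply: measurable_funX.
  move=> y; have h := sqr_coords_le_rho y.
  rewrite normrM normr_rhoXV ger0_norm ?addr_ge0 ?sqr_ge0//.
  apply: le_trans (ler_wpM2l (rhoXV_ge0 2 y) h) _.
  by rewrite expr2 invfM -mulrA mulVf ?mulr1// gt_eqF// rho_gt0.
have l := L1_diff2_weight (@rhoXV_cont R 2) (rhoXV_ge0 2) lk hf.
have [x0 lx0] := ae_mu3_exists (ae_integrable1 l).
have lx0' : L1 mu3 (fun y : R3 R => (rho y ^+ 2)^-1 * (f x0 - f (x0 - y)) ^+ 2) := lx0.
have l1 : L1 mu3 (fun y : R3 R => (rho y ^+ 2)^-1 * f (x0 - y) ^+ 2).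
  have lg := L1D (L1Z 2 lx0') (L1Z (2 * f x0 ^+ 2) (@L1_rhoXV R 2 isT)).
  apply: L1_dom lg _.
    apply: measurable_funM; first exact: continuous_m (@rhoXV_cont R 2).
    exact: (measurable_comp3 (measurable_minus_arg x0) cf2).
  move=> y; rewrite ger0_norm; last by apply: mulr_ge0; [exact: rhoXV_ge0|exact: sqr_ge0].
  have := rhoXV_ge0 2 y; move: (rho y ^+ 2)^-1 (f x0) (f (x0 - y)) => a p q a0.
  have -> : 2 * (a * (p - q) ^+ 2) + 2 * p ^+ 2 * a = a * (2 * (p - q) ^+ 2 + 2 * p ^+ 2).
    by ring.
  by rewrite ler_wpM2l//; have := sqr_ge0 (2 * p - q); nra.
have l2 := L1_reflect x0 l1.
apply: L1_dom (L1Z (8 ^+ 2 * rho x0 ^+ 2) l2) _.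
  by apply: continuous_m => x; apply: cvgM; [exact: cf2|exact: rhoXV_cont].
move=> z; rewrite subKr ger0_norm; last first.
  by apply: mulr_ge0; [exact: sqr_ge0|exact: rhoXV_ge0].
rewrite [leLHS]mulrC [leRHS]mulrA; apply: ler_wpM2r; first exact: sqr_ge0.
have := peetre x0 z; have := rho_gt0 x0; have := rho_gt0 z; have := rho_gt0 (x0 - z).
move: (rho x0) (rho z) (rho (x0 - z)) => a b c c0 b0 a0 h.
have h1 : b^-1 <= 8 * a * c^-1.
  by rewrite ler_pdivlMr// mulrC ler_pdivrMr.
have b1 : 0 <= b^-1 by rewrite invr_ge0 ltW.
rewrite -!exprVn -!exprMn; apply: lerXn2r; rewrite ?nnegrE//.
exact: le_trans h1.
Qed.

Lemma W_of_sqr m f : (0 < m)%N -> continuous f -> W m (fun x => f x ^+ 2) -> W m f.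
Proof.
move=> m0 cf [_ l]; split=> //; apply: L1_dom (L1D (L1_rhoXV m0) l) _.
  by apply: continuous_m => x; apply: cvgM; [exact: cf|exact: rhoXV_cont].
move=> x; rewrite normrM normr_rhoXV -[X in X + _]mul1r -mulrDl ler_wpM2r ?rhoXV_ge0//.
rewrite -[f x ^+ 2]real_normK ?num_real//.
by have := sqr_ge0 (`|f x| - 1); nra.
Qed.

(* The high frequency part of [f] is controlled by its gradient through the
   second moment of [K]. *)
Lemma conv_diff_L2 m C K f : (2 <= m)%N -> kern m C K -> \int[mu3]_x K x = 1 ->
  L1 mu3 (fun y : R3 R => `|K y| * (y.1.1 ^+ 2 + y.1.2 ^+ 2 + y.2 ^+ 2)) -> D12 f ->
  L1 mu3 (fun x => (f x - conv K f x) ^+ 2) /\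
  \int[mu3]_x ((f x - conv K f x) ^+ 2) <=
  \int[mu3]_x `|K x| *
  (\int[mu3]_y (`|K y| * ((y : R3 R).1.1 ^+ 2 + (y : R3 R).1.2 ^+ 2 + (y : R3 R).2 ^+ 2)) *
   (3 * grad2 f)).
Proof.
move=> m2 hK K1 lK2 hf; have m0 : (0 < m)%N by exact: leq_trans m2.
have cf := Cn_cont hf.1; have lK := kern_L1 m0 hK; have hK' := kern_norm hK.
have hf2 := W_le m2 (D12_W hf); have hfW := W_of_sqr m0 cf hf2.
have l := L1_diff2_weight hK'.1 (fun y => normr_ge0 (K y)) lK2 hf.
have [li Ei] := Rfubini1 l.
have cc : continuous (fun x => f x - conv K f x).
  by move=> x; apply: cvgB; [exact: cf|exact: conv_cont hK hfW _].
have E x : f x - conv K f x = \int[mu3]_y (K y * (f x - f (x - (y : R3 R)))).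
  rewrite -[X in X - _]mul1r -K1 -RintZr// -RintB; [|exact: L1Zr|exact: conv_L1 hK hfW].
  by apply: Rint_eq => y; rewrite mulrBr.
have b x : (f x - conv K f x) ^+ 2 <= \int[mu3]_y `|K y| *
    \int[mu3]_y (`|K y| * (f x - f (x - (y : R3 R))) ^+ 2).
  rewrite E; apply: weighted_CS.
  - exact: continuous_m hK.1.
  - apply: measurable_funB => //.
    exact: (measurable_comp3 (measurable_minus_arg x) cf).
  - exact: L1_norm lK.
  - have lg := L1D (L1Zr (2 * f x ^+ 2) (L1_norm lK)) (L1Z 2 (conv_L1 x hK' hf2)).
    apply: L1_dom lg _.
      apply: measurable_funM; first exact: continuous_m hK'.1.
      apply: measurable_funX; apply: measurable_funB => //.
      exact: (measurable_comp3 (measurable_minus_arg x) cf).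
    move=> y; rewrite ger0_norm; last by apply: mulr_ge0 => //; exact: sqr_ge0.
    move: (f x) (f (x - y)) `|K y| (normr_ge0 (K y)) => p q a a0.
    have -> : a * (2 * p ^+ 2) + 2 * (a * q ^+ 2) = a * (2 * p ^+ 2 + 2 * q ^+ 2) by ring.
    by rewrite ler_wpM2l//; have := sqr_ge0 (p + q); nra.
have lw : L1 mu3 (fun x => (f x - conv K f x) ^+ 2).
  apply: L1_dom (L1Z (\int[mu3]_y `|K y|) li) _.
    exact: continuous_m (continuous_sqr cc).
  by move=> x; rewrite ger0_norm ?sqr_ge0//; exact: b.
split=> //; apply: le_trans (Rint_le lw (L1Z (\int[mu3]_y `|K y|) li) b) _.
rewrite RintZ// ler_wpM2l ?Rint_ge0// Ei -(Rfubini2 l).2 /= -RintZr//.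
apply: Rint_le; [exact: (Rfubini2 l).1|exact: L1Zr|].
move=> y /=; have [l' h] := L2_diff_rho y hf.
rewrite RintZ// -mulrA ler_wpM2l//.
by rewrite mulrA [_ * 3]mulrC.
Qed.

End a_priori_growth.

(** * Ladyzhenskaya's inequality *)

Section cauchy_schwarz.
Context {R : realType}.

Lemma discriminant_le (A B D : R) : 0 <= A -> 0 <= B -> 0 <= D ->
  (forall s, 0 <= s ^+ 2 * A - 2 * s * B + D) -> B ^+ 2 <= A * D.
Proof.
move=> A0 B0 D0 key; have [A1|A1] := eqVneq A 0.
  have [->|B1] := eqVneq B 0; first by rewrite A1 expr0n mul0r.
  have Bp : 0 < B by rewrite lt_neqAle eq_sym B1.
  have := key ((D + 1) / B); rewrite A1 mulr0.
  rewrite (_ : 0 - _ + D = - D - 2); last by field.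
  lra.
have Ap : 0 < A by rewrite lt_neqAle eq_sym A1.
have := key (B / A).
rewrite (_ : _ + D = (A * D - B ^+ 2) / A); last by field.
by rewrite pmulr_lge0 ?invr_gt0// subr_ge0.
Qed.

Lemma cauchy_schwarz d (T : measurableType d) (mu : {measure set T -> \bar R})
    (p q : T -> R) : measurable_fun setT p -> measurable_fun setT q ->
  L1 mu (fun x => p x ^+ 2) -> L1 mu (fun x => q x ^+ 2) ->
  L1 mu (fun x => `|p x * q x|) /\
  (\int[mu]_x `|p x * q x|) ^+ 2 <= \int[mu]_x (p x ^+ 2) * \int[mu]_x (q x ^+ 2).
Proof.
move=> mp mq lp lq.
have b x : `|p x * q x| <= p x ^+ 2 + q x ^+ 2.
  rewrite normrM -(real_normK (num_real (p x))) -(real_normK (num_real (q x))).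
  have := sqr_ge0 (`|p x| - `|q x|); have := sqr_ge0 (`|p x|); have := sqr_ge0 (`|q x|).
  nra.
have l : L1 mu (fun x => `|p x * q x|).
  apply: L1_dom (L1D lp lq) _.
    by apply: measurableT_comp => //; exact: measurable_funM.
  by move=> x; rewrite normr_id; exact: b.
split; first exact: l.
apply: discriminant_le; try by apply: Rint_ge0 => x; rewrite ?sqr_ge0.
move=> s; rewrite -RintZ; last exact: lp.
rewrite -RintZ; last exact: l.
have l1 := L1Z (s ^+ 2) lp; have l2 := L1Z (2 * s) l.
rewrite -RintB; [|exact: l1|exact: l2].
rewrite -RintD; [|exact: L1B l1 l2|exact: lq].
apply: Rint_ge0 => x.
rewrite normrM -(real_normK (num_real (p x))) -(real_normK (num_real (q x))).
by rewrite (_ : _ + _ = (s * `|p x| - `|q x|) ^+ 2) ?sqr_ge0//; ring.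
Qed.

End cauchy_schwarz.

Section ladyzhenskaya.
Context {R : realType}.
Implicit Types (f g : R3 R -> R) (x y : R3 R).

(** A bound for [- d/ds ((1 - s) f ^ 2)] along a line parallel to the axis [i], for [s] in
    [0, 1]. *)
Definition lineweight f i : R3 R -> R := fun x => f x ^+ 2 + 2 * `|f x * partial i f x|.

Lemma lineweight_ge0 f i x : 0 <= lineweight f i x.
Proof. by rewrite addr_ge0 ?sqr_ge0// mulr_ge0. Qed.

Lemma lineweight_cont f i : Cn 1 f -> continuous (lineweight f i).
Proof.
move=> cf x; have c0 := Cn_cont cf; have c1 := Cn_cont (CnS_partial i cf).
apply: cvgD; first exact: continuous_sqr.
apply: cvgM; first exact: cvg_cst.
by apply: cvg_norm; apply: cvgM; [exact: c0|exact: c1].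
Qed.

Lemma m01_le_lebesgue (F : R -> R) : continuous F -> (forall t, 0 <= F t) ->
  ((\int[m01]_t F (clamp t))%:E <= \int[mu1]_t (F t)%:E)%E.
Proof.
move=> cF F0; have l := L1_m01 cF; rewrite EFin_Rint//.
pose D : set (measurableTypeR R) := `[0%R, 1%R]%classic.
have mD : measurable D by exact: measurable_itv.
rewrite -(setUCr D) ge0_integral_setU//=; last 4 first.
- exact: measurableC.
- by rewrite setUCr; exact: measurable_int l.
- by move=> x _; rewrite lee_fin.
- by rewrite disj_set2E setICr.
rewrite [X in (_ + X)%E](null_set_integral (mu := m01)) ?adde0//; last 3 first.
- exact: measurableC.
- by apply: measurable_funTS; exact: measurable_int l.
- by rewrite /m01 /= /mfrestr /mrestr setICl measure0.
rewrite setUCr.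
apply: (@le_trans _ _ (\int[mu1]_(x in D) (F x)%:E)%E); last first.
  apply: ge0_subset_integral => //.
    by apply/measurable_EFinP; exact: continuous_measurable_fun.
  by move=> x _; rewrite lee_fin.
rewrite le_eqVlt; apply/orP; left; apply/eqP.
transitivity (\int[mu1]_(x in D) (F (clamp x))%:E)%E.
  apply: eq_measure_integral => A mA AD.
  by rewrite /m01 /= /mfrestr /mrestr setIidl.
apply: eq_integral => x; rewrite inE /D /= in_itv/= => h.
by rewrite clamp_id.
Qed.

(* Integrate [d/ds ((1 - s) f (x + s e_i) ^ 2)] over [0, 1]. *)
Lemma sqr_le_line f i x : Cn 1 f ->
  ((f x ^+ 2)%:E <= \int[mu1]_s (lineweight f i (x + (s : R) *: evec i))%:E)%E.
Proof.
move=> cf.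
have cL : continuous (fun s : R => lineweight f i (x + s *: evec i)).
  move=> s; apply: (@continuous_comp _ _ _ (fun s : R => x + s *: evec i)).
    exact: continuous_line.
  exact: lineweight_cont cf _.
apply: le_trans (m01_le_lebesgue cL (fun s => lineweight_ge0 f i _)).
rewrite lee_fin.
have ch : Cn 1 (fun x => f x * f x) := CnM cf cf.
pose g (s : R) : R := - (f (x + s *: evec i) * f (x + s *: evec i)) +
   (1 - s) * (f (x + s *: evec i) * partial i f (x + s *: evec i) +
     partial i f (x + s *: evec i) * f (x + s *: evec i)).
have cl (q : R3 R -> R) : continuous q -> continuous (fun s : R => q (x + s *: evec i)).
  move=> cq s; apply: (@continuous_comp _ _ _ (fun s : R => x + s *: evec i)).
    exact: continuous_line.
  exact: cq.
have c0 := cl _ (Cn_cont cf); have c1 := cl _ (Cn_cont (CnS_partial i cf)).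
have cg : continuous g.
  move=> s; apply: cvgD; first by apply: cvgN; apply: cvgM; exact: c0.
  apply: cvgM; first by apply: cvgB; [exact: cvg_cst|exact: cvg_id].
  by apply: cvgD; apply: cvgM; [exact: c0|exact: c1|exact: c1|exact: c0].
have dG (s : R) : is_derive s 1
    (fun s : R => (1 - s) * (f (x + s *: evec i) * f (x + s *: evec i))) (g s).
  have d1 := is_derive_line (CnS_derivable i (x + s *: evec i) ch).
  have d2 := is_deriveB (is_derive_cst (1 : R^o) s (1 : R^o)) (is_derive_id s (1 : R^o)).
  have d3 := is_deriveM d2 d1.
  apply: is_derive_eq d3 _.
  rewrite -[X in (1 - s) *: X]/(partial i (fun x => f x * f x) (x + s *: evec i)).
  by rewrite (partialM i cf cf) /g /GRing.scale/=; ring.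
have := ftc01 cg dG.
rewrite subrr mul0r subr0 mul1r scale0r addr0 sub0r => /eqP.
rewrite eqr_oppLR => /eqP E.
rewrite expr2 E -RintN; last exact: (L1_m01 cg).
apply: Rint_le; [exact: L1N (L1_m01 cg)|exact: (L1_m01 cL)|].
move=> s; rewrite /g /lineweight.
have := clamp_ge0 s; have := clamp_le1 s.
move: (clamp s) (f _) (partial i f _) => t a b t1 t0.
have -> : - (- (a * a) + (1 - t) * (a * b + b * a)) = a ^+ 2 + 2 * ((1 - t) * - (a * b)).
  by ring.
rewrite lerD2l ler_wpM2l//.
have h : - (a * b) <= `|a * b| by rewrite -normrN ler_norm.
have := normr_ge0 (a * b); nra.
Qed.

End ladyzhenskaya.

Section ladyzhenskaya_L4.
Context {R : realType}.
Implicit Types (f g : R3 R -> R).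

Notation M1 := (measurableTypeR R).

Lemma lebesgue_shift (F : M1 -> \bar R) (a : R) : measurable_fun setT F ->
  (forall t, 0 <= F t)%E -> (\int[mu1]_s F ((s : R) + a)%R = \int[mu1]_s F s)%E.
Proof.
move=> mF F0; have [_ h] := scales_lebesgue a (oner_neq0 R).
have := h F mF F0; rewrite normr1 invr1 mul1e => <-.
by apply: eq_integral => s _; rewrite mul1r.
Qed.

(** Multiplying the two line bounds majorises [g ^ 4] by a function of [b] times a function of [a],
    whose double integral factors. *)
Lemma plane_le (g : M1 * M1 -> R) (e0 e1 : M1 * M1 -> \bar R) :
  measurable_fun setT g -> measurable_fun setT e0 -> measurable_fun setT e1 ->
  (forall z, 0 <= e0 z)%E -> (forall z, 0 <= e1 z)%E ->
  (forall a b, (g (a, b) ^+ 2)%:E <= \int[mu1]_s e0 (s, b))%E ->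
  (forall a b, (g (a, b) ^+ 2)%:E <= \int[mu1]_s e1 (a, s))%E ->
  (\int[mu2]_z (g z ^+ 4)%:E <= (\int[mu2]_z e0 z) * (\int[mu2]_z e1 z))%E.
Proof.
move=> mg me0 me1 e00 e10 h0 h1.
pose al (b : M1) := (\int[mu1]_s e0 (s, b))%E.
pose be (a : M1) := (\int[mu1]_s e1 (a, s))%E.
have mal : measurable_fun setT al by exact: measurable_fun_fubini_tonelli_G.
have mbe : measurable_fun setT be by exact: measurable_fun_fubini_tonelli_F.
have al0 b : (0 <= al b)%E by exact: integral_ge0.
have be0 a : (0 <= be a)%E by exact: integral_ge0.
have mg4 : measurable_fun setT (fun z => (g z ^+ 4)%:E).
  by apply/measurable_EFinP; exact: measurable_funX.
have g40 z : (0 <= (g z ^+ 4)%:E)%E.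
  by rewrite lee_fin (_ : g z ^+ 4 = (g z ^+ 2) ^+ 2) ?sqr_ge0// -exprM.
rewrite [leLHS](fubini_tonelli1 (m1 := mu1) (m2 := mu1) _ mg4 g40).
rewrite [X in (_ <= X * _)%E](fubini_tonelli2 (m1 := mu1) (m2 := mu1) _ me0 e00).
rewrite [X in (_ <= _ * X)%E](fubini_tonelli1 (m1 := mu1) (m2 := mu1) _ me1 e10).
rewrite -/al -/be.
rewrite -ge0_integralZl//; last by apply: integral_ge0 => b _; exact: al0.
apply: ge0_le_integral => //.
- by move=> a _; exact: integral_ge0.
- by have := measurable_fun_fubini_tonelli_F (m2 := mu1) _ mg4 g40.
- by apply: emeasurable_funM.
move=> a _; rewrite /fubini_F -ge0_integralZr//.
  apply: ge0_le_integral => //.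
  - exact: measurableT_comp mg4 (pair1_measurable a).
  - by apply: emeasurable_funM.
  move=> b _.
  rewrite (_ : g (a, b) ^+ 4 = g (a, b) ^+ 2 * g (a, b) ^+ 2); last by rewrite -exprD.
  by rewrite EFinM; apply: lee_pmul => //; rewrite lee_fin sqr_ge0.
- by move=> b _; exact: al0.
- exact: be0.
- by move=> x _; exact: be0.
Qed.

Lemma evec_shift0 (a b c s : R) :
  ((a, b), c) + s *: evec j0 = ((s + a, b), c) :> R3 R.
Proof.
congr (_, _, _); rewrite /= /GRing.scale/=.
- by rewrite mulr1 addrC.
- by rewrite mulr0 addr0.
- by rewrite mulr0 addr0.
Qed.

Lemma evec_shift1 (a b c s : R) :
  ((a, b), c) + s *: evec j1 = ((a, s + b), c) :> R3 R.
Proof.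
congr (_, _, _); rewrite /= /GRing.scale/=.
- by rewrite mulr0 addr0.
- by rewrite mulr1 addrC.
- by rewrite mulr0 addr0.
Qed.

Lemma evec_shift2 (a b c s : R) :
  ((a, b), c) + s *: evec j2 = ((a, b), s + c) :> R3 R.
Proof.
congr (_, _, _); rewrite /= /GRing.scale/=.
- by rewrite mulr0 addr0.
- by rewrite mulr0 addr0.
- by rewrite mulr1 addrC.
Qed.

Lemma measurable_lineweight f i : Cn 1 f ->
  measurable_fun setT (fun x : M3 R => (lineweight f i x)%:E).
Proof. by move=> cf; apply/measurable_EFinP; exact: continuous_m (@lineweight_cont R f i cf). Qed.

Lemma sqr_le_line0 f (a b c : R) : Cn 1 f ->
  ((f ((a, b), c) ^+ 2)%:E <= \int[mu1]_s (lineweight f j0 ((s, b), c))%:E)%E.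
Proof.
move=> cf; apply: le_trans (sqr_le_line j0 ((a, b), c) cf) _.
have h := lebesgue_shift (F := fun s => (lineweight f j0 ((s, b), c))%:E) a.
rewrite -h.
- rewrite le_eqVlt; apply/orP; left; apply/eqP; apply: eq_integral => s _.
  by rewrite evec_shift0.
- apply: measurableT_comp (measurable_lineweight j0 cf) _.
  exact: measurableT_comp (pair2_measurable c) (pair2_measurable b).
- by move=> t; rewrite lee_fin lineweight_ge0.
Qed.

Lemma sqr_le_line1 f (a b c : R) : Cn 1 f ->
  ((f ((a, b), c) ^+ 2)%:E <= \int[mu1]_s (lineweight f j1 ((a, s), c))%:E)%E.
Proof.
move=> cf; apply: le_trans (sqr_le_line j1 ((a, b), c) cf) _.
have h := lebesgue_shift (F := fun s => (lineweight f j1 ((a, s), c))%:E) b.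
rewrite -h.
- rewrite le_eqVlt; apply/orP; left; apply/eqP; apply: eq_integral => s _.
  by rewrite evec_shift1.
- apply: measurableT_comp (measurable_lineweight j1 cf) _.
  exact: measurableT_comp (pair2_measurable c) (pair1_measurable a).
- by move=> t; rewrite lee_fin lineweight_ge0.
Qed.

Lemma sqr_le_line2 f (a b c : R) : Cn 1 f ->
  ((f ((a, b), c) ^+ 2)%:E <= \int[mu1]_s (lineweight f j2 ((a, b), s))%:E)%E.
Proof.
move=> cf; apply: le_trans (sqr_le_line j2 ((a, b), c) cf) _.
have h := lebesgue_shift (F := fun s => (lineweight f j2 ((a, b), s))%:E) c.
rewrite -h.
- rewrite le_eqVlt; apply/orP; left; apply/eqP; apply: eq_integral => s _.
  by rewrite evec_shift2.
- exact: measurableT_comp (measurable_lineweight j2 cf) (pair1_measurable (a, b)).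
- by move=> t; rewrite lee_fin lineweight_ge0.
Qed.

Lemma lineweight_le f i x : lineweight f i x <= 2 * f x ^+ 2 + partial i f x ^+ 2.
Proof.
rewrite /lineweight normrM.
rewrite -(real_normK (num_real (f x))) -(real_normK (num_real (partial i f x))).
move: `|f x| `|partial i f x| => a b; have := sqr_ge0 (a - b); nra.
Qed.

Lemma slice_product_le (A a s t p q : R) : 0 <= a -> a <= A -> 0 <= s -> 0 <= t ->
  0 <= p -> 0 <= q -> s ^+ 2 <= a * p -> t ^+ 2 <= a * q ->
  (a + 2 * s) * (a + 2 * t) <= A * (2 * a + 4 * p + 4 * q).
Proof.
move=> a0 aA s0 t0 p0 q0 hs ht.
apply: (@le_trans _ _ (a * (2 * a + 4 * p + 4 * q))).
  have := sqr_ge0 (s - t); have := sqr_ge0 (a - 2 * s); have := sqr_ge0 (a - 2 * t); nra.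
by apply: ler_wpM2r => //; lra.
Qed.

Lemma slice_total_le (M' F p q r : R) : 0 <= F -> 0 <= p -> 0 <= q -> 0 <= r ->
  M' <= 2 * F + r -> M' * (2 * F + 4 * p + 4 * q) <= 8 * (F + (p + q + r)) ^+ 2.
Proof.
move=> F0' p0 q0 r0 hM; apply: (@le_trans _ _ ((2 * F + r) * (2 * F + 4 * p + 4 * q))).
  by apply: ler_wpM2r => //; lra.
nra.
Qed.

(** Ladyzhenskaya's argument by horizontal slices at height [c]. On a slice, [plane_le] gives a
    product of two integrals of line weights, and Cauchy-Schwarz in each of them brings out a factor
    [m c], the slice integral of [f ^ 2]. The vertical direction bounds [m c] uniformly by [M], and
    what remains is integrated in [c]. *)
Lemma L4_bound f : Cn 1 f -> L1 mu3 (fun x => f x ^+ 2) ->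
  (forall i, L1 mu3 (fun x => partial i f x ^+ 2)) ->
  L1 mu3 (fun x => f x ^+ 4) /\
  \int[mu3]_x (f x ^+ 4) <= 8 * (\int[mu3]_x (f x ^+ 2) + grad2 f) ^+ 2.
Proof.
move=> cf l0 lg; have c0 := Cn_cont cf.
have cp i : continuous (partial i f) := Cn_cont (CnS_partial i cf).
have mf : measurable_fun setT (f : M3 R -> R) := continuous_m c0.
have mp i : measurable_fun setT (partial i f : M3 R -> R) := continuous_m (cp i).
have lfp i := (cauchy_schwarz mf (mp i) l0 (lg i)).1.
have le i : L1 mu3 (lineweight f i) by exact: L1D l0 (L1Z 2 (lfp i)).
have mle i := measurable_lineweight i cf.
have e0 i (x : M3 R) : (0 <= (lineweight f i x)%:E)%E by rewrite lee_fin lineweight_ge0.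
pose sl (q : R3 R -> R) (c : M1) : M1 * M1 -> R := fun p => q (p, c).
have msl q c : measurable_fun setT (q : M3 R -> R) -> measurable_fun setT (sl q c).
  by move=> mq; exact: measurableT_comp mq (pair2_measurable c).
pose E i (c : M1) := (\int[mu2]_p (lineweight f i (p, c))%:E)%E.
pose M := \int[mu3]_x lineweight f j2 x.
have S c : (\int[mu2]_p (f (p, c) ^+ 4)%:E <= E j0 c * E j1 c)%E.
  apply: (plane_le (g := sl f c) (e0 := fun p => (lineweight f j0 (p, c))%:E)
    (e1 := fun p => (lineweight f j1 (p, c))%:E)) => //.
  - exact: msl.
  - by apply/measurable_EFinP; apply: msl; exact/L1_measurable/le.
  - by apply/measurable_EFinP; apply: msl; exact/L1_measurable/le.
  - by move=> a b; exact: sqr_le_line0.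
  - by move=> a b; exact: sqr_le_line1.
have [lm Em] := Rfubini2 (l0 : L1 (prod_measure mu2 mu1) _).
have [ld0 Ed0] := Rfubini2 (lg j0 : L1 (prod_measure mu2 mu1) _).
have [ld1 Ed1] := Rfubini2 (lg j1 : L1 (prod_measure mu2 mu1) _).
pose m (c : M1) := \int[mu2]_p (f (p, c) ^+ 2).
pose d i (c : M1) := \int[mu2]_p (partial i f (p, c) ^+ 2).
have M0 : 0 <= M by apply: Rint_ge0 => x; exact: lineweight_ge0.
have m0 c : 0 <= m c by apply: Rint_ge0 => p; exact: sqr_ge0.
have d0 i c : 0 <= d i c by apply: Rint_ge0 => p; exact: sqr_ge0.
(* The vertical line inequality, integrated over the slice, bounds all these slice masses by one
   number. *)
have mM c : L1 mu2 (fun p => f (p, c) ^+ 2) -> m c <= M.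
  move=> lc; rewrite -lee_fin EFin_Rint// /M EFin_Rint; last exact: le.
  rewrite [leRHS](fubini_tonelli1 (m1 := mu2) (m2 := mu1) _ (mle j2) (e0 j2)).
  apply: ge0_le_integral => //.
  - by move=> p _; rewrite lee_fin sqr_ge0.
  - exact/measurable_EFinP/L1_measurable/lc.
  - by have := measurable_fun_fubini_tonelli_F (m2 := mu1) _ (mle j2) (e0 j2).
  by move=> [a b] _; exact: sqr_le_line2.
have EA i c : L1 mu2 (fun p => f (p, c) ^+ 2) -> L1 mu2 (fun p => partial i f (p, c) ^+ 2) ->
   exists s : R, [/\ E i c = (m c + 2 * s)%:E, 0 <= s & s ^+ 2 <= m c * d i c].
  move=> lc lpc.
  have [ls hs] := cauchy_schwarz (msl _ c mf) (msl _ c (mp i)) lc lpc.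
  exists (\int[mu2]_p `|sl f c p * sl (partial i f) c p|); split.
  - rewrite -RintZ; last exact: ls.
    rewrite -RintD; [|exact: lc|exact: (L1Z 2 ls)].
    by rewrite EFin_Rint//; exact: (L1D lc (L1Z 2 ls)).
  - by apply: Rint_ge0.
  - exact: hs.
have lbd : L1 mu1 (fun c => M * (2 * m c + 4 * d j0 c + 4 * d j1 c)).
  exact: (L1Z M (L1D (L1D (L1Z 2 lm) (L1Z 4 ld0)) (L1Z 4 ld1))).
have m4 : measurable_fun setT (fun x : M3 R => (f x ^+ 4)%:E).
  by apply/measurable_EFinP; exact: measurable_funX.
have f40 (x : M3 R) : (0 <= (f x ^+ 4)%:E)%E.
  by rewrite lee_fin (_ : f x ^+ 4 = (f x ^+ 2) ^+ 2) ?sqr_ge0// -exprM.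
(* Fubini's theorem gives square-integrable data on almost every slice only, hence a comparison
   almost everywhere in [c]. *)
have key : (\int[mu3]_x (f x ^+ 4)%:E <=
    (\int[mu1]_c (M * (2 * m c + 4 * d j0 c + 4 * d j1 c)))%:E)%E.
  rewrite [leLHS](fubini_tonelli2 (m1 := mu2) (m2 := mu1) _ m4 f40) EFin_Rint//.
  apply: ae_ge0_le_integral => //.
  - by move=> c _; exact: integral_ge0.
  - by have := measurable_fun_fubini_tonelli_G (m1 := mu2) _ m4 f40.
  - by move=> c _; rewrite lee_fin mulr_ge0// !addr_ge0// mulr_ge0.
  - exact/measurable_EFinP/L1_measurable/lbd.
  have a0 := ae_integrable2 (l0 : (mu2 \x mu1)%E.-integrable _ _).
  have a1 := ae_integrable2 (lg j0 : (mu2 \x mu1)%E.-integrable _ _).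
  have a2 := ae_integrable2 (lg j1 : (mu2 \x mu1)%E.-integrable _ _).
  have step c : L1 mu2 (fun p => f (p, c) ^+ 2) ->
      L1 mu2 (fun p => partial j0 f (p, c) ^+ 2) ->
      L1 mu2 (fun p => partial j1 f (p, c) ^+ 2) ->
      (\int[mu2]_p (f (p, c) ^+ 4)%:E <=
       (M * (2 * m c + 4 * d j0 c + 4 * d j1 c))%:E)%E.
    move=> h0 h1 h2; apply: le_trans (S c) _.
    have [s [-> s0 hs]] := EA j0 c h0 h1; have [t [-> t0 ht]] := EA j1 c h0 h2.
    rewrite -EFinM lee_fin.
    exact: (slice_product_le (m0 c) (mM c h0) s0 t0 (d0 j0 c) (d0 j1 c) hs ht).
  move: a0 a1 a2; apply: filterS3 => c h0 h1 h2 _; exact: (step c h0 h1 h2).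
have l4 : L1 mu3 (fun x => f x ^+ 4).
  apply: L1_lty; first by apply: measurable_funX.
    by move=> x; have := f40 x; rewrite lee_fin.
  by apply: le_lt_trans key _; rewrite ltry.
split; first exact: l4.
have key' : \int[mu3]_x (f x ^+ 4) <=
    \int[mu1]_c (M * (2 * m c + 4 * d j0 c + 4 * d j1 c)).
  by rewrite -lee_fin EFin_Rint.
have lm2 : L1 mu1 (fun c => 2 * m c) := L1Z 2 lm.
have ld04 : L1 mu1 (fun c => 4 * d j0 c) := L1Z 4 ld0.
have ld14 : L1 mu1 (fun c => 4 * d j1 c) := L1Z 4 ld1.
have e1 : \int[mu1]_c (2 * m c) = 2 * \int[mu3]_x (f x ^+ 2).
  by apply: etrans (RintZ 2 lm) _; congr (2 * _); exact: Em.
have e2 : \int[mu1]_c (4 * d j0 c) = 4 * \int[mu3]_x (partial j0 f x ^+ 2).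
  by apply: etrans (RintZ 4 ld0) _; congr (4 * _); exact: Ed0.
have e3 : \int[mu1]_c (4 * d j1 c) = 4 * \int[mu3]_x (partial j1 f x ^+ 2).
  by apply: etrans (RintZ 4 ld1) _; congr (4 * _); exact: Ed1.
have tot : \int[mu1]_c (M * (2 * m c + 4 * d j0 c + 4 * d j1 c)) =
    M * (2 * \int[mu3]_x (f x ^+ 2) + 4 * \int[mu3]_x (partial j0 f x ^+ 2) +
      4 * \int[mu3]_x (partial j1 f x ^+ 2)).
  apply: etrans (RintZ M (L1D (L1D lm2 ld04) ld14)) _.
  apply: congr1; apply: etrans (RintD (L1D lm2 ld04) ld14) _.
  by apply: (f_equal2 +%R) e3; apply: etrans (RintD lm2 ld04) _; exact: (f_equal2 +%R e1 e2).
apply: le_trans key' _; rewrite [leLHS]tot.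
have MB : M <= 2 * \int[mu3]_x (f x ^+ 2) + \int[mu3]_x (partial j2 f x ^+ 2).
  rewrite -RintZ; last exact: l0.
  rewrite -RintD; [|exact: L1Z|exact: lg].
  apply: Rint_le; [exact: le|by apply: L1D; [exact: L1Z|exact: lg]|].
  by move=> x; exact: lineweight_le.
have F0 : 0 <= \int[mu3]_x (f x ^+ 2) by apply: Rint_ge0 => x; exact: sqr_ge0.
have D0 i : 0 <= \int[mu3]_x (partial i f x ^+ 2) by apply: Rint_ge0 => x; exact: sqr_ge0.
rewrite /grad2 sum3; exact: slice_total_le.
Qed.

End ladyzhenskaya_L4.

(** * Testing the equation *)

Section compactly_supported_parts.
Context {R : realType}.
Implicit Types (f g : R3 R -> R).

Lemma Rint_parts_vanish r f g i : Cn 1 f -> Cn 1 g -> vanish r g ->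
  \int[mu3]_x (f x * partial i g x) = - \int[mu3]_x (partial i f x * g x).
Proof.
move=> cf cg vg; have c0 := Cn_cont cf; have c1 := Cn_cont cg.
have c2 := Cn_cont (CnS_partial i cf); have c3 := Cn_cont (CnS_partial i cg).
apply: Rint_parts => //.
- apply: (@vanish_L1 _ r); last exact: vanish_mulr.
  by move=> x; apply: cvgM; [exact: c0|exact: c1].
- apply: (@vanish_L1 _ r); last by apply: vanish_mulr; exact: vanish_partial.
  by move=> x; apply: cvgM; [exact: c0|exact: c3].
- apply: (@vanish_L1 _ r); last exact: vanish_mulr.
  by move=> x; apply: cvgM; [exact: c2|exact: c1].
Qed.

Lemma L1_vanish_mul r f g : continuous f -> continuous g -> vanish r g ->
  L1 mu3 (fun x => f x * g x).
Proof.
move=> cf cg vg; apply: (@vanish_L1 _ r); last exact: vanish_mulr.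
by move=> x; apply: cvgM; [exact: cf|exact: cg].
Qed.

End compactly_supported_parts.

(** * Elimination of the pressure by divergence free test fields *)

Section stationary_solution.
Context {R : realType}.
Implicit Types (f g chi : R3 R -> R) (b : 'I_3 -> R3 R -> R).

Definition divfree b : Prop := forall x, \sum_(l < 3) partial l (b l) x = 0.

Variables (u : 'I_3 -> R3 R -> R) (P : R3 R -> R).

(** The momentum operator without its pressure term; the equation says that it is minus a
    gradient. *)
Definition NSop i : R3 R -> R := fun x =>
  - (\sum_(l < 3) partial l (partial l (u i)) x) + \sum_(l < 3) u l x * partial l (u i) x.

Hypothesis cu : forall n i, Cn n (u i).
Hypothesis cP : forall n, Cn n P.
Hypothesis NS : forall i x, NSop i x = - partial i P x.

Lemma NSop_cont i : continuous (NSop i).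
Proof.
have -> : NSop i = fun x => - partial i P x by apply/funext => x; exact: NS.
by move=> x; apply: cvgN; exact: (Cn_cont (CnS_partial i (cP 1))).
Qed.

(* The field [d_j g - e_j div g] is divergence free, so it does not see the
   pressure. *)
Lemma test_pressure_free r j (g : 'I_3 -> R3 R -> R) : (forall i, Cn 2 (g i)) ->
  (forall i, vanish r (g i)) ->
  \sum_(i < 3) \int[mu3]_x (NSop i x * partial j (g i) x) =
  \sum_(l < 3) \int[mu3]_x (NSop j x * partial l (g l) x).
Proof.
move=> cg vg; apply: eq_bigr => i _.
have E a : forall x, NSop a x = - 1 * partial a P x.
  by move=> x; rewrite NS mulN1r.
have L a c : \int[mu3]_x (NSop a x * partial c (g i) x) =
    \int[mu3]_x (partial c (partial a P) x * g i x).
  have cN : Cn 1 (NSop a).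
    have -> : NSop a = fun x => -1 * partial a P x by apply/funext => x; exact: E.
    exact: CnZ (CnS_partial a (cP 2)).
  rewrite (Rint_parts_vanish c cN (CnW (cg i)) (vg i)).
  have -> : partial c (NSop a) = fun x => - 1 * partial c (partial a P) x.
    by rewrite -(partialZ (-1) c (CnS_partial a (cP 2))); congr partial; apply/funext => x; exact: E.
  rewrite -RintN.
    by apply: Rint_eq => x; rewrite mulN1r mulNr opprK.
  apply: (L1_vanish_mul (r := r)); [|exact: (Cn_cont (cg i))|exact: vg].
  exact: (Cn_cont (CnZ (-1) (CnS_partial c (CnS_partial a (cP 2))))).
by rewrite !L (partialC i j (cP 2)).
Qed.

(** For divergence free [b], the component [i] of [d_j (chi b) - e_j div (chi b)] equals
    [chi * partial j (b i)] plus this term, which contains no derivative of [b]. *)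
Definition cutterm chi b j i : R3 R -> R := fun x =>
  partial j chi x * b i x - (i == j)%:R * \sum_(l < 3) partial l chi x * b l x.

Lemma cutterm_Cn1 chi b j i : Cn 2 chi -> (forall i, Cn 2 (b i)) -> Cn 1 (cutterm chi b j i).
Proof.
move=> cc cb; apply: CnB; first exact: (CnM (CnS_partial j cc) (CnW (cb i))).
apply: CnZ; apply: Cn_sum => l; exact: (CnM (CnS_partial l cc) (CnW (cb l))).
Qed.

Lemma cutterm_vanish r chi b j i : vanish r chi -> vanish r (cutterm chi b j i).
Proof.
move=> vc x rx; rewrite /cutterm (vanish_partial j vc)// mul0r big1 ?mulr0 ?subr0// => l _.
by rewrite (vanish_partial l vc)// mul0r.
Qed.

Lemma sum_cancel (s p q t : R) : s + p = q -> t = p - q -> s = - t.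
Proof. by move=> <- ->; rewrite opprB addrK. Qed.

Lemma kronecker_sum (A T : 'I_3 -> R) j :
  \sum_(i < 3) (A i - (i == j)%:R * T i) = \sum_(i < 3) A i - T j.
Proof.
rewrite sumrB; congr (_ - _).
rewrite (bigD1 j)//= eqxx mul1r big1 ?addr0// => i /negbTE ->.
by rewrite mul0r.
Qed.

(** [test_pressure_free] applied to [chi b]: expanding both sides leaves [chi d_j b] and the
    correction [cutterm], the term with div b being 0. *)
Lemma test_cutoff r j chi b : Cn 2 chi -> vanish r chi -> (forall i, Cn 2 (b i)) ->
  divfree b ->
  \sum_(i < 3) \int[mu3]_x (NSop i x * (chi x * partial j (b i) x)) =
  - \sum_(i < 3) \int[mu3]_x (NSop i x * cutterm chi b j i x).
Proof.
move=> cc vc cb db.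
have cg i : Cn 2 (fun x => chi x * b i x) := CnM cc (cb i).
have vg i : vanish r (fun x => chi x * b i x) by move=> x rx; rewrite (vc x rx) mul0r.
have T0 := test_pressure_free j cg vg.
have cN i := @NSop_cont i.
have pg l i x : partial l (fun x => chi x * b i x) x =
    chi x * partial l (b i) x + partial l chi x * b i x.
  by rewrite (partialM l cc (cb i)).
have lA i : L1 mu3 (fun x => NSop i x * (chi x * partial j (b i) x)).
  apply: (L1_vanish_mul (r := r) (cN i)); last exact: vanish_mull.
  move=> x; apply: cvgM; [exact: (Cn_cont cc)|exact: (Cn_cont (CnS_partial j (cb i)))].
have lB i l a : L1 mu3 (fun x => NSop i x * (partial l chi x * b a x)).
  apply: (L1_vanish_mul (r := r) (cN i)); last by apply: vanish_mull; exact: vanish_partial.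
  move=> x; apply: cvgM; [exact: (Cn_cont (CnS_partial l cc))|exact: (Cn_cont (cb a))].
have E1 i : \int[mu3]_x (NSop i x * partial j (fun x => chi x * b i x) x) =
    \int[mu3]_x (NSop i x * (chi x * partial j (b i) x)) +
    \int[mu3]_x (NSop i x * (partial j chi x * b i x)).
  rewrite -RintD; [|exact: lA|exact: lB].
  by apply: Rint_eq => x; rewrite pg mulrDr.
have E1s : \sum_(i < 3) \int[mu3]_x (NSop i x * partial j (fun x => chi x * b i x) x) =
    \sum_(i < 3) \int[mu3]_x (NSop i x * (chi x * partial j (b i) x)) +
    \sum_(i < 3) \int[mu3]_x (NSop i x * (partial j chi x * b i x)).
  by rewrite -big_split; apply: eq_bigr => i _; exact: E1.
have E2 : \sum_(l < 3) \int[mu3]_x (NSop j x * partial l (fun x => chi x * b l x) x) =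
    \sum_(l < 3) \int[mu3]_x (NSop j x * (partial l chi x * b l x)).
  have lC l : L1 mu3 (fun x => NSop j x * partial l (fun x => chi x * b l x) x).
    apply: (L1_vanish_mul (r := r) (cN j)).
      exact: (Cn_cont (CnS_partial l (cg l))).
    exact: (vanish_partial l (vg l)).
  apply: etrans (esym (Rint_sum _ (fun l _ => lC l))) _.
  apply: etrans _ (Rint_sum _ (fun l _ => lB j l l)).
  apply: Rint_eq => x; rewrite -!mulr_sumr; congr (_ * _).
  apply: etrans (eq_bigr _ (fun l _ => pg l l x)) _.
  by rewrite big_split /= -mulr_sumr db mulr0 add0r.
have E4 : \sum_(i < 3) \int[mu3]_x (NSop i x * cutterm chi b j i x) =
    \sum_(i < 3) \int[mu3]_x (NSop i x * (partial j chi x * b i x)) -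
    \sum_(l < 3) \int[mu3]_x (NSop j x * (partial l chi x * b l x)).
  have E5 i : \int[mu3]_x (NSop i x * cutterm chi b j i x) =
      \int[mu3]_x (NSop i x * (partial j chi x * b i x)) -
      (i == j)%:R * \sum_(l < 3) \int[mu3]_x (NSop i x * (partial l chi x * b l x)).
    have lBi : L1 mu3 (fun x => \sum_(l < 3) NSop i x * (partial l chi x * b l x)).
      by apply: L1_sum => l _; exact: lB.
    have RS := Rint_sum _ (fun l _ => lB i l l).
    suff H : \int[mu3]_x (NSop i x * cutterm chi b j i x) =
        \int[mu3]_x (NSop i x * (partial j chi x * b i x)) - (i == j)%:R *
        \int[mu3]_x (\sum_(l < 3) NSop i x * (partial l chi x * b l x)).
      by apply: etrans H _; congr (_ - _ * _); exact: RS.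
    rewrite -(RintZ (i == j)%:R lBi) -(RintB (lB i j i) (L1Z (i == j)%:R lBi)).
    apply: Rint_eq => x; rewrite /cutterm mulrBr [X in _ - X]mulrCA mulr_sumr.
    reflexivity.
  apply: etrans (eq_bigr _ (fun i _ => E5 i)) _.
  exact: (kronecker_sum (fun i => \int[mu3]_x (NSop i x * (partial j chi x * b i x)))
    (fun i => \sum_(l < 3) \int[mu3]_x (NSop i x * (partial l chi x * b l x))) j).
exact: (sum_cancel (etrans (esym E1s) (etrans T0 E2)) E4).
Qed.

End stationary_solution.

Section cutoff_bounds.
Context {R : realType}.
Implicit Types (f g chi : R3 R -> R) (b : 'I_3 -> R3 R -> R).

Lemma is_derive_sum3 (F : 'I_3 -> R3 R -> R) i x : (forall l, Cn 1 (F l)) ->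
  partial i (fun x => \sum_(l < 3) F l x) x = \sum_(l < 3) partial i (F l) x.
Proof.
move=> cF; have E : (fun x => \sum_(l < 3) F l x) = fun x => F j0 x + F j1 x + F j2 x.
  by apply/funext => y; rewrite sum3.
by rewrite E sum3 (partialD i (CnD (cF j0) (cF j1)) (cF j2)) (partialD i (cF j0) (cF j1)).
Qed.

Lemma cutterm_bound chi b j i x e : (forall l, `|partial l chi x| <= e) ->
  `|cutterm chi b j i x| <= 2 * e * \sum_(m < 3) `|b m x|.
Proof.
move=> ce; have e0 : 0 <= e := le_trans (normr_ge0 _) (ce j0).
have h l : `|partial l chi x * b l x| <= e * `|b l x| by rewrite normrM ler_wpM2r.
apply: le_trans (ler_normB _ _) _; rewrite -mulrA mulr2n mulrDl mul1r.
have hs : e * `|b i x| <= e * \sum_(m < 3) `|b m x|.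
  by rewrite ler_wpM2l// (bigD1 i)//= lerDl sumr_ge0.
apply: lerD.
  by apply: le_trans hs; rewrite normrM ler_wpM2r.
rewrite normrM; apply: (@le_trans _ _ (1 * `|\sum_(l < 3) partial l chi x * b l x|)).
  by rewrite ler_wpM2r//; case: (i == j); rewrite ?normr1 ?normr0 ?ler01.
rewrite mul1r mulr_sumr; apply: le_trans (ler_norm_sum _ _ _) _.
by apply: ler_sum => l _; exact: h.
Qed.

Lemma cutterm_partial_bound chi b j i l x e : Cn 2 chi -> (forall i, Cn 2 (b i)) ->
  (forall l, `|partial l chi x| <= e) ->
  (forall l m, `|partial l (partial m chi) x| <= e) ->
  `|partial l (cutterm chi b j i) x| <=
  2 * e * \sum_(m < 3) (`|b m x| + `|partial l (b m) x|).
Proof.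
move=> cc cb ce cce; have e0 : 0 <= e := le_trans (normr_ge0 _) (ce j0).
pose F m : R3 R -> R := fun x => partial m chi x * b m x.
have cF m : Cn 1 (F m) := CnM (CnS_partial m cc) (CnW (cb m)).
have cA : Cn 1 (fun x => partial j chi x * b i x) := CnM (CnS_partial j cc) (CnW (cb i)).
have cS : Cn 1 (fun x => \sum_(m < 3) F m x) := Cn_sum _ cF.
have pF a m : partial l (fun x => partial a chi x * b m x) x =
    partial a chi x * partial l (b m) x + partial l (partial a chi) x * b m x.
  by rewrite (partialM l (CnS_partial a cc) (CnW (cb m))).
have hF a m : `|partial l (fun x => partial a chi x * b m x) x| <=
    e * (`|b m x| + `|partial l (b m) x|).
  rewrite pF mulrDr addrC; apply: le_trans (ler_normD _ _) _.
  by rewrite !normrM; apply: lerD; apply: ler_wpM2r.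
rewrite /cutterm (partialB l cA (CnZ (i == j)%:R cS)) (partialZ (i == j)%:R l cS).
rewrite (is_derive_sum3 l x cF).
apply: le_trans (ler_normB _ _) _; rewrite -mulrA mulr2n mulrDl mul1r.
apply: lerD.
  apply: le_trans (hF j i) _; rewrite ler_wpM2l// (bigD1 i)//= lerDl sumr_ge0//.
rewrite normrM; apply: (@le_trans _ _ (1 * `|\sum_(m < 3) partial l (F m) x|)).
  by rewrite ler_wpM2r//; case: (i == j); rewrite ?normr1 ?normr0 ?ler01.
rewrite mul1r mulr_sumr; apply: le_trans (ler_norm_sum _ _ _) _.
by apply: ler_sum => m _; exact: hF.
Qed.

Lemma energy_term_le (a p q e : R) : 0 <= e ->
  `|a| * (2 * e * (`|p| + `|q|)) <= 2 * e * (2 * a ^+ 2 + p ^+ 2 + q ^+ 2).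
Proof.
move=> e0; rewrite mulrCA; apply: ler_wpM2l; first by rewrite mulr_ge0.
rewrite -(real_normK (num_real a)) -(real_normK (num_real p)) -(real_normK (num_real q)).
move: `|a| `|p| `|q| => x y z.
have := sqr_ge0 (x - y); have := sqr_ge0 (x - z); have := sqr_ge0 y; have := sqr_ge0 z.
nra.
Qed.

(** The drift is a bounded field plus an L4 field. The first is paid by two L2 norms, the second by
    one L2 and two L4 norms through Young's inequality; this is what the L4 bounds are for. *)
Lemma drift_term_le (v w a p e M : R) : 0 <= e -> `|v| <= M ->
  `|v + w| * `|a| * (2 * e * `|p|) <=
  2 * e * (M * (a ^+ 2 + p ^+ 2) + (a ^+ 2 + w ^+ 4 + p ^+ 4)).
Proof.
move=> e0 vM; rewrite mulrCA; apply: ler_wpM2l; first by rewrite mulr_ge0.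
have -> : w ^+ 4 = (`|w| ^+ 2) ^+ 2 by rewrite real_normK ?num_real// -exprM.
have -> : p ^+ 4 = (`|p| ^+ 2) ^+ 2 by rewrite real_normK ?num_real// -exprM.
rewrite -(real_normK (num_real a)) -(real_normK (num_real p)).
apply: (@le_trans _ _ ((M + `|w|) * (`|a| * `|p|))).
  rewrite -mulrA ler_wpM2r ?mulr_ge0//.
  by apply: le_trans (ler_normD _ _) _; rewrite lerD2r.
have M0 := le_trans (normr_ge0 v) vM.
move: `|w| `|a| `|p| (normr_ge0 w) (normr_ge0 a) (normr_ge0 p) => x y z x0 y0 z0.
rewrite mulrDl; apply: lerD.
  by apply: ler_wpM2l => //; have := sqr_ge0 (y - z); have := sqr_ge0 y; have := sqr_ge0 z; nra.
have h1 : x * (y * z) <= y ^+ 2 + (x * z) ^+ 2.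
  have := sqr_ge0 (y - x * z); have := sqr_ge0 (x * z); have := sqr_ge0 y; nra.
apply: le_trans h1 _; rewrite -addrA lerD2l exprMn.
move: (x ^+ 2) (z ^+ 2) => s t.
have := sqr_ge0 (s - t); have := sqr_ge0 s; have := sqr_ge0 t; nra.
Qed.

End cutoff_bounds.

Section weak_form.
Context {R : realType}.
Variable (u : 'I_3 -> R3 R -> R).
Hypothesis cu : forall n i, Cn n (u i).

(** One integration by parts, so that only first derivatives of [u] occur, the ones that have a
    global bound. *)
Lemma NSop_weak r i (g : R3 R -> R) : Cn 1 g -> vanish r g ->
  \int[mu3]_x (NSop u i x * g x) =
  \sum_(l < 3) (\int[mu3]_x (partial l (u i) x * partial l g x) +
                \int[mu3]_x (u l x * partial l (u i) x * g x)).
Proof.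
move=> cg vg.
have l1 l : L1 mu3 (fun x => partial l (partial l (u i)) x * g x).
  apply: (L1_vanish_mul (r := r)); [|exact: (Cn_cont cg)|exact: vg].
  exact: (Cn_cont (CnS_partial l (CnS_partial l (cu 2 i)))).
have l2 l : L1 mu3 (fun x => u l x * partial l (u i) x * g x).
  apply: (L1_vanish_mul (r := r)); [|exact: (Cn_cont cg)|exact: vg].
  exact: (Cn_cont (CnM (cu 0 l) (CnS_partial l (cu 1 i)))).
have E l : \int[mu3]_x (partial l (u i) x * partial l g x) =
    - \int[mu3]_x (partial l (partial l (u i)) x * g x).
  exact: (Rint_parts_vanish l (CnS_partial l (cu 2 i)) cg vg).
apply: etrans (_ : \int[mu3]_x (\sum_(l < 3) (u l x * partial l (u i) x * g x -
   partial l (partial l (u i)) x * g x)) = _).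
  apply: Rint_eq => x; rewrite /NSop sumrB -!mulr_suml.
  by rewrite mulrDl mulNr addrC.
apply: etrans (Rint_sum _ (fun l _ => L1B (l2 l) (l1 l))) _.
apply: eq_bigr => l _; apply: etrans (RintB (l2 l) (l1 l)) _.
by rewrite E addrC.
Qed.

(* [S] dominates all the square and fourth power integrals involved. *)
Lemma cutterm_test_bound r j chi (b v w : 'I_3 -> R3 R -> R) (e M S : R) :
  Cn 2 chi -> vanish r chi -> (forall i, Cn 2 (b i)) ->
  (forall l x, `|partial l chi x| <= e) ->
  (forall l m x, `|partial l (partial m chi) x| <= e) ->
  (forall i x, u i x = v i x + w i x) -> (forall i x, `|v i x| <= M) ->
  (forall i l, L1 mu3 (fun x => partial l (u i) x ^+ 2) /\
     \int[mu3]_x (partial l (u i) x ^+ 2) <= S) ->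
  (forall i, L1 mu3 (fun x => b i x ^+ 2) /\ \int[mu3]_x (b i x ^+ 2) <= S) ->
  (forall i l, L1 mu3 (fun x => partial l (b i) x ^+ 2) /\
     \int[mu3]_x (partial l (b i) x ^+ 2) <= S) ->
  (forall i, L1 mu3 (fun x => w i x ^+ 4) /\ \int[mu3]_x (w i x ^+ 4) <= S) ->
  (forall i, L1 mu3 (fun x => b i x ^+ 4) /\ \int[mu3]_x (b i x ^+ 4) <= S) ->
  `|\sum_(i < 3) \int[mu3]_x (NSop u i x * cutterm chi b j i x)| <=
  378 * e * (1 + M) * S.
Proof.
move=> cc vc cb ce cce uvw vM hu hb hdb hw hb4.
have e0 : 0 <= e := le_trans (normr_ge0 _) (ce j0 0).
have M0 : 0 <= M := le_trans (normr_ge0 _) (vM j0 0).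
pose g1 i l m (x : R3 R) := 2 * e * (2 * partial l (u i) x ^+ 2 + b m x ^+ 2 + partial l (b m) x ^+ 2).
pose g2 i l m (x : R3 R) := 2 * e * (M * (partial l (u i) x ^+ 2 + b m x ^+ 2) +
  (partial l (u i) x ^+ 2 + w l x ^+ 4 + b m x ^+ 4)).
have S0 : 0 <= S.
  by apply: le_trans (hb j0).2; apply: Rint_ge0 => x; exact: sqr_ge0.
have e20 : 0 <= 2 * e by rewrite mulr_ge0.
have lg1 i l m : L1 mu3 (g1 i l m).
  exact: (L1Z (2 * e) (L1D (L1D (L1Z 2 (hu i l).1) (hb m).1) (hdb m l).1)).
have lg2 i l m : L1 mu3 (g2 i l m).
  exact: (L1Z (2 * e) (L1D (L1Z M (L1D (hu i l).1 (hb m).1))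
    (L1D (L1D (hu i l).1 (hw l).1) (hb4 m).1))).
have num1 (p q t : R) : p <= S -> q <= S -> t <= S -> 2 * p + q + t <= 4 * S by lra.
have num2 (p q s t : R) : p <= S -> q <= S -> s <= S -> t <= S ->
    M * (p + q) + (p + s + t) <= (2 * M + 3) * S by nra.
(* For one pair [i], [l], with three indices [m] in each term, the sum is [e * S * (42 + 12 * M)];
   nine pairs give [378 + 108 * M]. *)
have num3 : (3 * (2 * e * (4 * S)) + 3 * (2 * e * ((2 * M + 3) * S))) *+ 9 <=
    378 * e * (1 + M) * S.
  by have := mulr_ge0 (mulr_ge0 e0 M0) S0; rewrite -mulr_natl; nra.
have I1 i l m : \int[mu3]_x g1 i l m x <= 2 * e * (4 * S).
  apply: le_trans (_ : 2 * e * (2 * \int[mu3]_x (partial l (u i) x ^+ 2) +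
    \int[mu3]_x (b m x ^+ 2) + \int[mu3]_x (partial l (b m) x ^+ 2)) <= _); last first.
    by apply: ler_wpM2l => //; exact: (num1 _ _ _ (hu i l).2 (hb m).2 (hdb m l).2).
  rewrite le_eqVlt; apply/orP; left; apply/eqP.
  apply: etrans (RintZ _ (L1D (L1D (L1Z 2 (hu i l).1) (hb m).1) (hdb m l).1)) _.
  apply: congr1; apply: etrans (RintD (L1D (L1Z 2 (hu i l).1) (hb m).1) (hdb m l).1) _.
  apply: (f_equal2 +%R) => //; apply: etrans (RintD (L1Z 2 (hu i l).1) (hb m).1) _.
  by apply: (f_equal2 +%R) => //; exact: RintZ (hu i l).1.
have I2 i l m : \int[mu3]_x g2 i l m x <= 2 * e * ((2 * M + 3) * S).
  apply: le_trans (_ : 2 * e * (M * (\int[mu3]_x (partial l (u i) x ^+ 2) +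
    \int[mu3]_x (b m x ^+ 2)) + (\int[mu3]_x (partial l (u i) x ^+ 2) +
    \int[mu3]_x (w l x ^+ 4) + \int[mu3]_x (b m x ^+ 4))) <= _); last first.
    by apply: ler_wpM2l => //; exact: (num2 _ _ _ _ (hu i l).2 (hb m).2 (hw l).2 (hb4 m).2).
  rewrite le_eqVlt; apply/orP; left; apply/eqP.
  have A1 := L1D (hu i l).1 (hb m).1; have A2 := L1D (hu i l).1 (hw l).1.
  apply: etrans (RintZ _ (L1D (L1Z M A1) (L1D A2 (hb4 m).1))) _.
  apply: congr1; apply: etrans (RintD (L1Z M A1) (L1D A2 (hb4 m).1)) _.
  apply: (f_equal2 +%R).
    apply: etrans (RintZ M A1) _; apply: congr1; exact: (RintD (hu i l).1 (hb m).1).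
  apply: etrans (RintD A2 (hb4 m).1) _; apply: (f_equal2 +%R) => //.
  exact: (RintD (hu i l).1 (hw l).1).
have cct i := cutterm_Cn1 j i cc cb.
have sum3c (a : R) : \sum_(m < 3) a = 3 * a by rewrite sum3; ring.
have D1 i l : `|\int[mu3]_x (partial l (u i) x * partial l (cutterm chi b j i) x)| <=
    3 * (2 * e * (4 * S)).
  rewrite -sum3c; apply: le_trans (ler_sum _ (fun m _ => I1 i l m)).
  rewrite -(Rint_sum _ (fun m _ => lg1 i l m)).
  apply: Rint_dom; last 1 first.
  - move=> x; rewrite normrM.
    apply: le_trans (ler_wpM2l (normr_ge0 _) (cutterm_partial_bound j i l cc cb
      (fun l => ce l x) (fun l m => cce l m x))) _.
    rewrite !mulr_sumr; apply: ler_sum => m _; exact: energy_term_le.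
  - apply: continuous_m => x; apply: cvgM; first exact: (Cn_cont (CnS_partial l (cu 1 i))).
    exact: (Cn_cont (CnS_partial l (cct i))).
  - by apply: L1_sum => m _; exact: lg1.
have D2 i l : `|\int[mu3]_x (u l x * partial l (u i) x * cutterm chi b j i x)| <=
    3 * (2 * e * ((2 * M + 3) * S)).
  rewrite -sum3c; apply: le_trans (ler_sum _ (fun m _ => I2 i l m)).
  rewrite -(Rint_sum _ (fun m _ => lg2 i l m)).
  apply: Rint_dom; last 1 first.
  - move=> x; rewrite !normrM.
    apply: le_trans (ler_wpM2l (mulr_ge0 (normr_ge0 _) (normr_ge0 _))
      (cutterm_bound b j i (fun l => ce l x))) _.
    rewrite !mulr_sumr; apply: ler_sum => m _; rewrite uvw; exact: drift_term_le.
  - apply: continuous_m => x; apply: cvgM; last exact: (Cn_cont (cct i)).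
    by apply: cvgM; [exact: (Cn_cont (cu 0 l))|exact: (Cn_cont (CnS_partial l (cu 1 i)))].
  - by apply: L1_sum => m _; exact: lg2.
have E i := NSop_weak i (cct i) (cutterm_vanish b j i vc).
rewrite (eq_bigr _ (fun i _ => E i)).
apply: le_trans (ler_norm_sum _ _ _) _.
apply: (@le_trans _ _ (\sum_(i < 3) \sum_(l < 3) (3 * (2 * e * (4 * S)) +
   3 * (2 * e * ((2 * M + 3) * S))))).
  apply: ler_sum => i _; apply: le_trans (ler_norm_sum _ _ _) _.
  apply: ler_sum => l _; apply: le_trans (ler_normD _ _) _.
  exact: lerD (D1 i l) (D2 i l).
by apply: le_trans num3; rewrite !sumr_const !card_ord -mulrnA.
Qed.

End weak_form.

(** * Antidifferences and symmetric sums of translates *)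

Section symmetric_differences.
Context {R : realType}.
Implicit Types (f : R3 R -> R) (p x y : R3 R).

Definition antidiff p f x := f (x - p) - f (x + p).

Lemma antidiff_Cn n p f : Cn n f -> Cn n (antidiff p f).
Proof. by move=> cf; exact: (CnB (Cn_shift (- p) cf) (Cn_shift p cf)). Qed.

Lemma partial_antidiff n p f i : Cn n.+1 f ->
  partial i (antidiff p f) = antidiff p (partial i f).
Proof.
move=> cf; have c1 : Cn 1 f by apply: Cn_le cf.
have -> : antidiff p f = fun x => f (x + - p) - f (x + p) by [].
rewrite (partialB i (Cn_shift (- p) c1) (Cn_shift p c1)).
by rewrite (partial_shift (- p) i c1) (partial_shift p i c1).
Qed.

Lemma antidiff_L2 p f : continuous f -> L1 mu3 (fun x => f x ^+ 2) ->
  L1 mu3 (fun x => antidiff p f x ^+ 2) /\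
  \int[mu3]_x (antidiff p f x ^+ 2) <= 4 * \int[mu3]_x (f x ^+ 2).
Proof.
move=> cf lf.
have l1 := L1_shift (- p) lf; have l2 := L1_shift p lf.
have lg := L1Z 2 (L1D l1 l2).
have dom x : `|antidiff p f x ^+ 2| <= 2 * (f (x + - p) ^+ 2 + f (x + p) ^+ 2).
  rewrite ger0_norm ?sqr_ge0// /antidiff.
  by move: (f _) (f _) => a b; have := sqr_ge0 (a + b); nra.
have ca : continuous (fun x => antidiff p f x ^+ 2).
  apply: continuous_sqr => x; apply: cvgB.
    by have := @continuous_comp _ _ _ (fun x => x - p) f x; apply; [apply: cvgB; [exact: cvg_id|exact: cvg_cst]|exact: cf].
  by have := @continuous_comp _ _ _ (fun x => x + p) f x; apply; [apply: cvgD; [exact: cvg_id|exact: cvg_cst]|exact: cf].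
have la := L1_dom (continuous_m ca) lg dom; split => //.
apply: le_trans (Rint_le la lg (fun x => le_trans (ler_norm _) (dom x))) _.
apply: le_trans (_ : 2 * (\int[mu3]_x (f x ^+ 2) + \int[mu3]_x (f x ^+ 2)) <= _).
  rewrite le_eqVlt; apply/orP; left; apply/eqP.
  apply: etrans (RintZ 2 (L1D l1 l2)) _; apply: congr1.
  apply: etrans (RintD l1 l2) _.
  exact: (f_equal2 +%R (Rint_shift (- p) lf) (Rint_shift p lf)).
by move: (\int[mu3]_x _) => a; lra.
Qed.

Lemma antidiff_diff_L2 p f : Cn 1 f -> (forall i, L1 mu3 (fun x => partial i f x ^+ 2)) ->
  L1 mu3 (fun x => antidiff p f x ^+ 2) /\
  \int[mu3]_x (antidiff p f x ^+ 2) <= 12 * rho p * grad2 f.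
Proof.
move=> cf lf; have [l1 h1] := L2_diff (2 *: p) cf lf.
have E x : antidiff p f x ^+ 2 = (f (x + - p + 2 *: p) - f (x + - p)) ^+ 2.
  by rewrite /antidiff -sqrrN opprB; congr ((f _ - f _) ^+ 2); rewrite scaler_nat mulr2n addrA subrK.
rewrite (_ : (fun x => antidiff p f x ^+ 2) =
  fun x => (f (x + - p + 2 *: p) - f (x + - p)) ^+ 2); last by apply/funext => x; exact: E.
split; first exact: (L1_shift (- p) l1).
apply: le_trans (_ : \int[mu3]_x (f ((x : R3 R) + 2 *: p) - f x) ^+ 2 <= _).
  by rewrite le_eqVlt; apply/orP; left; apply/eqP; exact: (Rint_shift (- p) l1).
apply: le_trans h1 _; rewrite -/(grad2 f); apply: ler_wpM2r; first exact: grad2_ge0.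
rewrite /= /GRing.scale/=; have := sqr_coords_le_rho p.
by move: (rho p) p.1.1 p.1.2 p.2 => a b c d; nra.
Qed.

Lemma antidiff_grad2 p f : Cn 1 f -> (forall i, L1 mu3 (fun x => partial i f x ^+ 2)) ->
  grad2 (antidiff p f) <= 4 * grad2 f.
Proof.
move=> cf lf; rewrite /grad2 mulr_sumr; apply: ler_sum => i _.
rewrite (partial_antidiff p i cf).
exact: (antidiff_L2 p (Cn_cont (CnS_partial i cf)) (lf i)).2.
Qed.

(** Ladyzhenskaya's inequality, with [12 * rho p * grad2 f] for the square integral and
    [4 * grad2 f] for the gradient. As [rho p >= 1], their sum is at most [16 * rho p * grad2 f],
    and 2048 = 8 * 16 ^ 2. *)
Lemma antidiff_L4 p f : Cn 1 f -> (forall i, L1 mu3 (fun x => partial i f x ^+ 2)) ->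
  L1 mu3 (fun x => antidiff p f x ^+ 4) /\
  \int[mu3]_x (antidiff p f x ^+ 4) <= 2048 * (rho p * grad2 f) ^+ 2.
Proof.
move=> cf lf; have [l2 h2] := antidiff_diff_L2 p cf lf.
have ld i : L1 mu3 (fun x => partial i (antidiff p f) x ^+ 2).
  rewrite (partial_antidiff p i cf).
  exact: (antidiff_L2 p (Cn_cont (CnS_partial i cf)) (lf i)).1.
have L4 := L4_bound (antidiff_Cn p cf) l2 ld; split; first exact: L4.1.
apply: le_trans L4.2 _.
have := grad2_ge0 (antidiff p f).
have : 0 <= \int[mu3]_x (antidiff p f x ^+ 2) by apply: Rint_ge0 => x; exact: sqr_ge0.
move: h2 (antidiff_grad2 p cf lf) (grad2_ge0 f) (rho_ge1 p).
move: (\int[mu3]_x _) (grad2 _) (grad2 _) (rho p) => a b c d h1 h2 c0 d1 a0 b0.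
have h : a + b <= 16 * (d * c).
  have : c <= d * c by rewrite ler_peMl.
  lra.
rewrite (_ : 2048 * (d * c) ^+ 2 = 8 * (16 * (d * c)) ^+ 2); last by ring.
by rewrite ler_wpM2l// ler_pXn2r// nnegrE ?addr_ge0// !mulr_ge0// (le_trans _ d1).
Qed.

(* The derivative of [f (x - p) + f (x + p)] in [p] is the derivative of an
   antidifference in [x]; unlike a symmetric sum, an antidifference is in L2. *)
Lemma diff_symsum f p x (h : R) j : Cn 2 f ->
  f (x - p) + f (x + p) - (f (x - (p + h *: evec j)) + f (x + (p + h *: evec j))) =
  \int[m01]_t (h * partial j (antidiff (p + (h * clamp t) *: evec j) f) x).
Proof.
move=> cf.
have cp : continuous (partial j f) := Cn_cont (CnS_partial j (CnW cf)).
have lc (z : R3 R) (a : R) : L1 m01 (fun t => a * partial j f (z + (a * clamp t) *: evec j)).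
  apply: (L1_m01 (g := fun s => a * partial j f (z + (a * s) *: evec j))) => s.
  apply: cvgM; first exact: cvg_cst.
  exact: (@continuous_comp _ _ _ (fun s : R => z + (a * s) *: evec j) (partial j f) s
    (@continuous_ray _ z a j s) (cp _)).
have e1 := diff01 (x - p) (- h) j cf; have e2 := diff01 (x + p) h j cf.
transitivity (- (f (x - p + - h *: evec j) - f (x - p)) -
              (f (x + p + h *: evec j) - f (x + p))).
  have -> : x - (p + h *: evec j) = x - p + - h *: evec j by rewrite scaleNr opprD addrA.
  have -> : x + (p + h *: evec j) = x + p + h *: evec j by rewrite addrA.
  move: (f _) (f _) (f _) (f _) => a b c d; ring.
rewrite e1 e2; apply: etrans (_ : \int[m01]_t
   (- (- h * partial j f (x - p + (- h * clamp t) *: evec j)) -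
     h * partial j f (x + p + (h * clamp t) *: evec j)) = _).
  apply/esym; apply: etrans (RintB (L1N (lc (x - p) (- h))) (lc (x + p) h)) _.
  by apply: (f_equal2 +%R) => //; exact: RintN (lc (x - p) (- h)).
apply: Rint_eq => t; rewrite (partial_antidiff _ j cf) /antidiff.
rewrite mulNr opprK -mulrBr mulNr scaleNr; congr (_ * (partial j f _ - partial j f _)).
  by rewrite opprD addrA.
by rewrite addrA.
Qed.

End symmetric_differences.

Section symmetric_pairing.
Context {R : realType}.
Variables (r A : R) (Q u : 'I_3 -> R3 R -> R).
Hypothesis cu : forall i, Cn 2 (u i).
Hypothesis cQ : forall i, continuous (Q i).
Hypothesis vQ : forall i, vanish r (Q i).
Hypothesis hA : forall p j,
  `|\sum_(i < 3) \int[mu3]_x (Q i x * partial j (antidiff p (u i)) x)| <= A * rho p ^+ 2.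

Arguments cQ : clear implicits.
Arguments vQ : clear implicits.

Let symsum p i (x : R3 R) := u i (x - p) + u i (x + p).

(** While [x] stays where [Q] lives and the shift runs along the segment, all arguments stay in one
    cube, on which the derivative of [u] is bounded. *)
Lemma L1_path_pairing i p h j : L1 (prod_measure mu3 m01) (fun z : M3 R * measurableTypeR R =>
  Q i z.1 * (h * partial j (antidiff (p + (h * clamp z.2) *: evec j) (u i)) z.1)).
Proof.
have cp : continuous (partial j (u i)) := Cn_cont (CnS_partial j (CnW (cu i))).
have mp : measurable_fun setT (fun z : M3 R * measurableTypeR R =>
    p + (h * clamp z.2) *: evec j : M3 R).
  apply: measurable_add3; first exact: measurable_cst.
  apply: measurable_scale3; last exact: measurable_cst.
  apply: measurable_funM; first exact: measurable_cst.
  apply: measurableT_comp; last exact: measurable_snd.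
  by apply: continuous_measurable_fun => s; exact: clamp_cont.
have [C C0 hC] := box_bounded (r + (`|p| + `|h|)) cp.
have bd x t : `|x| <= r ->
    `|h * partial j (antidiff (p + (h * clamp t) *: evec j) (u i)) x| <= `|h| * (2 * C).
  move=> xr; rewrite normrM ler_wpM2l// (partial_antidiff _ j (cu i)) /antidiff.
  have pn : `|p + (h * clamp t) *: evec j| <= `|p| + `|h|.
    apply: le_trans (ler_normD _ _) _; rewrite lerD2l normrZ normrM -mulrA ler_piMr//.
    by rewrite mulr_ile1// ?norm_evec// ger0_norm ?clamp_ge0 ?clamp_le1.
  apply: le_trans (ler_normB _ _) _; rewrite mulr2n mulrDl mul1r.
  by apply: lerD; apply: hC; [apply: le_trans (ler_normB _ _) _|apply: le_trans (ler_normD _ _) _];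
    exact: lerD.
have F x t : `|Q i x * (h * partial j (antidiff (p + (h * clamp t) *: evec j) (u i)) x)| <=
    `|h| * (2 * C) * `|Q i x|.
  rewrite normrM mulrC; have [xr|xr] := leP `|x| r; first exact: ler_wpM2r (bd x t xr).
  by rewrite (vQ i x xr) normr0 !mulr0.
have mF : measurable_fun setT (fun z : M3 R * measurableTypeR R =>
    Q i z.1 * (h * partial j (antidiff (p + (h * clamp z.2) *: evec j) (u i)) z.1)).
  apply: measurable_funM; first exact: (measurable_comp3 measurable_fst (cQ i)).
  apply: measurable_funM; first exact: measurable_cst.
  rewrite (_ : (fun z => _) = fun z : M3 R * measurableTypeR R =>
    partial j (u i) ((z.1 : R3 R) - (p + (h * clamp z.2) *: evec j)) -
    partial j (u i) ((z.1 : R3 R) + (p + (h * clamp z.2) *: evec j))); last first.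
    by apply/funext => z; rewrite (partial_antidiff _ j (cu i)).
  apply: measurable_funB.
    exact: (measurable_comp3 (measurable_sub3 measurable_fst mp) cp).
  exact: (measurable_comp3 (measurable_add3 measurable_fst mp) cp).
have lQ := vanish_L1 (cQ i) (vQ i).
apply: (@L1_prod1 _ _ _ _ _ _ _ _ (fun x : M3 R => `|h| * (2 * C) * `|Q i x|)) => //.
- move=> x; apply: (L1_m01_bounded (c := `|h| * (2 * C) * `|Q i x|)); last exact: F.
  exact: (measurableT_comp mF (measurable_pair1 x)).
- exact: L1Z (L1_norm lQ).
- move=> x; have k0 : 0 <= `|h| * (2 * C) * `|Q i x| by rewrite !mulr_ge0.
  apply: le_trans (ler_norm _) _; apply: Rint_m01_norm_le.
    by apply: measurableT_comp => //; exact: (measurableT_comp mF (measurable_pair1 x)).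
  by move=> t; rewrite normr_id; exact: F.
Qed.

(** By [diff_symsum] the change of the symmetric sum along a segment is an integral of derivatives
    of antidifferences; the bound assumed for these is integrated along the segment. *)
Lemma symsum_step p (h B : R) j :
  (forall t, 0 <= t <= 1 -> rho (p + (h * t) *: evec j) <= B) ->
  `|\sum_(i < 3) \int[mu3]_x (Q i x * (symsum p i x - symsum (p + h *: evec j) i x))| <=
  `|h| * (A * B ^+ 2).
Proof.
move=> hB.
have A0 : 0 <= A.
  have := le_trans (normr_ge0 _) (hA 0 j0).
  by rewrite pmulr_lge0// rhoX_gt0.
have l i := L1_path_pairing i p h j.
have E i : \int[mu3]_x (Q i x * (symsum p i x - symsum (p + h *: evec j) i x)) =
    \int[m01]_t \int[mu3]_x
      (Q i x * (h * partial j (antidiff (p + (h * clamp t) *: evec j) (u i)) x)).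
  apply: etrans (Rfubini (l i)); apply: Rint_eq => x /=.
  rewrite (diff_symsum p x h j (cu i)) -RintZ//.
  pose g s := h * partial j (antidiff (p + (h * s) *: evec j) (u i)) x.
  apply: (L1_m01 (g := g)).
  have cp : continuous (partial j (u i)) := Cn_cont (CnS_partial j (CnW (cu i))).
  have -> : g = fun s : R => h * (partial j (u i) (x - (p + (h * s) *: evec j)) -
                 partial j (u i) (x + (p + (h * s) *: evec j))).
    by apply/funext => s; rewrite /g (partial_antidiff _ j (cu i)).
  have cr := @continuous_ray _ p h j.
  move=> s; apply: cvgM; first exact: cvg_cst.
  apply: cvgB.
    apply: (@continuous_comp _ _ _ (fun s : R => x - (p + (h * s) *: evec j)) (partial j (u i)) s).
      by apply: cvgB; [exact: cvg_cst|exact: cr].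
    exact: cp.
  apply: (@continuous_comp _ _ _ (fun s : R => x + (p + (h * s) *: evec j)) (partial j (u i)) s).
    by apply: cvgD; [exact: cvg_cst|exact: cr].
  exact: cp.
rewrite (eq_bigr _ (fun i _ => E i)).
have l2 i := (Rfubini2 (l i)).1.
rewrite -(Rint_sum _ (fun i _ => l2 i)).
have lS := L1_sum _ (fun i (_ : true) => l2 i).
apply: Rint_m01_norm_le; first exact: (L1_measurable (lS _)).
move=> t; set q := p + (h * clamp t) *: evec j.
have E2 i : \int[mu3]_x (Q i x * (h * partial j (antidiff q (u i)) x)) =
    h * \int[mu3]_x (Q i x * partial j (antidiff q (u i)) x).
  rewrite -RintZ; first by apply: Rint_eq => x; rewrite mulrCA.
  apply: (vanish_L1 (r := r)); last exact: vanish_mull (vQ i).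
  move=> x; apply: cvgM; first exact: (cQ i).
  exact: (Cn_cont (CnS_partial j (CnW (antidiff_Cn q (cu i))))).
rewrite (eq_bigr _ (fun i _ => E2 i)) -mulr_sumr normrM ler_wpM2l//.
apply: le_trans (hA q j) _; apply: ler_wpM2l => //.
have h1 := hB _ (introT andP (conj (clamp_ge0 t) (clamp_le1 t))).
by rewrite ler_pXn2r// nnegrE ?(ltW (rho_gt0 _))// (le_trans _ h1) ?(ltW (rho_gt0 _)).
Qed.

End symmetric_pairing.

Section second_difference.
Context {R : realType}.
Variables (r A : R) (Q u : 'I_3 -> R3 R -> R).
Hypothesis cu : forall i, Cn 2 (u i).
Hypothesis cQ : forall i, continuous (Q i).
Hypothesis vQ : forall i, vanish r (Q i).
Hypothesis hA : forall p j,
  `|\sum_(i < 3) \int[mu3]_x (Q i x * partial j (antidiff p (u i)) x)| <= A * rho p ^+ 2.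
Arguments cQ : clear implicits.
Arguments vQ : clear implicits.

Lemma rhoX_ge0 m (x : R3 R) : 0 <= rho x ^+ m.
Proof. by rewrite ltW// rhoX_gt0. Qed.

Lemma rho_mono (x y : R3 R) : x.1.1 ^+ 2 <= y.1.1 ^+ 2 -> x.1.2 ^+ 2 <= y.1.2 ^+ 2 ->
  x.2 ^+ 2 <= y.2 ^+ 2 -> rho x <= rho y.
Proof.
move=> h1 h2 h3; rewrite /rho.
by rewrite !ler_pM ?mulr_ge0 ?lerD2l// ltW ?one_sqr_gt0.
Qed.

Lemma normr_le_rho (a : R) (y : R3 R) : a ^+ 2 <= y.1.1 ^+ 2 + y.1.2 ^+ 2 + y.2 ^+ 2 ->
  `|a| <= rho y.
Proof.
move=> h; have h1 := le_trans h (sqr_coords_le_rho y); have h2 := rho_ge1 y.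
rewrite -(@ler_pXn2r _ 2)// ?nnegrE ?(ltW (rho_gt0 _))// real_normK ?num_real//.
by apply: le_trans h1 _; rewrite expr2 ler_peMr// ltW// rho_gt0.
Qed.

(** The shift runs from 0 to [y] along the three axes. On this path [rho] never exceeds [rho y], and
    each leg has length at most [rho y], which turns the square in the assumed bound into a cube. *)
Lemma second_diff_pairing y :
  `|\sum_(i < 3) \int[mu3]_x (Q i x * (u i x + u i x - (u i (x - y) + u i (x + y))))| <=
  3 * A * rho y ^+ 3.
Proof.
pose p0 : R3 R := 0; pose p1 : R3 R := p0 + y.1.1 *: evec j0.
pose p2 : R3 R := p1 + y.1.2 *: evec j1; pose p3 : R3 R := p2 + y.2 *: evec j2.
have yE : p3 = y by rewrite /p3 /p2 /p1 /p0 add0r; exact: esym (evec_sum y).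
pose D (p q : R3 R) := \sum_(i < 3) \int[mu3]_x (Q i x * ((u i (x - p) + u i (x + p)) -
   (u i (x - q) + u i (x + q)))).
have A0 : 0 <= A.
  have := le_trans (normr_ge0 _) (hA 0 j0).
  by rewrite pmulr_lge0// rhoX_gt0.
have cs (p : R3 R) i : continuous (fun x : R3 R => u i (x - p) + u i (x + p)).
  exact: (Cn_cont (CnD (Cn_shift (- p) (cu i)) (Cn_shift p (cu i)))).
have lD (p q : R3 R) i : L1 mu3 (fun x : R3 R => Q i x * ((u i (x - p) + u i (x + p)) -
   (u i (x - q) + u i (x + q)))).
  apply: (vanish_L1 (r := r)); last exact: vanish_mull (vQ i).
  move=> x; apply: cvgM; first exact: (cQ i).
  by apply: cvgB; [exact: (cs p i)|exact: (cs q i)].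
have tri p q s : D p s = D p q + D q s.
  rewrite /D -big_split; apply: eq_bigr => i _ /=.
  rewrite -(RintD (lD p q i) (lD q s i)); apply: Rint_eq => x.
  by rewrite -mulrDr addrA subrK.
have E : \sum_(i < 3) \int[mu3]_x (Q i x * (u i x + u i x - (u i (x - y) + u i (x + y)))) =
    D p0 p1 + D p1 p2 + D p2 p3.
  rewrite -!tri yE; apply: eq_bigr => i _; apply: Rint_eq => x.
  by rewrite subr0 addr0.
have B h : `|h| <= rho y -> `|h| * (A * rho y ^+ 2) <= A * rho y ^+ 3.
  by move=> hh; rewrite mulrCA (exprS _ 2); apply: ler_wpM2l => //; apply: ler_wpM2r => //; rewrite rhoX_ge0.
have sq (a t : R) : 0 <= t <= 1 -> (a * t) ^+ 2 <= a ^+ 2.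
  move=> /andP[t0 t1]; rewrite exprMn ler_piMr ?sqr_ge0//.
  by rewrite expr_le1.
have S := @sqr_ge0 R.
have B1 : `|D p0 p1| <= A * rho y ^+ 3.
  apply: (le_trans (@symsum_step _ r A Q u cu cQ vQ hA p0 y.1.1 (rho y) j0 _)); last apply: B; last first.
    by apply: normr_le_rho; rewrite -addrA lerDl addr_ge0.
  move=> t t01; have h := sq y.1.1 t t01.
  apply: rho_mono; rewrite /p0 /= /GRing.scale/= /evec/= ?(mulr0, mulr1, add0r, expr0n)//=; exact: S.
have B2 : `|D p1 p2| <= A * rho y ^+ 3.
  apply: (le_trans (@symsum_step _ r A Q u cu cQ vQ hA p1 y.1.2 (rho y) j1 _)); last apply: B; last first.
    by apply: normr_le_rho; rewrite addrAC lerDr addr_ge0.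
  move=> t t01; have h := sq y.1.2 t t01.
  apply: rho_mono; rewrite /p1 /p0 /= /GRing.scale/= /evec/= ?(mulr0, mulr1, add0r, addr0, expr0n)//=; exact: S.
have B3 : `|D p2 p3| <= A * rho y ^+ 3.
  apply: (le_trans (@symsum_step _ r A Q u cu cQ vQ hA p2 y.2 (rho y) j2 _)); last apply: B; last first.
    by apply: normr_le_rho; rewrite lerDr addr_ge0.
  move=> t t01; have h := sq y.2 t t01.
  apply: rho_mono; rewrite /p2 /p1 /p0 /= /GRing.scale/= /evec/= ?(mulr0, mulr1, add0r, addr0, expr0n)//=; exact: S.
rewrite E; apply: le_trans (ler_normD _ _) _; apply: le_trans (lerD (ler_normD _ _) (lexx _)) _.
by apply: le_trans (lerD (lerD B1 B2) B3) _; rewrite -!mulrA; move: (A * _) => a; lra.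
Qed.

Lemma L1_pairing i (F : R3 R -> R3 R -> R) (G : R3 R -> R) :
  measurable_fun setT (fun z : M3 R * M3 R => F z.1 z.2) ->
  (forall x, L1 mu3 (F x)) -> continuous G -> (forall x, \int[mu3]_y `|F x y| <= G x) ->
  L1 (prod_measure mu3 mu3) (fun z : M3 R * M3 R => Q i z.1 * F z.1 z.2).
Proof.
move=> mF lF cG hG.
have cqg : continuous (fun x => `|Q i x| * G x).
  move=> x; apply: cvgM; last exact: cG.
  by apply: cvg_norm; exact: (cQ i).
apply: (@L1_prod1 _ _ _ _ _ _ _ _ (fun x : M3 R => `|Q i x| * G x)).
- by apply: measurable_funM => //; exact: (measurable_comp3 measurable_fst (cQ i)).
- by move=> x; exact: (L1Z (Q i x) (lF x)).
- apply: (vanish_L1 (r := r) cqg) => x rx.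
  by rewrite (vQ i x rx) normr0 mul0r.
- move=> x; apply: le_trans (_ : `|Q i x| * \int[mu3]_y `|F x y| <= _).
    rewrite le_eqVlt; apply/orP; left; apply/eqP.
    rewrite -(RintZ _ (L1_norm (lF x))); apply: Rint_eq => y; exact: normrM.
  by apply: ler_wpM2l.
Qed.

(* As [K] is even of integral 1, [u - K * u] is the average of half the second
   differences [2 u - u (. - y) - u (. + y)] against [K y]. *)
Lemma mollified_pairing C K : kern 4 C K -> \int[mu3]_x K x = 1 -> (forall x, K (- x) = K x) ->
  (forall i, W 4 (u i)) ->
  `|\sum_(i < 3) \int[mu3]_x (Q i x * (u i x - conv K (u i) x))| <=
  2 * A * \int[mu3]_y (`|K y| * rho y ^+ 3).
Proof.
move=> hK K1 Ke wu.
have A0 : 0 <= A.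
  have := le_trans (normr_ge0 _) (hA 0 j0).
  by rewrite pmulr_lge0// rhoX_gt0.
have lK : L1 mu3 K := @kern_L1 _ 4 C K isT hK.
have nK := kern_norm hK; have nu i := W_norm (wu i).
pose F i (x y : R3 R) := K y * (u i x + u i x - (u i (x - y) + u i (x + y))).
have l1 i x : L1 mu3 (fun y => K y * u i x) := L1Zr (u i x) lK.
have l2 i x : L1 mu3 (fun y => K y * u i (x - y)) := conv_L1 x hK (wu i).
have l3 i x : L1 mu3 (fun y => K y * u i (x + y)).
  by apply: L1_eq (L1_reflect 0 (l2 i x)) => y /=; rewrite sub0r Ke opprK.
have FE i x y : F i x y = K y * u i x + K y * u i x - (K y * u i (x - y) + K y * u i (x + y)).
  by rewrite /F mulrBr !mulrDr.
have lF i x : L1 mu3 (F i x).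
  by apply: L1_eq (L1B (L1D (l1 i x) (l1 i x)) (L1D (l2 i x) (l3 i x))) => y; rewrite FE.
have c3 i x : \int[mu3]_y (K y * u i (x + y)) = conv K (u i) x.
  rewrite /conv -(Rint_reflect 0 (l2 i x)); apply: Rint_eq => y /=.
  by rewrite sub0r Ke opprK.
have IF i x : \int[mu3]_y F i x y = 2 * (u i x - conv K (u i) x).
  apply: etrans (_ : \int[mu3]_y (K y * u i x + K y * u i x -
    (K y * u i (x - y) + K y * u i (x + y))) = _); first by apply: Rint_eq => y; exact: FE.
  apply: etrans (RintB (L1D (l1 i x) (l1 i x)) (L1D (l2 i x) (l3 i x))) _.
  apply: etrans (f_equal2 (fun a b => a - b) (RintD (l1 i x) (l1 i x)) (RintD (l2 i x) (l3 i x))) _.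
  rewrite /= c3 (RintZr (u i x) lK) K1 mul1r -/(conv K (u i) x).
  by move: (u i x) (conv _ _ _) => a b; ring.
pose I := \int[mu3]_y `|K y|.
pose V i x := conv (fun y => `|K y|) (fun y => `|u i y|) x.
pose G i x := (`|u i x| * I + `|u i x| * I) + (V i x + V i x).
have cG i : continuous (G i).
  have c1 : continuous (fun x => `|u i x| * I).
    move=> x; apply: cvgM; last exact: cvg_cst.
    by apply: cvg_norm; exact: (Cn_cont (cu i)).
  have c2 : continuous (V i) := conv_cont nK (nu i).
  by move=> x; apply: cvgD; apply: cvgD; [exact: c1|exact: c1|exact: c2|exact: c2].
have hG i x : \int[mu3]_y `|F i x y| <= G i x.
  have m1 := L1_norm (l1 i x); have m2 := L1_norm (l2 i x); have m3 := L1_norm (l3 i x).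
  apply: le_trans (_ : \int[mu3]_y ((`|K y * u i x| + `|K y * u i x|) +
     (`|K y * u i (x - y)| + `|K y * u i (x + y)|)) <= _).
    apply: Rint_le (L1_norm (lF i x)) (L1D (L1D m1 m1) (L1D m2 m3)) _ => y.
    rewrite FE; apply: le_trans (ler_normB _ _) _.
    by apply: lerD; exact: ler_normD.
  rewrite le_eqVlt; apply/orP; left; apply/eqP.
  apply: etrans (RintD (L1D m1 m1) (L1D m2 m3)) _.
  apply: etrans (f_equal2 +%R (RintD m1 m1) (RintD m2 m3)) _.
  have e1 : \int[mu3]_y `|K y * u i x| = `|u i x| * I.
    by rewrite -(RintZ _ (L1_norm lK)); apply: Rint_eq => y; rewrite normrM mulrC.
  have e2 : \int[mu3]_y `|K y * u i (x - y)| = V i x.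
    by apply: Rint_eq => y; rewrite normrM.
  have e3 : \int[mu3]_y `|K y * u i (x + y)| = V i x.
    rewrite -e2 -(Rint_reflect 0 m2); apply: Rint_eq => y /=.
    by rewrite sub0r Ke opprK.
  by rewrite e1 e2 e3.
have mF i : measurable_fun setT (fun z : M3 R * M3 R => F i z.1 z.2).
  apply: measurable_funM; first exact: (measurable_comp3 measurable_snd hK.1).
  have m1 := measurable_comp3 (@measurable_fst _ _ (M3 R) (M3 R)) (Cn_cont (cu i)).
  have m2 := measurable_comp3 (@measurable_fst_sub_snd R) (Cn_cont (cu i)).
  have m3 := measurable_comp3 (measurable_add3 (@measurable_fst _ _ (M3 R) (M3 R))
    (@measurable_snd _ _ (M3 R) (M3 R))) (Cn_cont (cu i)).
  by apply: measurable_funB; apply: measurable_funD.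
have lP i := L1_pairing i (mF i) (lF i) (cG i) (hG i).
have E i : \int[mu3]_x (Q i x * (u i x - conv K (u i) x)) =
    2^-1 * \int[mu3]_y \int[mu3]_x (Q i x * F i x y).
  rewrite -(Rfubini (lP i)) -(RintZ _ (Rfubini1 (lP i)).1); apply: Rint_eq => x /=.
  rewrite (RintZ _ (lF i x)) IF mulrCA [2^-1 * _]mulrA mulVf ?mul1r//.
rewrite (eq_bigr _ (fun i _ => E i)) -mulr_sumr normrM ger0_norm// ler_pdivrMl//.
have l4 i := (Rfubini2 (lP i)).1.
rewrite -(Rint_sum _ (fun i _ => l4 i)).
(* The decay of order 4 assumed of [K] leaves [1 / rho] here, which is integrable. *)
have lk3 : L1 mu3 (fun y : R3 R => `|K y| * rho y ^+ 3).
  apply: L1_dom (L1Z C L1_rhoV) _.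
    apply: continuous_m => y; apply: cvgM; last exact: rhoX_cont.
    by apply: cvg_norm; exact: hK.1.
  move=> y; rewrite ger0_norm; last by apply: mulr_ge0; [exact: normr_ge0|exact: rhoX_ge0].
  apply: le_trans (ler_wpM2r (rhoX_ge0 3 y) (hK.2 y)) _.
  have := rho_gt0 y; move: (rho y) => a a0; rewrite le_eqVlt; apply/orP; left; apply/eqP.
  by field; rewrite gt_eqF.
apply: le_trans (_ : \int[mu3]_y (3 * A * (`|K y| * rho y ^+ 3)) <= _); last first.
  rewrite (RintZ _ lk3).
  have : 0 <= \int[mu3]_y (`|K y| * rho y ^+ 3).
    by apply: Rint_ge0 => y; apply: mulr_ge0; [exact: normr_ge0|exact: rhoX_ge0].
  by move: (\int[mu3]_y _) => a a0; have := mulr_ge0 A0 a0; lra.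
have l5 := L1_sum _ (fun i (_ : true) => l4 i).
apply: Rint_dom; first exact: (L1_measurable (l5 _)).
  exact: L1Z.
move=> y.
have E2 i : \int[mu3]_x (Q i x * F i x y) =
    K y * \int[mu3]_x (Q i x * (u i x + u i x - (u i (x - y) + u i (x + y)))).
  rewrite -RintZ; first by apply: Rint_eq => x; rewrite mulrCA.
  apply: (vanish_L1 (r := r)); last exact: vanish_mull (vQ i).
  move=> x; apply: cvgM; first exact: (cQ i).
  exact: (Cn_cont (CnB (CnD (cu i) (cu i)) (CnD (Cn_shift (- y) (cu i)) (Cn_shift y (cu i))))).
rewrite (eq_bigr _ (fun i _ => E2 i)) -mulr_sumr normrM.
apply: le_trans (ler_wpM2l (normr_ge0 _) (second_diff_pairing y)) _.
by rewrite mulrCA.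
Qed.

End second_difference.

Section energy_constants.
Context {R : realType}.

(** Bounds of different degrees in [g] and [a] are put under one majorant, quadratic in [a]; [k]
    stands for the constant of [antidiff_L4]. *)
Lemma energy_const_le (k a g E : R) : 12 <= k -> 1 <= a -> 0 <= g -> g <= E ->
  [/\ g <= k * (E + 1) ^+ 2 * a ^+ 2, 12 * a * g <= k * (E + 1) ^+ 2 * a ^+ 2,
      4 * g <= k * (E + 1) ^+ 2 * a ^+ 2 &
      k * (a * g) ^+ 2 <= k * (E + 1) ^+ 2 * a ^+ 2].
Proof.
move=> k12 a1 g0 gE.
have h1 : g <= (E + 1) ^+ 2 by nra.
have h2 : g ^+ 2 <= (E + 1) ^+ 2 by nra.
have a0 : 0 <= a by lra.
have h3 : a <= a ^+ 2 by nra.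
have h4 : a * g <= (E + 1) ^+ 2 * a ^+ 2 by rewrite mulrC; apply: ler_pM.
have h5 : g <= (E + 1) ^+ 2 * a ^+ 2 by apply: le_trans h4; rewrite ler_peMl.
have h6 : (a * g) ^+ 2 <= (E + 1) ^+ 2 * a ^+ 2.
  by rewrite exprMn mulrC; apply: ler_wpM2r => //; exact: sqr_ge0.
have h0 := le_trans g0 h5.
move: h4 h5 h6 h0; rewrite -!(mulrA k) -!(mulrA 12).
move: ((E + 1) ^+ 2 * a ^+ 2) ((a * g) ^+ 2) (a * g) => z q p h4 h5 h6 h0.
have hk : 12 * z <= k * z by exact: ler_wpM2r.
split; [lra|lra|lra|]; apply: ler_wpM2l => //; lra.
Qed.

End energy_constants.

(** * The high frequency part and its pairing with the equation *)

Section mollified_energy.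
Context {R : realType}.
Variables (u : 'I_3 -> R3 R -> R) (P : R3 R -> R) (C M : R) (K : R3 R -> R).
Hypothesis cu : forall n i, Cn n (u i).
Hypothesis cP : forall n, Cn n P.
Hypothesis NS : forall i x, NSop u i x = - partial i P x.
Hypothesis du : divfree u.
Hypothesis gu : forall i l, L1 mu3 (fun x => partial l (u i) x ^+ 2).
Hypothesis hK : kern 4 C K.
Hypothesis K1 : \int[mu3]_x K x = 1.
Hypothesis Ke : forall x, K (- x) = K x.
Hypothesis vM : forall i x, `|conv K (u i) x| <= M.

Definition rem i x := u i x - conv K (u i) x.

Lemma D12_of i : D12 (u i). Proof. by split; [exact: (cu 1 i)|exact: gu]. Qed.

Lemma W_of i : W 4 (u i).
Proof.
apply: (@W_le _ 2) => //; apply: W_of_sqr => //; first exact: (Cn_cont (cu 0 i)).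
exact: D12_W (D12_of i).
Qed.

Lemma W_partial_of i l : W 4 (partial l (u i)).
Proof. by apply: W_L2 => //; exact: (Cn_cont (CnS_partial l (cu 1 i))). Qed.

Lemma conv_Cn1_of i : Cn 1 (conv K (u i)).
Proof. exact: (conv_Cn1 hK (cu 1 i) (W_of i) (W_partial_of i)).1. Qed.

Lemma partial_conv_of i l : partial l (conv K (u i)) = conv K (partial l (u i)).
Proof. exact: (conv_Cn1 hK (cu 1 i) (W_of i) (W_partial_of i)).2. Qed.

Lemma rem_Cn1 i : Cn 1 (rem i).
Proof. exact: (CnB (cu 1 i) (conv_Cn1_of i)). Qed.

Lemma partial_rem i l x : partial l (rem i) x = partial l (u i) x - partial l (conv K (u i)) x.
Proof. by rewrite /rem (partialB l (cu 1 i) (conv_Cn1_of i)). Qed.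

Lemma conv_grad_L2 i l : L1 mu3 (fun x => partial l (conv K (u i)) x ^+ 2).
Proof.
rewrite (partial_conv_of i l).
exact: (conv_L2 (m := 4) isT hK (Cn_cont (CnS_partial l (cu 1 i))) (gu i l)).1.
Qed.

Lemma L1_second_moment : L1 mu3 (fun y : R3 R => `|K y| * (y.1.1 ^+ 2 + y.1.2 ^+ 2 + y.2 ^+ 2)).
Proof.
have c2 : continuous (fun y : R3 R => y.1.1 ^+ 2 + y.1.2 ^+ 2 + y.2 ^+ 2).
  have c1 : continuous (fun x : R3 R => x.1.1).
    by move=> x; apply: (@continuous_comp _ _ _ fst fst); apply: cvg_fst.
  have c2 : continuous (fun x : R3 R => x.1.2).
    by move=> x; apply: (@continuous_comp _ _ _ fst snd); [apply: cvg_fst|apply: cvg_snd].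
  have c3 : continuous (fun x : R3 R => x.2) by move=> x; apply: cvg_snd.
  move=> y; apply: cvgD; last exact: (continuous_sqr c3).
  by apply: cvgD; [exact: (continuous_sqr c1)|exact: (continuous_sqr c2)].
apply: L1_dom (L1Z C (L1_rhoXV (m := 3) isT)) _.
  apply: continuous_m => y; apply: cvgM; last exact: c2.
  by apply: cvg_norm; exact: hK.1.
move=> y; rewrite ger0_norm; last by rewrite mulr_ge0// !addr_ge0 ?sqr_ge0.
apply: le_trans (ler_pM _ _ (hK.2 y) (sqr_coords_le_rho y)) _ => //.
  by rewrite !addr_ge0 ?sqr_ge0.
have := rho_gt0 y; move: (rho y) => a a0; rewrite le_eqVlt; apply/orP; left; apply/eqP.
by field; rewrite gt_eqF.
Qed.

Lemma rem_L2 i : L1 mu3 (fun x => rem i x ^+ 2).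
Proof. exact: (conv_diff_L2 (m := 4) isT hK K1 L1_second_moment (D12_of i)).1. Qed.

Lemma rem_grad_L2 i l : L1 mu3 (fun x => partial l (rem i) x ^+ 2).
Proof.
apply: L1_dom (L1Z 2 (L1D (gu i l) (conv_grad_L2 i l))) _.
  apply: continuous_m; apply: continuous_sqr.
  exact: (Cn_cont (CnS_partial l (rem_Cn1 i))).
move=> x; rewrite partial_rem ger0_norm ?sqr_ge0//.
by move: (partial _ _ _) (partial _ _ _) => a b; have := sqr_ge0 (a + b); nra.
Qed.

Lemma rem_L4 i : L1 mu3 (fun x => rem i x ^+ 4).
Proof. exact: (L4_bound (rem_Cn1 i) (rem_L2 i) (rem_grad_L2 i)).1. Qed.

(** Second derivatives of the cutoff are included because the weak form differentiates [cutterm],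
    which already contains first ones. *)
Definition cutoff_class r e (chi : R3 R -> R) : Prop :=
  [/\ Cn 2 chi, vanish r chi, (forall l x, `|partial l chi x| <= e) &
      forall l m x, `|partial l (partial m chi) x| <= e].

(** [A] depends on [u], [K] and [M] but not on the cutoff, so the pairing vanishes with [e]. The
    bound for antidifferences comes from [test_cutoff], and [mollified_pairing] averages it over the
    kernel. *)
Lemma pairing_rem_bound : exists2 A, 0 <= A & forall r e chi, cutoff_class r e chi ->
  `|\sum_(i < 3) \int[mu3]_x (NSop u i x * chi x * rem i x)| <= A * e.
Proof.
pose E := \sum_(i < 3) grad2 (u i).
have E0 : 0 <= E by apply: sumr_ge0 => i _; exact: grad2_ge0.
have gE i : grad2 (u i) <= E.
  by rewrite /E (bigD1 i)//= lerDl sumr_ge0// => l _; exact: grad2_ge0.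
have gl i l : \int[mu3]_x (partial l (u i) x ^+ 2) <= E.
  apply: le_trans (gE i); rewrite /grad2 (bigD1 l)//= lerDl sumr_ge0// => m _.
  by apply: Rint_ge0 => x; exact: sqr_ge0.
pose E4 := \sum_(i < 3) \int[mu3]_x (rem i x ^+ 4).
have w40 i : 0 <= \int[mu3]_x (rem i x ^+ 4).
  by apply: Rint_ge0 => x; rewrite exprn_even_ge0.
have E40 : 0 <= E4 by exact: sumr_ge0.
have w4 i : \int[mu3]_x (rem i x ^+ 4) <= E4 by rewrite /E4 (bigD1 i)//= lerDl sumr_ge0.
have [k [k12 kE]] : exists k : R, 12 <= k /\ k = 2048 by exists 2048; split; [rewrite ler_nat|].
have k0 : 0 <= k := le_trans (ler0n _ 12) k12.
pose S0 := k * (E + 1) ^+ 2 + E4.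
have S00 : 0 <= S0 := addr_ge0 (mulr_ge0 k0 (sqr_ge0 _)) E40.
have M0 : 0 <= M := le_trans (normr_ge0 _) (vM j0 0).
pose I := \int[mu3]_y (`|K y| * rho y ^+ 3).
have I0 : 0 <= I by apply: Rint_ge0 => y; apply: mulr_ge0; [exact: normr_ge0|exact: rhoX_ge0].
exists (2 * (378 * (1 + M) * S0) * I).
  apply: mulr_ge0 I0; apply: mulr_ge0; first exact: ler0n.
  by apply: mulr_ge0 S00; apply: mulr_ge0; [exact: ler0n|apply: addr_ge0].
move=> r e chi [cc vc ce cce].
have e0 : 0 <= e := le_trans (normr_ge0 _) (ce j0 0).
have cQ i : continuous (fun x => NSop u i x * chi x).
  move=> x; apply: cvgM; first exact: (NSop_cont cP NS).
  exact: (Cn_cont cc).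
have vQ i : vanish r (fun x => NSop u i x * chi x) := vanish_mulr _ vc.
have cb p i : Cn 2 (antidiff p (u i)) := antidiff_Cn p (cu 2 i).
have db p : divfree (fun i => antidiff p (u i)).
  move=> x; transitivity (\sum_(l < 3) (partial l (u l) (x - p) - partial l (u l) (x + p))).
    by apply: eq_bigr => l _; rewrite (partial_antidiff p l (cu 1 l)).
  by rewrite sumrB !du subrr.
(* The power [rho p ^ 2] is dictated by the L4 norms of the antidifferences; the other quantities
   grow at most linearly in [rho p]. *)
have hA p j : `|\sum_(i < 3) \int[mu3]_x (NSop u i x * chi x * partial j (antidiff p (u i)) x)| <=
    378 * e * (1 + M) * S0 * rho p ^+ 2.
  have T := test_cutoff cP NS j cc vc (cb p) (db p).
  have -> : \sum_(i < 3) \int[mu3]_x (NSop u i x * chi x * partial j (antidiff p (u i)) x) =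
     \sum_(i < 3) \int[mu3]_x (NSop u i x * (chi x * partial j (antidiff p (u i)) x)).
    by apply: eq_bigr => i _; apply: Rint_eq => x; rewrite mulrA.
  rewrite T normrN -mulrA.
  have rp := rho_ge1 p.
  have r2 : 1 <= rho p ^+ 2 by exact: rhoX_ge1.
  have big a : a <= k * (E + 1) ^+ 2 * rho p ^+ 2 -> a <= S0 * rho p ^+ 2.
    move=> h; apply: le_trans h _; apply: ler_wpM2r; first exact: rhoX_ge0.
    by rewrite lerDl.
  have n i := energy_const_le k12 rp (grad2_ge0 (u i)) (gE i).
  apply: (@cutterm_test_bound _ u cu r j chi (fun i => antidiff p (u i))
    (fun i => conv K (u i)) rem e M (S0 * rho p ^+ 2) cc vc (cb p) ce cce _ vM).
  - by move=> i x; rewrite /rem addrC subrK.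
  - move=> i l; split; first exact: gu.
    apply: big; apply: le_trans (gl i l) _.
    by have [h _ _ _] := energy_const_le k12 rp E0 (lexx E).
  - move=> i; have [h1 h2] := antidiff_diff_L2 p (cu 1 i) (gu i); split; first exact: h1.
    by apply: big; apply: le_trans h2 _; have [_ h _ _] := n i.
  - move=> i l; rewrite (partial_antidiff p l (cu 1 i)).
    have [h1 h2] := antidiff_L2 p (Cn_cont (CnS_partial l (cu 1 i))) (gu i l).
    split; first exact: h1.
    apply: big; apply: le_trans h2 _; apply: le_trans (ler_wpM2l _ (gl i l)) _ => //.
    by have [_ _ h _] := energy_const_le k12 rp E0 (lexx E).
  - move=> i; split; first exact: rem_L4.
    apply: le_trans (w4 i) _; apply: (@le_trans _ _ S0); last by rewrite ler_peMr.
    by rewrite /S0 lerDr; exact: mulr_ge0 k0 (sqr_ge0 _).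
  - move=> i; have [h1 h2] := antidiff_L4 p (cu 1 i) (gu i); split; first exact: h1.
    by apply: big; rewrite -kE in h2; apply: le_trans h2 _; have [_ _ _ h] := n i.
apply: le_trans (mollified_pairing (cu 2) cQ vQ hA hK K1 Ke W_of) _.
rewrite -/I le_eqVlt; apply/orP; left; apply/eqP.
by clearbody I S0; clear; ring.
Qed.

End mollified_energy.

Section flux_numeric.
Context {R : realType}.

Lemma flux_numeric (M p q y z : R) : 0 <= M -> 0 <= y -> 0 <= z ->
  p <= (M + y) * (z * z) -> q <= y * (z * M) ->
  2^-1 * p + q <= (M + 1) * (z ^+ 2 + y ^+ 2) + (z ^+ 2) ^+ 2.
Proof.
move=> M0 y0 z0 h1 h2.
have h3 : y * z ^+ 2 <= y ^+ 2 + (z ^+ 2) ^+ 2.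
  by move: (z ^+ 2) => t; have := sqr_ge0 (y - t); have := sqr_ge0 y; have := sqr_ge0 t; nra.
have h4 : M * (2 * (y * z)) <= M * (z ^+ 2 + y ^+ 2).
  by apply: ler_wpM2l => //; have := sqr_ge0 (y - z); nra.
have z2 := sqr_ge0 z; have y2 := sqr_ge0 y; have z4 := sqr_ge0 (z ^+ 2).
have Mz := mulr_ge0 M0 z2; have My := mulr_ge0 M0 y2.
lra.
Qed.

End flux_numeric.

Section energy_inequality.
Context {R : realType}.
Variables (u : 'I_3 -> R3 R -> R) (P : R3 R -> R) (C M : R) (K : R3 R -> R).
Hypothesis cu : forall n i, Cn n (u i).
Hypothesis cP : forall n, Cn n P.
Hypothesis NS : forall i x, NSop u i x = - partial i P x.
Hypothesis du : divfree u.
Hypothesis gu : forall i l, L1 mu3 (fun x => partial l (u i) x ^+ 2).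
Hypothesis hK : kern 4 C K.
Hypothesis K1 : \int[mu3]_x K x = 1.
Hypothesis Ke : forall x, K (- x) = K x.
Hypothesis vM : forall i x, `|conv K (u i) x| <= M.

Let v i := conv K (u i).
Let w := rem u K.
Let cv i : Cn 1 (v i) := conv_Cn1_of cu gu hK i.
Let cw i : Cn 1 (w i) := rem_Cn1 cu gu hK i.
Let M0 : 0 <= M := le_trans (normr_ge0 _) (vM j0 0).

Lemma Rint_add5 (f f1 f2 f3 f4 f5 : R3 R -> R) :
  L1 mu3 f1 -> L1 mu3 f2 -> L1 mu3 f3 -> L1 mu3 f4 -> L1 mu3 f5 ->
  (forall x, f x = f1 x + f2 x + f3 x + f4 x + f5 x) ->
  \int[mu3]_x f x = \int[mu3]_x f1 x + \int[mu3]_x f2 x + \int[mu3]_x f3 x +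
    \int[mu3]_x f4 x + \int[mu3]_x f5 x.
Proof.
move=> l1 l2 l3 l4 l5 E.
have l12 := L1D l1 l2; have l123 := L1D l12 l3; have l1234 := L1D l123 l4.
by rewrite -(RintD l1 l2) -(RintD l12 l3) -(RintD l123 l4) -(RintD l1234 l5); exact: Rint_eq.
Qed.

(* With [v = K * u], [w = u - v] and [div u = div w = 0], the convective term
   [((u . grad) u) . w] is the sum over [l, i] of [d_l (flux l i)] and of products
   involving [v]: no term is cubic in [w]. *)
Definition flux l i x := 2^-1 * (u l x * (w i x * w i x)) + w l x * (w i x * v i x).

Lemma flux_Cn1 l i : Cn 1 (flux l i).
Proof.
apply: (CnD (CnZ 2^-1 (CnM (cu 1 l) (CnM (cw i) (cw i)))) (CnM (cw l) (CnM (cw i) (cv i)))).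
Qed.

Lemma partial_flux l i x : partial l (flux l i) x =
  2^-1 * partial l (u l) x * w i x ^+ 2 + u l x * w i x * partial l (w i) x +
  partial l (w l) x * w i x * v i x +
  w l x * (partial l (w i) x * v i x + w i x * partial l (v i) x).
Proof.
rewrite /flux (partialD l (CnZ 2^-1 (CnM (cu 1 l) (CnM (cw i) (cw i)))) (CnM (cw l) (CnM (cw i) (cv i)))).
rewrite (partialZ 2^-1 l (CnM (cu 1 l) (CnM (cw i) (cw i)))) (partialM l (cu 1 l) (CnM (cw i) (cw i))).
rewrite (partialM l (cw i) (cw i)) (partialM l (cw l) (CnM (cw i) (cv i))) (partialM l (cw i) (cv i)).
move: (partial l (u l) x) (u l x) (w i x) (partial l (w i) x) (w l x) (partial l (w l) x)
  (partial l (v i) x) (v i x) => a b c d e f g h; by field.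
Qed.

(** The part cubic in [w] is at most [w l ^ 2 + w i ^ 4], integrable by the L2 and L4 bounds; the
    rest is quadratic in [w] with a factor bounded by [M]. *)
Lemma flux_L1 l i : L1 mu3 (flux l i).
Proof.
have w2 j : L1 mu3 (fun x => w j x ^+ 2) := rem_L2 cu gu hK K1 j.
have w4 j : L1 mu3 (fun x => w j x ^+ 4) := rem_L4 cu gu hK K1 j.
apply: L1_dom (L1D (L1Z (M + 1) (L1D (w2 i) (w2 l))) (w4 i)) _.
  exact: continuous_m (Cn_cont (flux_Cn1 l i)).
move=> x; rewrite /flux.
have -> : u l x = v l x + w l x by rewrite /w /rem addrC subrK.
have := vM l x; have := vM i x; rewrite -/(v l x) -/(v i x).
have -> : w i x ^+ 4 = (w i x ^+ 2) ^+ 2 by rewrite -exprM.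
move: (v l x) (v i x) (w l x) (w i x) => a b c d hb ha.
apply: le_trans (ler_normD _ _) _; rewrite !normrM ger0_norm//.
have hac : `|a + c| <= M + `|c| by apply: le_trans (ler_normD _ _) _; rewrite lerD2r.
have e1 : `|a + c| * (`|d| * `|d|) <= (M + `|c|) * (`|d| * `|d|) by rewrite ler_wpM2r.
have e2 : `|c| * (`|d| * `|b|) <= `|c| * (`|d| * M) by rewrite !ler_wpM2l.
rewrite -(real_normK (num_real d)) -(real_normK (num_real c)).
move: e1 e2 (normr_ge0 c) (normr_ge0 d) M0.
move: (`|a + c| * (`|d| * `|d|)) (`|c| * (`|d| * `|b|)) `|c| `|d| => p q y z h1 h2 y0 z0 M0'.
exact: flux_numeric.
Qed.

(* Bounded by a multiple of [M], the bound on [v], up to the first product. *)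
Definition resid l i x := partial l (u i) x * partial l (v i) x -
  (v l x * partial l (v i) x * w i x - w l x * partial l (w i) x * v i x).

Definition resid_bound l i x := `|partial l (u i) x| * `|partial l (v i) x| +
  M * (`|w i x| * `|partial l (v i) x| +
       `|w l x| * (`|partial l (u i) x| + `|partial l (v i) x|)).

Lemma resid_le l i x : `|resid l i x| <= resid_bound l i x.
Proof.
rewrite /resid /resid_bound (partial_rem cu gu hK i l x) -/(v i).
have := vM l x; have := vM i x; rewrite -/(v l x) -/(v i x).
move: (v l x) (v i x) (w l x) (w i x) (partial l (u i) x) (partial l (v i) x) => a b c d p q hb ha.
apply: le_trans (ler_normB _ _) _; rewrite normrM lerD2l.
apply: le_trans (ler_normB _ _) _; rewrite [M * (_ + _)]mulrDr !normrM; apply: lerD.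
  by rewrite mulrAC -mulrA ler_wpM2r.
rewrite mulrC; apply: ler_pM => //.
by apply: ler_wpM2l => //; exact: ler_normB.
Qed.

Lemma resid_bound_cont l i : continuous (resid_bound l i).
Proof.
have n (f : R3 R -> R) : Cn 0 f -> continuous (fun x => `|f x|).
  by move=> [cf _] x; apply: cvg_norm; exact: cf.
have a1 := n _ (CnS_partial l (cu 1 i)); have a2 := n _ (CnS_partial l (cv i)).
have a3 := n _ (CnW (cw i)); have a4 := n _ (CnW (cw l)).
move=> x; apply: cvgD; first by apply: cvgM; [exact: a1|exact: a2].
apply: cvgM; first exact: cvg_cst.
apply: cvgD; first by apply: cvgM; [exact: a3|exact: a2].
by apply: cvgM; [exact: a4|apply: cvgD; [exact: a1|exact: a2]].
Qed.

Lemma resid_bound_ge0 l i x : 0 <= resid_bound l i x.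
Proof. exact: le_trans (normr_ge0 _) (resid_le l i x). Qed.

Lemma resid_bound_L1 l i : L1 mu3 (resid_bound l i).
Proof.
have w2 j : L1 mu3 (fun x => w j x ^+ 2) := rem_L2 cu gu hK K1 j.
have v2 : L1 mu3 (fun x => partial l (v i) x ^+ 2) := conv_grad_L2 cu gu hK i l.
have u2 := gu i l.
apply: L1_dom (L1D (L1D u2 v2) (L1Z M (L1D (L1D (w2 i) v2) (L1D (L1Z 2 (w2 l)) (L1D u2 v2))))) _.
  exact: continuous_m (@resid_bound_cont l i).
move=> x; rewrite ger0_norm ?resid_bound_ge0// /resid_bound.
have h (a b : R) : `|a| * `|b| <= a ^+ 2 + b ^+ 2.
  rewrite -(real_normK (num_real a)) -(real_normK (num_real b)).
  by move: `|a| `|b| => y z; have := sqr_ge0 (y - z); have := sqr_ge0 y; have := sqr_ge0 z; nra.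
apply: lerD; first exact: h.
apply: ler_wpM2l => //; apply: lerD; first exact: h.
rewrite mulrDr.
have h1 := h (w l x) (partial l (u i) x); have h2 := h (w l x) (partial l (v i) x).
by move: h1 h2; move: (`|_| * _) (`|_| * _) (_ ^+ 2) (_ ^+ 2) (_ ^+ 2) => *; lra.
Qed.

(** Expand [partial l (chi w)] in the tested equation and insert the identity behind [flux]. The
    last integral carries div u and div w one index at a time: it vanishes only after summation over
    [l], so it is kept here. *)
Lemma energy_cell r e chi l i : cutoff_class r e chi ->
  \int[mu3]_x (chi x * partial l (u i) x ^+ 2) =
  (\int[mu3]_x (partial l (u i) x * partial l (fun x => chi x * w i x) x) +
   \int[mu3]_x (u l x * partial l (u i) x * (chi x * w i x))) +
  (- \int[mu3]_x (partial l (u i) x * (partial l chi x * w i x))) +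
  \int[mu3]_x (flux l i x * partial l chi x) +
  \int[mu3]_x (chi x * resid l i x) +
  \int[mu3]_x (chi x * (partial l (u l) x * (2^-1 * w i x ^+ 2) + partial l (w l) x * (w i x * v i x))).
Proof.
move=> [cc vc _ _].
have cw0 j := Cn_cont (cw j); have cv0 j := Cn_cont (cv j); have cu0 j := Cn_cont (cu 0 j).
have cpu j := Cn_cont (CnS_partial l (cu 1 j)); have cpv j := Cn_cont (CnS_partial l (cv j)).
have cpw j := Cn_cont (CnS_partial l (cw j)).
have cchi : Cn 1 (fun x => chi x * w i x) := CnM (CnW cc) (cw i).
have vchi : vanish r (fun x => chi x * w i x) := vanish_mull _ vc.
have l0 : L1 mu3 (fun x => partial l (u i) x * partial l (fun x => chi x * w i x) x).
  apply: (L1_vanish_mul (r := r)); [exact: cpu|exact: (Cn_cont (CnS_partial l cchi))|].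
  exact: vanish_partial.
have l0' : L1 mu3 (fun x => u l x * partial l (u i) x * (chi x * w i x)).
  apply: (L1_vanish_mul (r := r)); [|exact: (Cn_cont cchi)|exact: vchi].
  exact: (Cn_cont (CnM (cu 0 l) (CnS_partial l (cu 1 i)))).
have l1 : L1 mu3 (fun x => partial l (u i) x * (partial l chi x * w i x)).
  apply: (L1_vanish_mul (r := r)); [exact: cpu| |].
    exact: (Cn_cont (CnM (CnS_partial l cc) (cw i))).
  by apply: vanish_mull; exact: vanish_partial.
have l2 : L1 mu3 (fun x => chi x * partial l (flux l i) x).
  apply: L1_eq (L1_vanish_mul (r := r) (Cn_cont (CnS_partial l (flux_Cn1 l i))) (Cn_cont cc) vc) => x.
  exact: mulrC.
have l3 : L1 mu3 (fun x => chi x * resid l i x).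
  have cr : Cn 0 (resid l i).
    apply: (CnB (CnM (CnS_partial l (cu 1 i)) (CnS_partial l (cv i))) (CnB (CnM (CnM (CnW (cv l))
      (CnS_partial l (cv i))) (CnW (cw i))) (CnM (CnM (CnW (cw l)) (CnS_partial l (cw i))) (CnW (cv i))))).
  by apply: L1_eq (L1_vanish_mul (r := r) (Cn_cont cr) (Cn_cont cc) vc) => x; exact: mulrC.
have l4 : L1 mu3 (fun x => chi x * (partial l (u l) x * (2^-1 * w i x ^+ 2) + partial l (w l) x * (w i x * v i x))).
  have cr : continuous (fun x => partial l (u l) x * (2^-1 * w i x ^+ 2) + partial l (w l) x * (w i x * v i x)).
    move=> x; apply: cvgD; apply: cvgM.
    + exact: cpu.
    + by apply: cvgM; [exact: cvg_cst|exact: (continuous_sqr (cw0 i))].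
    + exact: cpw.
    + by apply: cvgM; [exact: cw0|exact: cv0].
  by apply: L1_eq (L1_vanish_mul (r := r) cr (Cn_cont cc) vc) => x; exact: mulrC.
have IF : \int[mu3]_x (flux l i x * partial l chi x) = \int[mu3]_x (- (chi x * partial l (flux l i) x)).
  rewrite (RintN l2) (Rint_parts_vanish l (flux_Cn1 l i) (CnW cc) vc); congr (- _).
  by apply: Rint_eq => x; exact: mulrC.
rewrite IF -(RintD l0 l0') -(RintN l1).
apply: (Rint_add5 (L1D l0 l0') (L1N l1) (L1N l2) l3 l4) => x.
rewrite partial_flux (partialM l (CnW cc) (cw i)) /resid (partial_rem cu gu hK i l x) -/(v i).
have -> : u l x = v l x + w l x by rewrite /w /rem addrC subrK.
move: (chi x) (partial l (u i) x) (partial l chi x) (w i x) (v l x) (w l x) (partial l (v i) x)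
  (v i x) (partial l (u l) x) (partial l (w l) x) => a b c d f g h k m n.
by field.
Qed.

Lemma divfree_rem x : \sum_(l < 3) partial l (w l) x = 0.
Proof.
rewrite (eq_bigr _ (fun l _ => partial_rem cu gu hK l l x)) sumrB du sub0r.
rewrite (eq_bigr (fun l => conv K (partial l (u l)) x)); last first.
  by move=> l _; rewrite (partial_conv_of cu gu hK l l).
rewrite -(Rint_sum _ (fun l _ => conv_L1 x hK (W_partial_of cu gu l l))).
have -> : \int[mu3]_y (\sum_(l < 3) K y * partial l (u l) (x - (y : R3 R))) = \int[mu3]_y (0 : R).
  apply: Rint_eq => y; by rewrite -mulr_sumr du mulr0.
by rewrite Rint0 oppr0.
Qed.

(** Terms with a derivative of [chi] cost [e] times a constant that does not see the cutoff, and so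
    does the tested equation by [pairing_rem_bound]. Only the residual is left with [chi] itself,
    whence the factor [B]. *)
Lemma energy_ineq B : exists2 A, 0 <= A & forall r e chi, cutoff_class r e chi ->
  (forall x, 0 <= chi x <= B) ->
  \sum_(i < 3) \sum_(l < 3) \int[mu3]_x (chi x * partial l (u i) x ^+ 2) <=
  A * e + B * \sum_(i < 3) \sum_(l < 3) \int[mu3]_x resid_bound l i x.
Proof.
have [A A0 hA] := pairing_rem_bound cu cP NS du gu hK K1 Ke vM.
have w2 j : L1 mu3 (fun x => w j x ^+ 2) := rem_L2 cu gu hK K1 j.
pose I1 l i := \int[mu3]_x (partial l (u i) x ^+ 2 + w i x ^+ 2).
pose I2 l i := \int[mu3]_x `|flux l i x|.
have I10 l i : 0 <= I1 l i by apply: Rint_ge0 => x; apply: addr_ge0; exact: sqr_ge0.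
have I20 l i : 0 <= I2 l i by apply: Rint_ge0 => x; exact: normr_ge0.
exists (A + \sum_(i < 3) \sum_(l < 3) (I1 l i + I2 l i)).
  apply: addr_ge0 A0 _; apply: sumr_ge0 => i _; apply: sumr_ge0 => l _.
  exact: addr_ge0 (I10 l i) (I20 l i).
move=> r e chi hc chiB; have [cc vc ce cce] := hc.
have e0 : 0 <= e := le_trans (normr_ge0 _) (ce j0 0).
have chi0 x : 0 <= chi x by case/andP: (chiB x).
rewrite (eq_bigr _ (fun i _ => eq_bigr _ (fun l _ => energy_cell l i hc))).
have cchi i : Cn 1 (fun x => chi x * w i x) := CnM (CnW cc) (cw i).
have vchi i : vanish r (fun x => chi x * w i x) := vanish_mull _ vc.
have X : \sum_(i < 3) \sum_(l < 3)
    (\int[mu3]_x (partial l (u i) x * partial l (fun x => chi x * w i x) x) +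
     \int[mu3]_x (u l x * partial l (u i) x * (chi x * w i x))) <= A * e.
  apply: le_trans (le_trans (ler_norm _) (hA r e chi hc)).
  rewrite le_eqVlt; apply/orP; left; apply/eqP; apply: eq_bigr => i _.
  rewrite -(NSop_weak cu i (cchi i) (vchi i)); apply: Rint_eq => x; exact: mulrA.
have D : \sum_(i < 3) \sum_(l < 3) \int[mu3]_x (chi x *
    (partial l (u l) x * (2^-1 * w i x ^+ 2) + partial l (w l) x * (w i x * v i x))) = 0.
  apply: big1 => i _.
  have ld l : L1 mu3 (fun x => chi x *
     (partial l (u l) x * (2^-1 * w i x ^+ 2) + partial l (w l) x * (w i x * v i x))).
    have cr : continuous (fun x => partial l (u l) x * (2^-1 * w i x ^+ 2) + partial l (w l) x * (w i x * v i x)).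
      move=> x; apply: cvgD; apply: cvgM.
      + exact: (Cn_cont (CnS_partial l (cu 1 l))).
      + by apply: cvgM; [exact: cvg_cst|exact: (continuous_sqr (Cn_cont (cw i)))].
      + exact: (Cn_cont (CnS_partial l (cw l))).
      + by apply: cvgM; [exact: (Cn_cont (cw i))|exact: (Cn_cont (cv i))].
    by apply: L1_eq (L1_vanish_mul (r := r) cr (Cn_cont cc) vc) => x; exact: mulrC.
  rewrite -(Rint_sum _ (fun l _ => ld l)).
  apply: etrans (_ : \int[mu3]_x (0 : R) = _); last exact: Rint0.
  apply: Rint_eq => x.
  by rewrite -mulr_sumr big_split/= -!mulr_suml du divfree_rem !mul0r addr0 mulr0.
have b1 l i : - (\int[mu3]_x (partial l (u i) x * (partial l chi x * w i x))) <= e * I1 l i.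
  have l1 := L1D (gu i l) (w2 i).
  have nle (a b : R) : `|a| <= b -> - a <= b by move/(le_trans _); apply; rewrite -normrN ler_norm.
  have E : \int[mu3]_x (e * (partial l (u i) x ^+ 2 + w i x ^+ 2)) = e * I1 l i := RintZ e l1.
  apply: nle; rewrite -E; apply: Rint_dom (L1Z e l1) _.
    apply: continuous_m; exact: (Cn_cont (CnM (CnS_partial l (cu 1 i))
      (CnM (CnW (CnS_partial l cc)) (CnW (cw i))))).
  move=> x; rewrite !normrM mulrCA.
  have h : `|partial l (u i) x| * `|w i x| <= partial l (u i) x ^+ 2 + w i x ^+ 2.
    move: (partial l (u i) x) (w i x) => a b.
    rewrite -(real_normK (num_real a)) -(real_normK (num_real b)).
    by move: `|a| `|b| => y z; have := sqr_ge0 (y - z); have := sqr_ge0 y; have := sqr_ge0 z; nra.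
  by apply: ler_pM; [exact: normr_ge0|exact: mulr_ge0|exact: ce|exact: h].
have b2 l i : \int[mu3]_x (flux l i x * partial l chi x) <= e * I2 l i.
  have l1 := L1_norm (flux_L1 l i).
  rewrite -(RintZ e l1); apply: le_trans (ler_norm _) _.
  apply: Rint_dom (L1Z e l1) _.
    apply: continuous_m; exact: (Cn_cont (CnM (CnW (flux_Cn1 l i)) (CnW (CnS_partial l cc)))).
  by move=> x; rewrite normrM mulrC; apply: ler_wpM2r.
have b3 l i : \int[mu3]_x (chi x * resid l i x) <= B * \int[mu3]_x resid_bound l i x.
  have l1 := resid_bound_L1 l i.
  rewrite -(RintZ B l1); apply: le_trans (ler_norm _) _.
  apply: Rint_dom (L1Z B l1) _.
    apply: continuous_m; apply: (Cn_cont (n := 0)); apply: CnM (CnW (CnW cc)) _.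
    apply: (CnB (CnM (CnS_partial l (cu 1 i)) (CnS_partial l (cv i))) (CnB (CnM (CnM (CnW (cv l))
      (CnS_partial l (cv i))) (CnW (cw i))) (CnM (CnM (CnW (cw l)) (CnS_partial l (cw i))) (CnW (cv i))))).
  move=> x; rewrite normrM ger0_norm//; apply: ler_pM => //; last exact: resid_le.
  by case/andP: (chiB x).
apply: le_trans (_ : A * e + \sum_(i < 3) \sum_(l < 3) (e * (I1 l i + I2 l i) +
  B * \int[mu3]_x resid_bound l i x) <= _); last first.
  rewrite le_eqVlt; apply/orP; left; apply/eqP.
  rewrite mulrDl -addrA; congr (_ + _).
  rewrite mulr_suml mulr_sumr -big_split; apply: eq_bigr => i _ /=.
  rewrite mulr_suml mulr_sumr -big_split; apply: eq_bigr => l _ /=.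
  by rewrite (mulrC e).
apply: le_trans (_ : \sum_(i < 3) \sum_(l < 3)
    (\int[mu3]_x (partial l (u i) x * partial l (fun x => chi x * w i x) x) +
     \int[mu3]_x (u l x * partial l (u i) x * (chi x * w i x))) +
  \sum_(i < 3) \sum_(l < 3) (e * (I1 l i + I2 l i) + B * \int[mu3]_x resid_bound l i x) +
  \sum_(i < 3) \sum_(l < 3) \int[mu3]_x (chi x *
    (partial l (u l) x * (2^-1 * w i x ^+ 2) + partial l (w l) x * (w i x * v i x))) <= _); last first.
  by rewrite D addr0; apply: lerD.
rewrite -!big_split/=; apply: ler_sum => i _; rewrite -!big_split/=; apply: ler_sum => l _.
rewrite lerD2r -!addrA !lerD2l mulrDr addrA.
by apply: lerD (b3 l i); apply: lerD; [exact: b1|exact: b2].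
Qed.

End energy_inequality.

(** * Limits of the energy inequality *)

Section positive_integral.
Context {R : realType}.
Implicit Types g : R3 R -> R.

Lemma Rint_box (r : R) : 0 <= r -> \int[mu3]_x (\1_(box r) x : R) = (2 * r) ^+ 3.
Proof.
move=> r0; rewrite /Rintegral.
have -> : (\int[mu3]_x (\1_(box r) x : R)%:E)%E = mu3 (box r : set (M3 R)).
  by rewrite (integral_indic _ measurableT (measurable_box r)) setIT.
by rewrite mu3_box.
Qed.

Lemma Rint_eq0_continuous g : continuous g -> (forall x, 0 <= g x) -> L1 mu3 g ->
  \int[mu3]_x g x = 0 -> forall x, g x = 0.
Proof.
move=> cg g0 lg I0 x0; apply/eqP; apply: contraT => gx; exfalso.
have gp : 0 < g x0 by rewrite lt0r gx g0.
have [r r0 hr] : exists2 r, 0 < r & forall x, `|x - x0| <= r -> 2^-1 * g x0 <= g x.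
  have e0 : 0 < 2^-1 * g x0 by rewrite mulr_gt0.
  have /cvgrPdist_le/(_ _ e0)/near_norm[d d0 hd] := cg x0.
  exists (d / 2); first exact: divr_gt0.
  move=> x xd; have xb : `|x0 - x| < d by rewrite distrC (le_lt_trans xd)// ltr_pdivrMr// ltr_pMr// ltr1n.
  have := hd x xb; rewrite /= => h.
  have := le_trans (ler_norm _) h; lra.
have lb := L1_shift (- x0) (L1_box r).
have : \int[mu3]_x (2^-1 * g x0 * \1_(box r) ((x : R3 R) + - x0)) <= \int[mu3]_x g x.
  apply: Rint_le (L1Z _ lb) lg _ => x; rewrite indicE.
  have [xb|xb] := boolP (x + - x0 \in box r); last by rewrite mulr0.
  by rewrite mulr1; apply: hr; apply: box_norm; move: xb; rewrite inE.
rewrite I0 (RintZ _ lb); apply/negP; rewrite -ltNge.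
have -> : \int[mu3]_x (\1_(box r) ((x : R3 R) + - x0) : R) = (2 * r) ^+ 3.
  by rewrite -(Rint_box (ltW r0)); exact: (Rint_shift (- x0) (L1_box r)).
by apply: mulr_gt0; [exact: mulr_gt0|rewrite exprn_gt0// mulr_gt0].
Qed.

Lemma Cn1_constant g : Cn 1 g -> (forall i x, partial i g x = 0) -> forall x, g x = g 0.
Proof.
move=> cg dg x.
have step y h j : g (y + h *: evec j) = g y.
  apply/eqP; rewrite -subr_eq0 (diff01 y h j cg); apply/eqP.
  by apply: etrans (_ : \int[m01]_t (0 : R) = _); [apply: Rint_eq => t; rewrite dg mulr0|exact: Rint0].
by rewrite (evec_sum x) !step -[RHS](step 0 x.1.1 j0) add0r.
Qed.

End positive_integral.

Section scaled_cutoff.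
Context {R : realType}.
Variables (chi : R3 R -> R) (B : R).
Hypothesis cchi : forall n, Cn n chi.
Hypothesis vchi : vanish 1 chi.
Hypothesis chiB : forall x, 0 <= chi x <= B.
Hypothesis chi1 : forall x, `|x| <= 4^-1 -> chi x = 1.

(** The summand [0] gives the argument the affine form of [Cn_affine] and [partial_affine]. *)
Definition cut (n : nat) (x : R3 R) := chi (n.+1%:R^-1 *: x + 0).

Lemma cut_Cn m n : Cn m (cut n). Proof. exact: Cn_affine. Qed.

Lemma cut_vanish n : vanish n.+1%:R (cut n).
Proof.
move=> x nx; apply: vchi; rewrite addr0 normrZ ger0_norm ?invr_ge0//.
by rewrite ltr_pdivlMl ?ltr0Sn// mulr1.
Qed.

Lemma cut_ge0 n x : 0 <= cut n x. Proof. by have /andP[] := chiB (n.+1%:R^-1 *: x + 0). Qed.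

Lemma cut_le n x : cut n x <= B. Proof. by have /andP[] := chiB (n.+1%:R^-1 *: x + 0). Qed.

(** Each derivative of the dilated cutoff brings a factor [1 / (n + 1)]; two such factors are
    weakened to one, so that one bound serves both orders. *)
Lemma cut_class : exists e, forall n, cutoff_class n.+1%:R (e * n.+1%:R^-1) (cut n).
Proof.
have bd1 l : exists C, 0 <= C /\ forall x, `|partial l chi x| <= C.
  have [C C0 h] := vanish_bounded (Cn_cont (CnS_partial l (cchi 1))) (vanish_partial l vchi).
  by exists C.
have bd2 (p : 'I_3 * 'I_3) : exists C, 0 <= C /\ forall x, `|partial p.1 (partial p.2 chi) x| <= C.
  have [C C0 h] := vanish_bounded (Cn_cont (CnS_partial p.1 (CnS_partial p.2 (cchi 2))))
    (vanish_partial p.1 (vanish_partial p.2 vchi)).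
  by exists C.
have [C1 h1] := choice bd1; have [C2 h2] := choice bd2.
pose e := \sum_l C1 l + \sum_p C2 p.
have s1 : 0 <= \sum_l C1 l by apply: sumr_ge0 => l _; exact: (h1 l).1.
have s2 : 0 <= \sum_p C2 p by apply: sumr_ge0 => p _; exact: (h2 p).1.
have e1 l x : `|partial l chi x| <= e.
  apply: le_trans ((h1 l).2 x) _; rewrite /e (bigD1 l)//= -addrA lerDl addr_ge0//.
  by apply: sumr_ge0 => m _; exact: (h1 m).1.
have e2 l m x : `|partial l (partial m chi) x| <= e.
  apply: le_trans ((h2 (l, m)).2 x) _; rewrite /e (bigD1 (l, m))//= addrCA lerDl addr_ge0//.
  by apply: sumr_ge0 => p _; exact: (h2 p).1.
exists e => n; set a := n.+1%:R^-1.
have a0 : 0 <= a by rewrite invr_ge0.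
have a1 : a <= 1 by rewrite invf_le1// ler1n.
split; [exact: cut_Cn|exact: cut_vanish| |] => l.
  move=> x; rewrite /cut (partial_affine a 0 l (cchi 1)) normrM (ger0_norm a0) mulrC.
  by apply: ler_wpM2r.
move=> m x; rewrite /cut (partial_affine a 0 m (cchi 2)).
rewrite (partialZ a l (Cn_affine a 0 (CnS_partial m (cchi 2)))).
rewrite (partial_affine a 0 l (CnS_partial m (cchi 2))) !normrM (ger0_norm a0) mulrA mulrC.
apply: ler_pM => //; first by rewrite mulr_ge0.
by rewrite ler_piMr.
Qed.

Lemma cvg_sum3 (F : 'I_3 -> nat -> R) (l : 'I_3 -> R) : (forall i, F i n @[n --> \oo] --> l i) ->
  \sum_(i < 3) F i n @[n --> \oo] --> \sum_(i < 3) l i.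
Proof.
move=> h; have -> : (fun n => \sum_(i < 3) F i n) = fun n => F j0 n + F j1 n + F j2 n.
  by apply/funext => n; rewrite sum3.
by rewrite sum3; apply: cvgD; [apply: cvgD|]; exact: h.
Qed.

Lemma cut_cvg x : cut n x @[n --> \oo] --> (1 : R).
Proof.
apply: cvg_near_cst.
have h : \forall n \near \oo, 4 * `|x| <= n%:R :> R by exact: nbhs_infty_ger.
near=> n; apply/eqP; rewrite /cut chi1// addr0 normrZ ger0_norm ?invr_ge0//.
rewrite ler_pdivrMl ?ltr0Sn//; have : 4 * `|x| <= n%:R :> R by near: n.
rewrite ler_pdivlMr// mulrC => /le_trans; apply; by rewrite -natr1 lerDl.
Unshelve. all: by end_near. Qed.

End scaled_cutoff.

Section vanishing_cutoff_error.
Context {R : realType}.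
Variables (u : 'I_3 -> R3 R -> R) (P : R3 R -> R) (C M : R) (K : R3 R -> R).
Hypothesis cu : forall n i, Cn n (u i).
Hypothesis cP : forall n, Cn n P.
Hypothesis NS : forall i x, NSop u i x = - partial i P x.
Hypothesis du : divfree u.
Hypothesis gu : forall i l, L1 mu3 (fun x => partial l (u i) x ^+ 2).
Hypothesis hK : kern 4 C K.
Hypothesis K1 : \int[mu3]_x K x = 1.
Hypothesis Ke : forall x, K (- x) = K x.
Hypothesis vM : forall i x, `|conv K (u i) x| <= M.
Variables (chi : R3 R -> R) (B : R).
Hypothesis cchi : forall n, Cn n chi.
Hypothesis vchi : vanish 1 chi.
Hypothesis chiB : forall x, 0 <= chi x <= B.
Hypothesis chi1 : forall x, `|x| <= 4^-1 -> chi x = 1.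

Definition energy : R := \sum_(i < 3) \sum_(l < 3) \int[mu3]_x (partial l (u i) x ^+ 2).

(** The limit of infinite cutoff radius at a fixed kernel: the error of [energy_ineq] tends to 0 and
    its left-hand side converges by dominated convergence. *)
Lemma energy_le_resid :
  energy <= B * \sum_(i < 3) \sum_(l < 3) \int[mu3]_x resid_bound u M K l i x.
Proof.
have [A A0 hA] := energy_ineq cu cP NS du gu hK K1 Ke vM B.
have [e he] := cut_class cchi vchi.
have h n := hA _ _ _ (he n) (fun x => introT andP (conj (cut_ge0 chiB n x) (cut_le chiB n x))).
set H := B * _ in h *.
have lim : (fun n : nat => \sum_(i < 3) \sum_(l < 3)
    \int[mu3]_x (cut chi n x * partial l (u i) x ^+ 2)) @ \oo --> energy.
  apply: cvg_sum3 => i; apply: cvg_sum3 => l.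
  apply: (@Rdct _ _ _ mu3 (fun n (x : R3 R) => cut chi n x * partial l (u i) x ^+ 2)
    (fun x => partial l (u i) x ^+ 2) (fun x => B * partial l (u i) x ^+ 2) _ _
    (L1Z B (gu i l)) _).2.
  - move=> n; apply: continuous_m => x; apply: cvgM; first exact: (Cn_cont (cut_Cn cchi 0 n)).
    exact: (continuous_sqr (Cn_cont (CnS_partial l (cu 1 i)))).
  - move=> x; rewrite -[X in _ --> X]mul1r; apply: cvgM; last exact: cvg_cst.
    exact: cut_cvg.
  - move=> n x; rewrite normrM ger0_norm; last exact: (cut_ge0 chiB n x).
    rewrite ger0_norm; last exact: sqr_ge0.
    by apply: ler_wpM2r; [exact: sqr_ge0|exact: (cut_le chiB n x)].
have lim2 : (fun n : nat => A * (e * n.+1%:R^-1) + H) @ \oo --> (0 + H : R).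
  apply: cvgD; last exact: cvg_cst.
  rewrite -(mulr0 (A * e)) (_ : (fun n : nat => _) = fun n : nat => A * e * n.+1%:R^-1).
    by apply: cvgM; [exact: cvg_cst|exact: cvg_harmonic].
  by apply/funext => n; rewrite mulrA.
rewrite -(add0r H); apply: (ler_cvg_to lim lim2); apply: nearW => n; exact: h.
Qed.

End vanishing_cutoff_error.

(** * Dilated kernels *)

Section dilation.
Context {R : realType}.
Variable lam : R.
Hypothesis lam0 : 0 < lam.
Implicit Types K f : R3 R -> R.

(** The dilation that preserves the integral; it moves the frequency scale of the kernel from 1 to
    [lam]. *)
Definition dil K (y : R3 R) := lam ^+ 3 * K (lam *: y + 0).

Lemma Rint_dil f : L1 mu3 f -> L1 mu3 (dil f) /\ \int[mu3]_x dil f x = \int[mu3]_x f x.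
Proof.
move=> lf; have [l E] := Rint_affine 0 (lt0r_neq0 lam0) lf.
split; first exact: (L1Z (lam ^+ 3) l).
apply: etrans (RintZ (lam ^+ 3) l) _; rewrite E mulrA (ger0_norm (ltW lam0)).
by rewrite mulfV ?mul1r// expf_neq0// lt0r_neq0.
Qed.

Lemma dil_norm K y : `|dil K y| = dil (fun x => `|K x|) y.
Proof. by rewrite /dil normrM ger0_norm// exprn_ge0// ltW. Qed.

Lemma dil_sqr K y : dil K y ^+ 2 = lam ^+ 3 * dil (fun x => K x ^+ 2) y.
Proof. by rewrite /dil exprMn expr2 mulrA. Qed.

Lemma dil_even K : (forall x, K (- x) = K x) -> forall x, dil K (- x) = dil K x.
Proof. by move=> Ke x; rewrite /dil !addr0 scalerN Ke. Qed.

Lemma dil_cont K : continuous K -> continuous (dil K).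
Proof.
move=> cK; have c0 : Cn 0 K by split.
by move=> x; apply: cvgM; [exact: cvg_cst|exact: (Cn_cont (Cn_affine lam 0 c0))].
Qed.

Lemma dil_moment K y : `|dil K y| * (y.1.1 ^+ 2 + y.1.2 ^+ 2 + y.2 ^+ 2) =
  lam ^- 2 * dil (fun x => `|K x| * (x.1.1 ^+ 2 + x.1.2 ^+ 2 + x.2 ^+ 2)) y.
Proof.
rewrite dil_norm /dil !addr0 /= /GRing.scale/=.
move: (`|K _|) y.1.1 y.1.2 y.2 => k a b c; field.
by rewrite lt0r_neq0.
Qed.

(** The decay constant blows up as [lam] tends to 0. This is harmless: it only guarantees that the
    integrals converge, while the final bounds rest on the exact scaling of the L1 norm, the L2 norm
    and the second moment. *)
Lemma kern_dil C K : lam <= 1 -> kern 4 C K -> exists C', kern 4 C' (dil K).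
Proof.
move=> lam1 [cK hK]; exists (lam ^+ 3 * C * (lam ^- 6) ^+ 4); split; first exact: dil_cont.
have C0 : 0 <= C by exact: (kern_ge0 (conj cK hK)).
move=> y; rewrite dil_norm /dil.
have h : rho y <= lam ^- 6 * rho (lam *: y + 0).
  have one (a : R) : 1 + a ^+ 2 <= lam ^- 2 * (1 + (lam * a) ^+ 2).
    rewrite mulrDr mulr1 exprMn mulKf ?expf_neq0 ?lt0r_neq0// lerD2r.
    by rewrite invf_ge1 ?exprn_gt0// expr_le1// ltW.
  rewrite addr0 /rho (_ : lam ^- 6 = lam ^- 2 * lam ^- 2 * lam ^- 2); last first.
    by field; rewrite lt0r_neq0.
  rewrite /= /GRing.scale/= (_ : lam ^- 2 * lam ^- 2 * lam ^- 2 * _ =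
    (lam ^- 2 * (1 + (lam * y.1.1) ^+ 2)) * (lam ^- 2 * (1 + (lam * y.1.2) ^+ 2)) *
    (lam ^- 2 * (1 + (lam * y.2) ^+ 2))); last by ring.
  have p (a : R) : 0 <= 1 + a ^+ 2 := ltW (one_sqr_gt0 a).
  by apply: ler_pM; [exact: mulr_ge0|exact: p|apply: ler_pM|].
have h4 : rho y ^+ 4 <= (lam ^- 6) ^+ 4 * rho (lam *: y + 0) ^+ 4.
  have r0 x : 0 <= rho x :> R := ltW (rho_gt0 x).
  by rewrite -exprMn ler_pXn2r// nnegrE// mulr_ge0// invr_ge0 exprn_ge0// ltW.
have -> : lam ^+ 3 * C * lam ^- 6 ^+ 4 / rho y ^+ 4 = lam ^+ 3 * (C * (lam ^- 6 ^+ 4 / rho y ^+ 4)).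
  by rewrite !mulrA.
rewrite ler_pM2l ?exprn_gt0//.
apply: le_trans (hK _) _; apply: ler_wpM2l => //.
by rewrite ler_pdivlMr ?rhoX_gt0// ler_pdivrMl ?rhoX_gt0// mulrC.
Qed.

End dilation.

Section cell.
Context {R : realType}.

Lemma young2 (d a b : R) : 0 < d -> a * b <= d * a ^+ 2 + (4 * d)^-1 * b ^+ 2.
Proof.
move=> d0; rewrite -subr_ge0.
have -> : d * a ^+ 2 + (4 * d)^-1 * b ^+ 2 - a * b = (4 * d)^-1 * (2 * d * a - b) ^+ 2.
  by field; rewrite lt0r_neq0.
by rewrite mulr_ge0 ?sqr_ge0// invr_ge0 mulr_ge0// ltW.
Qed.

Lemma sqrD_le (s t : R) : (s + t) ^+ 2 <= 2 * (s ^+ 2 + t ^+ 2).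
Proof. by have := sqr_ge0 (s - t); nra. Qed.

(** Young's inequality with parameter [d] on every product except one. Where [y], the size of [w],
    meets the near gradient [p], it is replaced by the size [c] of [u] plus [M * lam], so that the
    factor [lam] survives. *)
Lemma cell_pointwise (M lam d a b x y c p q : R) : 0 <= M -> 0 <= lam -> 0 < d ->
  0 <= p -> 0 <= y -> y <= c + M * lam -> a <= p + q ->
  a * b + M * lam * (x * b + y * (a + b)) <=
  d * (a ^+ 2 + M * (lam ^+ 2 * x ^+ 2 + 2 * (lam ^+ 2 * y ^+ 2))) +
  (4 * d)^-1 * ((1 + 2 * M) * b ^+ 2 + M * q ^+ 2) + lam * M * (c * p + M * lam * p).
Proof.
move=> M0 l0 d0 p0 y0 hy ha.
have h1 := young2 a b d0.
have h2 := ler_wpM2l M0 (young2 (lam * x) b d0).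
have h3 := ler_wpM2l M0 (young2 (lam * y) b d0).
have h4 := ler_wpM2l M0 (young2 (lam * y) q d0).
have Ml : 0 <= M * lam by exact: mulr_ge0.
have h5 := ler_wpM2l Ml (ler_wpM2l y0 ha).
have h6 := ler_wpM2l Ml (ler_wpM2r p0 hy).
have -> : M * lam * (x * b + y * (a + b)) =
  M * (lam * x * b) + M * lam * (y * a) + M * (lam * y * b) by ring.
apply: le_trans (lerD h1 (lerD (lerD h2 h5) h3)) _.
have -> : M * lam * (y * (p + q)) = M * lam * (y * p) + M * (lam * y * q) by ring.
apply: le_trans (lerD (lexx _) (lerD (lerD (lexx _) (lerD h6 h4)) (lexx _))) _.
by rewrite le_eqVlt; apply/orP; left; apply/eqP; ring.
Qed.

End cell.

Section cell_integral.
Context {R : realType}.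
Variables (u : 'I_3 -> R3 R -> R) (C M lam : R) (K : R3 R -> R).
Hypothesis cu : forall n i, Cn n (u i).
Hypothesis gu : forall i l, L1 mu3 (fun x => partial l (u i) x ^+ 2).
Hypothesis hK : kern 4 C K.
Hypothesis K1 : \int[mu3]_x K x = 1.
Hypothesis M0 : 0 <= M.
Hypothesis lam0 : 0 <= lam.
Hypothesis vM : forall i x, `|conv K (u i) x| <= M * lam.
Variables (r B d : R) (chi : R3 R -> R).
Hypothesis cchi : continuous chi.
Hypothesis vchi : vanish r chi.
Hypothesis chiB : forall x, 0 <= chi x <= B.
Hypothesis d0 : 0 < d.

(** The gradient is split by a cutoff: the near part has compact support, so it lies in L1 and can
    be multiplied by the unbounded [u]; the far part is small in L2 once the cutoff is wide. *)
Let near_part l i x := chi x * partial l (u i) x.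
Let far_part l i x := (1 - chi x) * partial l (u i) x.

Let cpu i l : continuous (partial l (u i)) := Cn_cont (CnS_partial l (cu 1 i)).

Lemma near_part_cont l i : continuous (near_part l i).
Proof. by move=> x; apply: cvgM; [exact: cchi|exact: cpu]. Qed.

Lemma near_part_vanish l i : vanish r (near_part l i).
Proof. exact: vanish_mull. Qed.

Lemma far_part_cont l i : continuous (far_part l i).
Proof.
by move=> x; apply: cvgM; [apply: cvgB; [exact: cvg_cst|exact: cchi]|exact: cpu].
Qed.

Lemma far_part_L2 l i : L1 mu3 (fun x => far_part l i x ^+ 2).
Proof.
apply: L1_dom (L1Z ((1 + B) ^+ 2) (gu i l)) _.
  exact: continuous_m (continuous_sqr (@far_part_cont l i)).
move=> x; rewrite ger0_norm ?sqr_ge0// exprMn; apply: ler_wpM2r; first exact: sqr_ge0.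
have /andP[c0 cB] := chiB x.
by have := mulr_ge0 (addr_ge0 (le_trans c0 cB) c0) (addr_ge0 (ler0n R 2) (addr_ge0 c0 c0)); move: (chi x) c0 cB => c; nra.
Qed.

(** One Schur test for each part. For dilated kernels the integral of [K ^ 2] is of order [lam ^ 3],
    which makes the near part small; the L1 norm does not change, so the far part remains as small
    as the tail. *)
Lemma conv_grad_small l i :
  \int[mu3]_x (partial l (conv K (u i)) x ^+ 2) <=
  2 * ((\int[mu3]_x `|near_part l i x|) ^+ 2 * \int[mu3]_x (K x ^+ 2) +
       (\int[mu3]_x `|K x|) ^+ 2 * \int[mu3]_x (far_part l i x ^+ 2)).
Proof.
have cn := @near_part_cont l i; have vn := @near_part_vanish l i.
have cf := @far_part_cont l i; have lf := far_part_L2 l i.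
have ln := vanish_L1 cn vn.
have ln2 : L1 mu3 (fun x => near_part l i x ^+ 2).
  apply: (vanish_L1 (r := r) (continuous_sqr cn)) => x rx.
  by rewrite (vn x rx) expr0n.
have Wn := @W_L2 _ 4 _ isT cn ln2; have Wf := @W_L2 _ 4 _ isT cf lf.
have [h1 b1] := conv_L2_small (m := 4) isT hK cn ln.
have [h2 b2] := conv_L2 (m := 4) isT hK cf lf.
have E x : partial l (conv K (u i)) x = conv K (near_part l i) x + conv K (far_part l i) x.
  rewrite (partial_conv_of cu gu hK i l) -(RintD (conv_L1 x hK Wn) (conv_L1 x hK Wf)).
  by apply: Rint_eq => y; rewrite -mulrDr /near_part /far_part; congr (_ * _); ring.
apply: le_trans (_ : \int[mu3]_x (2 * (conv K (near_part l i) x ^+ 2 + conv K (far_part l i) x ^+ 2)) <= _).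
  apply: Rint_le (conv_grad_L2 cu gu hK i l) (L1Z 2 (L1D h1 h2)) _ => x; rewrite E.
  exact: sqrD_le.
rewrite (RintZ 2 (L1D h1 h2)); apply: ler_wpM2l => //.
by rewrite (RintD h1 h2); exact: lerD b1 b2.
Qed.

Lemma resid_cell_bound l i :
  \int[mu3]_x resid_bound u (M * lam) K l i x <=
  d * (\int[mu3]_x (partial l (u i) x ^+ 2) +
       M * (lam ^+ 2 * \int[mu3]_x (rem u K i x ^+ 2) +
            2 * (lam ^+ 2 * \int[mu3]_x (rem u K l x ^+ 2)))) +
  (4 * d)^-1 * ((1 + 2 * M) * \int[mu3]_x (partial l (conv K (u i)) x ^+ 2) +
                M * \int[mu3]_x (far_part l i x ^+ 2)) +
  lam * M * (\int[mu3]_x (`|u l x| * `|near_part l i x|) +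
             M * lam * \int[mu3]_x `|near_part l i x|).
Proof.
have lu := gu i l; have lw j := rem_L2 cu gu hK K1 j.
have lv := conv_grad_L2 cu gu hK i l; have lf := far_part_L2 l i.
have cn := @near_part_cont l i; have vn := @near_part_vanish l i.
have ln := L1_norm (vanish_L1 cn vn).
have lun : L1 mu3 (fun x => `|u l x| * `|near_part l i x|).
  apply: (L1_vanish_mul (r := r)).
  - by move=> x; apply: cvg_norm; exact: (Cn_cont (cu 0 l)).
  - by move=> x; apply: cvg_norm; exact: cn.
  - by move=> x rx; rewrite (vn x rx) normr0.
have A1 := L1D (L1Z (lam ^+ 2) (lw i)) (L1Z 2 (L1Z (lam ^+ 2) (lw l))).
have A2 := L1D lu (L1Z M A1).
have A3 := L1D (L1Z (1 + 2 * M) lv) (L1Z M lf).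
have A4 := L1D lun (L1Z (M * lam) ln).
have A5 := L1D (L1Z d A2) (L1Z (4 * d)^-1 A3).
have A6 := L1D A5 (L1Z (lam * M) A4).
apply: le_trans (Rint_le (@resid_bound_L1 _ _ _ _ _ cu gu hK K1 vM l i) A6 _) _; last first.
  rewrite le_eqVlt; apply/orP; left; apply/eqP.
  rewrite (RintD A5 (L1Z (lam * M) A4)) (RintZ _ A4) (RintD lun (L1Z (M * lam) ln)) (RintZ _ ln).
  rewrite (RintD (L1Z d A2) (L1Z (4 * d)^-1 A3)) (RintZ _ A2) (RintZ _ A3).
  rewrite (RintD lu (L1Z M A1)) (RintZ _ A1).
  rewrite (RintD (L1Z (lam ^+ 2) (lw i)) (L1Z 2 (L1Z (lam ^+ 2) (lw l)))) (RintZ 2 (L1Z (lam ^+ 2) (lw l))).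
  rewrite (RintZ _ (lw i)) (RintZ _ (lw l)).
  by rewrite (RintD (L1Z (1 + 2 * M) lv) (L1Z M lf)) (RintZ _ lv) (RintZ _ lf).
move=> x; rewrite /resid_bound.
rewrite -(real_normK (num_real (partial l (u i) x))) -(real_normK (num_real (rem u K i x))).
rewrite -(real_normK (num_real (rem u K l x))) -(real_normK (num_real (partial l (conv K (u i)) x))).
rewrite -(real_normK (num_real (far_part l i x))).
apply: cell_pointwise => //.
  rewrite /rem; apply: le_trans (ler_normB _ _) _; rewrite lerD2l; exact: vM.
apply: le_trans (ler_normD _ _); rewrite /near_part /far_part -mulrDl addrC subrK mul1r//.
Qed.

End cell_integral.

Section core_constants.
Context {R : realType}.

(** Separates [d] times a constant free of [lam] and [d] from [lam] times a constant that depends on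
    [d]. The tail [t] is taken at most [d ^ 2] because it gets divided by [4 * d]. *)
Lemma cell_constant (d E M W e w1 w2 V t k1 k2 a q lam c : R) :
  0 < d -> 0 <= M -> 0 < lam -> lam <= 1 -> 0 <= k2 -> 0 <= a ->
  e <= E -> w1 <= W -> w2 <= W -> t <= d ^+ 2 ->
  V <= 2 * (a ^+ 2 * (lam ^+ 3 * k2) + k1 ^+ 2 * t) ->
  c <= d * (e + M * (w1 + 2 * w2)) + (4 * d)^-1 * ((1 + 2 * M) * V + M * t) +
       lam * M * (q + M * lam * a) ->
  c <= d * (E + 3 * M * W + 4^-1 * ((1 + 2 * M) * (2 * k1 ^+ 2) + M)) +
       lam * ((4 * d)^-1 * ((1 + 2 * M) * (2 * (a ^+ 2 * k2))) + M * (q + M * a)).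
Proof.
move=> d0 M0 l0 l1 k0 a0 eE w1W w2W td hV hc.
have D0 : 0 <= (4 * d)^-1 by rewrite invr_ge0 mulr_ge0// ltW.
have M1 : 0 <= 1 + 2 * M by rewrite addr_ge0// mulr_ge0.
have l3 : lam ^+ 3 <= lam by rewrite exprS ler_piMr ?(ltW l0)// expr_le1// ltW.
have hV2 : V <= 2 * (a ^+ 2 * (lam * k2) + k1 ^+ 2 * d ^+ 2).
  apply: le_trans hV _; apply: ler_wpM2l => //; apply: lerD.
    by apply: ler_wpM2l; [exact: sqr_ge0|exact: ler_wpM2r].
  by apply: ler_wpM2l => //; exact: sqr_ge0.
have h1 : d * (e + M * (w1 + 2 * w2)) <= d * (E + M * (W + 2 * W)).
  apply: ler_wpM2l; first exact: ltW.
  by apply: lerD eE _; apply: ler_wpM2l => //; apply: lerD w1W _; exact: ler_wpM2l.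
have h2 := ler_wpM2l D0 (lerD (ler_wpM2l M1 hV2) (ler_wpM2l M0 td)).
have h3 : lam * M * (q + M * lam * a) <= lam * M * (q + M * a).
  apply: ler_wpM2l; first by rewrite mulr_ge0// ltW.
  by rewrite lerD2l; apply: ler_wpM2r => //; rewrite ler_piMr.
apply: le_trans hc _; apply: le_trans (lerD (lerD h1 h2) h3) _.
rewrite le_eqVlt; apply/orP; left; apply/eqP; field.
by rewrite lt0r_neq0.
Qed.

Lemma le_sum33 (T : 'I_3 -> 'I_3 -> R) i l : (forall i l, 0 <= T i l) ->
  T i l <= \sum_(j < 3) \sum_(m < 3) T j m.
Proof.
move=> T0; apply: (@le_trans _ _ (\sum_(m < 3) T i m)).
  by rewrite (bigD1 l)//= lerDl; apply: sumr_ge0.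
by rewrite [leRHS](bigD1 i)//= lerDl; apply: sumr_ge0 => j _; apply: sumr_ge0.
Qed.

(** With [d] fixed, [lam] tends to 0 along the good values, and only then [d] tends to 0: [Q] may
    depend on [d], but [G] may not. *)
Lemma le0_of_small (E : R) (G : R) (good : R -> Prop) : 0 <= G ->
  (forall e, 0 < e -> exists2 lam, 0 < lam < e & good lam) ->
  (forall d, 0 < d -> exists2 Q, 0 <= Q & forall lam, 0 < lam -> good lam -> E <= d * G + lam * Q) ->
  E <= 0.
Proof.
move=> G0 hg h.
have step d : 0 < d -> E <= d * G.
  move=> d0; have [Q Q0 hQ] := h d d0; rewrite leNgt; apply/negP => lt.
  have Q1 : 0 < Q + 1 by rewrite ltr_wpDl.
  have e0 : 0 < (E - d * G) / (Q + 1) by rewrite divr_gt0 ?subr_gt0.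
  have [lam /andP[l0 l1] gl] := hg _ e0.
  have := hQ lam l0 gl; apply/negP; rewrite -ltNge.
  move: l1; rewrite ltr_pdivlMr// => l1.
  have : lam * Q <= lam * (Q + 1) by rewrite ler_pM2l// lerDl.
  by move: (d * G) (lam * Q) (lam * (Q + 1)) lt l1 => x y z *; lra.
rewrite leNgt; apply/negP => E0.
have G1 : 0 < 2 * (G + 1) by rewrite mulr_gt0// ltr_wpDl.
have := step (E / (2 * (G + 1))) (divr_gt0 E0 G1).
rewrite mulrAC ler_pdivlMr//; apply/negP; rewrite -ltNge.
rewrite ltr_pM2l//; lra.
Qed.

End core_constants.

Section liouville_core.
Context {R : realType}.
Variables (u : 'I_3 -> R3 R -> R) (P : R3 R -> R) (C M : R) (K : R3 R -> R).
Hypothesis cu : forall n i, Cn n (u i).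
Hypothesis cP : forall n, Cn n P.
Hypothesis NS : forall i x, NSop u i x = - partial i P x.
Hypothesis du : divfree u.
Hypothesis gu : forall i l, L1 mu3 (fun x => partial l (u i) x ^+ 2).
Hypothesis hK : kern 4 C K.
Hypothesis K1 : \int[mu3]_x K x = 1.
Hypothesis Ke : forall x, K (- x) = K x.
Hypothesis M0 : 0 <= M.
Variables (chi : R3 R -> R) (B : R).
Hypothesis cchi : forall n, Cn n chi.
Hypothesis vchi : vanish 1 chi.
Hypothesis chiB : forall x, 0 <= chi x <= B.
Hypothesis chi1 : forall x, `|x| <= 4^-1 -> chi x = 1.

Let k1 := \int[mu3]_x `|K x|.
Let k2 := \int[mu3]_x (K x ^+ 2).
Let m2 := \int[mu3]_x (`|K x| * ((x : R3 R).1.1 ^+ 2 + (x : R3 R).1.2 ^+ 2 + (x : R3 R).2 ^+ 2)).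
Let E := energy u.
Let W := k1 * (m2 * (3 * E)).

Definition small_mode lam : Prop :=
  [/\ 0 < lam, lam <= 1 & forall i x, `|conv (dil lam K) (u i) x| <= M * lam].

Lemma energy_cell_ge0 i l : 0 <= \int[mu3]_x (partial l (u i) x ^+ 2).
Proof. by apply: Rint_ge0 => x; exact: sqr_ge0. Qed.

Lemma energy_ge0 : 0 <= E.
Proof. by apply: sumr_ge0 => i _; apply: sumr_ge0 => l _; exact: energy_cell_ge0. Qed.

Lemma grad2_le_energy i : grad2 (u i) <= E.
Proof.
rewrite /E /energy (bigD1 i)//= lerDl; apply: sumr_ge0 => j _; apply: sumr_ge0 => l _.
exact: energy_cell_ge0.
Qed.

Lemma cell_le_energy i l : \int[mu3]_x (partial l (u i) x ^+ 2) <= E.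
Proof.
apply: le_trans (grad2_le_energy i); rewrite /grad2 (bigD1 l)//= lerDl.
by apply: sumr_ge0 => j _; exact: energy_cell_ge0.
Qed.

Lemma dil_K1 lam : 0 < lam -> \int[mu3]_x (dil lam K x) = 1.
Proof. by move=> l0; rewrite (Rint_dil l0 (@kern_L1 _ 4 C K isT hK)).2. Qed.

Lemma dil_k1 lam : 0 < lam -> \int[mu3]_x `|dil lam K x| = k1.
Proof.
move=> l0; have lK := L1_norm (@kern_L1 _ 4 C K isT hK).
have [_ e] := Rint_dil l0 lK; rewrite /k1 -e.
by apply: Rint_eq => x; exact: dil_norm.
Qed.

Lemma dil_k2 lam : 0 < lam -> \int[mu3]_x (dil lam K x ^+ 2) = lam ^+ 3 * k2.
Proof.
move=> l0; have lK := @kern_L1 _ 4 _ _ isT (kern_sqr hK).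
have [l e] := Rint_dil l0 lK; rewrite /k2 -e -(RintZ _ l).
by apply: Rint_eq => x; exact: dil_sqr.
Qed.

(** The second moment of the dilated kernel is [lam ^- 2] times that of [K], and the prefactor
    [lam ^ 2] compensates it exactly. *)
Lemma rem_dil_L2 lam j : small_mode lam ->
  lam ^+ 2 * \int[mu3]_x (rem u (dil lam K) j x ^+ 2) <= W.
Proof.
move=> [l0 l1 hl]; have [C' hK'] := kern_dil l0 l1 hK.
have lm := L1_second_moment hK'.
have [_ h] := conv_diff_L2 (m := 4) isT hK' (dil_K1 l0) lm (D12_of cu gu j).
apply: le_trans (ler_wpM2l (sqr_ge0 _) h) _.
have [l e] := Rint_dil l0 (L1_second_moment hK).
have em : \int[mu3]_x (`|dil lam K x| * ((x : R3 R).1.1 ^+ 2 + (x : R3 R).1.2 ^+ 2 + (x : R3 R).2 ^+ 2))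
    = lam ^- 2 * m2.
  rewrite /m2 -e -(RintZ _ l); apply: Rint_eq => x; exact: dil_moment.
rewrite em (dil_k1 l0) /W.
have -> : lam ^+ 2 * (k1 * (lam ^- 2 * m2 * (3 * grad2 (u j)))) = k1 * (m2 * (3 * grad2 (u j))).
  by field; rewrite lt0r_neq0.
have k10 : 0 <= k1 by apply: Rint_ge0 => x; exact: normr_ge0.
have m20 : 0 <= m2.
  by apply: Rint_ge0 => x; apply: mulr_ge0; [exact: normr_ge0|rewrite !addr_ge0 ?sqr_ge0].
apply: (ler_wpM2l k10); apply: (ler_wpM2l m20); apply: ler_wpM2l => //.
exact: grad2_le_energy.
Qed.

(** Dominated convergence; summing over all pairs of indices beforehand makes one [n] serve them
    all. *)
Lemma tail_small (d : R) : 0 < d -> exists n, forall i l,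
  \int[mu3]_x (((1 - cut chi n x) * partial l (u i) x) ^+ 2) <= d.
Proof.
move=> d0.
have t0 n i l : 0 <= \int[mu3]_x (((1 - cut chi n x) * partial l (u i) x) ^+ 2).
  by apply: Rint_ge0 => x; exact: sqr_ge0.
have lim : (fun n : nat => \sum_(i < 3) \sum_(l < 3)
    \int[mu3]_x (((1 - cut chi n x) * partial l (u i) x) ^+ 2)) @ \oo -->
    \sum_(i < 3) \sum_(l < 3) \int[mu3]_x (0 : R).
  apply: cvg_sum3 => i; apply: cvg_sum3 => l.
  apply: (@Rdct _ _ _ mu3 (fun n (x : R3 R) => ((1 - cut chi n x) * partial l (u i) x) ^+ 2)
    (fun x => 0) (fun x => (1 + B) ^+ 2 * partial l (u i) x ^+ 2) _ _
    (L1Z ((1 + B) ^+ 2) (gu i l)) _).2.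
  - move=> n; apply: continuous_m; apply: continuous_sqr => x; apply: cvgM.
      by apply: cvgB; [exact: cvg_cst|exact: (Cn_cont (cut_Cn cchi 0 n))].
    exact: (Cn_cont (CnS_partial l (cu 1 i))).
  - move=> x; have h : (1 - cut chi n x) * partial l (u i) x @[n --> \oo] -->
        (1 - 1) * partial l (u i) x.
      apply: cvgM; last exact: cvg_cst.
      by apply: cvgB; [exact: cvg_cst|exact: (cut_cvg chi1)].
    have := cvgM h h; rewrite subrr !mul0r => h2.
    rewrite (_ : (fun n => _) = fun n => ((1 - cut chi n x) * partial l (u i) x) * ((1 - cut chi n x) * partial l (u i) x)).
      exact: h2.
    by apply/funext => n; exact: expr2.
  - move=> n x; rewrite ger0_norm ?sqr_ge0// exprMn; apply: ler_wpM2r; first exact: sqr_ge0.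
    have := cut_ge0 chiB n x; have := cut_le chiB n x; move: (cut chi n x) => c cB c0.
    have := mulr_ge0 (addr_ge0 (le_trans c0 cB) c0) (addr_ge0 (ler0n R 2) (addr_ge0 c0 c0)).
    by nra.
move: lim; rewrite big1; last by move=> i _; apply: big1 => l _; exact: Rint0.
move=> /cvgrPdist_le/(_ _ d0)[n _ /(_ n (leqnn n))/=]; rewrite sub0r normrN => h.
exists n => i l; apply: le_trans (le_trans (ler_norm _) h).
exact: (le_sum33 i l (t0 n)).
Qed.

Let G := E + 3 * M * W + 4^-1 * ((1 + 2 * M) * (2 * k1 ^+ 2) + M).

(* [d] first absorbs the energy and fixes the cutoff, hence [Q]; the remaining
   terms then vanish with the mode [lam]. *)
Lemma energy_le_small (d : R) : 0 < d -> exists2 Q, 0 <= Q & forall lam, 0 < lam ->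
  small_mode lam -> E <= d * (B * (G *+ 9)) + lam * Q.
Proof.
move=> d0; have B0 : 0 <= B by have /andP[] := chiB 0; exact: le_trans.
have k20 : 0 <= k2 by apply: Rint_ge0 => x; exact: sqr_ge0.
have [n hn] := tail_small (exprn_gt0 2 d0).
pose a i l := \int[mu3]_x `|cut chi n x * partial l (u i) x|.
pose q i l := \int[mu3]_x (`|u l x| * `|cut chi n x * partial l (u i) x|).
have a0 i l : 0 <= a i l by apply: Rint_ge0 => x; exact: normr_ge0.
have q0 i l : 0 <= q i l by apply: Rint_ge0 => x; apply: mulr_ge0; exact: normr_ge0.
pose Q i l := (4 * d)^-1 * ((1 + 2 * M) * (2 * (a i l ^+ 2 * k2))) + M * (q i l + M * a i l).
have Q0 i l : 0 <= Q i l.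
  apply: addr_ge0; last by apply: mulr_ge0 => //; apply: addr_ge0 => //; exact: mulr_ge0.
  apply: mulr_ge0; first by rewrite invr_ge0 mulr_ge0// ltW.
  apply: mulr_ge0; first by rewrite addr_ge0// mulr_ge0.
  by apply: mulr_ge0 => //; apply: mulr_ge0 => //; exact: sqr_ge0.
exists (B * \sum_(i < 3) \sum_(l < 3) Q i l).
  by apply: mulr_ge0 => //; apply: sumr_ge0 => i _; apply: sumr_ge0 => l _.
move=> lam l0 sm; have [_ l1 hl] := sm; have [C' hK'] := kern_dil l0 l1 hK.
have Ke' := dil_even lam Ke.
apply: le_trans (energy_le_resid cu cP NS du gu hK' (dil_K1 l0) Ke' hl cchi vchi chiB chi1) _.
have cell i l : \int[mu3]_x resid_bound u (M * lam) (dil lam K) l i x <= d * G + lam * Q i l.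
  have hb := resid_cell_bound cu gu hK' (dil_K1 l0) M0 (ltW l0) hl
    (Cn_cont (cut_Cn cchi 0 n)) (cut_vanish vchi (n := n))
    (fun x => introT andP (conj (cut_ge0 chiB n x) (cut_le chiB n x))) d0 l i.
  have hs := conv_grad_small cu gu hK'
    (Cn_cont (cut_Cn cchi 0 n)) (cut_vanish vchi (n := n))
    (fun x => introT andP (conj (cut_ge0 chiB n x) (cut_le chiB n x))) l i.
  rewrite (dil_k1 l0) (dil_k2 l0) in hs.
  exact: (cell_constant d0 M0 l0 l1 k20 (a0 i l) (cell_le_energy i l) (rem_dil_L2 i sm)
    (rem_dil_L2 l sm) (hn i l) hs hb).
apply: le_trans (ler_wpM2l B0 (ler_sum _ (fun i _ => ler_sum _ (fun l _ => cell i l)))) _.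
rewrite le_eqVlt; apply/orP; left; apply/eqP.
have -> : \sum_(i < 3) \sum_(l < 3) (d * G + lam * Q i l) =
    (d * G) *+ 9 + lam * \sum_(i < 3) \sum_(l < 3) Q i l.
  rewrite mulr_sumr (eq_bigr (fun i => (d * G) *+ 3 + lam * \sum_(l < 3) Q i l)).
    by rewrite big_split/= sumr_const card_ord -mulrnA.
  by move=> i _; rewrite big_split/= sumr_const card_ord mulr_sumr.
rewrite mulrDr (mulrCA B lam) -mulrnAr (mulrCA B d)//.
Qed.

Lemma liouville_core : (forall e, 0 < e -> exists2 lam, 0 < lam < e & small_mode lam) ->
  forall i x, u i x = 0.
Proof.
move=> hs.
have B0 : 0 <= B by have /andP[] := chiB 0; exact: le_trans.
have k10 : 0 <= k1 by apply: Rint_ge0 => x; exact: normr_ge0.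
have W0 : 0 <= W.
  apply: mulr_ge0 => //; apply: mulr_ge0; last by apply: mulr_ge0 => //; exact: energy_ge0.
  by apply: Rint_ge0 => x; apply: mulr_ge0; [exact: normr_ge0|rewrite !addr_ge0 ?sqr_ge0].
have G0 : 0 <= B * (G *+ 9).
  apply: mulr_ge0 => //; rewrite mulrn_wge0//; apply: addr_ge0.
    exact: addr_ge0 energy_ge0 (mulr_ge0 (mulr_ge0 (ler0n _ 3) M0) W0).
  apply: mulr_ge0; first by rewrite invr_ge0.
  apply: addr_ge0 => //; apply: mulr_ge0; first by rewrite addr_ge0// mulr_ge0.
  by apply: mulr_ge0 => //; exact: sqr_ge0.
have E0 : E <= 0 := le0_of_small G0 hs energy_le_small.
have z i l x : partial l (u i) x = 0.
  have c0 : \int[mu3]_x (partial l (u i) x ^+ 2) = 0.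
    by apply/eqP; rewrite eq_le energy_cell_ge0 (le_trans (cell_le_energy i l) E0).
  have := Rint_eq0_continuous (continuous_sqr (Cn_cont (CnS_partial l (cu 1 i))))
    (fun x => sqr_ge0 _) (gu i l) c0 x.
  by move/eqP; rewrite sqrf_eq0 => /eqP.
move=> i x; have cst := Cn1_constant (cu 1 i) (fun l x => z i l x).
have b e : 0 < e -> `|u i x| <= M * e.
  move=> e0; have [lam /andP[l0 le] [_ l1 hl]] := hs e e0.
  apply: le_trans (_ : M * lam <= _); last by apply: ler_wpM2l => //; exact: ltW.
  apply: le_trans (hl i x); rewrite le_eqVlt; apply/orP; left; apply/eqP; congr (`|_|).
  have lK := (Rint_dil l0 (@kern_L1 _ 4 C K isT hK)).1.
  rewrite cst /conv; apply/esym; apply: etrans (_ : \int[mu3]_y (dil lam K y * u i 0) = _).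
    by apply: Rint_eq => y; rewrite cst.
  by rewrite (RintZr _ lK) (dil_K1 l0) mul1r.
apply/eqP; rewrite -normr_le0 leNgt; apply/negP => p.
have M1 : 0 < 2 * (M + 1) by rewrite mulr_gt0// ltr_wpDl.
have := b _ (divr_gt0 p M1); rewrite mulrA ler_pdivlMr//; apply/negP; rewrite -ltNge.
rewrite [X in _ < X]mulrC ltr_pM2r//; lra.
Qed.

End liouville_core.

(** * The cosine transform *)

Section poisson_kernel.
Context {R : realType}.
Implicit Types e t c x : R.

(** An antiderivative of [expR (- (e * x)) * (1 + cos (t * x))]. The summand 1 makes this integrand
    nonnegative, so its integral over the half-line follows from the limit of the antiderivative,
    and integrability with it. *)
Let primitive e t x := expR (- (e * x)) * (- e^-1 + (t * sin (t * x) - e * cos (t * x)) / (e ^+ 2 + t ^+ 2)).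

Lemma is_derive_expN e x : is_derive x 1 (fun x : R => expR (- (e * x))) (- e * expR (- (e * x))).
Proof.
have h : is_derive x 1 (fun x : R => - (e * x)) (- e).
  have := is_deriveN (is_derive_mulc e x).
  by rewrite (_ : - (fun s : R => e * s) = fun x => - (e * x)).
have := @is_derive1_comp R expR (fun x => - (e * x)) x _ _ (is_derive_expR (- (e * x))) h.
by rewrite (_ : _ \o _ = fun x : R => expR (- (e * x)))// mulrC.
Qed.

Lemma is_derive_primitive e t x : 0 < e ->
  is_derive x 1 (primitive e t) (expR (- (e * x)) * (1 + cos (t * x))).
Proof.
move=> e0; have D0 : e ^+ 2 + t ^+ 2 != 0.
  by rewrite gt_eqF// ltr_pwDl ?sqr_ge0// exprn_gt0.
have hs : is_derive x 1 (fun x : R => sin (t * x)) (cos (t * x) * t).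
  have := is_derive1_comp (is_derive_sin (t * x)) (is_derive_mulc t x).
  by rewrite (_ : _ \o _ = fun x : R => sin (t * x)).
have hc : is_derive x 1 (fun x : R => cos (t * x)) (- sin (t * x) * t).
  have := is_derive1_comp (is_derive_cos (t * x)) (is_derive_mulc t x).
  by rewrite (_ : _ \o _ = fun x : R => cos (t * x)).
have he := is_derive_expN e x.
pose a : R := t / (e ^+ 2 + t ^+ 2); pose b : R := - e / (e ^+ 2 + t ^+ 2).
have hb : is_derive x 1 (fun x : R => - e^-1 + (a * sin (t * x) + b * cos (t * x)))
    (0 + (a * (cos (t * x) * t) + b * (- sin (t * x) * t))).
  by apply: is_deriveD; apply: is_deriveD; apply: is_deriveZ.
have := is_deriveM he hb.
rewrite (_ : _ * _ = primitive e t); last first.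
  apply/funext => y; rewrite !fctE /primitive /a /b; field.
  by rewrite ?D0 ?gt_eqF.
move=> H; apply: (is_derive_eq H); rewrite /GRing.scale /= /a /b; field.
by rewrite D0 gt_eqF.
Qed.

Lemma primitive_cvg e t : 0 < e -> primitive e t x @[x --> +oo] --> (0 : R).
Proof.
move=> e0; pose C : R := e^-1 + (`|t| + e) / (e ^+ 2 + t ^+ 2).
have D0 : 0 < e ^+ 2 + t ^+ 2 by rewrite ltr_pwDl ?sqr_ge0// exprn_gt0.
have he : expR (- (e * x)) @[x --> +oo] --> (0 : R).
  have := @cvg_comp _ _ _ (fun x : R => e * x) (fun x => expR (- x)) _ _ _ _ (@cvgr_expR R).
  by apply; exact: gt0_cvgMry.
have hC : C * expR (- (e * x)) @[x --> +oo] --> (0 : R).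
  by rewrite -(mulr0 C); apply: cvgM; [exact: cvg_cst|exact: he].
have hN : - (C * expR (- (e * x))) @[x --> +oo] --> (0 : R).
  by rewrite -oppr0; exact: cvgN.
apply: (squeeze_cvgr _ hN hC); apply: nearW => x.
rewrite -ler_norml /primitive normrM ger0_norm ?expR_ge0// mulrC; apply: ler_wpM2r; first exact: expR_ge0.
apply: le_trans (ler_normD _ _) _; rewrite normrN ger0_norm ?invr_ge0 ?(ltW e0)// lerD2l.
rewrite normrM [X in _ * X <= _]ger0_norm ?invr_ge0 ?(ltW D0)//.
apply: ler_wpM2r; first by rewrite invr_ge0 ltW.
apply: le_trans (ler_normB _ _) _; rewrite !normrM (gtr0_norm e0); apply: lerD.
  by rewrite ler_piMr// ler_norml sin_geN1 sin_le1.
by rewrite ler_piMr ?(ltW e0)// ler_norml cos_geN1 cos_le1.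
Qed.

Lemma Rint_exp_cos1 e t : 0 < e ->
  L1 mu1 (fun x => expR (- (e * `|x|)) * (1 + cos (t * x))) /\
  \int[mu1]_x (expR (- (e * `|x : R|)) * (1 + cos (t * (x : R)))) =
  2 * (e^-1 + e / (e ^+ 2 + t ^+ 2)).
Proof.
move=> e0.
have D0 : e ^+ 2 + t ^+ 2 != 0 by rewrite gt_eqF// ltr_pwDl ?sqr_ge0// exprn_gt0.
have cc (g : R -> R) : continuous g -> continuous (fun x => expR (- (e * g x)) * (1 + cos (t * x))).
  move=> cg x; apply: cvgM.
    apply: (@continuous_comp _ _ _ (fun x : R => - (e * g x)) expR); last exact: continuous_expR.
    by apply: cvgN; apply: cvgM; [exact: cvg_cst|exact: cg].
  apply: cvgD; first exact: cvg_cst.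
  apply: (@continuous_comp _ _ _ (fun x : R => t * x) cos); last exact: continuous_cos.
  by apply: cvgM; [exact: cvg_cst|exact: cvg_id].
have ca := cc _ (@norm_continuous R R^o); 
have ci : continuous (fun x => expR (- (e * x)) * (1 + cos (t * x))).
  by apply: (cc id) => x; exact: cvg_id.
have p (a b : R) : 0 <= expR a * (1 + cos b).
  by rewrite mulr_ge0 ?expR_ge0// -lerBlDl sub0r cos_geN1.
have E : (\int[lebesgue_measure]_x (expR (- (e * `|x|)) * (1 + cos (t * x)))%:E =
   (2 * (e^-1 + e / (e ^+ 2 + t ^+ 2)))%:E)%E.
  rewrite ge0_symfun_integralT//; last by move=> x /=; rewrite normrN mulrN cosN.
  rewrite -set_itvcy.
  have -> : (\int[lebesgue_measure]_(x in `[0%R, +oo[) (expR (- (e * `|x|)) * (1 + cos (t * x)))%:E =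
      \int[lebesgue_measure]_(x in `[0%R, +oo[) (expR (- (e * x)) * (1 + cos (t * x)))%:E)%E.
    by apply: eq_integral => x; rewrite inE/= in_itv/= andbT => x0; rewrite ger0_norm.
  rewrite (ge0_continuous_FTC2y (F := primitive e t) (l := 0))//.
  - rewrite /primitive !mulr0 oppr0 expR0 sin0 cos0 mulr0 sub0r mul1r mulr1 -EFinB -EFinM.
    by congr (_%:E); field; rewrite D0 gt_eqF.
  - exact: continuous_subspaceT.
  - exact: primitive_cvg.
  - apply: cvg_at_right_filter; apply: differentiable_continuous; apply/derivable1_diffP.
    by have := is_derive_primitive t 0 e0; case.
  - by move=> x _; rewrite derive1E; have := is_derive_primitive t x e0; case.
have l : L1 mu1 (fun x => expR (- (e * `|x|)) * (1 + cos (t * x))).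
  apply: L1_lty => //; first exact: continuous_measurable_fun.
  by rewrite [X in (X < _)%E]E ltry.
by split=> //; apply: EFin_inj; rewrite EFin_Rint//.
Qed.

Lemma L1_expabs e : 0 < e -> L1 mu1 (fun x => expR (- (e * `|x|))).
Proof.
move=> e0; have [l _] := Rint_exp_cos1 0 e0.
by apply: L1_eq (L1Z 2^-1 l) => x; rewrite mul0r cos0; field.
Qed.

Lemma L1_expabs_cos e t c : 0 < e -> L1 mu1 (fun x => cos (t * x + c) * expR (- (e * `|x|))).
Proof.
move=> e0; apply: L1_dom (L1_expabs e0) _.
  apply: continuous_measurable_fun => x; apply: cvgM.
    apply: (@continuous_comp _ _ _ (fun x : R => t * x + c) cos); last exact: continuous_cos.
    by apply: cvgD; [apply: cvgM; [exact: cvg_cst|exact: cvg_id]|exact: cvg_cst].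
  apply: (@continuous_comp _ _ _ (fun x : R => - (e * `|x|)) expR); last exact: continuous_expR.
  by apply: cvgN; apply: cvgM; [exact: cvg_cst|exact: norm_continuous].
move=> x; rewrite normrM [X in _ * X]ger0_norm ?expR_ge0// ler_piMl ?expR_ge0//.
by rewrite ler_norml cos_geN1 cos_le1.
Qed.

Lemma Rint_poisson e t c : 0 < e ->
  \int[mu1]_x (cos (t * (x : R) + c) * expR (- (e * `|x : R|))) =
  cos c * (2 * e / (e ^+ 2 + t ^+ 2)).
Proof.
move=> e0.
have l1 := L1_expabs_cos t 0 e0; have lc := L1_expabs_cos t c e0.
have [lt It] := Rint_exp_cos1 t e0; have [l0 I0] := Rint_exp_cos1 0 e0.
have D0 : e ^+ 2 + t ^+ 2 != 0 by rewrite gt_eqF// ltr_pwDl ?sqr_ge0// exprn_gt0.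
have E0 : \int[mu1]_x (cos (t * (x : R) + 0) * expR (- (e * `|x : R|))) = 2 * e / (e ^+ 2 + t ^+ 2).
  (* Half of the case [t = 0], where the factor [1 + cos] is 2, removes the summand 1. *)
  transitivity (\int[mu1]_x (expR (- (e * `|x : R|)) * (1 + cos (t * (x : R)))) -
    2^-1 * \int[mu1]_x (expR (- (e * `|x : R|)) * (1 + cos (0 * (x : R))))).
    rewrite -(RintZ _ l0) -(RintB lt (L1Z _ l0)); apply: Rint_eq => x.
    by rewrite mul0r cos0 addr0; field.
  by rewrite It I0; field; rewrite D0 !gt_eqF// ?addr_gt0// exprn_gt0.
have n1 : (-1 : R) != 0 by rewrite oppr_eq0 oner_eq0.
have h1 : 0 <= `|-1 : R|^-1 by rewrite invr_ge0.
have [lr Er] := scales_Rint (mu := mu1) h1 (scales_lebesgue 0 n1) lc.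
rewrite normrN1 invr1 mul1r in Er.
(* Averaging with the reflected integral keeps only the even part [cos c * cos (t * x)] of the
   shifted cosine. *)
transitivity (2^-1 * (\int[mu1]_x (cos (t * (x : R) + c) * expR (- (e * `|x : R|))) +
   \int[mu1]_x (cos (t * (-1 * (x : R) + 0) + c) * expR (- (e * `|-1 * (x : R) + 0|))))).
  by rewrite Er; field.
rewrite -(RintD lc lr) -(RintZ _ (L1D lc lr)) -E0 -(RintZ _ l1); apply: Rint_eq => x.
rewrite !addr0 mulN1r normrN mulrN -mulrDl !mulrA; congr (_ * _).
by rewrite !cosD cosN sinN; field.
Qed.

End poisson_kernel.

(** * Cosine transforms with a phase: decay and smoothness *)

Section waves.
Context {R : realType}.
Implicit Types (x y xi : R3 R) (h : R3 R -> R) (c : R).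

Lemma dotE x y : dot x y = x.1.1 * y.1.1 + x.1.2 * y.1.2 + x.2 * y.2.
Proof. by rewrite /dot sum3 /ecoord. Qed.

Lemma dotC x y : dot x y = dot y x.
Proof. by rewrite !dotE; congr (_ + _ + _); exact: mulrC. Qed.

Lemma dotDl x y z : dot (x + y) z = dot x z + dot y z.
Proof. by rewrite !dotE /=; ring. Qed.

Lemma dotZl (a : R) x y : dot (a *: x) y = a * dot x y.
Proof. by rewrite !dotE /= /GRing.scale/=; ring. Qed.

Lemma dotNl x y : dot (- x) y = - dot x y.
Proof. by rewrite !dotE /=; ring. Qed.

Lemma dot_evec x i : dot x (evec i) = ecoord i x.
Proof.
by move: i; apply: ord3P; rewrite dotE /evec /ecoord /= ?mulr0 ?mulr1 ?add0r ?addr0.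
Qed.

Lemma dot_cont y : continuous (dot y).
Proof.
have c1 : continuous (fun x : R3 R => x.1.1).
  by move=> x; apply: (@continuous_comp _ _ _ fst fst); apply: cvg_fst.
have c2 : continuous (fun x : R3 R => x.1.2).
  by move=> x; apply: (@continuous_comp _ _ _ fst snd); [apply: cvg_fst|apply: cvg_snd].
have c3 : continuous (fun x : R3 R => x.2) by move=> x; apply: cvg_snd.
rewrite (_ : dot y = fun x : R3 R => y.1.1 * x.1.1 + y.1.2 * x.1.2 + y.2 * x.2); last first.
  by apply/funext => x; exact: dotE.
move=> x; apply: cvgD; [apply: cvgD|]; (apply: cvgM; first exact: cvg_cst).
- exact: c1.
- exact: c2.
- exact: c3.
Qed.

(** The phase [c] replaces complex exponentials: 0 gives the cosine, [pi / 2] minus the sine, and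
    each derivative adds [pi / 2]. All transforms become real integrals. *)
Definition wave c y xi := cos (dot y xi + c).

Lemma waveC c y xi : wave c y xi = wave c xi y.
Proof. by rewrite /wave dotC. Qed.

Lemma wave_cont c y : continuous (wave c y).
Proof.
move=> xi; apply: (@continuous_comp _ _ _ (fun z : R3 R => dot y z + c) cos); last exact: continuous_cos.
by apply: cvgD; [exact: dot_cont|exact: cvg_cst].
Qed.

Lemma wave_le1 c y xi : `|wave c y xi| <= 1.
Proof. by rewrite ler_norml cos_geN1 cos_le1. Qed.

Lemma is_derive_wave c y xi i :
  is_derive xi (evec i) (wave c y) (ecoord i y * wave (c + pi / 2) y xi).
Proof.
apply/is_derive_lineP.
have E : (fun s : R => wave c y (xi + s *: evec i)) = fun s => cos (ecoord i y * s + (dot y xi + c)).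
  by apply/funext => s; rewrite /wave dotC dotDl dotZl ![dot _ y]dotC dot_evec mulrC addrAC addrC.
have h : is_derive (0 : R) 1 (fun s : R => ecoord i y * s + (dot y xi + c)) (ecoord i y + 0).
  by apply: is_deriveD; exact: is_derive_mulc.
have := @is_derive1_comp R cos (fun s => ecoord i y * s + (dot y xi + c)) 0 _ _
  (is_derive_cos (ecoord i y * 0 + (dot y xi + c))) h.
rewrite (_ : _ \o _ = fun s : R => cos (ecoord i y * s + (dot y xi + c)))// -E => H.
apply: (is_derive_eq H); rewrite mulr0 add0r addr0 /wave addrA cosDpihalf.
by rewrite mulrC.
Qed.

Lemma partial_wave c y i : partial i (wave c y) = fun xi => ecoord i y * wave (c + pi / 2) y xi.
Proof. by apply/funext => xi; apply: partial_val; exact: is_derive_wave. Qed.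

Lemma wave_Cn n c y : Cn n (wave c y).
Proof.
elim: n c => [|n ih] c; split=> //; try exact: wave_cont.
move=> i; split; first by move=> x; have := is_derive_wave c y x i; case.
by rewrite partial_wave; exact: (CnZ (ecoord i y) (ih _)).
Qed.

Lemma wave_shift_pi c y xi : wave (c + pi / 2 + pi / 2) y xi = - wave c y xi.
Proof. by rewrite /wave !addrA !cosDpihalf sinDpihalf. Qed.

Definition test_class r h : Prop := (forall n, Cn n h) /\ vanish r h.

Definition ct c h y := \int[mu3]_xi (wave c y xi * h xi).

Lemma test_class_L1 r h : test_class r h -> L1 mu3 h.
Proof. by move=> [ch vh]; exact: (vanish_L1 (Cn_cont (ch 0)) vh). Qed.

Lemma wave_L1 r c y h : test_class r h -> L1 mu3 (fun xi => wave c y xi * h xi).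
Proof.
move=> [ch vh]; apply: (L1_vanish_mul (r := r)) => //; first exact: wave_cont.
exact: (Cn_cont (ch 0)).
Qed.

Lemma ct_le r c h y : test_class r h -> `|ct c h y| <= \int[mu3]_xi `|h xi|.
Proof.
move=> th; apply: Rint_dom (L1_norm (test_class_L1 th)) _; first exact: (L1_measurable (wave_L1 c y th)).
by move=> xi; rewrite normrM ler_piMl// wave_le1.
Qed.

Lemma ct_cont r c h : test_class r h -> continuous (ct c h).
Proof.
move=> th y0; have lh := test_class_L1 th.
apply: (@continuous_Rint _ _ _ mu3 (fun y (xi : M3 R) => wave c y xi * h xi) (fun xi => `|h xi|) y0).
- by move=> y; exact: (L1_measurable (wave_L1 c y th)).
- move=> xi; rewrite (_ : (fun y => _) = fun y => wave c xi y * h xi).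
    by apply: cvgM; [exact: wave_cont|exact: cvg_cst].
  by apply/funext => y; rewrite waveC.
- exact: L1_norm.
- by move=> y xi _; rewrite normrM ler_piMl// wave_le1.
Qed.

(* [1 - d_i^2], which the cosine transform turns into [1 + y_i^2]. *)
Definition bessel i h := fun xi => h xi - partial i (partial i h) xi.

Lemma bessel_test r i h : test_class r h -> test_class r (bessel i h).
Proof.
move=> [ch vh]; split=> [n|].
  exact: (CnB (ch n) (CnS_partial i (CnS_partial i (ch n.+2)))).
move=> x rx; rewrite /bessel vh//.
by rewrite (vanish_partial i (vanish_partial i vh) _ rx) subrr.
Qed.

Lemma ct_bessel r c i h y : test_class r h ->
  ct c (bessel i h) y = (1 + ecoord i y ^+ 2) * ct c h y.
Proof.
move=> th; have [ch vh] := th.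
have c1 : Cn 1 (partial i h) := CnS_partial i (ch 2).
have v1 := vanish_partial i vh.
have l0 := wave_L1 c y th.
have t2 : test_class r (partial i (partial i h)).
  by split=> [n|]; [exact: (CnS_partial i (CnS_partial i (ch n.+2)))|exact: vanish_partial].
have E : \int[mu3]_xi (wave c y xi * partial i (partial i h) xi) = - (ecoord i y ^+ 2 * ct c h y).
  rewrite (Rint_parts_vanish i (wave_Cn 1 c y) c1 v1).
  have -> : \int[mu3]_xi (partial i (wave c y) xi * partial i h xi) =
     ecoord i y * \int[mu3]_xi (wave (c + pi / 2) y xi * partial i h xi).
    have t1 : test_class r (partial i h) by split=> [n|//]; exact: (CnS_partial i (ch n.+1)).
    rewrite -(RintZ _ (wave_L1 (c + pi / 2) y t1)); apply: Rint_eq => xi.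
    by rewrite partial_wave mulrA.
  rewrite (Rint_parts_vanish i (wave_Cn 1 (c + pi / 2) y) (ch 1) vh).
  have -> : \int[mu3]_xi (partial i (wave (c + pi / 2) y) xi * h xi) =
     - ecoord i y * ct c h y.
    rewrite /ct -(RintZ _ l0); apply: Rint_eq => xi.
    by rewrite partial_wave wave_shift_pi; ring.
  by ring.
rewrite /ct /bessel; transitivity (\int[mu3]_xi (wave c y xi * h xi) -
   \int[mu3]_xi (wave c y xi * partial i (partial i h) xi)).
  rewrite -(RintB l0 (wave_L1 c y t2)); apply: Rint_eq => xi; exact: mulrBr.
by rewrite E -/(ct c h y); ring.
Qed.

(** Applying [bessel] along the three axes multiplies the transform by [rho] and stays in the test
    class, so any power of [rho] is absorbed. The constant is uniform in the phase because
    [inversion] uses phases that vary with the frequency. *)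
Lemma ct_decay r h m : test_class r h -> exists2 C, 0 <= C & forall c y,
  `|ct c h y| <= C / rho y ^+ m.
Proof.
suff H : test_class r h -> exists2 C, 0 <= C & forall c y, rho y ^+ m * `|ct c h y| <= C.
  by move=> /H[C C0 hC]; exists C => // c y; rewrite ler_pdivlMr ?rhoX_gt0// mulrC.
elim: m h => [|m ih] h th.
  exists (\int[mu3]_xi `|h xi|); first by apply: Rint_ge0 => x; exact: normr_ge0.
  by move=> c y; rewrite expr0 mul1r; exact: (ct_le c y th).
have t1 := bessel_test j0 th; have t2 := bessel_test j1 t1; have t3 := bessel_test j2 t2.
have [C C0 hC] := ih _ t3; exists C => // c y.
apply: le_trans (hC c y); rewrite (ct_bessel c j2 y t2) (ct_bessel c j1 y t1) (ct_bessel c j0 y th).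
rewrite exprSr -mulrA !normrM; apply: ler_wpM2l; first exact: rhoX_ge0.
have p (a : R) : `|1 + a ^+ 2| = 1 + a ^+ 2 by rewrite ger0_norm// ltW// one_sqr_gt0.
rewrite !p /rho /ecoord /= le_eqVlt; apply/orP; left; apply/eqP; ring.
Qed.

Lemma ct_kern r c h m : test_class r h -> exists C, kern m C (ct c h).
Proof.
move=> th; have [C C0 hC] := ct_decay m th.
by exists C; split; [exact: ct_cont th|exact: hC].
Qed.

Lemma ecoord_Cn n i : Cn n (@ecoord R i).
Proof.
case: n => [|n]; last first.
  have d x j : is_derive x (evec j) (@ecoord R i) (ecoord i (evec j)).
    apply/is_derive_lineP.
    have -> : (fun s : R => ecoord i (x + s *: evec j)) = fun s => ecoord i (evec j) * s + ecoord i x.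
      apply/funext => s; rewrite -!dot_evec dotDl dotZl addrC mulrC//.
    rewrite -[X in is_derive _ _ _ X]addr0.
    by apply: is_deriveD; exact: is_derive_mulc.
  split.
    by have := @dot_cont (evec i); rewrite (_ : dot _ = @ecoord R i)//; apply/funext => x; rewrite dotC dot_evec.
  move=> j; split; first by move=> x; have := d x j; case.
  rewrite (_ : partial j _ = fun=> ecoord i (evec j)); first exact: Cn_cst.
  by apply/funext => x; exact: (partial_val (d x j)).
split=> //.
by have := @dot_cont (evec i); rewrite (_ : dot _ = @ecoord R i)//; apply/funext => x; rewrite dotC dot_evec.
Qed.

Lemma coord_mul_test r i h : test_class r h -> test_class r (fun xi => ecoord i xi * h xi).
Proof.
move=> [ch vh]; split=> [n|]; first exact: (CnM (ecoord_Cn n i) (ch n)).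
exact: vanish_mulr.
Qed.

(** A wave is symmetric in position and frequency, so its increment in [y] is a segment integral as
    well; Fubini's theorem moves that integral outside, in the form required by
    [is_derive_of_int]. *)
Lemma ct_diff r c h y i (s : R) : test_class r h ->
  ct c h (y + s *: evec i) - ct c h y =
  \int[m01]_t (s * ct (c + pi / 2) (fun xi => ecoord i xi * h xi) (y + (s * clamp t) *: evec i)).
Proof.
move=> th; have ti := coord_mul_test i th; have lh := test_class_L1 ti.
pose F (z : M3 R * measurableTypeR R) : R :=
  s * (wave (c + pi / 2) (y + (s * clamp z.2) *: evec i) z.1 * (ecoord i z.1 * h z.1)).
have mp : measurable_fun setT (fun z : M3 R * measurableTypeR R =>
    y + (s * clamp z.2) *: evec i : M3 R).
  apply: measurable_add3; first exact: measurable_cst.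
  apply: measurable_scale3; last exact: measurable_cst.
  apply: measurable_funM; first exact: measurable_cst.
  apply: measurableT_comp; last exact: measurable_snd.
  by apply: continuous_measurable_fun => a; exact: clamp_cont.
have mw : measurable_fun setT (fun z : M3 R * measurableTypeR R =>
    wave (c + pi / 2) (y + (s * clamp z.2) *: evec i) z.1).
  apply: measurableT_comp; first exact: continuous_measurable_fun (@continuous_cos R).
  apply: measurable_funD; last exact: measurable_cst.
  have [a1 a2 a3] := measurable_coords mp.
  have [b1 b2 b3] := measurable_coords (@measurable_fst _ _ (M3 R) (measurableTypeR R)).
  rewrite (_ : (fun z => _) = fun z : M3 R * measurableTypeR R =>
    (y + (s * clamp z.2) *: evec i).1.1 * z.1.1.1 +
    (y + (s * clamp z.2) *: evec i).1.2 * z.1.1.2 +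
    (y + (s * clamp z.2) *: evec i).2 * z.1.2); last by apply/funext => z; exact: dotE.
  exact: (measurable_funD (measurable_funD (measurable_funM a1 b1) (measurable_funM a2 b2)) (measurable_funM a3 b3)).
have lF : L1 (prod_measure mu3 m01) F.
  apply: (@L1_prod2 _ _ _ _ _ _ _ _ (fun _ : measurableTypeR R =>
     `|s| * \int[mu3]_xi `|ecoord i xi * h xi|)).
  - apply: measurable_funM; first exact: measurable_cst.
    apply: measurable_funM; first exact: mw.
    exact: (measurable_comp3 measurable_fst (Cn_cont (ti.1 0))).
  - by move=> t; exact: (L1Z s (wave_L1 (c + pi / 2) (y + (s * clamp t) *: evec i) ti)).
  - exact: L1_m01_cst.
  - move=> t; rewrite -(RintZ _ (L1_norm lh)).
    apply: Rint_le (L1_norm (L1Z s (wave_L1 (c + pi / 2) (y + (s * clamp t) *: evec i) ti))) (L1Z _ (L1_norm lh)) _ => xi.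
    by rewrite /F /= !normrM ler_wpM2l// ler_piMl ?mulr_ge0// wave_le1.
have := Rfubini lF; rewrite /F /= => FE.
transitivity (\int[mu3]_xi \int[m01]_t (s * (wave (c + pi / 2) (y + (s * clamp t) *: evec i) xi *
   (ecoord i xi * h xi)))).
  rewrite /ct -(RintB (wave_L1 c (y + s *: evec i) th) (wave_L1 c y th)); apply: Rint_eq => xi.
  rewrite -mulrBl !(waveC c _ xi) (diff01 y s i (wave_Cn 1 c xi)) partial_wave.
  rewrite -RintZr.
    by apply: Rint_eq => t; rewrite (waveC _ xi); ring.
  apply: (L1_m01 (g := fun a => s * (ecoord i xi * wave (c + pi / 2) xi (y + (s * a) *: evec i)))).
  move=> a; apply: cvgM; first exact: cvg_cst.
  apply: cvgM; first exact: cvg_cst.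
  exact: (@continuous_comp _ _ _ (fun a : R => y + (s * a) *: evec i) (wave (c + pi / 2) xi) a
    (@continuous_ray _ y s i a) (@wave_cont _ _ _)).
rewrite FE; apply: Rint_eq => t.
by rewrite /ct -(RintZ _ (wave_L1 (c + pi / 2) (y + (s * clamp t) *: evec i) ti)).
Qed.

Lemma ct_Cn r n c h : test_class r h -> Cn n (ct c h).
Proof.
elim: n c h => [|n ih] c h th; split=> //; try exact: ct_cont th.
move=> i; have ti := coord_mul_test i th.
have d y : is_derive y (evec i) (ct c h) (ct (c + pi / 2) (fun xi => ecoord i xi * h xi) y).
  by apply: is_derive_of_int; [exact: ct_cont ti|move=> s; exact: ct_diff th].
split; first by move=> y; have := d y; case.
rewrite (_ : partial i _ = ct (c + pi / 2) (fun xi => ecoord i xi * h xi)); first exact: ih.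
by apply/funext => y; exact: (partial_val (d y)).
Qed.

End waves.

(** * Fourier inversion on compactly supported smooth functions *)

Section inversion.
Context {R : realType}.
Implicit Types (x y xi t : R3 R) (h : R3 R -> R) (e c : R).

Let ex e (a : R) := expR (- (e * `|a|)).
Let pk e (a : R) := 2 * e / (e ^+ 2 + a ^+ 2).

(** An exponential convergence factor in each coordinate, chosen because its transform is explicit:
    a product of three Poisson kernels [pk]. *)
Definition poisson_weight e xi := ex e xi.1.1 * ex e xi.1.2 * ex e xi.2.

Lemma poisson_weight_L1 e : 0 < e -> L1 mu3 (poisson_weight e).
Proof. by move=> e0; have l := L1_expabs e0; exact: (L1_tensor3 l l l).1. Qed.

Lemma poisson_weight_ge0 e xi : 0 <= poisson_weight e xi.
Proof. by rewrite /poisson_weight !mulr_ge0 ?expR_ge0. Qed.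

Lemma poisson_weight_le1 e xi : 0 < e -> poisson_weight e xi <= 1.
Proof.
move=> e0; have h (a : R) : ex e a <= 1.
  by rewrite -expR0 ler_expR oppr_le0 mulr_ge0// ltW.
by rewrite /poisson_weight -[leRHS]mulr1 ler_pM ?mulr_ge0 ?expR_ge0// mulr_ile1 ?expR_ge0.
Qed.

Lemma wave_weight_L1 e t c : 0 < e -> L1 mu3 (fun xi => wave c t xi * poisson_weight e xi).
Proof.
move=> e0; have l := poisson_weight_L1 e0; apply: (L1_dom _ l).
  by apply: measurable_funM; [exact: (continuous_m (@wave_cont _ c t))|exact: (L1_measurable l)].
by move=> xi; rewrite normrM (ger0_norm (poisson_weight_ge0 _ _)) ler_piMl ?poisson_weight_ge0// wave_le1.
Qed.

Lemma Rint_wave_weight e t c : 0 < e ->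
  \int[mu3]_xi (wave c t xi * poisson_weight e xi) = cos c * (pk e t.1.1 * pk e t.1.2 * pk e t.2).
Proof.
move=> e0; have l := wave_weight_L1 t c e0.
have [l2 <-] := Rfubini1 (m1 := mu2) (m2 := mu1) l.
have E2 (p : measurableTypeR R * measurableTypeR R) :
    \int[mu1]_s (wave c t (p, s) * poisson_weight e (p, s)) =
    cos (t.1.1 * p.1 + t.1.2 * p.2 + c) * (ex e p.1 * ex e p.2) * pk e t.2.
  transitivity (\int[mu1]_s ((ex e p.1 * ex e p.2) *
     (cos (t.2 * (s : R) + (t.1.1 * p.1 + t.1.2 * p.2 + c)) * expR (- (e * `|s : R|))))).
    apply: Rint_eq => s; rewrite /wave dotE /poisson_weight /= /ex.
    rewrite (_ : t.1.1 * p.1 + t.1.2 * p.2 + t.2 * s + c = t.2 * s + (t.1.1 * p.1 + t.1.2 * p.2 + c)); last by ring.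
    by ring.
  by rewrite (RintZ _ (L1_expabs_cos _ _ e0)) Rint_poisson// /pk; ring.
have l3 : L1 mu2 (fun p => cos (t.1.1 * p.1 + t.1.2 * p.2 + c) * (ex e p.1 * ex e p.2) * pk e t.2).
  exact: (L1_eq E2 l2).
rewrite (Rint_eq mu2 E2).
have [_ <-] := Rfubini1 (m1 := mu1) (m2 := mu1) l3.
have E1 (a : R) : \int[mu1]_b (cos (t.1.1 * a + t.1.2 * (b : R) + c) * (ex e a * ex e b) * pk e t.2) =
    pk e t.2 * pk e t.1.2 * (cos (t.1.1 * a + c) * ex e a).
  transitivity (\int[mu1]_b ((ex e a * pk e t.2) *
     (cos (t.1.2 * (b : R) + (t.1.1 * a + c)) * expR (- (e * `|b : R|))))).
    apply: Rint_eq => b; rewrite /= /ex.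
    rewrite (_ : t.1.1 * a + t.1.2 * b + c = t.1.2 * b + (t.1.1 * a + c)); last by ring.
    by ring.
  by rewrite (RintZ _ (L1_expabs_cos _ _ e0)) Rint_poisson// -/(pk e t.1.2); ring.
rewrite (Rint_eq mu1 E1) (RintZ _ (L1_expabs_cos _ _ e0)) Rint_poisson// -/(pk e t.1.1).
by ring.
Qed.

(** The phase carries the point: [- (dot x xi + c)] stands for a wave in [x - y]. The values 0 and
    [pi / 2] of [c] will give the real and the imaginary part of the inversion formula. *)
Lemma wave_conv r h x xi c : test_class r h ->
  \int[mu3]_y (wave c (x - (y : R3 R)) xi * h y) = ct (- (dot x xi + c)) h xi.
Proof.
move=> th; apply: Rint_eq => y; congr (_ * _).
rewrite /wave -cosN dotDl dotNl [dot xi y]dotC; congr cos; ring.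
Qed.

Lemma measurable_wave_sub x c : measurable_fun setT
  (fun z : M3 R * M3 R => wave c (x - (z.2 : R3 R)) z.1).
Proof.
apply: measurableT_comp; first exact: continuous_measurable_fun (@continuous_cos R).
apply: measurable_funD; last exact: measurable_cst.
have mp : measurable_fun setT (fun z : M3 R * M3 R => x - (z.2 : R3 R) : M3 R).
  by apply: measurable_sub3; [exact: measurable_cst|exact: measurable_snd].
have [a1 a2 a3] := measurable_coords mp.
have [b1 b2 b3] := measurable_coords (@measurable_fst _ _ (M3 R) (M3 R)).
rewrite (_ : (fun z => _) = fun z : M3 R * M3 R =>
  (x - (z.2 : R3 R)).1.1 * z.1.1.1 + (x - (z.2 : R3 R)).1.2 * z.1.1.2 +
  (x - (z.2 : R3 R)).2 * z.1.2); last by apply/funext => z; exact: dotE.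
exact: (measurable_funD (measurable_funD (measurable_funM a1 b1) (measurable_funM a2 b2)) (measurable_funM a3 b3)).
Qed.

Lemma test_class_shift_scale r h x e : test_class r h -> e != 0 ->
  L1 mu3 (fun z => h (x - e *: z) * (8 / rho z)).
Proof.
move=> [ch vh] e0; have [C C0 hC] := vanish_bounded (Cn_cont (ch 0)) vh.
have hx : continuous (fun z : R3 R => h (x - e *: z)).
  have := Cn_cont (Cn_affine (- e) x (ch 0)).
  by rewrite (_ : (fun z : R3 R => h (- e *: z + x)) = fun z => h (x - e *: z))//;
    apply/funext => z; rewrite scaleNr addrC.
have lr := L1Z 8 (@L1_rhoV R).
apply: L1_dom (L1Z C lr) _.
  by apply: measurable_funM; [exact: continuous_m hx|exact: L1_measurable lr].
move=> z; rewrite normrM [X in _ * X]ger0_norm; last by rewrite mulr_ge0// invr_ge0 ltW// rho_gt0.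
by apply: ler_wpM2r; first by rewrite mulr_ge0// invr_ge0 ltW// rho_gt0.
Qed.

Lemma poisson_scaled (a e : R) : 0 < e ->
  2 * e / (e ^+ 2 + (e * a) ^+ 2) = 2 * e^-1 * (1 + a ^+ 2)^-1.
Proof.
move=> e0; have h1 : e ^+ 2 + (e * a) ^+ 2 != 0.
  by rewrite gt_eqF// ltr_pwDl ?sqr_ge0// exprn_gt0.
have h2 : 1 + a ^+ 2 != 0 by rewrite gt_eqF// one_sqr_gt0.
by field; rewrite h1 h2 gt_eqF.
Qed.

(* After the substitution y = x - e z the product of Poisson kernels becomes 8 / rho z. *)
Lemma inversion_weighted r h x c e : test_class r h -> 0 < e ->
  \int[mu3]_xi (ct (- (dot x xi + c)) h xi * poisson_weight e xi) =
  cos c * \int[mu3]_z (h (x - e *: (z : R3 R)) * (8 / rho z)).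
Proof.
move=> th e0; have lh := test_class_L1 th; have lp := poisson_weight_L1 e0.
pose H (z : M3 R * M3 R) : R := poisson_weight e z.1 * (wave c (x - (z.2 : R3 R)) z.1 * h z.2).
have lH : L1 (prod_measure mu3 mu3) H.
  have [lt _] := L1_tensor (L1_norm lp) (L1_norm lh).
  apply: L1_dom lt _.
    apply: measurable_funM; first by apply: measurableT_comp (L1_measurable lp) measurable_fst.
    apply: measurable_funM; first exact: measurable_wave_sub.
    by apply: measurableT_comp (L1_measurable lh) measurable_snd.
  by move=> z; rewrite /H !normrM; apply: ler_wpM2l => //; rewrite ler_piMl// wave_le1.
have FE := Rfubini lH; rewrite /H /= in FE.
have lw xi : L1 mu3 (fun y : R3 R => wave c (x - y) xi * h y).
  apply: L1_eq (wave_L1 (- (dot x xi + c)) xi th) => y; congr (_ * _).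
  by rewrite /wave -cosN dotDl dotNl [dot xi y]dotC; congr cos; ring.
transitivity (\int[mu3]_y \int[mu3]_xi
    (poisson_weight e xi * (wave c (x - (y : R3 R)) xi * h y))).
  rewrite -FE; apply: Rint_eq => xi; rewrite -(wave_conv x xi c th) (RintZ _ (lw xi)).
  exact: mulrC.
pose g y := cos c * (h y * (pk e (x - y).1.1 * pk e (x - y).1.2 * pk e (x - y).2)).
have Eg y : \int[mu3]_xi (poisson_weight e xi * (wave c (x - y) xi * h y)) = g y.
  rewrite /g mulrCA -(Rint_wave_weight (x - y) c e0) -(RintZ _ (wave_weight_L1 (x - y) c e0)).
  by apply: Rint_eq => xi; ring.
have lg : L1 mu3 g.
  have := (Rfubini2 lH).1; rewrite /H /= (_ : (fun y : M3 R => _) = g)//.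
  by apply/funext => y; exact: Eg.
rewrite (Rint_eq mu3 Eg).
have en : - e != 0 by rewrite oppr_eq0 gt_eqF.
have [la Ea] := Rint_affine x en lg.
have -> : \int[mu3]_y g y = e ^+ 3 * \int[mu3]_z g (- e *: (z : R3 R) + x).
  by rewrite Ea normrN (gtr0_norm e0) mulrA mulfV ?mul1r// expf_neq0// gt_eqF.
rewrite -(RintZ _ la) -(RintZ _ (test_class_shift_scale x th _)) ?gt_eqF//.
apply: Rint_eq => z; rewrite /g.
rewrite (_ : - e *: z + x = x - e *: z); last by rewrite scaleNr addrC.
rewrite opprB addrCA subrr addr0 /pk /rho /= /GRing.scale/=.
have k (a : R) := poisson_scaled a e0.
rewrite !k !invfM; move: (h _) ((1 + _)^-1) ((1 + _)^-1) ((1 + _)^-1) (cos c) => p q s w v.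
by field; rewrite gt_eqF.
Qed.

Lemma Rint_rhoV : \int[mu3]_x (rho (x : R3 R))^-1 = pi ^+ 3.
Proof.
have [l E] := @int_cauchy R; have [_ h] := L1_tensor3 l l l.
rewrite E in h; rewrite !exprS expr0 mulr1 mulrA -h; apply: Rint_eq => x.
by rewrite /rho !invfM.
Qed.

Lemma ct_phase_cont r h x c : test_class r h -> continuous (fun xi => ct (- (dot x xi + c)) h xi).
Proof.
move=> th y0; have lh := test_class_L1 th.
have lw xi := wave_L1 (- (dot x xi + c)) xi th.
apply: (@continuous_Rint _ _ _ mu3 (fun xi (y : M3 R) => wave (- (dot x xi + c)) xi y * h y)
  (fun y => `|h y|) y0).
- by move=> xi; exact: L1_measurable (lw xi).
- move=> y; rewrite (_ : (fun xi => _) = fun xi => wave c (x - y) xi * h y).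
    by apply: cvgM; [exact: wave_cont|exact: cvg_cst].
  apply/funext => xi; congr (_ * _).
  by rewrite /wave -cosN dotDl dotNl [dot xi y]dotC; congr cos; ring.
- exact: L1_norm.
- by move=> xi y _; rewrite normrM ler_piMl// wave_le1.
Qed.

(* Abel summation with the weights [poisson_weight e], as e tends to 0. *)
Lemma inversion r h x c : test_class r h ->
  L1 mu3 (fun xi => ct (- (dot x xi + c)) h xi) /\
  \int[mu3]_xi ct (- (dot x xi + c)) h xi = (2 * pi) ^+ 3 * cos c * h x.
Proof.
move=> th; have [ch vh] := th; have [C C0 hC] := ct_decay 1 th.
have [B B0 hB] := vanish_bounded (Cn_cont (ch 0)) vh.
have cF := @ct_phase_cont r h x c th.
have lr := L1Z C (@L1_rhoV R).
have domF xi : `|ct (- (dot x xi + c)) h xi| <= C * (rho xi)^-1.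
  by have := hC (- (dot x xi + c)) xi; rewrite expr1.
have lF : L1 mu3 (fun xi => ct (- (dot x xi + c)) h xi) := L1_dom (continuous_m cF) lr domF.
split=> //.
pose e (n : nat) : R := n.+1%:R^-1; have e0 n : 0 < e n by rewrite invr_gt0.
have ce : e n @[n --> \oo] --> (0 : R) by exact: cvg_harmonic.
have lim1 : (fun n => \int[mu3]_xi (ct (- (dot x xi + c)) h xi * poisson_weight (e n) xi)) @ \oo -->
    \int[mu3]_xi ct (- (dot x xi + c)) h xi.
  apply: (@Rdct _ _ _ mu3 (fun n (xi : R3 R) => ct (- (dot x xi + c)) h xi * poisson_weight (e n) xi)
    (fun xi => ct (- (dot x xi + c)) h xi) (fun xi => C * (rho xi)^-1) _ _ lr _).2.
  - move=> n; apply: measurable_funM; first exact: continuous_m cF.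
    exact: L1_measurable (poisson_weight_L1 (e0 n)).
  - move=> xi; rewrite -[X in _ --> X]mulr1; apply: cvgM; first exact: cvg_cst.
    have hx (a : R) : ex (e n) a @[n --> \oo] --> (1 : R).
      have h0 : - (e n * `|a|) @[n --> \oo] --> (0 : R).
        rewrite -[X in _ --> X]oppr0 -(mul0r `|a|); apply: cvgN; apply: cvgM; first exact: ce.
        exact: cvg_cst.
      by rewrite -expR0; apply: (cvg_comp _ _ h0 (@continuous_expR R 0)).
    rewrite -[X in _ --> X]mulr1 -[X in X * 1]mulr1; apply: cvgM; last exact: hx.
    by apply: cvgM; exact: hx.
  - move=> n xi; rewrite normrM; apply: le_trans (domF xi).
    rewrite ler_piMr// ger0_norm ?poisson_weight_ge0//; exact: poisson_weight_le1.
have lr8 := L1Z B (L1Z 8 (@L1_rhoV R)).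
have lim2 : (fun n => \int[mu3]_z (h (x - e n *: (z : R3 R)) * (8 / rho z))) @ \oo -->
    \int[mu3]_z (h x * (8 / rho z)).
  apply: (@Rdct _ _ _ mu3 (fun n (z : R3 R) => h (x - e n *: z) * (8 / rho z))
    (fun z => h x * (8 / rho z)) (fun z => B * (8 * (rho z)^-1)) _ _ lr8 _).2.
  - by move=> n; exact: L1_measurable (test_class_shift_scale x th (lt0r_neq0 (e0 n))).
  - move=> z; apply: cvgM; last exact: cvg_cst.
    have h0 : x - e n *: z @[n --> \oo] --> x.
      rewrite -[X in _ --> X]subr0 -(scale0r z); apply: cvgB; first exact: cvg_cst.
      by apply: cvgZ; [exact: ce|exact: cvg_cst].
    by apply: (cvg_comp _ _ h0 (@Cn_cont _ 0 h (ch 0) x)).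
  - move=> n z; rewrite normrM [X in _ * X <= _]ger0_norm; last by rewrite mulr_ge0// invr_ge0 ltW// rho_gt0.
    by apply: ler_wpM2r => //; rewrite mulr_ge0// invr_ge0 ltW// rho_gt0.
have lim3 : (fun n => cos c * \int[mu3]_z (h (x - e n *: (z : R3 R)) * (8 / rho z))) @ \oo -->
    cos c * \int[mu3]_z (h x * (8 / rho z)) by apply: cvgM; [exact: cvg_cst|exact: lim2].
have E : (fun n => \int[mu3]_xi (ct (- (dot x xi + c)) h xi * poisson_weight (e n) xi)) =
   fun n => cos c * \int[mu3]_z (h (x - e n *: (z : R3 R)) * (8 / rho z)).
  by apply/funext => n; exact: inversion_weighted th (e0 n).
rewrite E in lim1.
rewrite (cvg_unique _ lim1 lim3)//.
(* The mass [8 * pi ^ 3] of [8 / rho] is the constant [(2 * pi) ^ 3]. *)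
have l8 := L1Z 8 (@L1_rhoV R).
by rewrite (RintZ _ l8) (RintZ _ (@L1_rhoV R)) Rint_rhoV; ring.
Qed.

End inversion.

(** * Fourier multipliers *)

Section complex_transform.
Local Open Scope complex_scope.
Context {R : realType}.
Implicit Types (x y xi : R3 R) (h : R3 R -> R) (phi : R3 R -> R[i]).

Definition cpi : R := (2 * pi) `^ (- (3 / 2)).

Lemma cpi_sqr : cpi * cpi = ((2 * pi) ^+ 3)^-1.
Proof.
have p0 : 0 < 2 * pi :> R by rewrite mulr_gt0// pi_gt0.
rewrite /cpi -powRD; last by rewrite (gt_eqF p0) implybT.
rewrite (_ : - (3 / 2) + - (3 / 2) = - 3%:R); last by field.
by rewrite powRN powR_mulrn ?(ltW p0).
Qed.

Lemma tau3_neq0 : (2 * pi) ^+ 3 != 0 :> R.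
Proof. by rewrite expf_neq0// mulf_neq0// gt_eqF// pi_gt0. Qed.

Lemma Re_realM (a : R) (z : R[i]) : complex.Re (a%:C * z) = a * complex.Re z.
Proof. by case: z => p q /=; rewrite mul0r subr0. Qed.

Lemma Im_realM (a : R) (z : R[i]) : complex.Im (a%:C * z) = a * complex.Im z.
Proof. by case: z => p q /=; rewrite mul0r addr0. Qed.

Definition L1c h : Prop := continuous h /\ L1 mu3 h.

Lemma L1c_test r h : test_class r h -> L1c h.
Proof. by move=> th; split; [exact: (Cn_cont (th.1 0))|exact: test_class_L1 th]. Qed.

Lemma L1c_wave c y h : L1c h -> L1 mu3 (fun x => wave c y x * h x).
Proof. by move=> [ch lh]; apply: (L1_bounded_mul (C := 1)) => //; [exact: wave_cont|exact: wave_le1]. Qed.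

Lemma L1cZ (a : R) h : L1c h -> L1c (fun x => a * h x).
Proof.
by move=> [ch lh]; split; [move=> x; apply: cvgM; [exact: cvg_cst|exact: ch]|exact: L1Z].
Qed.

Lemma L1cD h h' : L1c h -> L1c h' -> L1c (fun x => h x + h' x).
Proof.
by move=> [ch lh] [ch' lh']; split; [move=> x; apply: cvgD; [exact: ch|exact: ch']|exact: L1D].
Qed.

Lemma L1cB h h' : L1c h -> L1c h' -> L1c (fun x => h x - h' x).
Proof.
by move=> [ch lh] [ch' lh']; split; [move=> x; apply: cvgB; [exact: ch|exact: ch']|exact: L1B].
Qed.

Lemma ct_L1c r c h : test_class r h -> L1c (ct c h).
Proof.
move=> th; split; first exact: ct_cont th.
by have [C hC] := ct_kern c 1 th; exact: kern_L1 hC.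
Qed.

Lemma ctZ c (a : R) h y : L1c h -> ct c (fun x => a * h x) y = a * ct c h y.
Proof.
by move=> lh; rewrite /ct -(RintZ a (L1c_wave c y lh)); apply: Rint_eq => x; rewrite mulrCA.
Qed.

Lemma ctD c h h' y : L1c h -> L1c h' -> ct c (fun x => h x + h' x) y = ct c h y + ct c h' y.
Proof.
move=> lh lh'; rewrite /ct -(RintD (L1c_wave c y lh) (L1c_wave c y lh')).
by apply: Rint_eq => x; rewrite mulrDr.
Qed.

Lemma ctB c h h' y : L1c h -> L1c h' -> ct c (fun x => h x - h' x) y = ct c h y - ct c h' y.
Proof.
move=> lh lh'; rewrite /ct -(RintB (L1c_wave c y lh) (L1c_wave c y lh')).
by apply: Rint_eq => x; rewrite mulrBr.
Qed.

Lemma fourierE phi : L1c (fun x => complex.Re (phi x)) -> L1c (fun x => complex.Im (phi x)) ->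
  fourier phi = fun xi =>
  (cpi * (ct 0 (fun x => complex.Re (phi x)) xi - ct (pi / 2) (fun x => complex.Im (phi x)) xi))
  +i* (cpi * (ct 0 (fun x => complex.Im (phi x)) xi + ct (pi / 2) (fun x => complex.Re (phi x)) xi)).
Proof.
move=> l1 l2; apply/funext => xi; rewrite /fourier -/cpi /cint leb3E.
have w1 x : wave 0 xi x = cos (- dot x xi) by rewrite /wave addr0 dotC cosN.
have w2 x : wave (pi / 2) xi x = sin (- dot x xi) by rewrite /wave dotC cosDpihalf sinN.
apply/eqP; rewrite eq_complex Re_realM Im_realM /=; apply/andP; split; apply/eqP; congr (_ * _).
  rewrite /ct -(RintB (L1c_wave 0 xi l1) (L1c_wave (pi / 2) xi l2)); apply: Rint_eq => x.
  by rewrite w1 w2 /cexpi; case: (phi x).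
rewrite /ct -(RintD (L1c_wave 0 xi l2) (L1c_wave (pi / 2) xi l1)); apply: Rint_eq => x.
by rewrite w1 w2 /cexpi; case: (phi x).
Qed.

Lemma ifourierE phi : L1c (fun x => complex.Re (phi x)) -> L1c (fun x => complex.Im (phi x)) ->
  ifourier phi = fun xi =>
  (cpi * (ct 0 (fun x => complex.Re (phi x)) xi + ct (pi / 2) (fun x => complex.Im (phi x)) xi))
  +i* (cpi * (ct 0 (fun x => complex.Im (phi x)) xi - ct (pi / 2) (fun x => complex.Re (phi x)) xi)).
Proof.
move=> l1 l2; apply/funext => xi; rewrite /ifourier -/cpi /cint leb3E.
have w1 x : wave 0 xi x = cos (dot xi x) by rewrite /wave addr0.
have w2 x : wave (pi / 2) xi x = - sin (dot xi x) by rewrite /wave cosDpihalf.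
apply/eqP; rewrite eq_complex Re_realM Im_realM /=; apply/andP; split; apply/eqP; congr (_ * _).
  rewrite /ct -(RintD (L1c_wave 0 xi l1) (L1c_wave (pi / 2) xi l2)); apply: Rint_eq => x.
  by rewrite w1 w2 /cexpi; case: (phi x) => p q /=; ring.
rewrite /ct -(RintB (L1c_wave 0 xi l2) (L1c_wave (pi / 2) xi l1)); apply: Rint_eq => x.
by rewrite w1 w2 /cexpi; case: (phi x) => p q /=; ring.
Qed.

Lemma ct_phase0 r h x xi : test_class r h -> ct (- (dot x xi + 0)) h xi =
  wave 0 x xi * ct 0 h xi + wave (pi / 2) x xi * ct (pi / 2) h xi.
Proof.
move=> th; have l0 := wave_L1 0 xi th; have l1 := wave_L1 (pi / 2) xi th.
rewrite /ct -(RintZ _ l0) -(RintZ _ l1) -(RintD (L1Z _ l0) (L1Z _ l1)); apply: Rint_eq => y.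
rewrite /wave !addr0 !cosDpihalf cosB; ring.
Qed.

Lemma ct_phase1 r h x xi : test_class r h -> ct (- (dot x xi + pi / 2)) h xi =
  wave (pi / 2) x xi * ct 0 h xi - wave 0 x xi * ct (pi / 2) h xi.
Proof.
move=> th; have l0 := wave_L1 0 xi th; have l1 := wave_L1 (pi / 2) xi th.
rewrite /ct -(RintZ _ l0) -(RintZ _ l1) -(RintB (L1Z _ l0) (L1Z _ l1)); apply: Rint_eq => y.
rewrite /wave !addr0 !cosDpihalf cosB cosDpihalf sinDpihalf; ring.
Qed.

Definition ctest r phi : Prop :=
  test_class r (fun x => complex.Re (phi x)) /\ test_class r (fun x => complex.Im (phi x)).

(** [inversion] at the phases 0 and [pi / 2], with the shifted wave expanded by the addition
    formulas. The first recovers [h]; the second gives 0 since [cos (pi / 2) = 0], which cancels the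
    cross terms. *)
Lemma inv_pair r h x : test_class r h ->
  [/\ L1 mu3 (fun xi => wave 0 x xi * ct 0 h xi), L1 mu3 (fun xi => wave (pi / 2) x xi * ct (pi / 2) h xi),
      L1 mu3 (fun xi => wave (pi / 2) x xi * ct 0 h xi), L1 mu3 (fun xi => wave 0 x xi * ct (pi / 2) h xi) &
  ct 0 (ct 0 h) x + ct (pi / 2) (ct (pi / 2) h) x = (2 * pi) ^+ 3 * h x /\
  ct (pi / 2) (ct 0 h) x = ct 0 (ct (pi / 2) h) x].
Proof.
move=> th; have l0 := ct_L1c 0 th; have l1 := ct_L1c (pi / 2) th.
have a00 := L1c_wave 0 x l0; have a11 := L1c_wave (pi / 2) x l1.
have a10 := L1c_wave (pi / 2) x l0; have a01 := L1c_wave 0 x l1.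
split; [exact: a00|exact: a11|exact: a10|exact: a01|split].
  have [_ e] := inversion x 0 th; rewrite cos0 mulr1 in e; rewrite -e /ct -(RintD a00 a11).
  by apply: Rint_eq => xi; rewrite -(ct_phase0 x xi th).
have [_ e] := inversion x (pi / 2) th; rewrite cos_pihalf mulr0 mul0r in e.
apply/eqP; rewrite -subr_eq0; apply/eqP; apply: (etrans _ e).
apply: etrans (esym (RintB a10 a01)) _.
by apply: Rint_eq => xi; rewrite -(ct_phase1 x xi th).
Qed.

(** Serves to compose multipliers: between two of them the test function undergoes a transform and
    its inverse. *)
Lemma ifourier_fourier r phi : ctest r phi -> ifourier (fourier phi) = phi.
Proof.
move=> [t1 t2]; have l1 := L1c_test t1; have l2 := L1c_test t2.
rewrite (fourierE l1 l2).
pose p1 x := complex.Re (phi x); pose p2 x := complex.Im (phi x).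
have a1 := ct_L1c 0 t1; have a2 := ct_L1c 0 t2.
have b1 := ct_L1c (pi / 2) t1; have b2 := ct_L1c (pi / 2) t2.
have d1 := L1cB a1 b2; have d2 := L1cD a2 b1.
rewrite ifourierE /=; [|exact: (L1cZ cpi d1)|exact: (L1cZ cpi d2)].
apply/funext => x.
have [_ _ _ _ [e1 e1']] := inv_pair x t1; have [_ _ _ _ [e2 e2']] := inv_pair x t2.
rewrite !(ctZ _ _ _ d1) !(ctZ _ _ _ d2) !(ctB _ _ a1 b2) !(ctD _ _ a2 b1).
rewrite [RHS](_ : _ = p1 x +i* p2 x); last by rewrite /p1 /p2; case: (phi x).
move: e1 e1' e2 e2'; rewrite -/p1 -/p2 -/(p1 x) -/(p2 x).
move: (ct 0 (ct 0 _) x) (ct 0 (ct 0 _) x) (ct (pi / 2) (ct (pi / 2) _) x) (ct (pi / 2) (ct (pi / 2) _) x) => c1 c2 c3 c4.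
move: (ct 0 (ct _ _) x) (ct 0 (ct _ _) x) (ct _ (ct 0 _) x) (ct _ (ct 0 _) x) => c5 c6 c7 c8.
move=> e1 e1' e2 e2'.
have sq (a : R) : cpi * (cpi * ((2 * pi) ^+ 3 * a)) = a by rewrite mulrA cpi_sqr mulKf// tau3_neq0.
apply/eqP; rewrite eq_complex /=; apply/andP; split; apply/eqP.
  rewrite -[RHS]sq; congr (_ * _); rewrite -mulrDr; congr (_ * _); lra.
rewrite -[RHS]sq; congr (_ * _); rewrite -mulrBr; congr (_ * _); lra.
Qed.

End complex_transform.

Section multipliers.
Local Open Scope complex_scope.
Context {R : realType}.
Implicit Types (x y xi : R3 R) (h m f : R3 R -> R) (phi : R3 R -> R[i]).

Definition ofr h : R3 R -> R[i] := fun x => (h x)%:C.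

(** The real part of the convolution kernel of the multiplier [m]. For [m] not even the full kernel
    is complex; its real part is always even, and it is all that the real part of a pairing of real
    functions sees. *)
Definition mkern m y : R := ((2 * pi) ^+ 3)^-1 * ct 0 m y.

Lemma mkern_kern r m n : test_class r m -> exists C, kern n C (mkern m).
Proof.
move=> tm; have [C [cK hK]] := ct_kern 0 n tm; exists (`|((2 * pi : R) ^+ 3)^-1| * C); split.
  by move=> y; apply: cvgM; [exact: cvg_cst|exact: cK].
by move=> y; rewrite normrM -mulrA; apply: ler_wpM2l => //; exact: normr_ge0.
Qed.

Lemma mkern_even m y : mkern m (- y) = mkern m y.
Proof.
congr (_ * _); apply: Rint_eq => xi; congr (_ * _).
by rewrite /wave !addr0 dotNl cosN.
Qed.

(** Fourier inversion at the origin. *)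
Lemma mkern_int r m : test_class r m -> \int[mu3]_y mkern m y = m 0.
Proof.
move=> tm; have [l e] := inversion 0 0 tm; have l0 := (ct_L1c 0 tm).2.
rewrite /mkern (RintZ _ l0).
have -> : \int[mu3]_y ct 0 m y = (2 * pi) ^+ 3 * m 0.
  rewrite cos0 mulr1 in e; rewrite -e; apply: Rint_eq => y.
  by rewrite addr0 dotE /= !mul0r !addr0 oppr0.
by rewrite mulKf// tau3_neq0.
Qed.

Lemma test_classB r h h' : test_class r h -> test_class r h' -> test_class r (fun x => h x - h' x).
Proof.
move=> [ch vh] [ch' vh']; split=> [n|x rx]; first exact: CnB.
by rewrite vh// vh'// subrr.
Qed.

Lemma mkernB r m m' y : test_class r m -> test_class r m' ->
  mkern (fun x => m x - m' x) y = mkern m y - mkern m' y.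
Proof. by move=> tm tm'; rewrite /mkern (ctB _ _ (L1c_test tm) (L1c_test tm')) mulrBr. Qed.

Lemma ct_zero c y : ct c (fun=> 0 : R) y = 0.
Proof. by rewrite /ct -[RHS](@Rint0 _ _ _ mu3); apply: Rint_eq => x; rewrite mulr0. Qed.

Lemma L1c0 : L1c (fun _ : R3 R => 0 : R).
Proof. by split; [move=> x; exact: cvg_cst|exact: L1_0]. Qed.

Lemma ifourier_ofr r h : test_class r h -> ifourier (ofr h) =
  fun xi => (cpi * ct 0 h xi) +i* (- (cpi * ct (pi / 2) h xi)).
Proof.
move=> th; rewrite ifourierE; [|exact: (L1c_test th)|exact: L1c0].
by apply/funext => xi; rewrite /ofr /= !ct_zero addr0 sub0r mulrN.
Qed.

Lemma mult_ctest r r' m h : test_class r m -> test_class r' h ->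
  ctest r (fun xi => (m xi)%:C * ifourier (ofr h) xi).
Proof.
move=> [cm vm] th; rewrite (ifourier_ofr th); split.
  rewrite (_ : (fun x => _) = fun x => m x * (cpi * ct 0 h x)); last first.
    by apply/funext => x; rewrite Re_realM.
  by split=> [n|]; [exact: (CnM (cm n) (CnZ cpi (ct_Cn n 0 th)))|exact: vanish_mull].
rewrite (_ : (fun x => _) = fun x => m x * (- (cpi * ct (pi / 2) h x))); last first.
  by apply/funext => x; rewrite Im_realM.
by split=> [n|]; [exact: (CnM (cm n) (CnN (CnZ cpi (ct_Cn n (pi / 2) th))))|exact: vanish_mull].
Qed.

(** The two factors [cpi] combine to [(2 * pi) ^- 3] and the phases 0 and [pi / 2] recombine into a
    wave in [x - y]; by Fubini's theorem it is then [m] that gets transformed instead of [h]. *)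
Lemma mult_re r r' m h x : test_class r m -> test_class r' h ->
  complex.Re (fourier (fun xi => (m xi)%:C * ifourier (ofr h) xi) x) =
  \int[mu3]_y (h y * mkern m (x - (y : R3 R))).
Proof.
move=> tm th; have [t1 t2] := mult_ctest tm th.
have [cm vm] := tm; have lm := test_class_L1 tm; have lh := test_class_L1 th.
rewrite (fourierE (L1c_test t1) (L1c_test t2)) /=.
have E1 : (fun x => complex.Re ((m x)%:C * ifourier (ofr h) x)) = fun x => cpi * (m x * ct 0 h x).
  by apply/funext => xi; rewrite (ifourier_ofr th) Re_realM /= mulrCA.
have E2 : (fun x => complex.Im ((m x)%:C * ifourier (ofr h) x)) = fun x => (- cpi) * (m x * ct (pi / 2) h x).
  by apply/funext => xi; rewrite (ifourier_ofr th) Im_realM /= mulrN mulNr mulrCA.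
have s0 : test_class r (fun x => m x * ct 0 h x).
  by split=> [n|]; [exact: (CnM (cm n) (ct_Cn n 0 th))|exact: vanish_mull].
have s1 : test_class r (fun x => m x * ct (pi / 2) h x).
  by split=> [n|]; [exact: (CnM (cm n) (ct_Cn n (pi / 2) th))|exact: vanish_mull].
rewrite E1 E2 (ctZ 0 cpi x (L1c_test s0)) (ctZ (pi / 2) (- cpi) x (L1c_test s1)).
rewrite mulNr opprK -mulrDr mulrA cpi_sqr.
have w0 := L1c_wave 0 x (L1c_test s0); have w1 := L1c_wave (pi / 2) x (L1c_test s1).
pose F (z : M3 R * M3 R) : R := m z.1 * (wave 0 (x - (z.2 : R3 R)) z.1 * h z.2).
have lF : L1 (prod_measure mu3 mu3) F.
  have [lt _] := L1_tensor (L1_norm lm) (L1_norm lh).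
  apply: (L1_dom _ lt).
    apply: measurable_funM; first by exact: (measurableT_comp (L1_measurable lm) measurable_fst).
    apply: measurable_funM; first exact: measurable_wave_sub.
    by exact: (measurableT_comp (L1_measurable lh) measurable_snd).
  by move=> z; rewrite /F !normrM; apply: ler_wpM2l => //; rewrite ler_piMl// wave_le1.
have FE := Rfubini lF; rewrite /F /= in FE.
have lw xi : L1 mu3 (fun y : R3 R => wave 0 (x - y) xi * h y).
  apply: (L1_eq _ (wave_L1 (- (dot x xi + 0)) xi th)) => y; congr (_ * _).
  by rewrite /wave -cosN dotDl dotNl [dot xi y]dotC; congr cos; ring.
have -> : ct 0 (fun x => m x * ct 0 h x) x + ct (pi / 2) (fun x => m x * ct (pi / 2) h x) x =
   \int[mu3]_xi \int[mu3]_y (m xi * (wave 0 (x - (y : R3 R)) xi * h y)).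
  apply: etrans (esym (RintD w0 w1)) _; apply: Rint_eq => xi.
  rewrite (RintZ _ (lw xi)) (wave_conv x xi 0 th) (ct_phase0 x xi th) mulrDr.
  by congr (_ + _); exact: mulrCA.
rewrite FE.
have lz y : L1 mu3 (fun xi => wave 0 (x - y) xi * m xi) := wave_L1 0 (x - y) tm.
have E3 y : \int[mu3]_xi (m xi * (wave 0 (x - y) xi * h y)) = h y * ct 0 m (x - y).
  by rewrite /ct -(RintZ _ (lz y)); apply: Rint_eq => xi; ring.
rewrite (Rint_eq mu3 E3).
have l3 : L1 mu3 (fun y => h y * ct 0 m (x - y)).
  have := (Rfubini2 lF).1; rewrite /F /= (_ : (fun y : M3 R => _) = (fun y => h y * ct 0 m (x - y)))//.
  by apply/funext => y; exact: E3.
by rewrite -(RintZ _ l3); apply: Rint_eq => y; rewrite /mkern mulrCA.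
Qed.

(** The multiplier acts on the test function, where [mult_re] makes it a convolution; Fubini's
    theorem and the evenness of [mkern m] move the kernel onto [f]. This identifies the real part of
    the distribution with a continuous function. *)
Lemma fourier_mult_re r r' m h f : test_class r m -> test_class r' h -> W 4 f ->
  complex.Re (fourier_mult m (dist_of f) (ofr h)) = \int[mu3]_y (h y * conv (mkern m) f y).
Proof.
move=> tm th wf; have [ch vh] := th; have [C hK] := mkern_kern 4 tm.
pose F (z : M3 R * M3 R) : R := h z.1 * (mkern m ((z.1 : R3 R) - (z.2 : R3 R)) * f z.2).
have lF : L1 (prod_measure mu3 mu3) F.
  apply: (@L1_pairing _ r' (fun _ : 'I_3 => h) (fun=> Cn_cont (ch 0)) (fun=> vh) j0
    (fun y x => mkern m (y - x) * f x) (conv (fun y => `|mkern m y|) (fun y => `|f y|))).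
  - apply: measurable_funM; first exact: (measurable_comp3 (@measurable_fst_sub_snd R) hK.1).
    exact: (measurable_comp3 measurable_snd wf.1).
  - by move=> x; exact: (conv_flip_L1 x hK wf).
  - exact: (conv_cont (kern_norm hK) (W_norm wf)).
  - move=> x; rewrite (conv_flip x (kern_norm hK) (W_norm wf)).
    rewrite le_eqVlt; apply/orP; left; apply/eqP; apply: Rint_eq => y; exact: normrM.
have FE := Rfubini lF; rewrite /F /= in FE.
transitivity (\int[mu3]_x (f x * \int[mu3]_y (h y * mkern m ((x : R3 R) - (y : R3 R))))).
  transitivity (\int[mu3]_x complex.Re ((f x)%:C *
      fourier (fun xi => (m xi)%:C * ifourier (ofr h) xi) x)); first by [].
  by apply: Rint_eq => x; rewrite Re_realM (mult_re x tm th).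
transitivity (\int[mu3]_y \int[mu3]_x (h y * (mkern m ((y : R3 R) - (x : R3 R)) * f x))).
  rewrite FE; apply: Rint_eq => x.
  have lK : L1 mu3 (fun y : R3 R => h y * mkern m (x - y)).
    apply: (vanish_L1 (r := r')); last exact: vanish_mull.
    move=> y; apply: cvgM; first exact: (Cn_cont (ch 0)).
    apply: (@continuous_comp _ _ _ (fun y : R3 R => x - y) (mkern m)); last exact: hK.1.
    by apply: cvgB; [exact: cvg_cst|exact: cvg_id].
  rewrite -(RintZ _ lK); apply: Rint_eq => y.
  by rewrite -(mkern_even m (y - x)) opprB mulrC -mulrA.
apply: Rint_eq => y; rewrite (conv_flip y hK wf) -(RintZ _ (conv_flip_L1 y hK wf)).
exact: Rint_eq.
Qed.

(** The whole computation takes place on the test function, so it holds for every functional [T]. *)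
Lemma fourier_mult_comp r r' m1 m2 (T : dist R) h : test_class r m2 -> test_class r' h ->
  (forall xi, m1 xi * m2 xi = m2 xi) ->
  fourier_mult m2 (fourier_mult m1 T) (ofr h) = fourier_mult m2 T (ofr h).
Proof.
move=> tm th E; rewrite /fourier_mult /dist_ifourier /dist_mul /dist_fourier.
rewrite (ifourier_fourier (mult_ctest tm th)); congr (T (fourier _)).
by apply/funext => xi; rewrite mulrA -rmorphM /= E.
Qed.

Lemma mkern_dil lam m y : 0 < lam -> L1c m ->
  mkern (fun xi => m (lam^-1 *: xi)) y = dil lam (mkern m) y.
Proof.
move=> l0 lm; rewrite /mkern /dil mulrCA; congr (_ * _); rewrite /ct addr0.
have li : lam^-1 != 0 by rewrite invr_eq0 gt_eqF.
have [l E] := Rint_affine 0 li (L1c_wave 0 (lam *: y) lm).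
rewrite normrV ?unitfE ?gt_eqF// (gtr0_norm l0) -exprVn invrK in E; rewrite -E.
apply: Rint_eq => xi; rewrite addr0; congr (_ * _); rewrite /wave !addr0; congr cos.
by rewrite dotZl [dot y (_ *: _)]dotC dotZl [dot xi y]dotC mulrA mulfV ?mul1r// gt_eqF.
Qed.

(** If [|v x0| > M], continuity keeps [v] close to [v x0] on a small ball, and a nonnegative test
    function living there contradicts the assumption. Dilates of [psi] about [x0] provide it. *)
Lemma weak_to_pointwise r (psi v : R3 R -> R) M : test_class r psi -> (forall x, 0 <= psi x) ->
  psi 0 = 1 -> continuous v ->
  (forall r' h, test_class r' h -> `|\int[mu3]_y (h y * v y)| <= M * \int[mu3]_y `|h y|) ->
  forall x, `|v x| <= M.
Proof.
move=> tp p0 p1 cv hM x0; have [cp vp] := tp; rewrite leNgt; apply/negP => lt.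
pose e := 2^-1 * (`|v x0| - M).
have e0 : 0 < e by rewrite mulr_gt0// subr_gt0.
have /cvgrPdist_le/(_ _ e0)/near_norm[d d0 hd] := cv x0.
have r1 : 0 < `|r| + 1 by rewrite ltr_wpDl.
(* With this dilation [psi (a (y - x0))] vanishes at distance [d] and beyond; [|r| + 1] is positive
   and exceeds [r] whatever the sign of [r]. *)
pose a := (`|r| + 1) / d; have a0 : 0 < a by rewrite divr_gt0.
pose h y := psi (a *: y + (- (a *: x0))).
have ch n : Cn n h := Cn_affine a (- (a *: x0)) (cp n).
have hz y : d <= `|x0 - y| -> h y = 0.
  move=> dy; apply: vp; rewrite -scalerBr normrZ gtr0_norm// distrC.
  apply: (@lt_le_trans _ _ (a * d)); last by rewrite ler_pM2l.
  by rewrite /a divfK ?gt_eqF// (le_lt_trans (ler_norm r))// ltrDl.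
have vh : vanish (`|x0| + d) h.
  move=> y hy; apply: hz; rewrite distrC; apply: le_trans (lerB_dist _ _).
  by rewrite lerBrDl ltW.
have th : test_class (`|x0| + d) h by split.
have h0 y : 0 <= h y by exact: p0.
have lh := test_class_L1 th.
have Ih : 0 < \int[mu3]_y h y.
  rewrite lt0r Rint_ge0// andbT; apply/eqP => I0.
  have := Rint_eq0_continuous (Cn_cont (ch 0)) h0 lh I0 x0.
  by rewrite /h subrr p1 => /eqP; rewrite oner_eq0.
have nh : \int[mu3]_y `|h y| = \int[mu3]_y h y by apply: Rint_eq => y; rewrite ger0_norm.
have lv : L1 mu3 (fun y => h y * v y).
  apply: (vanish_L1 (r := `|x0| + d)); last exact: vanish_mull.
  by move=> y; apply: cvgM; [exact: (Cn_cont (ch 0))|exact: cv].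
have k1 : `|v x0 * \int[mu3]_y h y - \int[mu3]_y (h y * v y)| <= e * \int[mu3]_y h y.
  rewrite -(RintZ _ lh) -(RintZ e lh) -(RintB (L1Z (v x0) lh) lv).
  apply: Rint_dom (L1Z e lh) _; first exact: (L1_measurable (L1B (L1Z (v x0) lh) lv)).
  move=> y; rewrite mulrC -mulrBr normrM (ger0_norm (h0 y)) mulrC.
  have [dy|dy] := ltP `|x0 - y| d; last by rewrite hz// !mulr0.
  by apply: ler_wpM2r => //; exact: hd.
have k2 := hM _ _ th; rewrite nh in k2.
have k3 : `|v x0| * \int[mu3]_y h y <= (e + M) * \int[mu3]_y h y.
  rewrite mulrDl -[X in _ * X <= _](gtr0_norm Ih) -normrM.
  by rewrite -[X in `|X|](subrK (\int[mu3]_y (h y * v y))); apply: le_trans (ler_normD _ _) _; exact: lerD.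
move: k3; rewrite ler_pM2r// /e; move: lt; clear; lra.
Qed.

End multipliers.

(** * The three criteria *)

Section euclidean_norm.
Local Open Scope complex_scope.
Context {R : realType}.
Implicit Types x : R3 R.

Lemma norm_le_enorm x : `|x| <= enorm x.
Proof.
have h (a : R) : a ^+ 2 <= dot x x -> `|a| <= enorm x.
  by move=> ha; rewrite /enorm -sqrtr_sqr ler_wsqrtr.
have := sqr_ge0 x.1.1; have := sqr_ge0 x.1.2; have := sqr_ge0 x.2 => c0 b0 a0.
rewrite {1}/Num.norm/= !ge_max; apply/andP; split; [apply/andP; split|];
  by apply: h; rewrite dotE -!expr2; lra.
Qed.

(** The sharp factor is the square root of 3; 2 keeps the later radii dyadic. *)
Lemma enorm_le_norm x : enorm x <= 2 * `|x|.
Proof.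
have n0 : 0 <= 2 * `|x| by rewrite mulr_ge0.
rewrite /enorm -[leRHS]ger0_norm// -sqrtr_sqr; apply: ler_wsqrtr.
have h (a : R) : `|a| <= `|x| -> a * a <= `|x| ^+ 2.
  by move=> ha; rewrite -expr2 -real_normK ?num_real// ler_pXn2r ?nnegrE.
have : `|x| <= `|x| by []; rewrite {1}/Num.norm/= !ge_max => /andP[/andP[h1 h2] h3].
rewrite dotE exprMn; move: (h _ h1) (h _ h2) (h _ h3) (sqr_ge0 `|x|).
by move: (_ * _) (_ * _) (_ * _) (`|x| ^+ 2) => *; lra.
Qed.

Lemma enormZ (a : R) x : 0 <= a -> enorm (a *: x) = a * enorm x.
Proof.
move=> a0; rewrite /enorm dotZl [dot x _]dotC dotZl mulrA -expr2.
by rewrite sqrtrM ?sqr_ge0// sqrtr_sqr ger0_norm.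
Qed.

End euclidean_norm.

Section liminf.
Local Open Scope complex_scope.
Context {R : realType}.

(** A real number strictly above the lower limit exists, and the terms fall below it infinitely
    often. *)
Lemma liminf_bounded (a : int -> \bar R) : (liminf_ninfty a < +oo)%E ->
  exists2 M : R, 0 <= M & forall N, exists2 n : nat, (N <= n)%N & (a (- n%:Z)%R < M%:E)%E.
Proof.
rewrite /liminf_ninfty limn_einf_lim; set v := fun n : nat => a (- n%:Z).
move=> h; have [M M0 hM] : exists2 M : R, 0 <= M & (limn (einfs v) < M%:E)%E.
  move: h; case: (limn (einfs v)) => [r| |]// _; last by exists 0 => //; exact: ltNyr.
  exists (`|r| + 1); first by rewrite addr_ge0.
  by rewrite lte_fin (le_lt_trans (ler_norm r))// ltrDl.
exists M => // N.
have hN : (einfs v N < M%:E)%E.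
  apply: le_lt_trans hM; rewrite (cvg_lim _ (@cvg_einfs_sup _ v))//.
  by apply: ereal_sup_ubound; exists N.
have [y [n /= Nn <-] yM] := ereal_inf_lt hN.
by exists n.
Qed.

End liminf.

Section essential_bound.
Local Open Scope complex_scope.
Context {R : realType}.

Lemma Rint_dom_ae (f G : M3 R -> R) : measurable_fun setT f -> L1 mu3 G ->
  {ae mu3, forall x, `|f x| <= G x} -> `|\int[mu3]_x f x| <= \int[mu3]_x G x.
Proof.
move=> mf lG ae; have mG := L1_measurable lG.
have mnf : measurable_fun setT (fun x => `|f x|) by exact: measurableT_comp.
have mnG : measurable_fun setT (fun x => `|G x|) by exact: measurableT_comp.
have E : (\int[mu3]_x (`|f x|)%:E <= \int[mu3]_x (`|G x|)%:E)%E.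
  apply: ae_ge0_le_integral => //.
  - exact/measurable_EFinP.
  - exact/measurable_EFinP.
  - by apply: filterS ae => x h _; rewrite lee_fin; apply: le_trans h (ler_norm _).
have fG : (\int[mu3]_x (`|G x|)%:E < +oo)%E by rewrite -(EFin_Rint (L1_norm lG)) ltry.
have lnf : L1 mu3 (fun x => `|f x|) by apply: L1_lty => //; exact: le_lt_trans E fG.
have lf : L1 mu3 f by exact: (L1_dom mf lnf).
apply: le_trans (Rint_norm lf) _.
have G0 : \int[mu3]_x `|G x| = \int[mu3]_x G x.
  rewrite /Rintegral; congr fine; apply: ae_eq_integral => //.
  - exact/measurable_EFinP.
  - exact/measurable_EFinP.
  - by apply: filterS ae => x h _; rewrite ger0_norm// (le_trans _ h).
by rewrite -G0 -lee_fin (EFin_Rint lnf) (EFin_Rint (L1_norm lG)).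
Qed.

Lemma Re_le_cmod (z : R[i]) : `|complex.Re z| <= cmod z.
Proof. by rewrite /cmod -sqrtr_sqr ler_wsqrtr// lerDl sqr_ge0. Qed.

Lemma cmod_ge0 (z : R[i]) : 0 <= cmod z. Proof. exact: sqrtr_ge0. Qed.

Lemma cmod_le_cmod3 (z : 'I_3 -> R[i]) i : cmod (z i) <= cmod3 z.
Proof.
rewrite /cmod3 -[leLHS]ger0_norm ?cmod_ge0// -sqrtr_sqr ler_wsqrtr// (bigD1 i)//= lerDl.
by apply: sumr_ge0 => j _; exact: sqr_ge0.
Qed.

Lemma Re_mul_real (z : R[i]) (a : R) : complex.Re (z * a%:C) = complex.Re z * a.
Proof. by case: z => p q /=; rewrite mulr0 subr0. Qed.

Lemma ofr_test r (h : R3 R -> R) U : test_class r h -> box r `<=` U -> test_fun U (ofr h).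
Proof.
move=> [ch vh] bU.
have s : supp (ofr h) `<=` box r.
  have hb : [set x | ofr h x != 0] `<=` box r.
    move=> x /= hx; apply: norm_boxP; rewrite leNgt; apply/negP => rx.
    by move: hx; rewrite /ofr vh// eqxx.
  apply: subset_trans (closure_subset hb) _.
  by rewrite -(closure_id _).1//; apply: compact_closed; [exact: norm_hausdorff|exact: box_compact].
split; [split|apply: (subclosed_compact _ (@box_compact _ r) s); exact: closed_closure|exact: subset_trans s bU].
  exact: Cn_smooth.
by apply: Cn_smooth => n; exact: Cn_cst.
Qed.

(** The norm of exponent [+oo] is an essential supremum only when the measure is not zero. *)
Lemma mu3_setT_gt0 : (0 < mu3 (setT : set (M3 R)))%E.
Proof.
apply: (@lt_le_trans _ _ (mu3 (box 1 : set (M3 R)))).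
  by rewrite mu3_box// lte_fin exprn_gt0// mulr1.
by apply: le_measure; rewrite ?inE//; exact: measurable_box.
Qed.

(** The easy half of the duality of L1 and L-infinity: a real [y] strictly above the infimum yields
    a representing function bounded by [y] almost everywhere. [weak_to_pointwise] is the way
    back. *)
Lemma dist_Lnorm_weak (T : 'I_3 -> dist R) (y : R) i r h :
  (dist_Lnorm setT +oo T < y%:E)%E -> test_class r h ->
  `|complex.Re (T i (ofr h))| <= y * \int[mu3]_x `|h x|.
Proof.
move=> /ereal_inf_lt[_ [g [mg _ Tg] ->] hy] th.
have ae : {ae mu3, forall x, `|complex.Re (g x i * ofr h x)| <= y * `|h x|}.
  move: hy; rewrite /Lnorm_on leb3E unlock mu3_setT_gt0 => hy.
  have := @ess_sup_ge _ _ _ mu3 (abse \o (fun x : M3 R => (\1_[set: R3 R] x * cmod3 (g x))%:E)).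
  apply: filterS => x hx; have := le_lt_trans hx hy.
  rewrite /= indicE in_setT mul1r lte_fin => /ltW hy3.
  rewrite /ofr Re_mul_real normrM; apply: ler_wpM2r => //.
  apply: le_trans (Re_le_cmod _) (le_trans (cmod_le_cmod3 _ _) _).
  exact: le_trans (ler_norm _) hy3.
have lh := test_class_L1 th.
have iT : box r `<=` [set: R3 R]° by move=> x _; exact: filterT.
rewrite (Tg i _ (ofr_test th iT)) /cint leb3E /=.
rewrite -(RintZ y (L1_norm lh)); apply: Rint_dom_ae.
- rewrite (_ : (fun x => _) = fun x => complex.Re (g x i) * h x); last first.
    by apply/funext => x; rewrite /ofr Re_mul_real.
  by apply: measurable_funM; [exact: (mg i).1|exact: (L1_measurable lh)].
- exact: L1Z (L1_norm lh).
- exact: ae.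
Qed.

End essential_bound.

(** * The low frequency cutoffs at scale [lam] *)

Section cutoff_psi.
Local Open Scope complex_scope.
Context {R : realType}.
Variables (psi : R3 R -> R).
Hypothesis hpsi : LP_cutoff psi.

Definition psik (lam : R) (xi : R3 R) := psi (lam^-1 *: xi).

Lemma psi_out xi : 1 < enorm xi -> psi xi = 0.
Proof.
have [_ sp _ _] := hpsi => h; apply/eqP; apply: contraT => nz.
have : eball 1 xi by apply: sp; apply: subset_closure.
by rewrite /eball /= leNgt h.
Qed.

Lemma psi_test : test_class 1 psi.
Proof.
have [s _ _ _] := hpsi; split=> [n|x x1]; first exact: smooth_Cn.
by apply: psi_out; apply: lt_le_trans x1 (norm_le_enorm x).
Qed.

Lemma psi_near xi : `|xi| <= 4^-1 -> psi xi = 1.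
Proof.
have [_ _ _ h] := hpsi => hx; apply: h; apply: le_trans (enorm_le_norm xi) _.
by move: (`|xi|) hx => a; lra.
Qed.

Lemma psi_bounds : exists B, forall xi, 0 <= psi xi <= B.
Proof.
have [cp vp] := psi_test; have [B _ hB] := vanish_bounded (Cn_cont (cp 0)) vp.
have [_ _ p0 _] := hpsi.
by exists B => xi; rewrite p0 (le_trans (ler_norm _) (hB xi)).
Qed.

Lemma psi_zero : psi 0 = 1. Proof. by apply: psi_near; rewrite normr0 invr_ge0. Qed.

Lemma psik_test lam : 0 < lam -> test_class lam (psik lam).
Proof.
move=> l0; have [cp vp] := psi_test; split=> [n|x lx].
  by have := Cn_affine lam^-1 0 (cp n); rewrite (_ : (fun x => _) = psik lam)//; apply/funext => x; rewrite addr0.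
by apply: vp; rewrite normrZ gtr0_norm ?invr_gt0// ltr_pdivlMl ?mulr1.
Qed.

(** The support of [psik lam'] lies in the ball of radius [lam'], and [psik lam] equals 1 up to
    radius [lam / 2], whence the factor 2. *)
Lemma psik_mul lam lam' xi : 0 < lam' -> 2 * lam' <= lam -> psik lam xi * psik lam' xi = psik lam' xi.
Proof.
move=> l'0 ll; have l0 : 0 < lam by apply: lt_le_trans ll; rewrite mulr_gt0.
have [e|e] := leP (enorm (lam'^-1 *: xi)) 1; last by rewrite /psik (psi_out e) mulr0.
have [_ _ _ h] := hpsi; rewrite [psik lam xi]h ?mul1r//.
rewrite enormZ in e; last by rewrite invr_ge0 ltW.
rewrite enormZ; last by rewrite invr_ge0 ltW.
move: e; rewrite ler_pdivrMl// mulr1 => e.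
rewrite ler_pdivrMl//; apply: le_trans e _.
by rewrite ler_pdivlMr// mulrC.
Qed.

Lemma psik_mkern lam y : 0 < lam -> mkern (psik lam) y = dil lam (mkern psi) y.
Proof. by move=> l0; exact: mkern_dil l0 (L1c_test psi_test). Qed.

Lemma LP_SE k (T : dist R) : LP_S psi k T = fourier_mult (psik ((2 : R) ^ k)) T.
Proof. by rewrite /LP_S /psik invr_expz. Qed.

Lemma conv_psik_bound lam f M : 0 < lam -> W 4 f ->
  (forall r h, test_class r h ->
    `|complex.Re (fourier_mult (psik lam) (dist_of f) (ofr h))| <= M * \int[mu3]_x `|h x|) ->
  forall x, `|conv (mkern (psik lam)) f x| <= M.
Proof.
move=> l0 wf hM; have tl := psik_test l0; have [C hK] := mkern_kern 4 tl.
have [_ _ p0 _] := hpsi.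
apply: (weak_to_pointwise psi_test p0 psi_zero (conv_cont hK wf)) => r h th.
by rewrite -(fourier_mult_re tl th wf); exact: hM th.
Qed.

End cutoff_psi.

Section dyadic.
Local Open Scope complex_scope.
Context {R : realType}.

Definition lamn (n : nat) : R := (2 ^+ n)^-1.

Lemma lamn_gt0 n : 0 < lamn n. Proof. by rewrite invr_gt0 exprn_gt0. Qed.

Lemma lamnS n : lamn n = 2 * lamn n.+1.
Proof. by rewrite /lamn exprS invfM mulrA mulfV ?mul1r// pnatr_eq0. Qed.

Lemma lamn_le m n : (m <= n)%N -> lamn n <= lamn m.
Proof.
by move=> mn; rewrite /lamn lef_pV2 ?posrE ?exprn_gt0// ler_weXn2l// ler1n.
Qed.

Lemma lamn_le1 n : lamn n <= 1.
Proof. by apply: le_trans (lamn_le (leq0n n)) _; rewrite /lamn expr0 invr1. Qed.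

Lemma lamn_double m n : (n < m)%N -> 2 * lamn m <= lamn n.
Proof. by move=> nm; rewrite (lamnS n) ler_pM2l// lamn_le. Qed.

Lemma expz_lamn n : (2 : R) ^ (- n%:Z) = lamn n. Proof. by rewrite -exprnN. Qed.

Lemma cvg_shift_seq (f : nat -> R) (l : R) N : f n @[n --> \oo] --> l ->
  f (n + N)%N @[n --> \oo] --> l.
Proof. by rewrite -(cvg_shiftn N). Qed.

Lemma lamn_small (e : R) N : 0 < e -> exists2 N', (N <= N')%N & forall n, (N' <= n)%N -> lamn n < e.
Proof.
move=> e0; have c : (2^-1 : R) ^+ n @[n --> \oo] --> (0 : R).
  by apply: cvg_expr; rewrite ger0_norm ?invr_ge0// invf_lt1// ltr1n.
have /cvgrPdist_lt/(_ _ e0)[N0 _ h] := c.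
exists (maxn N N0); first exact: leq_maxl.
move=> n; rewrite geq_max => /andP[_ Nn]; have := h n Nn.
by rewrite /= sub0r normrN ger0_norm ?exprn_ge0 ?invr_ge0// exprVn.
Qed.

End dyadic.

Section solution.
Local Open Scope complex_scope.
Context {R : realType}.
Variables (psi : R3 R -> R) (u : R3 R -> R3 R) (P : R3 R -> R).
Hypothesis hpsi : LP_cutoff psi.
Hypothesis hu : forall i, smooth (vcomp u i).
Hypothesis hP : smooth P.
Hypothesis hNS : stationary_NS u P.
Hypothesis hD : (dirichlet_energy u < +oo)%E.

Let uu := vcomp u.

Lemma solution_Cn n i : Cn n (uu i). Proof. exact: (smooth_Cn n (hu i)). Qed.

Lemma solution_NS i x : NSop uu i x = - partial i P x.
Proof. by apply/eqP; rewrite -subr_eq0 opprK; apply/eqP; exact: hNS.1. Qed.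

Lemma solution_divfree : divfree uu. Proof. exact: hNS.2. Qed.

Lemma solution_grad i l : L1 mu3 (fun x => partial l (uu i) x ^+ 2).
Proof.
have c j m : continuous (fun x => partial m (uu j) x ^+ 2).
  exact: continuous_sqr (Cn_cont (CnS_partial m (solution_Cn 1 j))).
have ms : measurable_fun setT (fun x : M3 R => \sum_(j < 3) \sum_(m < 3) partial m (uu j) x ^+ 2).
  apply: measurable_sum => j; apply: measurable_sum => m.
  exact: continuous_m (@c j m).
have l0 : L1 mu3 (fun x => \sum_(j < 3) \sum_(m < 3) partial m (uu j) x ^+ 2).
  apply: L1_lty => //.
  by move=> x; apply: sumr_ge0 => j _; apply: sumr_ge0 => m _; exact: sqr_ge0.
apply: (L1_dom _ l0); first exact: continuous_m (@c i l).
move=> x; rewrite ger0_norm ?sqr_ge0//.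
by apply: (le_sum33 (T := fun j m => partial m (uu j) x ^+ 2)) => j m; exact: sqr_ge0.
Qed.

Lemma solution_W i : W 4 (uu i). Proof. exact: W_of solution_Cn solution_grad i. Qed.

(** The common end of the three criteria: each has only to bound the low frequency part by
    [M * lamn n] for infinitely many [n]. *)
Lemma liouville_of_bounds M : 0 <= M ->
  (forall N, exists2 n, (N <= n)%N &
    forall i x, `|conv (mkern (psik psi (lamn n))) (uu i) x| <= M * lamn n) ->
  forall x, u x = 0.
Proof.
move=> M0 hM; have tp := psi_test hpsi; have [C hK] := mkern_kern 4 tp.
have [B hB] := psi_bounds hpsi; have [cp vp] := tp.
have K1 : \int[mu3]_x mkern psi x = 1 by rewrite (mkern_int tp) psi_zero.
have z : forall i x, uu i x = 0.
  have L := liouville_core solution_Cn (fun n => smooth_Cn n hP) solution_NS solution_divfree solution_grad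
    hK K1 (mkern_even psi) M0 cp vp hB (psi_near hpsi).
  apply: L => e e0.
  have [N _ hN] := lamn_small 0 e0; have [n Nn hn] := hM N.
  exists (lamn n); first by rewrite lamn_gt0 hN.
  split; [exact: lamn_gt0|exact: lamn_le1|move=> i x].
  have -> : dil (lamn n) (mkern psi) = mkern (psik psi (lamn n)).
    by apply/funext => y; rewrite (psik_mkern hpsi y (lamn_gt0 n)).
  exact: hn.
move=> x; have := z j0 x; have := z j1 x; have := z j2 x.
by rewrite /uu /vcomp /ecoord /=; case: (u x) => -[a b] c /= -> -> ->.
Qed.

Lemma liminf_S_Linfty :
  (liminf_ninfty (fun k : int => ((2 : R) ^ (- k))%:E *
     dist_Lnorm setT +oo (fun i => LP_S psi k (vdist_of u i))) < +oo)%E ->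
  forall x, u x = 0.
Proof.
move=> /liminf_bounded[M M0 hM]; apply: (liouville_of_bounds M0) => N.
have [n Nn hn] := hM N; exists n => // i.
have hy : (dist_Lnorm setT +oo (fun i => LP_S psi (- n%:Z) (vdist_of u i)) < (M * lamn n)%:E)%E.
  move: hn; rewrite opprK -exprnP => hn.
  by rewrite -lte_pdivlMl ?exprn_gt0// in hn; rewrite mulrC EFinM.
apply: (conv_psik_bound hpsi (lamn_gt0 n) (solution_W i)) => r h th.
have := dist_Lnorm_weak i hy th.
by rewrite LP_SE expz_lamn.
Qed.

End solution.

Section test_schwartz.
Local Open Scope complex_scope.
Context {R : realType}.
Implicit Types (h : R3 R -> R).

Lemma dpart0 (s : seq 'I_3) : dpart s (fun _ : R3 R => 0 : R) = fun=> 0.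
Proof. by elim: s => [//|i s ih] /=; rewrite ih partial_cst. Qed.

Lemma test_class_partial r h i : test_class r h -> test_class r (partial i h).
Proof.
by move=> [ch vh]; split=> [n|]; [exact: CnS_partial i (ch n.+1)|exact: vanish_partial].
Qed.

Lemma dpart_bounded r h N : test_class r h ->
  exists2 C, 0 <= C & forall s x, (size s <= N)%N -> `|dpart s h x| <= C.
Proof.
elim: N h => [|N ih] h th.
  have [C C0 hC] := vanish_bounded (Cn_cont (th.1 0)) th.2.
  by exists C => // s x; rewrite leqn0 => /nilP ->; exact: hC.
have [C C0 hC] := ih h th.
have [C1 C10 h1] := ih _ (test_class_partial j0 th).
have [C2 C20 h2] := ih _ (test_class_partial j1 th).
have [C3 C30 h3] := ih _ (test_class_partial j2 th).
exists (C + C1 + C2 + C3); first by rewrite !addr_ge0.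
(* The last index of [s] is the derivative taken first, so it is absorbed by the induction
   hypothesis for [partial i h]. *)
move=> s x; case/lastP: s => [|s i].
  by move=> _; apply: le_trans (hC [::] x _) _ => //; rewrite -!addrA lerDl !addr_ge0.
rewrite size_rcons ltnS => sN; rewrite /dpart foldr_rcons -/(dpart s (partial i h)).
move: i; apply: ord3P.
- by apply: le_trans (h1 s x sN) _; lra.
- by apply: le_trans (h2 s x sN) _; lra.
- by apply: le_trans (h3 s x sN) _; lra.
Qed.

Lemma dpart_vanish r h s : vanish r h -> vanish r (dpart s h).
Proof. by move=> vh; elim: s => [//|i s ih] /=; exact: vanish_partial. Qed.

(** The limit in [Sh] is tested on Schwartz functions; this admits the compactly supported ones
    there. *)
Lemma ofr_schwartz r h : test_class r h -> schwartz (ofr h).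
Proof.
move=> th; have [ch vh] := th; split.
  by split; [exact: Cn_smooth|apply: Cn_smooth => n; exact: Cn_cst].
move=> N; have [C C0 hC] := dpart_bounded N th.
apply: (@le_lt_trans _ _ ((1 + 2 * `|r|) ^+ N * C)%:E); last exact: ltry.
apply: ge_ereal_sup => _ [s [x [sN ->]]]; rewrite lee_fin.
have -> : cmod (cdpart s (ofr h) x) = `|dpart s h x|.
  by rewrite /cmod /cdpart /ofr /= dpart0 expr0n addr0 sqrtr_sqr.
have e0 : 0 <= 1 + enorm x by rewrite addr_ge0// sqrtr_ge0.
have [xr|xr] := leP `|x| r; last first.
  by rewrite (dpart_vanish s vh xr) normr0 mulr0 mulr_ge0// exprn_ge0// addr_ge0// mulr_ge0.
apply: ler_pM => //; [exact: exprn_ge0| |exact: hC].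
apply: lerXn2r; [by rewrite nnegrE|by rewrite nnegrE addr_ge0// mulr_ge0|].
rewrite lerD2l; apply: le_trans (enorm_le_norm x) _.
by rewrite ler_pM2l// (le_trans xr)// ler_norm.
Qed.

End test_schwartz.

(** * The Besov criterion *)

Section besov_part.
Local Open Scope complex_scope.
Context {R : realType}.
Variables (psi : R3 R -> R) (u : R3 R -> R3 R) (P : R3 R -> R).
Hypothesis hpsi : LP_cutoff psi.
Hypothesis hu : forall i, smooth (vcomp u i).
Hypothesis hP : smooth P.
Hypothesis hNS : stationary_NS u P.
Hypothesis hD : (dirichlet_energy u < +oo)%E.

Let wf i := solution_W hu hD i.
Let a i m x := conv (mkern (psik psi (lamn m))) (vcomp u i) x.

(** As [LP_phi psi xi] is [psi (xi / 2) - psi xi], the block of index [- (m + 1)], not [- m], is the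
    one between the scales [lamn m] and [lamn m.+1]. *)
Lemma LP_DeltaE m (T : dist R) : LP_Delta psi (- (m.+1)%:Z) T =
  fourier_mult (fun xi => psik psi (lamn m) xi - psik psi (lamn m.+1) xi) T.
Proof.
rewrite /LP_Delta; congr (fourier_mult _ T); apply/funext => xi.
rewrite /LP_phi /psik scalerA opprK -exprnP /lamn !invrK exprS mulrA mulVf ?mul1r//.
Qed.

Lemma a_cont i m : continuous (a i m).
Proof.
have [C hK] := mkern_kern 4 (psik_test hpsi (lamn_gt0 m)).
exact: conv_cont hK (wf i).
Qed.

Lemma a_pairing_L1 i m r h : test_class r h -> L1 mu3 (fun y => h y * a i m y).
Proof.
move=> [ch vh]; apply: (vanish_L1 (r := r)); last exact: vanish_mull.
by move=> y; apply: cvgM; [exact: (Cn_cont (ch 0))|exact: a_cont].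
Qed.

(** For [n < m] the cutoff at scale [lamn n] is 1 on the supports of the two cutoffs in the block.
    So the block of the truncated field is that of [u], a difference of consecutive low frequency
    parts. *)
Lemma block_bound M n m i x : (n < m)%N ->
  (dist_Lnorm setT +oo (fun i => LP_Delta psi (- (m.+1)%:Z) (LP_S psi (- n%:Z) (vdist_of u i)))
     < (M * lamn m.+1)%:E)%E ->
  `|a i m x - a i m.+1 x| <= M * lamn m.+1.
Proof.
move=> nm hy; have t1 := psik_test hpsi (lamn_gt0 m); have t2 := psik_test hpsi (lamn_gt0 m.+1).
have t2' : test_class (lamn m) (psik psi (lamn m.+1)).
  by split; [exact: t2.1|move=> y hy2; apply: t2.2; apply: le_lt_trans hy2; exact: lamn_le].
have td := test_classB t1 t2'.
have [C1 k1] := mkern_kern 4 t1; have [C2 k2] := mkern_kern 4 t2; have [C3 k3] := mkern_kern 4 td.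
have E y : conv (mkern (fun xi => psik psi (lamn m) xi - psik psi (lamn m.+1) xi)) (vcomp u i) y =
    a i m y - a i m.+1 y.
  apply: (etrans _ (RintB (conv_L1 y k1 (wf i)) (conv_L1 y k2 (wf i)))).
  by apply: Rint_eq => z; rewrite (mkernB z t1 t2') mulrBl.
rewrite -E; have [_ _ p0 _] := hpsi; move: x.
apply: (weak_to_pointwise (psi_test hpsi) p0 (psi_zero hpsi) (conv_cont k3 (wf i))) => r h th.
rewrite -(fourier_mult_re td th (wf i)).
have := dist_Lnorm_weak i hy th; rewrite LP_DeltaE LP_SE expz_lamn.
rewrite (fourier_mult_comp _ td th)// => xi.
rewrite mulrBr (psik_mul hpsi xi (lamn_gt0 m) (lamn_double nm)).
by rewrite (psik_mul hpsi xi (lamn_gt0 m.+1) (lamn_double (ltnW nm : (n < m.+1)%N))).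
Qed.

(** Telescoping: the block between [m] and [m.+1] costs [M * lamn m.+1 = M * (lamn m - lamn m.+1)],
    so the sum stays below [M * lamn n.+1]. It starts at [n.+1] because the blocks agree with those
    of [u] only for [m > n]. The remainder at deep scales vanishes only weakly, by the limit in
    [Sh], hence the passage through test functions. *)
Lemma besov_bound M n i x : 0 <= M ->
  (besov_norm psi (- 1) (fun i => LP_S psi (- n%:Z) (vdist_of u i)) < M%:E)%E ->
  `|a i n.+1 x| <= M * lamn n.+1.
Proof.
move=> M0; rewrite /besov_norm; case: ifPn => [/asboolP hS|_]; last by rewrite ltNge leey.
move=> hB.
have blk m : (n < m)%N -> (dist_Lnorm setT +oo
    (fun i => LP_Delta psi (- (m.+1)%:Z) (LP_S psi (- n%:Z) (vdist_of u i))) < (M * lamn m.+1)%:E)%E.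
  move=> nm; set D := dist_Lnorm _ _ _.
  have hm : ((2 `^ ((- (m.+1)%:Z)%:~R * (- 1)))%:E * D < M%:E)%E.
    apply: le_lt_trans hB; apply: ereal_sup_ubound.
    by exists (- (m.+1)%:Z).
  have e : ((- (m.+1)%:Z)%:~R * (- 1) : R) = m.+1%:R by rewrite mulrNz mulrN1 opprK.
  rewrite e powR_mulrn// in hm.
  by rewrite -lte_pdivlMl ?exprn_gt0// in hm; rewrite mulrC EFinM.
have tel q y : `|a i n.+1 y - a i (n.+1 + q) y| <= M * (lamn n.+1 - lamn (n.+1 + q)).
  elim: q => [|q ih]; first by rewrite addn0 !subrr normr0 mulr0.
  have nm : (n < n.+1 + q)%N by rewrite addSn ltnS leq_addr.
  have b := block_bound i y nm (blk _ nm).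
  rewrite addnS -(subrK (a i (n.+1 + q) y) (a i n.+1 y)) -addrA.
  apply: le_trans (ler_normD _ _) _; apply: le_trans (lerD ih b) _.
  by rewrite (lamnS (n.+1 + q)) le_eqVlt; apply/orP; left; apply/eqP; ring.
move: x; apply: (conv_psik_bound hpsi (lamn_gt0 n.+1) (wf i)) => r h th.
rewrite (fourier_mult_re (psik_test hpsi (lamn_gt0 n.+1)) th (wf i)) -/(a i n.+1).
have lh := L1_norm (test_class_L1 th).
have key q : `|\int[mu3]_y (h y * a i n.+1 y)| <=
    M * lamn n.+1 * \int[mu3]_y `|h y| + `|\int[mu3]_y (h y * a i (n.+1 + q) y)|.
  have l1 := a_pairing_L1 i n.+1 th; have l2 := a_pairing_L1 i (n.+1 + q) th.
  rewrite -{1}(subrK (\int[mu3]_y (h y * a i (n.+1 + q) y)) (\int[mu3]_y (h y * a i n.+1 y))).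
  apply: le_trans (ler_normD _ _) _; rewrite lerD2r -(RintB l1 l2) -(RintZ _ lh).
  apply: Rint_dom (L1Z _ lh) _; first exact: (L1_measurable (L1B l1 l2)).
  move=> y; rewrite -mulrBr normrM mulrC; apply: ler_wpM2r => //.
  apply: le_trans (tel q y) _; apply: ler_wpM2l => //.
  by rewrite gerBl ltW// lamn_gt0.
have c0 := (hS i).2 _ (ofr_schwartz th).
have lim : (fun q : nat => `|\int[mu3]_y (h y * a i (n.+1 + q) y)|) @ \oo --> (0 : R).
  (* At depth [q + n.+1] the inner truncation at [n] is invisible by [psik_mul], so this limit
     concerns [u] itself. *)
  have c1 : (fun q : nat => cmod (LP_S psi (- (q + n.+1)%N%:Z)
      (LP_S psi (- n%:Z) (vdist_of u i)) (ofr h))) @ \oo --> (0 : R).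
    exact: (@cvg_shift_seq _ (fun p : nat => cmod (LP_S psi (- p%:Z)
      (LP_S psi (- n%:Z) (vdist_of u i)) (ofr h))) 0 n.+1 c0).
  have c00 : (fun _ : nat => 0 : R) @ \oo --> (0 : R) by exact: cvg_cst.
  apply: (squeeze_cvgr _ c00 c1); apply: nearW => q.
  rewrite normr_ge0 /= LP_SE expz_lamn LP_SE expz_lamn (addnC q).
  have nq : (n < n.+1 + q)%N by rewrite addSn ltnS leq_addr.
  have tq := psik_test hpsi (lamn_gt0 (n.+1 + q)).
  rewrite (fourier_mult_comp _ tq th); last first.
    by move=> xi; exact: (psik_mul hpsi xi (lamn_gt0 _) (lamn_double nq)).
  by rewrite -(fourier_mult_re tq th (wf i)) Re_le_cmod.
have lim2 : (fun q : nat => M * lamn n.+1 * \int[mu3]_y `|h y| + `|\int[mu3]_y (h y * a i (n.+1 + q) y)|) @ \oo -->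
   M * lamn n.+1 * \int[mu3]_y `|h y| + 0 by apply: cvgD; [exact: cvg_cst|exact: lim].
rewrite addr0 in lim2.
by apply: (cvgr_to_ge lim2); apply: nearW => q; exact: key.
Qed.

Lemma liminf_S_besov :
  (liminf_ninfty (fun k : int => besov_norm psi (- 1) (fun i => LP_S psi k (vdist_of u i))) < +oo)%E ->
  forall x, u x = 0.
Proof.
move=> /liminf_bounded[M M0 hM]; apply: (liouville_of_bounds hpsi hu hP hNS hD M0) => N.
have [n Nn hn] := hM N; exists n.+1; first exact: leqW.
by move=> i x; exact: besov_bound M0 hn.
Qed.

End besov_part.

(** * Integrability of the Fourier transform near the origin *)

Section local_Lr.
Local Open Scope complex_scope.
Context {R : realType}.
Lemma ae_imp (P Q : M3 R -> Prop) : (forall x, P x -> Q x) ->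
  {ae mu3, forall x, P x} -> {ae mu3, forall x, Q x}.
Proof. by move=> PQ [N [mN N0 sub]]; exists N; split=> // x nQ; apply: sub => /PQ. Qed.

Lemma measurable_sqrt (D : set (M3 R)) (F : M3 R -> R) : measurable_fun D F ->
  measurable_fun D (fun x => Num.sqrt (F x)).
Proof.
move=> mF; apply: (measurableT_comp _ mF).
exact: (continuous_measurable_fun (@sqrt_continuous R)).
Qed.

Lemma measurable_eball (r : R) : measurable (eball r : set (M3 R)).
Proof.
rewrite (_ : eball r = setT `&` (fun x : M3 R => enorm (x : R3 R)) @^-1` `]-oo, r]%classic).
  have c : continuous (@enorm R).
    move=> x; apply: (@continuous_comp _ _ _ (fun x : R3 R => dot x x) Num.sqrt); last exact: sqrt_continuous.
    rewrite (_ : (fun x : R3 R => dot x x) = fun x => \sum_(i < 3) ecoord i x * ecoord i x)//.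
    exact: (Cn_cont (Cn_sum (n := 0) _ (fun i => CnM (ecoord_Cn 0 i) (ecoord_Cn 0 i)))).
  exact: (continuous_m c).
by apply/seteqP; split=> x /=; rewrite in_itv/= ?setTI //; case.
Qed.

Lemma measurable_cut_fun (B : set (M3 R)) (F : M3 R -> R) : measurable B ->
  measurable_fun B F -> measurable_fun setT (fun x => \1_B x * F x).
Proof.
move=> mB /(measurable_restrictT F mB).1; rewrite (_ : F \_ B = fun x => \1_B x * F x)//.
by apply/funext => x; rewrite patchE indicE; case: (x \in B); rewrite ?mul1r ?mul0r.
Qed.

(** A point within [l] of the support has max norm at most [2 * l], hence Euclidean norm at most
    [4 * l]: the support is interior to this ball. *)
Lemma ctest_test_fun (l : R) (phi : R3 R -> R[i]) : 0 < l -> ctest l phi -> test_fun (eball (4 * l))° phi.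
Proof.
move=> l0 [t1 t2].
have s : supp phi `<=` box l.
  have hb : [set x | phi x != 0] `<=` box l.
    move=> x /= hx; apply: norm_boxP; rewrite leNgt; apply/negP => rx.
    move: hx; have := t1.2 x rx; have := t2.2 x rx.
    by case: (phi x) => p q /= -> ->; rewrite eqxx.
  apply: subset_trans (closure_subset hb) _.
  by rewrite -(closure_id _).1//; apply: compact_closed; [exact: norm_hausdorff|exact: box_compact].
split; [split; apply: Cn_smooth; [exact: t1.1|exact: t2.1]| |].
  by apply: (subclosed_compact _ (@box_compact _ l) s); exact: closed_closure.
move=> x /s/box_norm xl; apply: (@norm_near _ x l) => // y xy.
rewrite /eball /=; apply: le_trans (enorm_le_norm y) _.
have : `|y| <= l + l.
  rewrite -(subrK x y) addrC; apply: le_trans (ler_normD _ _) _.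
  by apply: lerD => //; rewrite distrC ltW.
by move: (`|y|) => a; lra.
Qed.

(** A pointwise substitute for Hölder's inequality. Above the level [lam ^- 2], the power
    [Y ^ (p - 1)] is at least the square root of [Y], hence at least [1 / lam]; [p - 1 >= 1 / 2] is
    the condition on [p]. Integrated over a volume of order [lam ^ 3], the level contributes a term
    of order [lam]. *)
Lemma Lr_split (lam Y p : R) : 0 < lam -> lam <= 1 -> 0 <= Y -> 3 / 2 <= p ->
  Y <= lam ^- 2 + lam * Y `^ p.
Proof.
move=> l0 l1 Y0 p32.
have [h|h] := leP Y (lam ^- 2).
  by apply: le_trans h _; rewrite lerDl mulr_ge0 ?powR_ge0// ltW.
have li : 1 <= lam ^- 2 by rewrite invf_ge1 ?exprn_gt0// expr_le1// ltW.
have Y1 : 1 <= Y by rewrite (le_trans li)// ltW.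
have Yp : 0 < Y by rewrite (lt_le_trans ltr01).
have e : Y `^ p = Y * Y `^ (p - 1).
  by rewrite -{2}[Y](powRr1 Y0) -powRD ?(gt_eqF Yp) ?implybT// addrC subrK.
have h2 : lam^-1 <= Y `^ (p - 1).
  apply: (@le_trans _ _ (Y `^ (2^-1))); last by apply: ler_powR => //; lra.
  have hs : lam^-1 = Num.sqrt (lam ^- 2).
    by rewrite -exprVn sqrtr_sqr ger0_norm// invr_ge0 ltW.
  by rewrite powR12_sqrt// hs; apply: ler_wsqrtr; exact: ltW.
apply: (@le_trans _ _ (lam * Y `^ p)); last by rewrite lerDr invr_ge0 exprn_ge0// ltW.
rewrite e mulrCA ler_peMr//.
apply: (@le_trans _ _ (lam * lam^-1)); first by rewrite mulfV// gt_eqF.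
by rewrite ler_pM2l.
Qed.

Lemma cmod_mul_le (z w : R[i]) : `|complex.Re (z * w)| <= cmod z * (`|complex.Re w| + `|complex.Im w|).
Proof.
case: z => a b; case: w => c d /=.
have ha : `|a| <= cmod (a +i* b) by exact: (Re_le_cmod (a +i* b)).
have hb : `|b| <= cmod (a +i* b).
  by rewrite /cmod /= -sqrtr_sqr ler_wsqrtr// lerDr sqr_ge0.
apply: le_trans (ler_normB _ _) _; rewrite !normrM mulrDr.
by apply: lerD; apply: ler_wpM2r.
Qed.

Lemma ball_pairing_ae (G : M3 R -> R) (lam c0 : R) (g : M3 R -> 'I_3 -> R[i]) (B : set (M3 R))
    (phi : R3 R -> R[i]) i : measurable B ->
  measurable_fun B (fun x => complex.Re (g x i)) -> measurable_fun B (fun x => complex.Im (g x i)) ->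
  continuous (fun x => complex.Re (phi x)) -> continuous (fun x => complex.Im (phi x)) ->
  (forall x, ~ B x -> phi x = 0) -> (forall x, ~ box lam x -> phi x = 0) ->
  (forall x, `|complex.Re (phi x)| + `|complex.Im (phi x)| <= c0) ->
  L1 mu3 G -> {ae mu3, forall x, box lam x -> \1_B x * cmod3 (g x) <= G x} ->
  (forall x, 0 <= G x) ->
  `|complex.Re (cint (fun x => g x i * phi x))| <= c0 * \int[mu3]_x G x.
Proof.
move=> mB m1 m2 c1 c2 pB pb hc lG ae G0; rewrite /cint leb3E /=.
have c00 : 0 <= c0 by apply: le_trans (hc 0); rewrite addr_ge0.
rewrite -(RintZ c0 lG); apply: Rint_dom_ae; last first.
- apply: (ae_imp _ ae) => x hx.
  have [bx|nbx] := pselect (box lam x); last first.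
    by rewrite (pb x nbx) mulr0 normr0 mulr_ge0.
  have [Bx|nBx] := pselect (B x); last by rewrite (pB x nBx) mulr0 normr0 mulr_ge0.
  have := hx bx; rewrite indicE mem_set// mul1r => h.
  apply: le_trans (cmod_mul_le _ _) _; rewrite mulrC; apply: ler_pM => //.
  + exact: cmod_ge0.
  + exact: le_trans (cmod_le_cmod3 _ _) h.
- exact: L1Z.
rewrite (_ : (fun x => _) = fun x => \1_B x * complex.Re (g x i) * complex.Re (phi x) -
   \1_B x * complex.Im (g x i) * complex.Im (phi x)).
  apply: measurable_funB; apply: measurable_funM.
  - exact: measurable_cut_fun.
  - exact: (continuous_m c1).
  - exact: measurable_cut_fun.
  - exact: (continuous_m c2).
apply/funext => x; have [Bx|nBx] := pselect (B x).
  by rewrite indicE mem_set// !mul1r; case: (g x i) => ? ?; case: (phi x).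
by rewrite (pB x nBx) /= mulr0 !mulr0 subrr.
Qed.

Lemma weight_sum_le (M l s t : R) : 0 <= M -> 0 <= l -> l * t <= l * s ->
  8 * l + l * t <= (8 + 8 * M + s) * l.
Proof. by move=> M0 l0; have := mulr_ge0 M0 l0; lra. Qed.

Lemma weight_sum_le2 (M l s : R) : 0 <= s -> 0 <= l -> M * (8 * l) <= (8 + 8 * M + s) * l.
Proof. by move=> s0 l0; have := mulr_ge0 s0 l0; lra. Qed.

(* Bound Y <= lam^-2 + lam Y^p on the ball of radius lam, whose volume is O(lam^3):
   this is where r >= 3/2 enters. *)
Lemma local_Lr_weak (r : \bar R) (T : 'I_3 -> dist R) (M l c0 : R) i phi :
  ((3 / 2 : R)%:E <= r)%E -> 0 <= M -> 0 < l -> l <= 1 ->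
  (dist_Lnorm (eball (4 * l)) r T < M%:E)%E -> ctest l phi ->
  (forall x, `|complex.Re (phi x)| + `|complex.Im (phi x)| <= c0) ->
  `|complex.Re (T i phi)| <= c0 * ((8 + 8 * M + M `^ fine r) * l).
Proof.
move=> hr M0 l0 l1 /ereal_inf_lt[_ [g [mg _ Tg] ->] hy] tphi hc.
have tf := ctest_test_fun l0 tphi; rewrite (Tg i _ tf).
set B := eball (4 * l) in mg hy tf *; have mB : measurable (B : set (M3 R)) := measurable_eball _.
have [t1 t2] := tphi.
have c00 : 0 <= c0 by apply: le_trans (hc 0); rewrite addr_ge0.
have pb x : ~ box l x -> phi x = 0.
  move=> nb; have lx : l < `|x| by rewrite ltNge; apply/negP => h; apply: nb; exact: norm_boxP.
  by have := t1.2 x lx; have := t2.2 x lx; case: (phi x) => p q /= -> ->.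
have pB x : ~ B x -> phi x = 0.
  move=> nB; apply: pb => /box_norm xl; apply: nB; rewrite /B /eball /=.
  apply: le_trans (enorm_le_norm x) _; move: (`|x|) xl => a; lra.
have fin G : L1 mu3 G -> {ae mu3, forall x, box l x -> \1_B x * cmod3 (g x) <= G x} ->
   (forall x, 0 <= G x) -> \int[mu3]_x G x <= (8 + 8 * M + M `^ fine r) * l ->
   `|complex.Re (cint (fun x => g x i * phi x))| <= c0 * ((8 + 8 * M + M `^ fine r) * l).
  move=> lG ae G0 IG.
  apply: le_trans (ball_pairing_ae mB (mg i).1 (mg i).2 (Cn_cont (t1.1 0)) (Cn_cont (t2.1 0))
    pB pb hc lG ae G0) _.
  exact: ler_wpM2l.
have Ib : \int[mu3]_x (\1_(box l) x : R) = (2 * l) ^+ 3 := Rint_box (ltW l0).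
have lb := L1_box (R := R) l.
have l3 : (2 * l) ^+ 3 <= 8 * l.
  rewrite exprMn (_ : 2 ^+ 3 = 8 :> R); last by ring.
  by rewrite ler_pM2l// exprS ler_piMr ?(ltW l0)// expr_le1// ltW.
have Mr0 : 0 <= M `^ fine r := powR_ge0 _ _.
(* For [r = +oo] the value of [fine r] is 0, and the power of [M] is merely a nonnegative constant;
   that case rests on the essential bound times the volume. *)
case: r hr hy fin Mr0 => [p| |//] hr hy fin Mr0.
- have p32 : 3 / 2 <= p by [].
  have pge0 : 0 <= p by apply: le_trans p32; rewrite divr_ge0.
  have p0 : p != 0 by rewrite gt_eqF//; lra.
  pose Y (x : M3 R) := \1_B x * cmod3 (g x).
  have Y0 x : 0 <= Y x by rewrite /Y mulr_ge0// sqrtr_ge0.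
  have mY : measurable_fun setT Y.
    apply: measurable_cut_fun => //; rewrite /cmod3.
    apply: measurable_sqrt.
    apply: measurable_sum => j; apply: measurable_funX.
    apply: measurable_sqrt.
    by apply: measurable_funD; apply: measurable_funX; [exact: (mg j).1|exact: (mg j).2].
  have mYp : measurable_fun setT (fun x => Y x `^ p) by apply: (measurableT_comp (measurable_powR p)).
  have EN : (\int[mu3]_x (Y x `^ p)%:E <= (M `^ p)%:E)%E.
    have N0 := Lnorm_ge0 leb3 p%:E (fun x => (Y x)%:E).
    have := poweR_Lnorm leb3 (fun x => (Y x)%:E) p0.
    rewrite leb3E in N0 *; move: hy; rewrite /Lnorm_on leb3E -/Y => hy.
    have E : (\int[mu3]_x (`|(Y x)%:E| `^ p) = \int[mu3]_x (Y x `^ p)%:E)%E.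
      by apply: eq_integral => x _; rewrite /= ger0_norm.
    rewrite E => <-; rewrite -poweR_EFin; apply: (gt0_ler_poweR pge0).
    + by rewrite in_itv/= N0 leey.
    + by rewrite in_itv/= lee_fin M0 leey.
    + exact: ltW hy.
  have lY : L1 mu3 (fun x => Y x `^ p).
    apply: L1_lty => //; first by move=> x; exact: powR_ge0.
    by apply: le_lt_trans EN _; exact: ltry.
  have IY : \int[mu3]_x (Y x `^ p) <= M `^ p by rewrite -lee_fin (EFin_Rint lY).
  have lb2 := L1Z (l ^- 2) lb; have lY2 := L1Z l lY.
  apply: (fin (fun x => l ^- 2 * \1_(box l) x + l * Y x `^ p)).
  + exact: L1D lb2 lY2.
  + apply: aeW => x bx; have -> : \1_(box l) x = 1 :> R by rewrite indicE mem_set.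
    by rewrite mulr1; exact: (Lr_split l0 l1 (Y0 x) p32).
  + by move=> x; rewrite addr_ge0// mulr_ge0 ?powR_ge0 ?invr_ge0 ?exprn_ge0// ltW.
  + rewrite (RintD lb2 lY2) (RintZ _ lb) (RintZ _ lY) Ib.
    have -> : l ^- 2 * (2 * l) ^+ 3 = 8 * l by field; rewrite gt_eqF.
    have := ler_wpM2l (ltW l0) IY; rewrite /= in Mr0 *.
    exact: weight_sum_le M0 (ltW l0).
- have aeM : {ae mu3, forall x, \1_B x * cmod3 (g x) <= M}.
    move: hy; rewrite /Lnorm_on leb3E unlock mu3_setT_gt0 => hy.
    have := @ess_sup_ge _ _ _ mu3 (abse \o (fun x : M3 R => (\1_B x * cmod3 (g x))%:E)).
    apply: ae_imp => x hx; have := le_lt_trans hx hy.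
    by rewrite /= lte_fin => /ltW; exact: le_trans (ler_norm _).
  have lb2 := L1Z M lb.
  apply: (fin (fun x => M * \1_(box l) x)).
  + exact: lb2.
  + apply: (ae_imp _ aeM) => x hx bx.
    have -> : \1_(box l) x = 1 :> R by rewrite indicE mem_set.
    by rewrite mulr1.
  + by move=> x; rewrite mulr_ge0.
  + rewrite (RintZ _ lb) Ib; apply: le_trans (ler_wpM2l M0 l3) _.
    exact: weight_sum_le2 Mr0 (ltW l0).
Qed.

End local_Lr.

Section fourier_part.
Local Open Scope complex_scope.
Context {R : realType}.
Variables (psi : R3 R -> R) (u : R3 R -> R3 R) (P : R3 R -> R).
Hypothesis hpsi : LP_cutoff psi.
Hypothesis hu : forall i, smooth (vcomp u i).
Hypothesis hP : smooth P.
Hypothesis hNS : stationary_NS u P.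
Hypothesis hD : (dirichlet_energy u < +oo)%E.

Lemma liminf_fourier_Lr (r : \bar R) : ((3 / 2 : R)%:E <= r)%E ->
  (liminf_ninfty (fun k : int => dist_Lnorm (eball ((2 : R) ^ k)) r
     (fun i => dist_fourier (vdist_of u i))) < +oo)%E ->
  forall x, u x = 0.
Proof.
move=> hr /liminf_bounded[M M0 hM]; have [B hB] := psi_bounds hpsi.
have B0 : 0 <= B by have /andP[] := hB 0; exact: le_trans.
have c0 : 0 <= cpi :> R := powR_ge0 _ _.
pose A := 8 + 8 * M + M `^ fine r.
have A0 : 0 <= A by rewrite addr_ge0 ?powR_ge0// addr_ge0// mulr_ge0.
have M'0 : 0 <= B * (2 * cpi) * A.
  by apply: mulr_ge0 A0; apply: mulr_ge0 B0 _; exact: mulr_ge0.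
apply: (liouville_of_bounds hpsi hu hP hNS hD M'0) => N.
(* The ball of radius [2 ^ (- n)] has radius [4 * lamn n.+2], the room that [ctest_test_fun] asks
   for; hence the shift by two. *)
have [n Nn hn] := hM N; exists n.+2; first by rewrite !leqW.
move=> i; have wf := solution_W hu hD i.
apply: (conv_psik_bound hpsi (lamn_gt0 n.+2) wf) => q h th.
have e4 : 4 * lamn n.+2 = (2 : R) ^ (- n%:Z).
  by rewrite expz_lamn (lamnS n) (lamnS n.+1); ring.
rewrite -e4 in hn.
have tl := psik_test hpsi (lamn_gt0 n.+2).
have tphi := mult_ctest tl th.
set I := \int[mu3]_x `|h x|.
(* The real and the imaginary part are each at most [B * cpi] times the L1 norm of [h], whence the
   factor 2. *)
have bd xi : `|complex.Re ((psik psi (lamn n.+2) xi)%:C * ifourier (ofr h) xi)| +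
    `|complex.Im ((psik psi (lamn n.+2) xi)%:C * ifourier (ofr h) xi)| <= B * (2 * cpi) * I.
  rewrite Re_realM Im_realM (ifourier_ofr th) /= mulrN normrN.
  rewrite !normrM (ger0_norm c0) -mulrDr -mulrDr -mulrA; have /andP[p0 pB] := hB ((lamn n.+2)^-1 *: xi).
  rewrite /psik (ger0_norm p0); apply: ler_pM => //; first by rewrite mulr_ge0// addr_ge0.
  rewrite -mulrA mulrCA; apply: ler_wpM2l => //.
  by have := lerD (ct_le 0 xi th) (ct_le (pi / 2) xi th); rewrite -/I => H; apply: le_trans H _; rewrite -mulr2n mulr_natl.
have := local_Lr_weak (phi := fun xi => (psik psi (lamn n.+2) xi)%:C * ifourier (ofr h) xi) i
  hr M0 (lamn_gt0 n.+2) (lamn_le1 n.+2) hn tphi bd.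
rewrite -/A => H; apply: le_trans H _.
by rewrite le_eqVlt; apply/orP; left; apply/eqP; move: (B * (2 * cpi)) => b; ring.
Qed.

End fourier_part.

Unset Implicit Arguments.

Theorem corollary1p1 (R : realType) (psi : R3 R -> R) (hpsi : LP_cutoff psi)
    (u : R3 R -> R3 R) (P : R3 R -> R)
    (hu : forall i, smooth (vcomp u i)) (hP : smooth P)
    (hNS : stationary_NS u P)
    (hD : (dirichlet_energy u < +oo)%E) :
  [/\ (liminf_ninfty (fun k : int => ((2 : R) ^ (- k))%:E *
          dist_Lnorm setT +oo (fun i => LP_S psi k (vdist_of u i))) < +oo)%E ->
        forall x, u x = 0,
      (liminf_ninfty (fun k : int =>
          besov_norm psi (- 1) (fun i => LP_S psi k (vdist_of u i))) < +oo)%E ->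
        forall x, u x = 0 &
      forall r : \bar R, ((3 / 2 : R)%:E <= r)%E ->
        (liminf_ninfty (fun k : int =>
          dist_Lnorm (eball ((2 : R) ^ k)) r
            (fun i => dist_fourier (vdist_of u i))) < +oo)%E ->
        forall x, u x = 0].
Proof.
split=> [|| r hr].
- exact: (liminf_S_Linfty hpsi hu hP hNS hD).
- exact: (liminf_S_besov hpsi hu hP hNS hD).
- exact: (liminf_fourier_Lr hpsi hu hP hNS hD hr).
Qed.
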